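(* Let $n\ge2$, $m\ge1$, $I=[t_0,+\infty)$, $A\in\mathbb R^{n\times n}$, let a class $\mathcal K_3(A)$ be given, $f\in\mathcal K_3^{n\times1}(A)$, and let $\varphi_0(t,c_0)$ (parameter $c_0\in\mathbb R^{n_0}$, $0\le n_0\le n$) be some particular solution of class $\mathcal K_3^{n\times1}(A)\cap C^1(I)$ of $\frac{d\varphi}{dt}=A\varphi+f(t)$. Let $a>0$, $D:=\{(t,y):t\in I,\ y\in\mathbb R^{n\times1},\ \|y-\varphi_0(t,c_0)\|\le a\}$, and consider $$\frac{dy}{dt}=Ay+f(t)+\sum_{l=1}^m\varepsilon_l(t)f_l(t,y),\qquad(t,y)\in D.\qquad( * )$$ Let ranks $\varrho_1\le\dots\le\varrho_m$ ($\varrho_l\in\mathbb R^+$) of the $\varepsilon_l$ be given, let $k,k_0\in\mathbb N$, $p_{kl}:=\max\{0,[\rho_k-\varrho_l]+1\}$, $q_{kl}:=\left[\frac{\rho_k-\varrho_l}{\varrho_1}\right]$ ($l=1,\dots,m$), and suppose: 1. $\varepsilon_l:I\to\mathbb R$, $\varepsilon_l\in C^{p_{kl}}(I)$, $\frac{d^r\varepsilon_l(t)}{dt^r}=O\bigl((\varepsilon_1(t))^{(\varrho_l+r)/\varrho_1}\bigr)$, $\varepsilon_1(t)\ge0$, $\varepsilon_1(t)=o(1)$ ($l=1,\dots,m$, $r=0,\dots,p_{kl}$, $t\to+\infty$); 2. $f_l:D\to\mathbb R^{n\times1}$, $f_l\in C^{0,\max\{2,q_{kl}+1\}}_{t,y}(D)$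 ($l=1,\dots,m$); 3. $\sup_{(t,y)\in D}\|\partial_y^\wp f_l(t,y)\|<+\infty$ for $\wp\in\mathbb N_0^n$, $0\le|\wp|\le\max\{2,q_{kl}+1\}$, $l=1,\dots,m$; 4. $\partial_y^\wp f_l(t,\varphi_0(t,c_0))\in\mathcal K_3^{n\times1}(A)$ for $\wp\in\mathbb N_0^n$, $0\le|\wp|\le q_{kl}$ and all $l$ with $\rho_k\ge\varrho_l$; 5. there is a number $\varpi\in\mathbb R^+$ such that $\varepsilon_1\in\mathcal R_\varpi(I)$; 6. $\frac{d^r\varepsilon_l(t)}{dt^r}\in\mathcal R_1(I)$ for $r=1,\dots,[\rho_k-\varrho_l]$ and all $l$ with $\rho_k-\varrho_l\ge1$; 7. for all $l$ with $\varrho_l\le\varpi\varrho_1$, with $s_l:=\left[\varpi-\frac{\varrho_l}{\varrho_1}\right]$: $f_l\in C^{0,s_l+2}_{t,y}(D)$; $\sup_{(t,y)\in D}\|\partial_y^\wp f_l(t,y)\|<+\infty$ for $\wp\in\mathbb N_0^n$, $3\le|\wp|\le s_l+2$; and $\partial_y^\wp f_l(t,\varphi_0(t,c_0))\in\mathcal K_3^{n\times1}(A)$ for $\wp\in\mathbb N_0^n$, $1\le|\wp|\le s_l+1$; 8. $0\notin\Delta(A)$; 9. for every $l$ with $\varepsilon_l\notin\mathcal R_1(I)$, $\varepsilon_l$ is (at least non-strictly) monotone on $I$ and tends to $0$ as $t\to+\infty$, and $\frac{d\varepsilon_l}{dt}\in C(I)\cap\mathcal R_1(I)$; moreover $\varepsilon_1(t)>0$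 for $t\in I$; 10. every function of the form $$\gamma_1(\varepsilon_1(t))^{-1}\frac{d\varepsilon_1(t)}{dt}+\sum_{\substack{\wp\in\mathbb N_0^m,\ 1\le|\wp|<\varpi\\ \mu_\wp\notin\mathcal R_1(I)}}\gamma_\wp\mu_\wp(t),\qquad\gamma_1,\gamma_\wp\in\mathbb R,$$ keeps its sign, at least in the non-strict sense, for all sufficiently large $t\in I$; 11. $\rho_{k+1}>\varrho_1\varpi$ and $\rho_{k+1}\ge\varrho_1(2\varpi-1)$; 12. $\rho_{k+1}\ge\rho_{k_0+1}+\varpi\varrho_1$. Then for sufficiently large $t_0$ equation $( * )$ has on $I$ at least one particular solution of the form $$y=\varphi_0(t,c_0)+\sum_{s=1}^{k_0}\sum_{p=1}^{\varkappa_s}\nu_{sp}(t)\varphi_{sp}(t,c_{sp})+r,\qquad r=O\bigl((\varepsilon_1(t))^{\rho_{k_0+1}/\varrho_1}\bigr)\quad(t\to+\infty),$$ where $\varphi_0(t,c_0),\varphi_{sp}(t,c_{sp})\in\mathcal K_3^{n\times1}(A)\cap C^1(I)$ ($s=1,\dots,k_0$, $p=1,\dots,\varkappa_s$). Moreover, $r$ depends on as many arbitrary scalar constants, sufficiently small in absolute value, as there are indices $j\in\{1,\dots,n\}$ such that $\int_Ip_{jj}(t)\,dt\ne+\infty$, where the functions $p_{jj}$ are defined in the context. (This family of solutions can contain no more than $n$ independent scalar parameters.)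
   Context: Notation: $\mathbb N_0=\{0\}\cup\mathbb N$; $\mathbb R^+=(0,+\infty)$; $[x]$ is the integer part (floor); $\|\cdot\|$ is the maximum modulus of the entries; $S^{n\times1}$ denotes $n$-vectors with entries in the class $S$; $\lambda_1(A),\dots,\lambda_n(A)$ are the eigenvalues of $A$, $\Lambda(A)$ its spectrum, $\Delta(A)=\{\lambda_j(A)-\lambda_l(A):j,l=1,\dots,n,\ j\ne l\}$; for a multi-index $\wp$, $|\wp|=\sum_j\wp_j$, $\wp!=\prod_j\wp_j!$, $y^\wp=\prod_jy_j^{\wp_j}$, $\partial_y^\wp$ is the corresponding partial derivative. $C^{0,q}_{t,y}(D)$: partial $y$-derivatives up to order $q$ exist and are continuous on $D$. $\mathcal R(I)$ is the set of $g:I\to\mathbb C$ for which $\int_Ig\,dt$ exists (as a convergent integral) in $\mathbb C$; $\mathcal R_p(I)=\{g:I\to\mathbb C: |g|^p\in\mathcal R(I)\}$ for $p>0$. For $\wp\in\mathbb N_0^m$, $\mu_\wp(t)=\prod_{l=1}^m(\varepsilon_l(t))^{\wp_l}$. Empty sums are $0$, empty products $1$. A parameter in $\mathbb R^0$ means no parameter. ''For sufficiently large $t_0$'' means after replacing $t_0$ by a larger number and restricting everything to the new $I=[t_0,+\infty)$. Class $\mathcal K_3(A)$: some nonempty class of functions $f:I\to\mathbb R$ such that (1) every $f$ in it is continuous and bounded on $I$; (2) if $f_1,f_2\in\mathcal K_3(A)$, $\alpha\in\mathbb R$, then $\alpha f_1,\ f_1+f_2,\ f_1f_2\in\mathcal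 K_3(A)$; (3) for each $f\in\mathcal K_3(A)$ the mean value $\operatorname M(f)=\lim_{t\to+\infty}\frac1t\int_{t_0}^tf(\tau)\,d\tau$ exists (finite) and $\sup_{t\in I}\bigl|\int_{t_0}^t(f(\tau)-\operatorname M(f))\,d\tau\bigr|<+\infty$; (4) for every $\tilde f:I\to\mathbb C$ with $\Re\tilde f,\Im\tilde f\in\mathcal K_3(A)$ and every $\lambda\in\Lambda(A)\cup\Delta(A)$, the equation $\frac{dy}{dt}=\lambda y+\tilde f(t)$ ($y:I\to\mathbb C$) has at least one particular solution $y(t,\tilde c)$ on $I$ (parameter $\tilde c\in\mathbb C^{\tilde n}$, $0\le\tilde n\le1$) with $\Re y,\Im y\in\mathcal K_3(A)\cap C^1(I)$. Ranks: $\operatorname{Rank}(\varepsilon_l)=\varrho_l$. A product $\prod_{l=1}^m\prod_{r=0}^{k_l}\bigl(\frac{d^r\varepsilon_l(t)}{dt^r}\bigr)^{\beta_{lr}}$ with $k_l,\beta_{lr}\in\mathbb N_0$, not all $\beta_{lr}$ zero, has rank $\sum_l\sum_r(\varrho_l+r)\beta_{lr}$ (products are regarded as formal monomials in the $\varepsilon_l$ and their derivatives). The set of all ranks is discrete and is enumerated increasingly as $\rho_1<\rho_2<\dots$ (so $\rho_1=\varrho_1$). For each $s$, $\nu_{s1},\dots,\nu_{s\varkappa_s}$ enumerates the products of rank $\rho_s$, with $\nu_{1p}=\varepsilon_p$ for $p=1,\dots,\varkappa_1$. Coefficients: $\varphi_{sp}(t,c_{sp})$ (parameters $c_{sp}\in\mathbb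 R^{n_{sp}}$, $0\le n_{sp}\le n$) are, recursively in $s=1,\dots,k$, particular solutions of class $\mathcal K_3^{n\times1}(A)\cap C^1(I)$ of $\frac{d\varphi_{sp}}{dt}=A\varphi_{sp}+g_{sp}$, where, with $\tilde\delta=\sum_{s\ge1}\sum_p\nu_{sp}\varphi_{sp}$, $g_{sp}$ is the coefficient of $\nu_{sp}$ in the formal expansion of $$-\sum_{s',p'}\frac{d\nu_{s'p'}}{dt}\varphi_{s'p'}+\sum_{l=1}^m\varepsilon_l\sum_{\wp\in\mathbb N_0^n}\frac1{\wp!}\partial_y^\wp f_l(t,\varphi_0(t,c_0))\tilde\delta^\wp$$ ($d\nu_{s'p'}/dt$ being expanded by the product rule as a combination of products of rank $\rho_{s'}+1$). The function $g_{sp}$ involves only $\varphi_0$ and the $\varphi_{s'p'}$ with $s'<s$, and for $s\le k$ only the derivatives $\partial_y^\wp f_l(t,\varphi_0)$ with $\rho_k\ge\varrho_l$, $|\wp|\le q_{kl}$. Put $s(t)=\varphi_0(t,c_0)+\sum_{s=1}^k\sum_{p=1}^{\varkappa_s}\nu_{sp}(t)\varphi_{sp}(t,c_{sp})$. Functions $p_{jj}$: let $\hat A(t)=A+\sum_{l=1}^m\varepsilon_l(t)\frac{\partial f_l(t,s(t))}{\partial y}$. A real Lyapunov matrix is $Q:I\to\mathbb R^{n\times n}$, $Q\in C^1(I)$, with $Q$ and $dQ/dt$ bounded and $|\det Q(t)|\ge\mathrm{const}>0$ on $I$. Under the hypotheses, for $t_0$ large, there is (by an earlier theorem of the authors) a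 real Lyapunov matrix $Q$, with $\lim_{t\to+\infty}\det Q(t)$ existing and nonzero, such that $r=Q(t)x$ transforms $\frac{dr}{dt}=\hat A(t)r$ into $\frac{dx}{dt}=\Re D(t)\,x$, $D=\operatorname{diag}(d_1,\dots,d_n)$, $$d_j(t)=\lambda_j(A)+\sum_{\substack{\wp\in\mathbb N_0^m,\ 1\le|\wp|<\varpi\\ \mu_\wp\notin\mathcal R_1(I)}}\gamma_{j\wp}\mu_\wp(t)+\varsigma_j(t),\qquad\gamma_{j\wp}\in\mathbb C,\ \ \varsigma_j:I\to\mathbb C,\ \varsigma_j\in\mathcal R(I)\cap C(I).$$ Fix such $Q,\gamma_{j\wp},\varsigma_j$ and put $$p_{jj}(t)=\Re d_j(t)+\Bigl(\varpi-\frac{\rho_{k+1}}{\varrho_1}\Bigr)(\varepsilon_1(t))^{-1}\frac{d\varepsilon_1(t)}{dt},\qquad j=1,\dots,n.$$ Standing assumption: $g(t):=-\frac{ds(t)}{dt}+As(t)+f(t)+\sum_{l=1}^m\varepsilon_l(t)f_l(t,s(t))$ is not identically zero on $I$ (otherwise $y\equiv s(t)$ is an exact solution). *)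

(* Defs.v *)
Set Warnings "-notation-incompatible-prefix,-notation-overridden,-ambiguous-paths".
From HB Require Import structures.
From mathcomp Require Import all_boot all_order all_algebra complex finmap multiset.
From mathcomp Require Import all_classical all_reals all_analysis.
Set Implicit Arguments.
Unset Strict Implicit.
Unset Printing Implicit Defensive.
Import Order.TTheory GRing.Theory Num.Theory.
Import numFieldNormedType.Exports.
Local Open Scope classical_set_scope.
Local Open Scope ring_scope.

(* Functions on I = [t0, +oo[ or on a set D are represented by total functions;
   only their values on I, resp. D, are ever used. *)

(* Derivative of g at x along points of S: one-sided at an endpoint of S.  The
   two-sided library derivative would depend on values outside of S. *)
Definition dwithin (R : realType) (V : normedModType R) (S : set R)
    (g : R -> V) (x : R) : V :=
  lim ((s - x)^-1 *: (g s - g x) @[s --> within S x^']).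

Definition derivable_within (R : realType) (V : normedModType R) (S : set R)
    (g : R -> V) (x : R) : Prop :=
  cvg ((s - x)^-1 *: (g s - g x) @[s --> within S x^']).

Definition dI (R : realType) (V : normedModType R) (t0 : R) (g : R -> V) : R -> V :=
  dwithin `[t0, +oo[ g.

Definition derivable_on (R : realType) (V : normedModType R) (t0 : R)
    (g : R -> V) : Prop :=
  forall t, t0 <= t -> derivable_within `[t0, +oo[ g t.

(* C^p(I) *)
Definition CI (R : realType) (V : normedModType R) (t0 : R) (p : nat)
    (g : R -> V) : Prop :=
  (forall r, (r < p)%N -> derivable_on t0 (iter r (dI t0) g)) /\
  (forall r, (r <= p)%N -> {within `[t0, +oo[, continuous (iter r (dI t0) g)}).

Definition cylinder (R : realType) (n : nat) (t0 : R) (phi0 : R -> 'cV[R]_n)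
    (a : R) : set (R * 'cV[R]_n) :=
  [set p | t0 <= p.1 /\ `|p.2 - phi0 p.1| <= a].

Definition set_coord (R : realType) (n : nat) (y : 'cV[R]_n) (j : 'I_n) (s : R) :
    'cV[R]_n :=
  \col_i (if i == j then s else y i 0).

Definition pline (R : realType) (n : nat) (D : set (R * 'cV[R]_n)) (j : 'I_n)
    (p : R * 'cV[R]_n) : set R :=
  [set s | D (p.1, set_coord p.2 j s)].

Definition pder (R : realType) (n : nat) (D : set (R * 'cV[R]_n)) (j : 'I_n)
    (F : R * 'cV[R]_n -> 'cV[R]_n) (p : R * 'cV[R]_n) : 'cV[R]_n :=
  dwithin (pline D j p) (fun s => F (p.1, set_coord p.2 j s)) (p.2 j 0).

Definition pderivable (R : realType) (n : nat) (D : set (R * 'cV[R]_n)) (j : 'I_n)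
    (F : R * 'cV[R]_n -> 'cV[R]_n) (p : R * 'cV[R]_n) : Prop :=
  derivable_within (pline D j p) (fun s => F (p.1, set_coord p.2 j s)) (p.2 j 0).

Definition pders (R : realType) (n : nat) (D : set (R * 'cV[R]_n)) (js : seq 'I_n)
    (F : R * 'cV[R]_n -> 'cV[R]_n) : R * 'cV[R]_n -> 'cV[R]_n :=
  foldr (pder D) F js.

(* C^{0,q}_{t,y}(D); mixed derivatives are taken in every order *)
Definition C0y (R : realType) (n : nat) (D : set (R * 'cV[R]_n)) (q : nat)
    (F : R * 'cV[R]_n -> 'cV[R]_n) : Prop :=
  (forall js j p, (size js < q)%N -> D p -> pderivable D j (pders D js F) p) /\
  (forall js, (size js <= q)%N -> {within D, continuous (pders D js F)}).

Definition mindex (n : nat) := {ffun 'I_n -> nat}.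

Definition mabs (n : nat) (w : mindex n) : nat := \sum_j w j.

Definition mfact (n : nat) (w : mindex n) : nat := \prod_j (w j)`!.

Definition pderm (R : realType) (n : nat) (D : set (R * 'cV[R]_n)) (w : mindex n)
    (F : R * 'cV[R]_n -> 'cV[R]_n) : R * 'cV[R]_n -> 'cV[R]_n :=
  pders D (flatten [seq nseq (w j) j | j <- enum 'I_n]) F.

Definition mu (R : realType) (m : nat) (eps : 'I_m -> R -> R) (w : mindex m)
    (t : R) : R :=
  \prod_l eps l t ^+ w l.

Definition intI (R : realType) (t0 : R) (g : R -> R) (T : R) : R :=
  \int[lebesgue_measure]_(t in `[t0, T]) g t.

(* intR and intC: the integral over I converges, possibly conditionally *)
Definition intR (R : realType) (t0 : R) (g : R -> R) : Prop :=
  (forall T, t0 <= T -> lebesgue_measure.-integrable `[t0, T] (EFin \o g)) /\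
  cvg (intI t0 g T @[T --> +oo]).

Definition intC (R : realType) (t0 : R) (g : R -> R[i]) : Prop :=
  intR t0 (fun t => complex.Re (g t)) /\ intR t0 (fun t => complex.Im (g t)).

Definition intRp (R : realType) (t0 : R) (p : R) (g : R -> R) : Prop :=
  intR t0 (fun t => `|g t| `^ p).

Definition bigO_pinfty (R : realType) (V : normedModType R) (f : R -> V)
    (g : R -> R) : Prop :=
  exists M : R, \forall t \near +oo, `|f t| <= M * `|g t|.

(* lam lists the complex eigenvalues of A with multiplicity *)
Definition eigenvalues (R : realType) (n : nat) (A : 'M[R]_n)
    (lam : 'I_n -> R[i]) : Prop :=
  char_poly (map_mx (real_complex R) A) = \prod_j ('X - (lam j)%:P).

Definition Spec (R : realType) (n : nat) (lam : 'I_n -> R[i]) : set R[i] :=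
  [set z | exists j, z = lam j].

Definition Delta (R : realType) (n : nat) (lam : 'I_n -> R[i]) : set R[i] :=
  [set z | exists j l, j != l /\ z = lam j - lam l].

Definition reIm (R : realType) (K : set (R -> R)) (y : R -> R[i]) : Prop :=
  K (fun t => complex.Re (y t)) /\ K (fun t => complex.Im (y t)).

Record K3_class (R : realType) (n : nat) (t0 : R) (lam : 'I_n -> R[i])
    (K : set (R -> R)) : Prop := {
  (* members of K stand for functions on I *)
  K3_ext : forall g h, K g -> (forall t, t0 <= t -> g t = h t) -> K h;
  K3_nonempty : K !=set0;
  K3_continuous : forall g, K g -> {within `[t0, +oo[, continuous g};
  K3_bounded : forall g, K g -> exists M : R, forall t, t0 <= t -> `|g t| <= M;
  K3_scale : forall (c : R) g, K g -> K (fun t => c * g t);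
  K3_add : forall g h, K g -> K h -> K (fun t => g t + h t);
  K3_mul : forall g h, K g -> K h -> K (fun t => g t * h t);
  K3_mean : forall g, K g -> exists M : R,
    T^-1 * intI t0 g T @[T --> +oo] --> M /\
    exists B : R, forall T, t0 <= T -> `|intI t0 (fun t => g t - M) T| <= B;
  K3_solve : forall (h : R -> R[i]) (z : R[i]), reIm K h ->
    (Spec lam `|` Delta lam) z ->
    exists y : R -> R[i],
      [/\ reIm K y, reIm (CI t0 1) y &
          forall t, t0 <= t ->
            Complex (dI t0 (fun s => complex.Re (y s)) t)
                    (dI t0 (fun s => complex.Im (y s)) t) = z * y t + h t]
}.

Definition vecK (R : realType) (n : nat) (K : set (R -> R)) (g : R -> 'cV[R]_n) :
    Prop :=
  forall i, K (fun t => g t i 0).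

Definition K3_solution (R : realType) (n : nat) (t0 : R) (K : set (R -> R))
    (A : 'M[R]_n) (h : R -> 'cV[R]_n) (y : R -> 'cV[R]_n) : Prop :=
  [/\ vecK K y, CI t0 1 y &
      forall t, t0 <= t -> dI t0 y t = A *m y t + h t].

(* A monomial is the multiset of its factors; (l, r) stands for the r-th derivative
   of eps_l.  The monomials of the statement are those different from mset0. *)
Definition mono (m : nat) := multiset ('I_m * nat)%type.

Definition rank (R : realType) (m : nat) (varrho : 'I_m -> R) (nu : mono m) : R :=
  \sum_(x <- enum_mset nu) (varrho x.1 + x.2%:R).

(* rho 1 < rho 2 < ... enumerates all ranks; rho 0 is not used *)
Definition rank_enum (R : realType) (m : nat) (varrho : 'I_m -> R) (rho : nat -> R) :
    Prop :=
  (forall s, (1 <= s)%N -> rho s < rho s.+1) /\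
  (forall x : R, (exists2 s, (1 <= s)%N & rho s = x) <->
                 (exists2 nu : mono m, nu <> mset0 & rank varrho nu = x)).

Definition monos_of_rank (R : realType) (m : nat) (varrho : 'I_m -> R) (x : R) :
    set (mono m) :=
  [set nu | nu <> mset0 /\ rank varrho nu = x].

Definition mval (R : realType) (m : nat) (t0 : R) (eps : 'I_m -> R -> R)
    (nu : mono m) (t : R) : R :=
  \prod_(x <- enum_mset nu) iter x.2 (dI t0) (eps x.1) t.

(* Formal series in the variables (l, r), given by their coefficients; all sums
   over infinite index sets below have finitely many nonzero terms. *)
Definition fseries (R : realType) (m : nat) := mono m -> R.

Definition fone (R : realType) (m : nat) : fseries R m :=
  fun nu => (nu == mset0)%:R.

Definition fvar (R : realType) (m : nat) (l : 'I_m) : fseries R m :=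
  fun nu => (nu == msetn 1 (l, 0%N))%:R.

Definition fmul (R : realType) (m : nat) (F G : fseries R m) : fseries R m :=
  fun nu => \sum_(p \in [set p : mono m * mono m | msetD p.1 p.2 = nu])
              (F p.1 * G p.2).

(* product rule: each factor in turn is replaced by its derivative *)
Definition fder (R : realType) (m : nat) (nu : mono m) : fseries R m :=
  fun nu' => \sum_(x <- enum_mset nu)
    (nu' == msetD (msetB nu (msetn 1 x)) (msetn 1 (x.1, x.2.+1)))%:R.

(* j-th component, at time t, of the formal sum delta of all nu * phi_nu *)
Definition fdelta (R : realType) (n m : nat) (phi : mono m -> R -> 'cV[R]_n) (t : R)
    (j : 'I_n) : fseries R m :=
  fun nu => if nu == mset0 then 0 else phi nu t j 0.

Definition fdelta_pow (R : realType) (n m : nat) (phi : mono m -> R -> 'cV[R]_n)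
    (t : R) (w : mindex n) : fseries R m :=
  \big[@fmul R m/@fone R m]_j iter (w j) (fmul (fdelta phi t j)) (@fone R m).

(* The coefficient of nu in the formal expansion of
     - sum_nu' (d nu'/dt) phi_nu'
     + sum_l eps_l sum_w (1/w!) (d_y^w f_l)(t, phi_0(t)) delta^w;
   it is the inhomogeneous term in the equation of phi_nu. *)
Definition gcoef (R : realType) (n m : nat) (D : set (R * 'cV[R]_n))
    (fl : 'I_m -> R * 'cV[R]_n -> 'cV[R]_n) (phi0 : R -> 'cV[R]_n)
    (phi : mono m -> R -> 'cV[R]_n) (nu : mono m) (t : R) : 'cV[R]_n :=
  - (\sum_(nu' \in [set nu' : mono m | nu' <> mset0]) (fder R nu' nu *: phi nu' t)) +
  \sum_(l < m) \sum_(w \in [set: mindex n])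
     ((mfact w)%:R^-1 * fmul (fvar R l) (fdelta_pow phi t w) nu)
       *: pderm D w (fl l) (t, phi0 t).

(* phi is indexed by the monomials themselves instead of pairs (s, p); it is only
   constrained, and only used, on monomials of rank rho 1, ..., rho k. *)
Definition coefficients (R : realType) (n m : nat) (t0 : R) (K : set (R -> R))
    (A : 'M[R]_n) (D : set (R * 'cV[R]_n))
    (fl : 'I_m -> R * 'cV[R]_n -> 'cV[R]_n) (phi0 : R -> 'cV[R]_n)
    (varrho : 'I_m -> R) (rho : nat -> R) (k : nat)
    (phi : mono m -> R -> 'cV[R]_n) : Prop :=
  forall s nu, (1 <= s <= k)%N -> monos_of_rank varrho (rho s) nu ->
    K3_solution t0 K A (gcoef D fl phi0 phi nu) (phi nu).

Definition psum (R : realType) (n m : nat) (t0 : R) (eps : 'I_m -> R -> R)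
    (phi0 : R -> 'cV[R]_n) (varrho : 'I_m -> R) (rho : nat -> R)
    (phi : mono m -> R -> 'cV[R]_n) (k : nat) (t : R) : 'cV[R]_n :=
  phi0 t + \sum_(1 <= s < k.+1)
             \sum_(nu \in monos_of_rank varrho (rho s)) (mval t0 eps nu t *: phi nu t).

Definition rhs (R : realType) (n m : nat) (A : 'M[R]_n) (f : R -> 'cV[R]_n)
    (eps : 'I_m -> R -> R) (fl : 'I_m -> R * 'cV[R]_n -> 'cV[R]_n)
    (t : R) (y : 'cV[R]_n) : 'cV[R]_n :=
  A *m y + f t + \sum_(l < m) eps l t *: fl l (t, y).

Definition solution (R : realType) (n m : nat) (A : 'M[R]_n) (f : R -> 'cV[R]_n)
    (eps : 'I_m -> R -> R) (fl : 'I_m -> R * 'cV[R]_n -> 'cV[R]_n)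
    (D : set (R * 'cV[R]_n)) (t1 : R) (y : R -> 'cV[R]_n) : Prop :=
  derivable_on t1 y /\
  forall t, t1 <= t -> D (t, y t) /\ dI t1 y t = rhs A f eps fl t (y t).

(* A family y(., C) depends on the N scalar constants C, independently: at each
   C in U it is differentiable in C, and its partial derivatives in C_1, ..., C_N
   are linearly independent functions on [t1, +oo[. *)
Definition independent_family (R : realType) (n N : nat) (t1 : R)
    (U : set 'rV[R]_N) (y : 'rV[R]_N -> R -> 'cV[R]_n) : Prop :=
  forall C, U C ->
    (forall t, t1 <= t -> differentiable (fun C' => y C' t) C) /\
    (forall v : 'rV[R]_N,
       (forall t, t1 <= t -> 'D_v (fun C' => y C' t) C = 0) -> v = 0).

Definition Ahat (R : realType) (n m : nat) (A : 'M[R]_n) (D : set (R * 'cV[R]_n))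
    (eps : 'I_m -> R -> R) (fl : 'I_m -> R * 'cV[R]_n -> 'cV[R]_n)
    (s : R -> 'cV[R]_n) (t : R) : 'M[R]_n :=
  A + \sum_(l < m) eps l t *: \matrix_(i, j) pder D j (fl l) (t, s t) i 0.

Definition lyapunov (R : realType) (n : nat) (t1 : R) (Q : R -> 'M[R]_n) : Prop :=
  [/\ CI t1 1 Q,
      exists M : R, forall t, t1 <= t -> `|Q t| <= M /\ `|dI t1 Q t| <= M &
      exists2 c : R, 0 < c & forall t, t1 <= t -> c <= `|\det (Q t)|].

(* r = Q(t) x transforms r' = B(t) r into x' = E(t) x: substituting r = Q x gives
   Q x' = (B Q - Q') x *)
Definition transforms (R : realType) (n : nat) (t1 : R) (Q B E : R -> 'M[R]_n) :
    Prop :=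
  forall t, t1 <= t -> invmx (Q t) *m (B t *m Q t - dI t1 Q t) = E t.

Definition critical (R : realType) (m : nat) (t0 : R) (eps : 'I_m -> R -> R)
    (varpi : R) : set (mindex m) :=
  [set w | [/\ (1 <= mabs w)%N, (mabs w)%:R < varpi & ~ intRp t0 1 (mu eps w)]].

Definition diagonalization (R : realType) (n m : nat) (t0 t1 : R)
    (lam : 'I_n -> R[i]) (eps : 'I_m -> R -> R) (varpi : R)
    (B : R -> 'M[R]_n) (Q : R -> 'M[R]_n) (d : 'I_n -> R -> R[i])
    (gamma : 'I_n -> mindex m -> R[i]) (sigma : 'I_n -> R -> R[i]) : Prop :=
  [/\ lyapunov t1 Q,
      exists2 l : R, l != 0 & \det (Q t) @[t --> +oo] --> l,
      transforms t1 Q B (fun t => diag_mx (\row_j complex.Re (d j t))),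
      forall j, intC t1 (sigma j) /\
                reIm (fun g : R -> R => {within `[t1, +oo[, continuous g}) (sigma j) &
      forall j t, t1 <= t ->
        d j t = lam j + \sum_(w \in critical t0 eps varpi)
                          (gamma j w * real_complex R (mu eps w t)) + sigma j t].

(* the diagonal coefficients after also factoring eps_1^(rho_(k+1)/varrho_1 - varpi)
   out of r *)
Definition pjj (R : realType) (n m : nat) (t0 : R) (eps : 'I_m.+1 -> R -> R)
    (varrho : 'I_m.+1 -> R) (rho : nat -> R) (varpi : R) (k : nat)
    (d : 'I_n -> R -> R[i]) (j : 'I_n) (t : R) : R :=
  complex.Re (d j t) +
  (varpi - rho k.+1 / varrho ord0) * (eps ord0 t)^-1 * dI t0 (eps ord0) t.

Definition free_indices (R : realType) (n m : nat) (t0 t1 : R)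
    (eps : 'I_m.+1 -> R -> R) (varrho : 'I_m.+1 -> R) (rho : nat -> R) (varpi : R)
    (k : nat) (d : 'I_n -> R -> R[i]) : {set 'I_n} :=
  [set j | ~~ `[< intI t1 (pjj t0 eps varrho rho varpi k d j) T @[T --> +oo] --> +oo >]].

Definition pkl (R : realType) (m : nat) (varrho : 'I_m.+1 -> R) (rho : nat -> R)
    (k : nat) (l : 'I_m.+1) : nat :=
  absz (Num.max 0 (Num.floor (rho k - varrho l) + 1))%R.

(* may be negative *)
Definition qkl (R : realType) (m : nat) (varrho : 'I_m.+1 -> R) (rho : nat -> R)
    (k : nat) (l : 'I_m.+1) : int :=
  Num.floor ((rho k - varrho l) / varrho ord0).

Definition smoothness (R : realType) (m : nat) (varrho : 'I_m.+1 -> R)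
    (rho : nat -> R) (k : nat) (l : 'I_m.+1) : nat :=
  absz (Num.max 2 (qkl varrho rho k l + 1))%R.

Definition sl (R : realType) (m : nat) (varrho : 'I_m.+1 -> R) (varpi : R)
    (l : 'I_m.+1) : nat :=
  absz (Num.floor (varpi - varrho l / varrho ord0))%R.

(* Main.v *)
Require Import Defs.
Set Warnings "-notation-incompatible-prefix,-notation-overridden,-ambiguous-paths".
From HB Require Import structures.
From mathcomp Require Import all_boot all_order all_algebra complex finmap multiset.
From mathcomp Require Import all_classical all_reals all_analysis.
From mathcomp Require Import ring lra zify.
Set Implicit Arguments.
Unset Strict Implicit.
Unset Printing Implicit Defensive.
Import Order.TTheory GRing.Theory Num.Theory.
Import numFieldNormedType.Exports.
Local Open Scope classical_set_scope.
Local Open Scope ring_scope.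

(* The coefficients are found recursively in the rank: the inhomogeneous term at a given rank
   is a polynomial in earlier coefficients, hence in the algebra K, and A is diagonalizable
   over C since its eigenvalues are distinct.

   Let e = eps_1, let s be the partial sum of order k and theta = e^kappa with
   kappa = rho_(k+1)/varrho_1 - varpi.  Taylor expansion in y shows that s solves the equation
   up to O(e^(rho_(k+1)/varrho_1)).  If S is bounded with a bounded right inverse W and
   S' = Ahat S - S (diag p0 + E) with E integrable, then y = s + theta S z is a solution as soon
   as z' = (p0 - kappa e'/e) z + N(t, z), where N and its derivative in z are dominated by
   C e^varpi + |E|, which is integrable.  Each scalar coefficient has a primitive that is
   monotone up to a bounded error, by the sign hypothesis, so Green's formula started at t1 or
   at +oo and the contraction principle give bounded solutions, with one free parameter for
   every coordinate started at t1.

   For the manifold of solutions S is the given Lyapunov matrix.  For mere existence S is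
   obtained by averaging: with mu_w running over the critical products,
   X = 1 + sum_w mu_w P_w reduces Ahat, written in an eigenbasis of A, to a diagonal matrix up
   to integrable terms; a rotation removes the imaginary parts of the diagonal, and replacing
   complex numbers by real 2x2 blocks makes S real of size n x 2n.

   The bound on the number of parameters is Gronwall's inequality at the initial time. *)

(** * Calculus on half-lines *)

Section Calculus.
Variable R : realType.
Implicit Types (f g : R -> R) (t a b l : R).

(** Hypotheses 11 and 12 are what the gauge [theta] requires. The first half of 11 says kappa > 0,
    so [theta] tends to 0 and y stays in the cylinder. Division of the residual by [theta] leaves
    O(e^varpi). The nonlinear remainder is O(e theta^2), hence O(e^(1+kappa)) after division, and
    the second half of 11 says 1 + kappa >= varpi. Hypothesis 12 says that [theta] is
    O(e^(rho_(k0+1)/varrho_1)).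

    The Lyapunov matrix is an assumption of the manifold statement, whereas existence is asserted
    outright; this is why a reducing transformation has to be constructed. A right inverse of S
    suffices for that, and surplus coordinates do no harm as long as no parameters are counted.

    Real parts of eigenvalues may vanish, so there is no exponential dichotomy: the Green kernels
    are bounded but need not decay. Contraction therefore comes from the small tail of an integrable
    majorant, at a large t1. Independence of the parameters is read off at t1, where the Green part
    vanishes in the free coordinates. *)

Lemma der_ext f g t l : f =1 g -> is_derive t 1 f l -> is_derive t 1 g l.
Proof. by move=> /funext->. Qed.

Lemma der_near f g t l : (\forall x \near t, f x = g x) -> is_derive t 1 f l ->
  is_derive t 1 g l.
Proof. by move=> fg; apply: near_eq_is_derive => //; exact: oner_neq0. Qed.

Lemma derD f g t a b : is_derive t 1 f a -> is_derive t 1 g b ->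
  is_derive t 1 (fun x => f x + g x) (a + b).
Proof. by move=> fa gb; exact: is_deriveD. Qed.

Lemma derB f g t a b : is_derive t 1 f a -> is_derive t 1 g b ->
  is_derive t 1 (fun x => f x - g x) (a - b).
Proof. by move=> fa gb; exact: is_deriveB. Qed.

Lemma derN f t a : is_derive t 1 f a -> is_derive t 1 (fun x => - f x) (- a).
Proof. by move=> fa; exact: is_deriveN. Qed.

Lemma derM f g t a b : is_derive t 1 f a -> is_derive t 1 g b ->
  is_derive t 1 (fun x => f x * g x) (a * g t + f t * b).
Proof.
by move=> fa gb; apply: is_derive_eq; rewrite addrC; congr +%R; rewrite mulrC.
Qed.

Lemma derc t (c : R) : is_derive t 1 (fun=> c : R) 0.
Proof. exact: is_derive_cst. Qed.

Lemma derZ f t (c : R) a : is_derive t 1 f a -> is_derive t 1 (fun x => c * f x) (c * a).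
Proof. by move=> fa; apply: is_derive_eq (derM (derc t c) fa) _; rewrite mul0r add0r. Qed.

Lemma der_sum (I : Type) (r : seq I) (P : pred I) (F : I -> R -> R) (dF : I -> R) t :
  (forall i, P i -> is_derive t 1 (F i) (dF i)) ->
  is_derive t 1 (fun x => \sum_(i <- r | P i) F i x) (\sum_(i <- r | P i) dF i).
Proof.
move=> H; elim: r => [|i r IH].
  by rewrite big_nil; apply: (@der_ext (fun=> 0)) (derc _ _) => x; rewrite big_nil.
rewrite big_cons; case: ifP => Pi; last by
  apply: der_ext IH => x; rewrite big_cons Pi.
by apply: der_ext (derD (H i Pi) IH) => x; rewrite big_cons Pi.
Qed.

Lemma der_comp f g t a b : is_derive t 1 g b -> is_derive (g t) 1 f a ->
  is_derive t 1 (fun x => f (g x)) (a * b).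
Proof.
move=> gb fa; have := @is_derive1_comp _ f g t a b; exact.
Qed.

Lemma der_expR f t a : is_derive t 1 f a ->
  is_derive t 1 (fun x => expR (f x)) (expR (f t) * a).
Proof. by move=> fa; apply: der_comp fa _; exact: is_derive_expR. Qed.

Lemma der_cos f t a : is_derive t 1 f a ->
  is_derive t 1 (fun x => cos (f x)) (- sin (f t) * a).
Proof. by move=> fa; apply: der_comp fa _; exact: is_derive_cos. Qed.

Lemma der_sin f t a : is_derive t 1 f a ->
  is_derive t 1 (fun x => sin (f x)) (cos (f t) * a).
Proof. by move=> fa; apply: der_comp fa _; exact: is_derive_sin. Qed.

Lemma der_cont f t l : is_derive t 1 f l -> {for t, continuous f}.
Proof.
by move=> [fd _]; apply: differentiable_continuous; apply/derivable1_diffP.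
Qed.

Lemma der_uniq f t a b : is_derive t 1 f a -> is_derive t 1 f b -> a = b.
Proof. by move=> [_ <-] [_ <-]. Qed.

Lemma der_within_cont f df a b : (forall t, a <= t <= b -> is_derive t 1 f (df t)) ->
  {within `[a, b], continuous f}.
Proof.
move=> H; apply: derivable_within_continuous => t; rewrite in_itv /= => /H.
by move=> [].
Qed.

Lemma mean_value f df a b : a < b ->
  (forall t, a <= t <= b -> is_derive t 1 f (df t)) ->
  exists2 c, a < c < b & f b - f a = df c * (b - a).
Proof.
move=> ab H.
have [||c] := @MVT _ f df a b ab.
- by move=> t; rewrite in_itv /= => /andP[t1 t2]; apply: H; rewrite !ltW.
- exact: der_within_cont H.
- by rewrite in_itv /= => ct e; exists c.
Qed.

Lemma der_le0 f df a b : a <= b ->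
  (forall t, a <= t <= b -> is_derive t 1 f (df t)) ->
  (forall t, a <= t <= b -> 0 <= df t) -> f a <= f b.
Proof.
rewrite le_eqVlt => /predU1P[->//|ab] H H0; rewrite -subr_ge0.
have [c /andP[c1 c2] ->] := mean_value ab H.
by rewrite mulr_ge0 ?subr_ge0 ?H0 ?(ltW c1) ?(ltW c2) ?ltW.
Qed.

(** Both [g - f] and [g + f] are nondecreasing. Most integral estimates below are obtained in this
    way from primitives, without any integral. *)
Lemma der_dom f df g dg a b : a <= b ->
  (forall t, a <= t <= b -> is_derive t 1 f (df t)) ->
  (forall t, a <= t <= b -> is_derive t 1 g (dg t)) ->
  (forall t, a <= t <= b -> `|df t| <= dg t) -> `|f b - f a| <= g b - g a.
Proof.
move=> ab Hf Hg H.
have h1 : g a - f a <= g b - f b.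
  apply: (der_le0 (f := fun t => g t - f t) ab) => [t tt|t tt].
    exact: derB (Hg _ tt) (Hf _ tt).
  by rewrite subr_ge0; apply: le_trans (H _ tt); exact: ler_norm.
have h2 : g a + f a <= g b + f b.
  apply: (der_le0 (f := fun t => g t + f t) ab) => [t tt|t tt].
    exact: derD (Hg _ tt) (Hf _ tt).
  by have := H _ tt; rewrite ler_norml => /andP[? _]; lra.
by rewrite ler_norml; apply/andP; split; lra.
Qed.

Lemma der_lip f df a b M :
  (forall t, Num.min a b <= t <= Num.max a b -> is_derive t 1 f (df t)) ->
  (forall t, Num.min a b <= t <= Num.max a b -> `|df t| <= M) ->
  `|f b - f a| <= M * `|b - a|.
Proof.
wlog ab : a b / a <= b => [wl|].
  have [ab|/ltW ba] := leP a b; first by have := wl _ _ ab; rewrite (min_idPl ab) (max_idPr ab).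
  by have := wl _ _ ba; rewrite (min_idPl ba) (max_idPr ba) distrC (distrC b).
rewrite (min_idPl ab) (max_idPr ab) => H1 H2.
have -> : M * `|b - a| = M * b - M * a by rewrite -mulrBr ger0_norm// subr_ge0.
apply: (der_dom (g := fun t => M * t) ab H1 _ H2) => t _.
by apply: is_derive_eq (derZ M (is_derive_id t 1)) _; rewrite mulr1.
Qed.

Lemma der0_const f a b : a <= b ->
  (forall t, a <= t <= b -> is_derive t 1 f 0) -> f a = f b.
Proof.
move=> ab H; have := @der_dom f (fun=> 0) (fun=> 0) (fun=> 0) a b ab H.
rewrite subrr => /(_ (fun t _ => derc t 0)) h.
have {}h : `|f b - f a| <= 0 by apply: h => t _; rewrite normr0.
by apply/esym/eqP; rewrite -subr_eq0 -normr_le0.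
Qed.

Lemma cont_max (t1 : R) : continuous (fun t : R => Num.max t t1).
Proof. by move=> t; apply: (@continuous_max _ _ (@id R) (cst t1)); [exact: cvg_id|exact: cvg_cst]. Qed.

(* g is frozen to the left of t1; this encodes continuity on [t1, +oo[. *)
Definition contI (V : topologicalType) (t1 : R) (g : R -> V) := continuous (fun t => g (Num.max t t1)).

Lemma der_contI f df t1 : (forall t, t1 <= t -> is_derive t 1 f (df t)) -> contI t1 f.
Proof.
move=> H t; apply: (@continuous_comp _ _ _ (fun t => Num.max t t1) f); first exact: cont_max.
by apply: der_cont (H _ _); rewrite le_max lexx orbT.
Qed.

Lemma contI_le (V : topologicalType) (g : R -> V) t1 t2 : t1 <= t2 -> contI t1 g -> contI t2 g.
Proof.
move=> t12 gc t; pose h x := g (Num.max x t1).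
have -> : (fun t => g (Num.max t t2)) = h \o (fun t => Num.max t t2).
  by apply/funext => x /=; rewrite /h -maxA (max_idPl t12).
by apply: continuous_comp; [exact: cont_max|exact: gc].
Qed.

Lemma contI_at (V : topologicalType) (g : R -> V) t1 t : t1 < t -> contI t1 g -> {for t, continuous g}.
Proof.
move=> t1t gc; have := gc t; rewrite /continuous_at (max_idPl (ltW t1t)).
apply: cvg_trans; apply: near_eq_cvg; near=> x.
by rewrite (max_idPl _)//; apply/ltW; near: x; exact: lt_nbhsr.
Unshelve. all: by end_near. Qed.

Lemma within_comp (T U V : topologicalType) (D : set U) (F : U -> V) (h : T -> U) :
  {within D, continuous F} -> continuous h -> (forall x, D (h x)) -> continuous (F \o h).
Proof.
move=> /subspace_continuousP Fc hc Dh x.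
move=> A /(Fc _ (Dh x)) wA; have := hc x _ wA.
by move=> wB; apply: (@filterS _ (nbhs x) _ _ _ _ wB) => y /= Ay; exact: Ay.
Qed.

Lemma contI_comp (U V : topologicalType) (D : set U) (F : U -> V) (h : R -> U) t1 :
  {within D, continuous F} -> contI t1 h -> (forall t, t1 <= t -> D (h t)) -> contI t1 (F \o h).
Proof.
move=> Fc gc Dg; have := @within_comp _ _ _ D F (fun t => h (Num.max t t1)) Fc gc.
by apply=> t; apply: Dg; rewrite le_max lexx orbT.
Qed.

Lemma withinP_contI (V : topologicalType) (g : R -> V) t1 :
  {within `[t1, +oo[, continuous g} <-> contI t1 g.
Proof.
split=> [gc|gc].
  apply: (@contI_comp _ _ _ g id t1 gc) => [|t tt]; first exact: cont_max.
  by rewrite /= in_itv /= tt.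
apply/subspace_continuousP => t; rewrite /= in_itv /= andbT => tt.
move=> A /= wA; have := gc t A; rewrite (max_idPl tt) => /(_ wA) wB.
apply: (@filterS _ (nbhs t) _ _ _ _ wB) => x /= + tx.
by rewrite (max_idPl _)//; move: tx; rewrite in_itv /= andbT.
Qed.

Lemma contI_primitive f t1 : contI t1 f ->
  exists2 F, (forall t, t1 <= t -> is_derive t 1 F (f t)) & F t1 = 0.
Proof.
move=> fc; pose h x := f (Num.max x t1).
(* The integral starts at [t1 - 1], so that [t1] is an interior point and the derivative there is
   two-sided. *)
pose F x := (\int[lebesgue_measure]_(y in `[t1 - 1, x]) h y)%R.
have Fd t : t1 <= t -> is_derive t 1 F (f t).
  move=> tt; have [||||d1 d2] := @continuous_FTC1_closed _ h (t1 - 1) t (t + 1).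
  - lra.
  - apply: continuous_compact_integrable; first exact: segment_compact.
    exact: continuous_subspaceT.
  - lra.
  - exact: fc.
  apply: DeriveDef => //; rewrite -derive1E d2 /h.
  by rewrite (max_idPl tt).
exists (fun x => F x - F t1); last by rewrite subrr.
by move=> t tt; apply: is_derive_eq (derB (Fd t tt) (derc _ _)) _; rewrite subr0.
Qed.

End Calculus.

(** * Matrices in the maximum norm, entry by entry *)

Section MatrixNorm.
Variable R : realType.

Lemma mx_norm_entry (p q : nat) (M : 'M[R]_(p, q)) i j : `|M i j| <= `|M|.
Proof.
rewrite [leRHS]/Num.norm/= mx_normrE.
exact: (@le_bigmax _ _ _ 0 (fun ij : 'I_p * 'I_q => `|M ij.1 ij.2|) (i, j)).
Qed.

Lemma mx_norm_leP (p q : nat) (M : 'M[R]_(p, q)) c : 0 <= c ->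
  (forall i j, `|M i j| <= c) -> `|M| <= c.
Proof.
by move=> c0 H; rewrite [leLHS]/Num.norm/= mx_normrE; apply: bigmax_le => // -[].
Qed.

Lemma mx_norm_mul (p q r : nat) (M : 'M[R]_(p, q)) (N : 'M[R]_(q, r)) :
  `|M *m N| <= q%:R * `|M| * `|N|.
Proof.
apply: mx_norm_leP => [|i j]; first by rewrite !mulr_ge0.
rewrite mxE; apply: (le_trans (ler_norm_sum _ _ _)).
apply: (@le_trans _ _ (\sum_(k < q) `|M| * `|N|)).
  by apply: ler_sum => k _; rewrite normrM ler_pM ?mx_norm_entry.
by rewrite sumr_const card_ord -mulrA mulr_natl.
Qed.

Lemma mx_cvg (T : Type) (F : set_system T) {FF : Filter F} (p q : nat) (f : T -> 'M[R]_(p, q))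
    (l : 'M[R]_(p, q)) :
  (forall i j, f x i j @[x --> F] --> l i j) -> f x @[x --> F] --> l.
Proof.
move=> H; apply/cvgrPdist_le => e e0.
have : \forall x \near F, forall ij : 'I_p * 'I_q, `|l ij.1 ij.2 - f x ij.1 ij.2| <= e.
  by apply: filter_forall => -[i j]; have /cvgrPdist_le/(_ e e0) := H i j.
apply: filterS => x Hx; apply: mx_norm_leP; first exact: ltW.
by move=> i j; rewrite !mxE; exact: (Hx (i, j)).
Qed.

Lemma mx_cvg_entry (T : Type) (F : set_system T) {FF : Filter F} (p q : nat) (f : T -> 'M[R]_(p, q))
    (l : 'M[R]_(p, q)) i j : f x @[x --> F] --> l -> f x i j @[x --> F] --> l i j.
Proof.
move=> fl; exact: (@continuous_cvg _ _ _ _ _ f (fun M : 'M[R]_(p, q) => M i j) l (@coord_continuous _ _ _ i j l) fl).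
Qed.

Lemma mx_continuous (T : topologicalType) (p q : nat) (f : T -> 'M[R]_(p, q)) :
  (forall i j, continuous (fun x => f x i j)) <-> continuous f.
Proof.
split=> [H x|H i j x]; first by apply: mx_cvg => i j; exact: H.
exact: mx_cvg_entry (H x).
Qed.

Lemma mx_contI t1 (p q : nat) (f : R -> 'M[R]_(p, q)) :
  (forall i j, contI t1 (fun x => f x i j)) <-> contI t1 f.
Proof. by rewrite /contI; exact: (mx_continuous (fun t => f (Num.max t t1))). Qed.

End MatrixNorm.

(** * One-sided derivatives of the statement against two-sided ones *)

Section WithinDerivative.
Variable R : realType.
Implicit Types (t : R).

(** Relational form of [dwithin]: the value is an argument, so calculus rules can be stated without
    first proving that the limit exists. *)
Definition dcvg (V : normedModType R) (S : set R) (g : R -> V) x (l : V) :=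
  (s - x)^-1 *: (g s - g x) @[s --> within S x^'] --> l.

Lemma derivable_within_dcvg (V : normedModType R) (S : set R) (g : R -> V) x :
  derivable_within S g x -> dcvg S g x (dwithin S g x).
Proof. by []. Qed.

(** The points [t + e / 2] are in the half-line for every radius [e], even at the left endpoint;
    properness makes one-sided limits unique. *)
Lemma within_proper t0 t : t0 <= t -> ProperFilter (within `[t0, +oo[ t^').
Proof.
move=> tt; apply: Build_ProperFilter_ex => P; rewrite /within /= /dnbhs /within /=.
move=> /nbhs_ballP[e /= e0 H].
exists (t + e / 2); apply: H.
- by rewrite /ball /= opprD addrA subrr add0r normrN gtr0_norm ?divr_gt0// ltr_pdivrMr// mulr_natr mulr2n ltrDl.
- by rewrite gt_eqF// ltrDl divr_gt0.
- by rewrite in_itv /= andbT (le_trans tt)// lerDl divr_ge0 ?ltW.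
Qed.

Lemma dcvg_dwithin (V : normedModType R) (S : set R) (g : R -> V) x l :
  ProperFilter (within S x^') -> dcvg S g x l -> derivable_within S g x /\ dwithin S g x = l.
Proof.
by move=> PF gl; split; [apply: cvgP gl|apply: cvg_lim gl].
Qed.

Lemma dcvg_dI (V : normedModType R) (g : R -> V) t0 t l : t0 <= t ->
  dcvg `[t0, +oo[ g t l -> derivable_within `[t0, +oo[ g t /\ dI t0 g t = l.
Proof. by move=> tt; apply: dcvg_dwithin; exact: within_proper. Qed.

Lemma dcvg_entry (p q : nat) (S : set R) (g : R -> 'M[R]_(p, q)) x l i j :
  dcvg S g x l -> dcvg S (fun s => g s i j) x (l i j).
Proof.
move=> /(mx_cvg_entry (F := within S x^') (i := i) (j := j)); apply: cvg_trans.
by apply: near_eq_cvg; apply: nearW => s; rewrite !mxE.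
Qed.

Lemma dcvg_mx (p q : nat) (S : set R) (g : R -> 'M[R]_(p, q)) x (l : 'M[R]_(p, q)) :
  (forall i j, dcvg S (fun s => g s i j) x (l i j)) -> dcvg S g x l.
Proof.
move=> H; apply: mx_cvg => i j; apply: cvg_trans (H i j).
by apply: near_eq_cvg; apply: nearW => s; rewrite !mxE.
Qed.

Lemma near_dwithin (S : set R) (x : R) (P : R -> Prop) :
  (forall s, s != x -> S s -> P s) -> \forall s \near within S x^', P s.
Proof.
move=> H; apply: (@filterE _ (nbhs x)) => s sx Ss; exact: H.
Qed.

Lemma is_derive_dcvg (S : set R) (g : R -> R) (x l : R) :
  is_derive x 1 g l -> dcvg S g x l.
Proof.
move=> /is_derive1_caratheodory[h [hE hc <-]].
have {}hc : h s @[s --> within S x^'] --> h x.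
  apply: cvg_trans hc => A hA; rewrite /fmap /= /within /=.
  rewrite /dnbhs /within /=; apply: (@filterS _ (nbhs x) _ _ _ _ hA) => y /= hy _ _; exact: hy.
apply: cvg_trans hc; apply: near_eq_cvg; apply: near_dwithin => s sx _.
by rewrite hE /GRing.scale/= mulrCA mulVf ?mulr1// subr_eq0.
Qed.

(** Carathéodory's form: the difference quotient, completed by [l] at [x], is continuous at [x]; at
    an interior point of [S] the restriction to [S] disappears. *)
Lemma dcvg_is_derive (S : set R) (g : R -> R) (x l : R) : nbhs x S ->
  dcvg S g x l -> is_derive x 1 g l.
Proof.
move=> Sx gl; apply/is_derive1_caratheodory.
exists (fun s => if s == x then l else (s - x)^-1 * (g s - g x)); split; last by rewrite eqxx.
  move=> s; case: eqVneq => [->|sx]; first by rewrite !subrr mulr0.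
  by rewrite mulrAC mulVf ?mul1r// subr_eq0.
apply/continuous_withinNx; rewrite /= eqxx; apply: cvg_trans gl => A /= wA.
rewrite /fmap /= in wA *; rewrite /within /= /dnbhs /within /= in wA.
rewrite /nbhs /= /dnbhs /within /=.
apply: filterS2 Sx wA => s /= Ss; rewrite /within /= => H sx.
by rewrite (negbTE sx); apply: H.
Qed.

Lemma nbhs_itvy t0 t : t0 < t -> nbhs t `[t0, +oo[%classic.
Proof.
move=> tt; near=> s; rewrite /= in_itv /= andbT; apply/ltW; near: s.
exact: lt_nbhsr.
Unshelve. all: by end_near. Qed.

Lemma dI_derive (g : R -> R) (t0 t : R) : t0 < t -> derivable_within `[t0, +oo[ g t ->
  is_derive t 1 g (dI t0 g t).
Proof. by move=> tt /derivable_within_dcvg; apply: dcvg_is_derive; exact: nbhs_itvy. Qed.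

Lemma dI_derive_mx (p q : nat) (g : R -> 'M[R]_(p, q)) t0 t i j : t0 < t ->
  derivable_within `[t0, +oo[ g t -> is_derive t 1 (fun s => g s i j) (dI t0 g t i j).
Proof.
move=> tt /derivable_within_dcvg /(dcvg_entry (i := i) (j := j)); apply: dcvg_is_derive.
exact: nbhs_itvy.
Qed.

Lemma derive_dI_mx (p q : nat) (g : R -> 'M[R]_(p, q)) t0 t (l : 'M[R]_(p, q)) : t0 <= t ->
  (forall i j, is_derive t 1 (fun s => g s i j) (l i j)) ->
  derivable_within `[t0, +oo[ g t /\ dI t0 g t = l.
Proof.
move=> tt H; apply: dcvg_dI => //; apply: dcvg_mx => i j; apply: is_derive_dcvg; exact: H.
Qed.

Lemma dcvg_ext (V : normedModType R) t0 (g h : R -> V) t l : t0 <= t ->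
  (forall s, t0 <= s -> g s = h s) -> dcvg `[t0, +oo[ g t l -> dcvg `[t0, +oo[ h t l.
Proof.
move=> tt gh; apply: cvg_trans; apply: near_eq_cvg.
apply: near_dwithin => s _; rewrite /= in_itv /= andbT => ts.
by rewrite !gh.
Qed.

Lemma dcvgD (S : set R) (g h : R -> R) x a b : dcvg S g x a -> dcvg S h x b ->
  dcvg S (fun s => g s + h s) x (a + b).
Proof.
move=> ga hb; apply: cvg_trans (cvgD ga hb); apply: near_eq_cvg; apply: nearW => s /=.
by rewrite !fctE /GRing.scale/=; ring.
Qed.

Lemma dcvgZ (S : set R) (g : R -> R) x a c : dcvg S g x a ->
  dcvg S (fun s => c * g s) x (c * a).
Proof.
move=> ga; rewrite /dcvg.
have -> : (fun s => (s - x)^-1 *: (c * g s - c * g x)) = (fun s => c * ((s - x)^-1 *: (g s - g x))).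
  by apply/funext => s; rewrite /GRing.scale/=; ring.
exact: cvgMl_tmp ga.
Qed.

End WithinDerivative.

(** * Integrability near infinity through bounded primitives *)

Section Integrability.
Variable R : realType.
Implicit Types (t T : R) (f g h : R -> R).

Lemma near_pinftyP (P : R -> Prop) :
  (\forall t \near +oo, P t) <-> (exists T, forall t, T <= t -> P t).
Proof.
split=> [[M [_ H]]|[T H]].
  by exists (M + 1) => t Mt; apply: H; lra.
by exists T; split; [exact: num_real|move=> t Tt; apply: H; exact: ltW].
Qed.

Lemma mono_bounded_cvg g T B : (forall s t, T <= s -> s <= t -> g s <= g t) ->
  (forall t, T <= t -> g t <= B) -> exists2 l, g t @[t --> +oo] --> l & forall t, T <= t -> g t <= l.
Proof.
move=> gm gB; pose h r := g (Num.max r T).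
have hm : {homo h : x y / x <= y}.
  by move=> x y xy; apply: gm; rewrite ?ge_max !le_max ?xy lexx !orbT.
have hB : has_ubound (range h).
  by exists B => _ [x _ <-]; apply: gB; rewrite le_max lexx orbT.
exists (sup (range h)).
  apply: cvg_trans (nondecreasing_cvgr hm hB); apply: near_eq_cvg.
  apply/near_pinftyP; exists T => t Tt; rewrite /h (max_idPl Tt)//.
move=> t Tt; apply: ub_le_sup => //; exists t => //; by rewrite /h (max_idPl Tt).
Qed.

(* Absolute integrability near +oo in a form that needs no measure theory. *)
Definition L1dom g := exists T h H B, forall t, T <= t ->
  [/\ is_derive t 1 H (h t), `|g t| <= h t & `|H t| <= B].

(** The conditional counterpart of [L1dom]: no majorant, and not even convergence of the primitive.
    It is all that is kept of a conditionally convergent integral, and it also covers terms that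
    merely oscillate around their mean. *)
Definition bprim g := exists T H B, forall t, T <= t -> is_derive t 1 H (g t) /\ `|H t| <= B.

Lemma L1dom_le g h C : L1dom h -> (exists T, forall t, T <= t -> `|g t| <= C * `|h t|) -> L1dom g.
Proof.
move=> [T [f [F [B HF]]]] [T' gh].
exists (Num.max T T'), (fun t => Num.max 0 C * f t), (fun t => Num.max 0 C * F t), (Num.max 0 C * B) => t.
rewrite ge_max => /andP[/HF[Fd hf FB] /gh gh'].
have C0 : 0 <= Num.max 0 C by rewrite le_max lexx.
split; first exact: derZ.
  apply: (le_trans gh'); apply: (@le_trans _ _ (Num.max 0 C * `|h t|)).
    by apply: ler_wpM2r => //; rewrite le_max lexx orbT.
  exact: ler_wpM2l.
by rewrite normrM ger0_norm//; apply: ler_wpM2l.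
Qed.

Lemma L1domD g h : L1dom g -> L1dom h -> L1dom (fun t => g t + h t).
Proof.
move=> [T [f [F [B HF]]]] [T' [f' [F' [B' HF']]]].
exists (Num.max T T'), (fun t => f t + f' t), (fun t => F t + F' t), (B + B') => t.
rewrite ge_max => /andP[/HF[Fd hf FB] /HF'[Fd' hf' FB']].
split; first exact: derD.
  by apply: (le_trans (ler_normD _ _)); exact: lerD.
by apply: (le_trans (ler_normD _ _)); exact: lerD.
Qed.

Lemma L1dom0 : L1dom (fun=> 0).
Proof.
exists 0, (fun=> 0), (fun=> 0), 0 => t _; rewrite normr0; split=> //; exact: derc.
Qed.

Lemma L1dom_ext g h : L1dom g -> (exists T, forall t, T <= t -> g t = h t) -> L1dom h.
Proof.
move=> gl [T gh]; apply: (L1dom_le (C := 1) gl); exists T => t /gh ->.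
by rewrite mul1r.
Qed.

Lemma L1dom_sum (I : Type) (r : seq I) (P : pred I) (F : I -> R -> R) :
  (forall i, P i -> L1dom (F i)) -> L1dom (fun t => \sum_(i <- r | P i) F i t).
Proof.
move=> H; elim: r => [|i r IH].
  by apply: (L1dom_ext L1dom0); exists 0 => t _; rewrite big_nil.
case Pi : (P i); last by apply: (L1dom_ext IH); exists 0 => t _; rewrite big_cons Pi.
by apply: (L1dom_ext (L1domD (H i Pi) IH)); exists 0 => t _; rewrite big_cons Pi.
Qed.

Lemma L1dom_Mb g h C : L1dom g -> (exists T, forall t, T <= t -> `|h t| <= C) ->
  L1dom (fun t => h t * g t).
Proof.
move=> gl [T hC]; apply: (L1dom_le (C := C) gl); exists T => t /hC hC'.
by rewrite normrM ler_wpM2r.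
Qed.

Lemma L1dom_norm g : L1dom g -> L1dom (fun t => `|g t|).
Proof.
by move=> gl; apply: (L1dom_le (C := 1) gl); exists 0 => t _; rewrite mul1r normr_id.
Qed.

(** The primitive of the majorant is monotone and bounded; subtracting its limit makes it small on a
    tail. This smallness is the source of every contraction below. *)
Lemma L1dom_tail g T0 (e : R) : L1dom g -> 0 < e -> exists T h H, T0 <= T /\
  forall t, T <= t -> [/\ is_derive t 1 H (h t), `|g t| <= h t & `|H t| <= e].
Proof.
move=> [T [h [H [B HH]]]] e0.
have Hm s t : T <= s -> s <= t -> H s <= H t.
  move=> Ts st; apply: (der_le0 st (df := h)) => u /andP[su _].
    by have [] := HH u (le_trans Ts su).
  by have [_ + _] := HH u (le_trans Ts su); apply: le_trans.
have HB t : T <= t -> H t <= B by move=> /HH[_ _]; apply: le_trans; exact: ler_norm.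
have [l Hl Hle] := mono_bounded_cvg Hm HB.
have /cvgrPdist_le/(_ e e0)/near_pinftyP[T1 H1] := Hl.
exists (Num.max T0 (Num.max T T1)), h, (fun t => H t - l).
split; first by rewrite le_max lexx.
move=> t; rewrite !ge_max => /and3P[_ /HH[h1 h2 _] /H1 h3]; split=> //.
  by apply: is_derive_eq (derB h1 (derc _ _)) _; rewrite subr0.
by rewrite distrC.
Qed.

(** A dominated function need not have a primitive. Continuity supplies one, and the primitive of
    the majorant bounds it. *)
Lemma bprim_contI g T0 : contI T0 g -> L1dom g -> bprim g.
Proof.
move=> gc [T [h [H [B HH]]]]; pose T1 := Num.max T T0.
have T01 : T0 <= T1 by rewrite le_max lexx orbT.
have [F Fd F0] := contI_primitive (contI_le T01 gc).
exists T1, F, (B + B) => t Tt; split; first exact: Fd.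
have TT1 : T <= T1 by rewrite le_max lexx.
have -> : F t = F t - F T1 by rewrite F0 subr0.
apply: (@le_trans _ _ (H t - H T1)).
  apply: (der_dom Tt (df := g) (dg := h)) => s /andP[s1 s2].
  - exact: Fd.
  - by have [] := HH s (le_trans TT1 s1).
  - by have [] := HH s (le_trans TT1 s1).
have [_ _ h1] := HH t (le_trans TT1 Tt); have [_ _ h2] := HH T1 TT1.
by move: h1 h2; rewrite !ler_norml => /andP[? ?] /andP[? ?]; lra.
Qed.

Lemma bprimD g h : bprim g -> bprim h -> bprim (fun t => g t + h t).
Proof.
move=> [T [G [B HG]]] [T' [H [B' HH]]].
exists (Num.max T T'), (fun t => G t + H t), (B + B') => t; rewrite ge_max => /andP[/HG[? ?] /HH[? ?]].
split; first exact: derD.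
by apply: (le_trans (ler_normD _ _)); exact: lerD.
Qed.

Lemma bprimZ g c : bprim g -> bprim (fun t => c * g t).
Proof.
move=> [T [G [B HG]]]; exists T, (fun t => c * G t), (`|c| * B) => t /HG[? ?]; split; first exact: derZ.
by rewrite normrM ler_wpM2l.
Qed.

Lemma bprim_ext g h : bprim g -> (exists T, forall t, T <= t -> g t = h t) -> bprim h.
Proof.
move=> [T [G [B HG]]] [T' gh]; exists (Num.max T T'), G, B => t.
by rewrite ge_max => /andP[/HG[? ?] /gh <-].
Qed.

Lemma bprim0 : bprim (fun=> 0).
Proof. by exists 0, (fun=> 0), 0 => t _; rewrite normr0; split=> //; exact: derc. Qed.

Lemma bprim_sum (I : Type) (r : seq I) (P : pred I) (F : I -> R -> R) :
  (forall i, P i -> bprim (F i)) -> bprim (fun t => \sum_(i <- r | P i) F i t).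
Proof.
move=> H; elim: r => [|i r IH].
  by apply: (bprim_ext bprim0); exists 0 => t _; rewrite big_nil.
case Pi : (P i); last by apply: (bprim_ext IH); exists 0 => t _; rewrite big_cons Pi.
by apply: (bprim_ext (bprimD (H i Pi) IH)); exists 0 => t _; rewrite big_cons Pi.
Qed.

Lemma contI_integrable g t0 T : contI t0 g ->
  (@lebesgue_measure R).-integrable `[t0, T] (EFin \o g).
Proof.
move=> gc; apply: continuous_compact_integrable; first exact: segment_compact.
apply: continuous_subspaceW (_ : {within `[t0, +oo[, continuous g}); last exact/withinP_contI.
by apply: subset_itv => //=; rewrite bnd_simp.
Qed.

Lemma intI_derive g t0 t : contI t0 g -> t0 < t -> is_derive t 1 (intI t0 g) (g t).
Proof.
move=> gc tt; have t1 : t < t + 1 by rewrite ltrDl.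
have [d1 d2] := @continuous_FTC1_closed R g t0 t (t + 1) t1 (contI_integrable (t + 1) gc) tt (contI_at tt gc).
by apply: DeriveDef; [exact: d1|rewrite -derive1E; exact: d2].
Qed.

Lemma intR_bprim g t0 : contI t0 g -> intR t0 g -> bprim g.
Proof.
move=> gc [_ /cvg_ex[l gl]].
have /cvgrPdist_le/(_ 1 ltr01)/near_pinftyP[T1 H1] := gl.
exists (Num.max T1 (t0 + 1)), (intI t0 g), (`|l| + 1) => t; rewrite ge_max => /andP[t1 t2].
split; first by apply: intI_derive => //; lra.
by have := lerB_dist l (intI t0 g t); have := H1 t t1; have := ler_normB l (l - intI t0 g t); rewrite opprB addrC subrK; lra.
Qed.

Lemma intRp_L1dom g t0 p : contI t0 (fun t => `|g t| `^ p) -> intRp t0 p g -> L1dom (fun t => `|g t| `^ p).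
Proof.
move=> gc /(intR_bprim gc) [T [H [B HH]]]; exists T, (fun t => `|g t| `^ p), H, B => t /HH[? ?].
by split=> //; rewrite ger0_norm// powR_ge0.
Qed.

Lemma contI_norm g t0 : contI t0 g -> contI t0 (fun t => `|g t|).
Proof. by move=> gc t; apply: cvg_norm; exact: gc. Qed.

Lemma powRr1_norm g : (fun t => `|g t| `^ 1) = (fun t => `|g t|).
Proof. by apply/funext => t; rewrite powRr1. Qed.

Lemma intR1_L1dom g t0 : contI t0 g -> intRp t0 1 g -> L1dom g.
Proof.
move=> gc gi; apply: (L1dom_le (C := 1) (intRp_L1dom _ gi)).
  by rewrite powRr1_norm; exact: contI_norm.
by exists 0 => t _; rewrite powRr1// mul1r normr_id.
Qed.

(** The way back to the integrability of the statement. It is needed to refute that a product is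
    critical, since critical products are defined by the failure of [intRp]. *)
Lemma L1dom_intR1 g t0 : contI t0 g -> L1dom g -> intRp t0 1 g.
Proof.
move=> gc gl; rewrite /intRp powRr1_norm; have nc := contI_norm gc.
split; first by move=> T _; exact: contI_integrable.
have [T [H [B HH]]] := bprim_contI nc (L1dom_norm gl).
pose T1 := Num.max T (t0 + 1).
have TT : T <= T1 by rewrite le_max lexx.
have tT : t0 + 1 <= T1 by rewrite le_max lexx orbT.
have der s : T1 <= s -> is_derive s 1 (intI t0 (fun t => `|g t|)) `|g s|.
  by move=> s1; apply: intI_derive => //; lra.
have [||l lc _] := @mono_bounded_cvg (intI t0 (fun t => `|g t|)) T1 (intI t0 (fun t => `|g t|) T1 + B + B).
- move=> s t s1 st; apply: (der_le0 (df := fun s => `|g s|) st) => u /andP[su _]; last exact: normr_ge0.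
  by apply: der; exact: le_trans su.
- move=> t t1.
  have e : H t - intI t0 (fun t => `|g t|) t = H T1 - intI t0 (fun t => `|g t|) T1.
    apply/esym/(der0_const (f := fun t => H t - intI t0 (fun t => `|g t|) t) t1) => s /andP[s1 s2].
    have h1 := der s s1; have [h2 _] := HH s (le_trans TT s1).
    by apply: is_derive_eq (derB h2 h1) _; rewrite subrr.
  have [_ h1] := HH t (le_trans TT t1); have [_ h2] := HH T1 TT.
  by move: h1 h2; rewrite !ler_norml => /andP[? ?] /andP[? ?]; lra.
- exact: cvgP lc.
Qed.

End Integrability.

(** * Bounded solutions of perturbed diagonal systems *)

Section Banach.
Variable R : realType.
Implicit Types (t : R).

Lemma geo_small (a C : R) : (forall i : nat, a <= C * 2^-1 ^+ i) -> a <= 0.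
Proof.
move=> H; rewrite leNgt; apply/negP => a0.
have C0 : 0 < C by have := H 0%N; rewrite expr0 mulr1; apply: lt_le_trans.
have /cvgrPdist_lt/(_ _ (divr_gt0 a0 C0)) [i _ /(_ i (leqnn i))] /= :=
  @cvg_expr R 2^-1 ltac:(by rewrite ger0_norm; lra).
rewrite sub0r normrN ger0_norm ?exprn_ge0// => h; have := H i.
by rewrite leNgt mulrC -ltr_pdivlMr ?h.
Qed.

(** The sequences [u i - 2 * C * 2^-1 ^+ i] and [u i + 2 * C * 2^-1 ^+ i] are monotone in opposite
    directions and enclose the limit, which is the supremum of the lower one. *)
Lemma geo_limit (u : nat -> R) C : (forall i, `|u i.+1 - u i| <= C * 2^-1 ^+ i) ->
  exists l, forall i, `|u i - l| <= 2 * C * 2^-1 ^+ i.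
Proof.
move=> H; pose v i := u i - 2 * C * 2^-1 ^+ i; pose w i := u i + 2 * C * 2^-1 ^+ i.
have C0 : 0 <= C by have := H 0%N; rewrite expr0 mulr1; apply: le_trans.
have p0 i : 0 <= 2^-1 ^+ i :> R by rewrite exprn_ge0.
have vS i : v i <= v i.+1.
  by have := H i; rewrite /v exprS ler_norml => /andP[h1 h2]; have := p0 i; lra.
have wS i : w i.+1 <= w i.
  by have := H i; rewrite /w exprS ler_norml => /andP[h1 h2]; have := p0 i; lra.
have vm i j : (i <= j)%N -> v i <= v j.
  by move=> /subnKC <-; elim: (j - i)%N => [|k IH]; rewrite ?addn0 ?addnS ?(le_trans IH).
have wm i j : (i <= j)%N -> w j <= w i.
  by move=> /subnKC <-; elim: (j - i)%N => [|k IH]; rewrite ?addn0 ?addnS ?(le_trans _ IH).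
have vw i j : v i <= w j.
  have vwi k : v k <= w k by rewrite /v /w; have := mulr_ge0 C0 (p0 k); lra.
  have [ij|/ltnW ji] := leqP i j; first exact: le_trans (vm _ _ ij) (vwi _).
  exact: le_trans (vwi _) (wm _ _ ji).
exists (sup (range v)) => i.
have h1 : v i <= sup (range v).
  by apply: ub_le_sup; [exists (w 0%N) => _ [k _ <-]|exists i].
have h2 : sup (range v) <= w i.
  by apply: ge_sup; [exists (v 0%N), 0%N|move=> _ [k _ <-]].
by rewrite ler_norml; move: h1 h2; rewrite /v /w => h1 h2; apply/andP; split; lra.
Qed.

(** Applying the hypothesis [k] times to the crude bound [b] gives [b * 2^-1 ^+ k + 2 * K]. The
    bound [b] does not enter the conclusion; its existence is what makes the absorption
    legitimate. *)
Lemma half_absorb (I : Type) (P : set I) (f : I -> R) (b K : R) : 0 <= K -> P !=set0 ->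
  (forall i, P i -> 0 <= f i <= b) ->
  (forall c, 0 <= c -> (forall i, P i -> f i <= c) -> forall i, P i -> f i <= c / 2 + K) ->
  forall i, P i -> f i <= 2 * K.
Proof.
move=> K0 [i0 Pi0] fb H.
have b0 : 0 <= b by have /andP[] := fb i0 Pi0; exact: le_trans.
have Hk (k : nat) : forall i, P i -> f i <= b * 2^-1 ^+ k + 2 * K.
  elim: k => [|k IH] i Pi.
    by have /andP[_] := fb i Pi; rewrite expr0 mulr1; move/le_trans; apply; lra.
  have p0 : 0 <= b * 2^-1 ^+ k by rewrite mulr_ge0// exprn_ge0.
  have := H _ _ IH i Pi; rewrite exprS => /(_ ltac:(lra)).
  by move/le_trans; apply; lra.
move=> i Pi; rewrite -subr_le0; apply: (@geo_small _ b) => k.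
by rewrite lerBlDr; exact: Hk.
Qed.

Definition bball (d : nat) t1 (r : R) (x : R -> 'cV[R]_d) :=
  contI t1 x /\ forall t, t1 <= t -> `|x t| <= r.

Lemma uniform_limit_contI (d : nat) t1 (X : nat -> R -> 'cV[R]_d) (x : R -> 'cV[R]_d) C :
  (forall i, contI t1 (X i)) ->
  (forall i t, t1 <= t -> `|X i t - x t| <= C * 2^-1 ^+ i) -> contI t1 x.
Proof.
move=> Xc XC t; apply/cvgrPdist_le => e e0.
have C0 : 0 <= C by have := XC 0%N t1 (lexx _); rewrite expr0 mulr1; apply: le_trans.
have [k kC] : exists k : nat, C * 2^-1 ^+ k <= e / 3.
  apply: contrapT => /forallNP nk; suff: e / 3 <= 0 by lra.
  by apply: (@geo_small _ C) => i; rewrite leNgt; apply/negP => /ltW; exact: nk.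
have /cvgrPdist_le/(_ (e / 3)) := Xc k t; move=> /(_ ltac:(lra)).
apply: filterS => s hs.
have mt r : t1 <= Num.max r t1 by rewrite le_max lexx orbT.
have h1 := XC k _ (mt t); have h2 := XC k _ (mt s).
have -> : x (Num.max t t1) - x (Num.max s t1) =
  - (X k (Num.max t t1) - x (Num.max t t1)) + (X k (Num.max t t1) - X k (Num.max s t1))
  + (X k (Num.max s t1) - x (Num.max s t1)).
  by apply/matrixP => i j; rewrite !mxE; ring.
apply: (le_trans (ler_normD _ _)); apply: (le_trans (lerD (ler_normD _ _) (lexx _))).
by rewrite normrN; lra.
Qed.

(** Iteration from 0 converges geometrically, uniformly on the half-line, so the limit is
    continuous. Functions are total and only their values from [t1] on count, so the fixed point
    equation holds there only. *)
Lemma banach_bounded (d : nat) t1 (r : R) (Phi : (R -> 'cV[R]_d) -> R -> 'cV[R]_d) : 0 <= r ->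
  (forall x, bball t1 r x -> bball t1 r (Phi x)) ->
  (forall x y c, 0 <= c -> bball t1 r x -> bball t1 r y ->
     (forall t, t1 <= t -> `|x t - y t| <= c) ->
     forall t, t1 <= t -> `|Phi x t - Phi y t| <= c / 2) ->
  exists2 x, bball t1 r x & forall t, t1 <= t -> x t = Phi x t.
Proof.
move=> r0 Phib Phic; pose X i := iter i Phi (fun=> 0).
have X0 i : bball t1 r (X i).
  elim: i => [|i IH]; last exact: Phib.
  by split=> [t|t _]; [exact: cvg_cst|rewrite normr0].
have XS i t : t1 <= t -> `|X i.+1 t - X i t| <= r * 2^-1 ^+ i.
  elim: i t => [|i IH] t tt.
    by rewrite /= subr0 expr0 mulr1; have [_] := X0 1%N; apply.
  rewrite exprS mulrCA mulrC; apply: (Phic (X i.+1) (X i)) => //.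
  by rewrite mulr_ge0// exprn_ge0.
have [x xX] : exists x : R -> 'cV[R]_d, forall i t, t1 <= t -> `|X i t - x t| <= 2 * r * 2^-1 ^+ i.
  have E t k : exists l, t1 <= t -> forall i, `|X i t k 0 - l| <= 2 * r * 2^-1 ^+ i.
    have [tt|/negP tt] := boolP (t1 <= t); last by exists 0.
    have [|l Hl] := @geo_limit (fun i => X i t k 0) r; last by exists l.
    move=> i; apply: le_trans (XS i t tt).
    by apply: le_trans (mx_norm_entry _ k 0); rewrite !mxE.
  have /choice[l Hl] : forall tk : R * 'I_d, exists l, t1 <= tk.1 ->
      forall i, `|X i tk.1 tk.2 0 - l| <= 2 * r * 2^-1 ^+ i.
    by move=> -[t k]; exact: E.
  exists (fun t => \col_k l (t, k)) => i t tt; apply: mx_norm_leP.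
    by rewrite !mulr_ge0// exprn_ge0.
  by move=> k j; rewrite !mxE (ord1 j); exact: (Hl (t, k)).
have xb : bball t1 r x.
  split; first by apply: uniform_limit_contI xX => i; have [] := X0 i.
  move=> t tt; rewrite -subr_le0; apply: (@geo_small _ (2 * r)) => i.
  rewrite lerBlDr; have -> : x t = - (X i t - x t) + X i t by rewrite opprB subrK.
  apply: (le_trans (ler_normD _ _)); rewrite normrN; apply: lerD; first exact: xX.
  by have [_] := X0 i; apply.
exists x => // t tt; apply/eqP; rewrite -subr_eq0 -normr_le0; apply: (@geo_small _ (2 * r)) => i.
have -> : x t - Phi x t = - (X i.+1 t - x t) + (Phi (X i) t - Phi x t).
  by rewrite opprB addrA subrK.
apply: (le_trans (ler_normD _ _)); rewrite normrN.
have p0 : 0 <= r * 2^-1 ^+ i by rewrite mulr_ge0// exprn_ge0.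
have h1 := xX i.+1 t tt.
have h2 := @Phic (X i) x (2 * r * 2^-1 ^+ i) ltac:(lra) (X0 i) xb (xX i) t tt.
by rewrite exprS in h1; lra.
Qed.

(** A quadratic error near [x] is o(h), whatever the constant [K]. *)
Lemma quad_differentiable (V W : normedModType R) (f : V -> W) (x : V) (df : {linear V -> W}) K e :
  continuous df -> 0 < e -> (forall h, `|h| < e -> `|f (h + x) - f x - df h| <= K * `|h| ^+ 2) ->
  differentiable f x.
Proof.
move=> dfc e0 H.
have Ho : f \o shift x = cst (f x) + df +o_ 0 id.
  apply/eqaddoP => eps eps0; pose K' := Num.max 1 K.
  have K0 : 0 < K' by rewrite lt_max ltr01.
  have d0 : 0 < Num.min e (eps / K') by rewrite lt_min e0 divr_gt0.
  near=> h.
  have : `|h| < Num.min e (eps / K').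
    by near: h; apply/nbhs_normP; exists (Num.min e (eps / K')) => // h /=; rewrite sub0r normrN.
  rewrite lt_min => /andP[he hk]; rewrite !fctE/= opprD addrA.
  apply: (le_trans (H h he)); rewrite expr2 mulrA ler_wpM2r//.
  apply: (@le_trans _ _ (K' * `|h|)); first by rewrite ler_wpM2r// le_max lexx orbT.
  by rewrite mulrC -ler_pdivlMr// ltW.
apply/diffP => /=.
(* The differential is the value of a choice operator, so the predicate by which it is chosen has to
   be met; there the base point is written as [lim (nbhs x)]. *)
apply: (@getPex _ (fun (df : {linear V -> W}) => continuous df /\
  forall y, f y = f (lim (nbhs x)) + df (y - lim (nbhs x))
                  +o_(y \near x) (y - lim (nbhs x)))).
exists df; split=> //; apply: eqaddoEx => z.
have hdf h : (f \o shift x = cst (f x) + h +o_ 0 id) ->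
    h = f \o shift x - cst (f x) +o_ 0 id.
  move=> hdf; apply: eqaddoE.
  rewrite hdf addrAC -!addrA addrC !addrA subrK.
  rewrite -[LHS]addr0 -addrA; congr (_ + _).
  by apply/eqP; rewrite eq_sym addrC addr_eq0 oppo.
rewrite (hdf _ Ho) !addrA lim_id // /(_ \o _) /= subrK [f _ + _]addrC addrK.
rewrite -addrA -[LHS]addr0; congr (_ + _).
apply/eqP; rewrite eq_sym addrC addr_eq0 oppox; apply/eqP.
rewrite [in LHS]littleo_center0 (comp_centerK x id).
by rewrite -[- _ in RHS](comp_centerK x).
Unshelve. all: by end_near. Qed.

End Banach.

(** * Green's formula for a scalar linear equation *)

Section Green.
Variable R : realType.
Implicit Types (t : R).

(** A primitive as a function of its integrand, so that the solution operator is a formula. It is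
    meaningful for integrands continuous from [t1] on, and determined there only. *)
Definition prim t1 (g : R -> R) : R -> R :=
  get [set F : R -> R | (forall t, t1 <= t -> is_derive t 1 F (g t)) /\ F t1 = 0].

Lemma primP t1 (g : R -> R) : contI t1 g ->
  (forall t, t1 <= t -> is_derive t 1 (prim t1 g) (g t)) /\ prim t1 g t1 = 0.
Proof.
move=> /contI_primitive[F Fd F0].
exact: (@getPex _ [set F : R -> R | (forall t, t1 <= t -> is_derive t 1 F (g t)) /\ F t1 = 0]
  (ex_intro _ F (conj Fd F0))).
Qed.

Lemma prim_uniq t1 (g F : R -> R) : contI t1 g ->
  (forall t, t1 <= t -> is_derive t 1 F (g t)) -> F t1 = 0 -> forall t, t1 <= t -> F t = prim t1 g t.
Proof.
move=> /primP[Gd G0] Fd F0 t tt; apply/eqP; rewrite -subr_eq0.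
have Dd s : t1 <= s <= t -> is_derive s 1 (fun t => F t - prim t1 g t) 0.
  by move=> /andP[s1 s2]; apply: is_derive_eq (derB (Fd s s1) (Gd s s1)) _; rewrite subrr.
by have := der0_const tt Dd; rewrite F0 G0 subrr => <-.
Qed.

Lemma contIM t1 (f g : R -> R) : contI t1 f -> contI t1 g -> contI t1 (fun t => f t * g t).
Proof. by move=> fc gc t; apply: cvgM; [exact: fc|exact: gc]. Qed.

Lemma contID t1 (f g : R -> R) : contI t1 f -> contI t1 g -> contI t1 (fun t => f t + g t).
Proof. by move=> fc gc t; apply: cvgD; [exact: fc|exact: gc]. Qed.

Lemma contIc (V : topologicalType) t1 (c : V) : contI t1 (fun=> c).
Proof. by move=> t; exact: cvg_cst. Qed.

Lemma contIZ t1 c (f : R -> R) : contI t1 f -> contI t1 (fun t => c * f t).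
Proof. by move=> fc; apply: contIM => //; exact: contIc. Qed.

Lemma contIB t1 (f g : R -> R) : contI t1 f -> contI t1 g -> contI t1 (fun t => f t - g t).
Proof. by move=> fc gc t; apply: cvgB; [exact: fc|exact: gc]. Qed.

Lemma contI_sum (I : Type) (r : seq I) (P : pred I) t1 (F : I -> R -> R) :
  (forall i, P i -> contI t1 (F i)) -> contI t1 (fun t => \sum_(i <- r | P i) F i t).
Proof.
move=> H; elim: r => [|i r IH].
  have -> : (fun t => \sum_(i <- [::] | P i) F i t) = (fun=> 0) by apply/funext => t; rewrite big_nil.
  exact: contIc.
have -> : (fun t => \sum_(j <- i :: r | P j) F j t) =
  (fun t => if P i then F i t + \sum_(j <- r | P j) F j t else \sum_(j <- r | P j) F j t).
  by apply/funext => t; rewrite big_cons.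
by case Pi : (P i) => //; apply: contID => //; exact: H.
Qed.

Lemma contI_mulmx t1 (a b c : nat) (F : R -> 'M[R]_(a, b)) (G : R -> 'M[R]_(b, c)) :
  contI t1 F -> contI t1 G -> contI t1 (fun t => F t *m G t).
Proof.
move=> /mx_contI Fc /mx_contI Gc; apply/mx_contI => i j.
have -> : (fun x => (F x *m G x) i j) = (fun x => \sum_k F x i k * G x k j).
  by apply/funext => x; rewrite mxE.
by apply: contI_sum => k _; apply: contIM.
Qed.

Lemma contI_mxD t1 (a b : nat) (F G : R -> 'M[R]_(a, b)) :
  contI t1 F -> contI t1 G -> contI t1 (fun t => F t + G t).
Proof. by move=> fc gc t; apply: cvgD; [exact: fc|exact: gc]. Qed.

Lemma contI_mxB t1 (a b : nat) (F G : R -> 'M[R]_(a, b)) :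
  contI t1 F -> contI t1 G -> contI t1 (fun t => F t - G t).
Proof. by move=> fc gc t; apply: cvgB; [exact: fc|exact: gc]. Qed.

Lemma contI_mxZ t1 (a b : nat) (f : R -> R) (G : R -> 'M[R]_(a, b)) :
  contI t1 f -> contI t1 G -> contI t1 (fun t => f t *: G t).
Proof. by move=> fc gc t; apply: cvgZ; [exact: fc|exact: gc]. Qed.

Lemma contI_expR t1 (f : R -> R) : contI t1 f -> contI t1 (fun t => expR (f t)).
Proof.
move=> fc t; have := @continuous_comp _ _ _ (fun t => f (Num.max t t1)) expR t (fc t).
by apply; exact: continuous_expR.
Qed.

(** [F + K * H] is nondecreasing and bounded, [K * H] converges too, and [F] is the difference. *)
Lemma dominated_cvg t1 (F H dF h : R -> R) B K : 0 <= K ->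
  (forall t, t1 <= t -> is_derive t 1 F (dF t)) ->
  (forall t, t1 <= t -> [/\ is_derive t 1 H (h t), 0 <= h t & `|H t| <= B]) ->
  (forall t, t1 <= t -> `|dF t| <= K * h t) -> cvg (F t @[t --> +oo]).
Proof.
move=> K0 Fd HH Fh.
have Hm s t : t1 <= s -> s <= t -> H s <= H t.
  move=> Ts st; apply: (der_le0 st (df := h)) => u /andP[su _].
    by have [] := HH u (le_trans Ts su).
  by have [] := HH u (le_trans Ts su).
have HB t : t1 <= t -> H t <= B by move=> /HH[_ _]; apply: le_trans; exact: ler_norm.
have [l Hl _] := mono_bounded_cvg Hm HB.
have Fd' s t : t1 <= s -> s <= t -> `|F t - F s| <= K * H t - K * H s.
  move=> Ts st; apply: (der_dom st (df := dF) (g := fun t => K * H t) (dg := fun t => K * h t)) => u /andP[su _].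
  - exact: Fd (le_trans Ts su).
  - by apply: derZ; have [] := HH u (le_trans Ts su).
  - exact: Fh (le_trans Ts su).
(* The upper bound consists of [F t1], at most [2 * K * B] for the variation of [F], and [K * B] for
   the added term. *)
have [||l' Gl _] := @mono_bounded_cvg _ (fun t => F t + K * H t) t1 (F t1 + 3 * K * B).
- by move=> s t Ts st; have := Fd' s t Ts st; rewrite ler_norml => /andP[h1 h2]; lra.
- move=> t tt; have := Fd' t1 t (lexx _) tt; rewrite ler_norml => /andP[h1 h2].
  have [_ _] := HH t1 (lexx _); have [_ _] := HH t tt.
  by rewrite !ler_norml => /andP[g1 g2] /andP[g3 g4]; nra.
have -> : F = (fun t => F t + K * H t - K * H t) by apply/funext => t; rewrite addrK.
exact: cvgP (cvgB Gl (cvgMl_tmp (a := K) Hl)).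
Qed.

Section ScalarGreen.
Variables (t1 : R) (p P : R -> R) (M : R) (h H : R -> R) (eta : R) (b : bool).
Hypothesis HP : forall t, t1 <= t -> is_derive t 1 P (p t).
Hypothesis HM : forall s t, t1 <= s -> s <= t ->
  expR (if b then P t - P s else P s - P t) <= M.
Hypothesis HH : forall t, t1 <= t -> [/\ is_derive t 1 H (h t), 0 <= h t & `|H t| <= eta].

Let ig (N : R -> R) t := expR (- P t) * N t.

(* forward solution from t1 (b = true) or backward solution from +oo (b = false)
   of z' = p z + N *)
Definition green (N : R -> R) t : R :=
  expR (P t) * (prim t1 (ig N) t - if b then 0 else lim (prim t1 (ig N) s @[s --> +oo])).

Let dom (c : R) (N : R -> R) := contI t1 N /\ forall t, t1 <= t -> `|N t| <= c * h t.

Let ig_cont N : contI t1 N -> contI t1 (ig N).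
Proof.
move=> Nc; apply: contIM => //; apply: contI_expR.
have /contIZ : contI t1 P by exact: der_contI HP.
by move=> /(_ (-1)); congr (contI _ _); apply/funext => t; rewrite mulN1r.
Qed.

Lemma green_derive N : contI t1 N -> forall t, t1 <= t ->
  is_derive t 1 (green N) (p t * green N t + N t).
Proof.
move=> Nc t tt; have [Gd _] := primP (ig_cont Nc).
apply: is_derive_eq (derM (der_expR (HP tt)) (derB (Gd t tt) (derc _ _))) _.
rewrite subr0 /ig mulrA -expRD subrr expR0 mul1r; congr (_ + _).
by rewrite /green (mulrC (expR (P t)) (p t)) -mulrA.
Qed.

Lemma green_start N : contI t1 N -> b -> green N t1 = 0.
Proof.
by move=> /ig_cont/primP[_ P0] bT; rewrite /green bT P0 subrr mulr0.
Qed.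

Let M0 : 0 <= M.
Proof. by apply: le_trans (HM (lexx t1) (lexx t1)); exact: expR_ge0. Qed.

(** In the backward case [HM] taken from [t1] bounds [expR (P t1 - P t)], so the integrand is
    dominated by a multiple of [h] and the integral up to +oo exists. *)
Let prim_cvg c N : ~~ b -> 0 <= c -> dom c N -> cvg (prim t1 (ig N) s @[s --> +oo]).
Proof.
move=> bF c0 [Nc Nh]; have [Gd _] := primP (ig_cont Nc).
apply: (dominated_cvg (t1 := t1) (K := M * expR (- P t1) * c) _ Gd HH).
  by rewrite !mulr_ge0// expR_ge0.
move=> t tt; rewrite /ig normrM (ger0_norm (expR_ge0 _)).
have := HM (lexx t1) tt; rewrite (negbTE bF) => h1.
have -> : expR (- P t) = expR (P t1 - P t) * expR (- P t1) by rewrite -expRD; congr expR; lra.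
rewrite -2!mulrA -[leRHS]mulrA; apply: ler_pM => //.
by rewrite -[leRHS]mulrA ler_wpM2l ?expR_ge0// Nh.
Qed.

(** The kernel [expR (P t - P r)] is at most [M] for [r] on the side of [t] selected by [b]: the
    past for the forward solution, the future for the backward one. The total mass of [h] is at most
    [2 * eta]. *)
Let part_bound c N s u t : 0 <= c -> dom c N -> t1 <= s -> s <= u -> t1 <= t ->
  (if b then u <= t else t <= s) ->
  `|expR (P t) * (prim t1 (ig N) u - prim t1 (ig N) s)| <= M * c * (2 * eta).
Proof.
move=> c0 [Nc Nh] ts su tt bt; have [Gd _] := primP (ig_cont Nc).
rewrite mulrBr; apply: (@le_trans _ _ (M * c * H u - M * c * H s)).
  apply: (der_dom su (f := fun r => expR (P t) * prim t1 (ig N) r) (df := fun r => expR (P t) * ig N r)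
     (g := fun r => M * c * H r) (dg := fun r => M * c * h r)) => r /andP[r1 r2].
  - by apply: derZ; apply: Gd; exact: le_trans r1.
  - by apply: derZ; have [] := HH (le_trans ts r1).
  - rewrite /ig mulrA -expRD normrM (ger0_norm (expR_ge0 _)) -(mulrA M).
    apply: ler_pM; rewrite ?expR_ge0//; last exact: Nh (le_trans ts r1).
    have := HM; case: (b) bt => [ut|st] hm.
      by apply: hm; [exact: le_trans r1|exact: le_trans ut].
    by apply: hm => //; exact: le_trans r1.
rewrite -mulrBr ler_wpM2l// ?mulr_ge0//.
have [_ _ ] := HH ts; have [_ _] := HH (le_trans ts su).
by rewrite !ler_norml => /andP[? ?] /andP[? ?]; lra.
Qed.

Lemma green_bound c N : 0 <= c -> dom c N -> forall t, t1 <= t ->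
  `|green N t| <= M * c * (2 * eta).
Proof.
move=> c0 Nd t tt; have [Nc Nh] := Nd.
have [Gd G0] := primP (ig_cont Nc).
rewrite /green; case bE: (b).
  rewrite subr0; have := @part_bound c N t1 t t c0 Nd (lexx _) tt tt.
  by rewrite bE G0 subr0; apply.
have lc := prim_cvg (negbT bE) c0 Nd; set l := lim _.
(* In the backward case the limit at +oo is replaced by the value at a late [u], at the cost of
   [e]. *)
apply/ler_addgt0Pr => e e0.
have e1 : 0 < e / expR (P t) by rewrite divr_gt0 ?expR_gt0.
have /cvgrPdist_le/(_ _ e1)/near_pinftyP[T HT] := lc.
pose u := Num.max T t; have tu : t <= u by rewrite le_max lexx orbT.
have h1 := HT u ltac:(by rewrite le_max lexx).
have h2 := @part_bound c N t u t c0 Nd tt tu tt; rewrite bE lexx in h2.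
have -> : expR (P t) * (prim t1 (ig N) t - l) =
   - (expR (P t) * (prim t1 (ig N) u - prim t1 (ig N) t)) - expR (P t) * (l - prim t1 (ig N) u) by ring.
apply: (le_trans (ler_normB _ _)); rewrite normrN; apply: lerD; first exact: h2.
rewrite normrM (ger0_norm (expR_ge0 _)) mulrC -ler_pdivlMr ?expR_gt0//.
Qed.

(** Domination of both inputs is required because the limit at +oo in the backward case is additive
    only where it exists. *)
Lemma green_lin a c c' N N' : 0 <= c -> 0 <= c' -> dom c N -> dom c' N' -> forall t, t1 <= t ->
  green (fun s => a * N s + N' s) t = a * green N t + green N' t.
Proof.
move=> c0 c0' Nd Nd' t tt; have [Nc Nh] := Nd; have [Nc' Nh'] := Nd'.
have [Gd G0] := primP (ig_cont Nc); have [Gd' G0'] := primP (ig_cont Nc').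
have Lc : contI t1 (fun s => a * N s + N' s) by apply: contID => //; exact: contIZ.
have e s : t1 <= s -> a * prim t1 (ig N) s + prim t1 (ig N') s = prim t1 (ig (fun s => a * N s + N' s)) s.
  move=> ss; apply: (prim_uniq (F := fun s => a * prim t1 (ig N) s + prim t1 (ig N') s) (ig_cont Lc)) ss => [u uu|].
    by apply: is_derive_eq (derD (derZ a (Gd u uu)) (Gd' u uu)) _; rewrite /ig; ring.
  by rewrite G0 G0' mulr0 addr0.
rewrite /green -e//; case bE: (b); first by ring.
have lc := prim_cvg (negbT bE) c0 Nd; have lc' := prim_cvg (negbT bE) c0' Nd'.
have -> : lim (prim t1 (ig (fun s => a * N s + N' s)) s @[s --> +oo]) =
   a * lim (prim t1 (ig N) s @[s --> +oo]) + lim (prim t1 (ig N') s @[s --> +oo]).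
  apply/cvg_lim => //; apply: cvg_trans (cvgD (cvgMl_tmp (a := a) lc) lc').
  by apply: near_eq_cvg; apply/near_pinftyP; exists t1 => s ss; rewrite -e.
by ring.
Qed.

End ScalarGreen.
End Green.

Lemma row_lin_continuous (R : realType) (I : Type) (r : seq I) (N : nat) (k : I -> 'I_N) (c : I -> R) :
  continuous (fun v : 'rV[R]_N => \sum_(i <- r) v 0 (k i) * c i).
Proof.
elim: r => [|i r IH] v.
  have -> : (fun v : 'rV[R]_N => \sum_(i <- [::]) v 0 (k i) * c i) = (fun=> 0).
    by apply/funext => w; rewrite big_nil.
  exact: cst_continuous.
have -> : (fun v : 'rV[R]_N => \sum_(j <- i :: r) v 0 (k j) * c j) =
   (fun v => v 0 (k i) * c i + \sum_(j <- r) v 0 (k j) * c j).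
  by apply/funext => w; rewrite big_cons.
apply: (@cvgD _ _ _ (nbhs v) _ (fun w => w 0 (k i) * c i)); last exact: IH.
apply: (@cvgM _ _ (nbhs v) _ (fun w => w 0 (k i)) (fun=> c i)); last exact: cvg_cst.
exact: coord_continuous.
Qed.

(** * Weakly nonlinear diagonal systems and their dependence on the starting values *)

Section DiagonalSystem.
Variable R : realType.
Variables (d : nat) (t1 : R) (p P : 'I_d -> R -> R) (M : R) (h H : R -> R) (eta : R) (b : 'I_d -> bool).
Hypothesis HP : forall j t, t1 <= t -> is_derive t 1 (P j) (p j t).
Hypothesis HP0 : forall j, P j t1 = 0.
Hypothesis HM : forall j s t, t1 <= s -> s <= t ->
  expR (if b j then P j t - P j s else P j s - P j t) <= M.
Hypothesis HH : forall t, t1 <= t -> [/\ is_derive t 1 H (h t), 0 <= h t & `|H t| <= eta].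
Hypothesis M1 : 1 <= M.
Hypothesis Meta : M * (2 * eta) <= 1 / 2.

Definition vgreen (N : R -> 'cV[R]_d) t : 'cV[R]_d :=
  \col_j green t1 (P j) (b j) (fun s => N s j 0) t.

Let vdom (c : R) (N : R -> 'cV[R]_d) := contI t1 N /\ forall t, t1 <= t -> `|N t| <= c * h t.

Let vdom_entry c N j : vdom c N -> contI t1 (fun s => N s j 0) /\
  forall t, t1 <= t -> `|N t j 0| <= c * h t.
Proof.
by move=> [/mx_contI Nc Nh]; split=> [|t tt]; [exact: Nc|exact: le_trans (mx_norm_entry _ _ _) (Nh t tt)].
Qed.

Lemma vgreen_derive N : contI t1 N -> forall t j, t1 <= t ->
  is_derive t 1 (fun s => vgreen N s j 0) (p j t * vgreen N t j 0 + N t j 0).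
Proof.
move=> /mx_contI Nc t j tt; have := green_derive (b j) (HP j) (Nc j 0) tt.
rewrite /vgreen mxE; apply: der_ext => s; by rewrite mxE.
Qed.

Lemma vgreen_contI N : contI t1 N -> contI t1 (vgreen N).
Proof.
move=> Nc; apply/mx_contI => j k; rewrite (ord1 k).
by apply: der_contI => t tt; exact: vgreen_derive.
Qed.

(** By [Meta] the solution operator has norm at most 1/2 from inputs measured against the density
    [h] to bounded functions. *)
Lemma vgreen_bound c N : 0 <= c -> vdom c N -> forall t, t1 <= t -> `|vgreen N t| <= c / 2.
Proof.
move=> c0 Nd t tt; apply: mx_norm_leP => [|j k]; first by rewrite divr_ge0.
rewrite mxE; apply: le_trans (green_bound (HP j) (HM j) HH c0 (vdom_entry j Nd) tt) _.
have := ler_wpM2l c0 Meta; lra.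
Qed.

Lemma vgreen_lin a c c' N N' : 0 <= c -> 0 <= c' -> vdom c N -> vdom c' N' -> forall t, t1 <= t ->
  vgreen (fun s => a *: N s + N' s) t = a *: vgreen N t + vgreen N' t.
Proof.
move=> c0 c0' Nd Nd' t tt; apply/matrixP => j k; rewrite !mxE.
rewrite -(green_lin (HP j) (HM j) HH a c0 c0' (vdom_entry j Nd) (vdom_entry j Nd') tt).
by congr (green _ _ _ _ _); apply/funext => s; rewrite !mxE.
Qed.

Lemma vgreen_B c c' N N' : 0 <= c -> 0 <= c' -> vdom c N -> vdom c' N' -> forall t, t1 <= t ->
  vgreen N t - vgreen N' t = vgreen (fun s => N s - N' s) t.
Proof.
move=> c0 c0' Nd Nd' t tt.
rewrite addrC -scaleN1r -(vgreen_lin _ c0' c0 Nd' Nd tt).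
by congr (vgreen _ _); apply/funext => s; rewrite scaleN1r addrC.
Qed.

Lemma vgreen0 t : t1 <= t -> vgreen (fun=> 0) t = 0.
Proof.
move=> tt; apply/eqP; rewrite -normr_le0 -(mul0r 2^-1); apply: vgreen_bound tt => //.
by split=> [|s _]; [exact: contIc|rewrite normr0 mul0r].
Qed.

Lemma vgreen_sum (I : Type) (r : seq I) (a : I -> R) (N : I -> R -> 'cV[R]_d) (c : R) : 0 <= c ->
  (forall i, vdom c (N i)) -> exists2 c', 0 <= c' & vdom c' (fun s => \sum_(i <- r) a i *: N i s) /\
  forall t, t1 <= t -> vgreen (fun s => \sum_(i <- r) a i *: N i s) t = \sum_(i <- r) a i *: vgreen (N i) t.
Proof.
move=> c0 HN; elim: r => [|i r [c' c0' [[IH1 IH2] IH3]]].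
  have -> : (fun s => \sum_(i <- [::]) a i *: N i s) = (fun=> 0) by apply/funext => s; rewrite big_nil.
  exists 0 => //; split; first by split=> [|t _]; [exact: contIc|rewrite normr0 mul0r].
  by move=> t tt; rewrite big_nil vgreen0.
have -> : (fun s => \sum_(j <- i :: r) a j *: N j s) = (fun s => a i *: N i s + \sum_(j <- r) a j *: N j s).
  by apply/funext => s; rewrite big_cons.
have [Nc Nh] := HN i.
exists (`|a i| * c + c'); first by rewrite addr_ge0// mulr_ge0.
split; last by move=> t tt; rewrite big_cons (vgreen_lin _ c0 c0' (HN i) (conj IH1 IH2) tt) IH3.
split; first by apply: contI_mxD => //; apply: contI_mxZ => //; exact: contIc.
move=> t tt; apply: (le_trans (ler_normD _ _)); rewrite mulrDl; apply: lerD; last exact: IH2.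
by rewrite normrZ -mulrA ler_wpM2l// Nh.
Qed.

Definition free_set : {set 'I_d} := [set j | b j]%SET.

Lemma free_setE j : (j \in free_set) = b j.
Proof. by rewrite inE. Qed.

Definition inj_free (C : 'rV[R]_#|free_set|) : 'cV[R]_d :=
  \col_j \sum_i (if enum_val i == j then C 0 i else 0).

Lemma inj_free_val C i : inj_free C (enum_val i) 0 = C 0 i.
Proof.
rewrite mxE (bigD1 i)//= eqxx big1 ?addr0// => i' ii'.
by rewrite (inj_eq enum_val_inj) (negbTE ii').
Qed.

Lemma inj_free_out C j : ~~ b j -> inj_free C j 0 = 0.
Proof.
move=> bj; rewrite mxE big1// => i _; case: eqP => // e.
by have := enum_valP i; rewrite e free_setE (negbTE bj).
Qed.

Lemma inj_free_lin a C C' : inj_free (a *: C + C') = a *: inj_free C + inj_free C'.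
Proof.
apply/matrixP => j k; rewrite !mxE mulr_sumr -big_split/=; apply: eq_bigr => i _.
by case: ifP; rewrite ?mxE ?mulr0 ?addr0.
Qed.

Definition homog (C : 'rV[R]_#|free_set|) t : 'cV[R]_d := \col_j (expR (P j t) * inj_free C j 0).

Lemma homog_lin a C C' t : homog (a *: C + C') t = a *: homog C t + homog C' t.
Proof. by apply/matrixP => j k; rewrite /homog inj_free_lin !mxE; ring. Qed.

(** Only the coordinates started at [t1] carry a homogeneous part, and for these the forward bound
    applies with [s = t1]. *)
Lemma homog_bound C t : t1 <= t -> `|homog C t| <= M * `|C|.
Proof.
move=> tt; have M0 : 0 <= M by have := M1; lra.
apply: mx_norm_leP => [|j k]; first by rewrite mulr_ge0.
rewrite mxE; have [bj|bj] := boolP (b j); last by rewrite inj_free_out// mulr0 normr0 mulr_ge0.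
have jf : j \in free_set by rewrite inE.
rewrite -(enum_rankK_in jf jf) inj_free_val normrM (ger0_norm (expR_ge0 _)).
apply: ler_pM; rewrite ?expR_ge0 ?mx_norm_entry//.
by have := HM j (lexx t1) tt; rewrite bj HP0 subr0 enum_rankK_in.
Qed.

Lemma homog_derive C t j : t1 <= t -> is_derive t 1 (fun s => homog C s j 0) (p j t * homog C t j 0).
Proof.
move=> tt; rewrite mxE.
have -> : (fun s => homog C s j 0) = (fun s => inj_free C j 0 * expR (P j s)).
  by apply/funext => s; rewrite mxE mulrC.
by apply: is_derive_eq (derZ _ (der_expR (HP j tt))) _; ring.
Qed.

Lemma homog_contI C : contI t1 (homog C).
Proof.
apply/mx_contI => j k; rewrite (ord1 k).
by apply: der_contI => t tt; exact: homog_derive.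
Qed.

Variables (Nf : R -> 'cV[R]_d -> 'cV[R]_d) (DN : R -> 'cV[R]_d -> 'M[R]_d).
Hypothesis Nf_bound : forall t (z : 'cV[R]_d), t1 <= t -> `|z| <= 1 -> `|Nf t z| <= h t.
Hypothesis Nf_lip : forall t (z z' : 'cV[R]_d), t1 <= t -> `|z| <= 1 -> `|z'| <= 1 -> `|Nf t z - Nf t z'| <= h t * `|z - z'|.
Hypothesis Nf_quad : forall t (z z' : 'cV[R]_d), t1 <= t -> `|z| <= 1 -> `|z'| <= 1 ->
  `|Nf t z' - Nf t z - DN t z *m (z' - z)| <= h t * `|z' - z| ^+ 2.
Hypothesis DN_bound : forall t (z v : 'cV[R]_d), t1 <= t -> `|z| <= 1 -> `|DN t z *m v| <= h t * `|v|.
Hypothesis Nf_cont : forall z, bball t1 1 z -> contI t1 (fun t => Nf t (z t)).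
Hypothesis DN_cont : forall z, bball t1 1 z -> contI t1 (fun t => DN t (z t)).

Let N_dom z : bball t1 1 z -> vdom 1 (fun t => Nf t (z t)).
Proof.
move=> zb; split; first exact: Nf_cont.
by move=> t tt; rewrite mul1r; apply: Nf_bound => //; have [_] := zb; apply.
Qed.

Let NB_dom z z' c : bball t1 1 z -> bball t1 1 z' -> (forall t, t1 <= t -> `|z t - z' t| <= c) ->
  vdom c (fun t => Nf t (z t) - Nf t (z' t)).
Proof.
move=> zb zb' zc; split; first by apply: contI_mxB; exact: Nf_cont.
move=> t tt; have [_ h1] := zb; have [_ h2] := zb'.
apply: le_trans (Nf_lip tt (h1 t tt) (h2 t tt)) _; rewrite mulrC ler_wpM2r ?zc//.
by have [] := HH tt.
Qed.

(** The homogeneous part is at most 1/2 by the size of [C], the Green part at most 1/2 by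
    [vgreen_bound]; so the unit ball is mapped into itself. *)
Lemma nonlinear_solve C : `|C| < (2 * M)^-1 -> exists2 z, bball t1 1 z &
  forall t, t1 <= t -> z t = homog C t + vgreen (fun s => Nf s (z s)) t.
Proof.
move=> Ch; have MC : M * `|C| <= 1 / 2.
  have := M1; move: Ch; rewrite -[X in _ < X]div1r => + m1; rewrite ltr_pdivlMr; last by lra.
  by move=> ?; lra.
apply: banach_bounded => //.
- move=> z zb; split.
    by apply: contI_mxD; [exact: homog_contI|apply: vgreen_contI; exact: Nf_cont].
  move=> t tt; apply: (le_trans (ler_normD _ _)).
  have h1 := homog_bound C tt; have := vgreen_bound ler01 (N_dom zb) tt; lra.
- move=> z z' c c0 zb zb' zc t tt.
  rewrite opprD addrACA subrr add0r (vgreen_B ler01 ler01 (N_dom zb) (N_dom zb') tt).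
  exact: vgreen_bound c0 (NB_dom zb zb' zc) _ tt.
Qed.

(** The candidate for the derivative in the parameters is built from the solutions [xi i] of the
    linearized fixed point equations. The error of linearization satisfies a fixed point inequality
    with factor 1/2 and a quadratic source, which [half_absorb] turns into a quadratic bound. At
    [t1] the Green part vanishes in the forward coordinates, so these start at [C]. *)
Theorem diagonal_system : exists (z : 'rV[R]_#|free_set| -> R -> 'cV[R]_d) (e : R), 0 < e /\
  forall C, `|C| < e ->
  [/\ bball t1 1 (z C),
      forall t j, t1 <= t -> is_derive t 1 (fun s => z C s j 0) (p j t * z C t j 0 + Nf t (z C t) j 0),
      forall t, t1 <= t -> differentiable (fun C' => z C' t) C &
      forall i, z C t1 (enum_val i) 0 = C 0 i].
Proof.
have M0 : 0 < M by have := M1; lra.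
have e0 : 0 < (2 * M)^-1 by rewrite invr_gt0; lra.
have /choice[z Hz] : forall C, exists z, `|C| < (2 * M)^-1 -> bball t1 1 z /\
  forall t, t1 <= t -> z t = homog C t + vgreen (fun s => Nf s (z s)) t.
  move=> C; have [Ch|_] := boolP (`|C| < (2 * M)^-1); last by exists (fun=> 0).
  by have [z z1 z2] := nonlinear_solve Ch; exists z.
(* The chosen [z] is controlled only from [t1] on. The right-hand side of its equation agrees with
   it there and has a two-sided derivative even at [t1]. *)
pose y C t := homog C t + vgreen (fun s => Nf s (z C s)) t.
have yz C t : `|C| < (2 * M)^-1 -> t1 <= t -> y C t = z C t by move=> /Hz[_ h1] /h1 ->.
exists y, (2 * M)^-1; split=> // C Ch; have [zb zE] := Hz C Ch.
have yb : bball t1 1 (y C).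
  split; last by move=> t tt; rewrite yz//; have [_] := zb; apply.
  by apply: contI_mxD; [exact: homog_contI|apply: vgreen_contI; exact: Nf_cont].
split=> //.
- move=> t j tt; have h1 := homog_derive C j tt.
  have h2 := vgreen_derive (Nf_cont zb) j tt.
  rewrite yz//; have -> : (fun s => y C s j 0) = (fun s => homog C s j 0 + vgreen (fun s => Nf s (z C s)) s j 0).
    by apply/funext => s; rewrite mxE.
  apply: is_derive_eq (derD h1 h2) _.
  by rewrite [in RHS]zE// [in RHS]mxE -zE//; ring.
- have [x [xE [xb xE2]]] : exists x, x = z C /\ bball t1 1 x /\
      forall t, t1 <= t -> x t = homog C t + vgreen (fun s => Nf s (x s)) t by exists (z C).
  have [xc xb1] := xb.
  (* Lipschitz dependence on the parameter: 2 is the crude bound for two functions in the unit ball,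
     [M * |C' - C|] the contribution of the homogeneous parts. *)
  have Hlip C' t : `|C'| < (2 * M)^-1 -> t1 <= t -> `|z C' t - x t| <= 2 * (M * `|C' - C|).
    move=> Ch' tt; have [zb' zE'] := Hz C' Ch'; have [zc' zb1'] := zb'.
    apply: (@half_absorb R R [set t | t1 <= t] (fun t => `|z C' t - x t|) 2 (M * `|C' - C|)) tt => /=.
    + by rewrite mulr_ge0// ltW.
    + by exists t1 => /=.
    + move=> s ss; rewrite normr_ge0/=; apply: (le_trans (ler_normB _ _)).
      by have := zb1' s ss; have := xb1 s ss; lra.
    + move=> c c0 Hc s ss; rewrite (zE' s ss) (xE2 s ss) opprD addrACA.
      rewrite (vgreen_B ler01 ler01 (N_dom zb') (N_dom xb) ss).
      have -> : homog C' s - homog C s = homog (C' - C) s.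
        by rewrite -(scaleN1r (homog C s)) addrC -homog_lin scaleN1r addrC.
      apply: (le_trans (ler_normD _ _)); rewrite addrC; apply: lerD; last exact: homog_bound.
      exact: vgreen_bound c0 (NB_dom zb' xb Hc) _ ss.
  have DN_dom c (xi : R -> 'cV[R]_d) : contI t1 xi -> (forall t, t1 <= t -> `|xi t| <= c) ->
      vdom c (fun t => DN t (x t) *m xi t).
    move=> xic xb'; split; first by apply: contI_mulmx => //; exact: DN_cont.
    move=> t tt; apply: le_trans (DN_bound _ tt (xb1 t tt)) _; rewrite mulrC ler_wpM2r ?xb'//.
    by have [] := HH tt.
  have M20 : 0 <= 2 * M by lra.
  have /choice[xi Hxi] : forall i, exists xi, bball t1 (2 * M) xi /\
     forall t, t1 <= t -> xi t = homog (delta_mx 0 i) t + vgreen (fun s => DN s (x s) *m xi s) t.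
    (* Radius [2 * M]: a unit vector contributes at most [M] through [homog], and half of the radius
       comes back from [vgreen]. *)
    move=> i; have [|||xi x1 x2] := @banach_bounded R d t1 (2 * M)
      (fun xi t => homog (delta_mx 0 i) t + vgreen (fun s => DN s (x s) *m xi s) t); last by exists xi.
    + exact: M20.
    + move=> xi [xic xib]; split.
        apply: contI_mxD; [exact: homog_contI|apply: vgreen_contI].
        by have [] := DN_dom _ _ xic xib.
      move=> t tt; apply: (le_trans (ler_normD _ _)).
      have h1 := homog_bound (delta_mx 0 i) tt.
      have h2 : `|(delta_mx 0 i : 'rV[R]_#|free_set|)| <= 1.
        by apply: mx_norm_leP => // u v; rewrite mxE; case: (_ && _); rewrite ?normr0 ?normr1.
      have h3 := vgreen_bound M20 (DN_dom _ _ xic xib) tt.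
      have h4 : M * `|(delta_mx 0 i : 'rV[R]_#|free_set|)| <= M * 1 by rewrite ler_wpM2l// ltW.
      by lra.
    + move=> u v c c0 [uc ub] [vc vb] uv t tt.
      rewrite opprD addrACA subrr add0r (vgreen_B M20 M20 (DN_dom _ _ uc ub) (DN_dom _ _ vc vb) tt).
      have -> : (fun s => DN s (x s) *m u s - DN s (x s) *m v s) = (fun s => DN s (x s) *m (u s - v s)).
        by apply/funext => s; rewrite mulmxBr.
      by apply: (vgreen_bound c0 _ tt); apply: DN_dom => //; exact: contI_mxB.
  pose L (v : 'rV[R]_#|free_set|) t := \sum_i v 0 i *: xi i t.
  have xi_dom i : vdom (2 * M) (fun s => DN s (x s) *m xi i s).
    by have [[xic xib] _] := Hxi i; exact: DN_dom.
  have LE v : exists2 c, 0 <= c & vdom c (fun s => DN s (x s) *m L v s) /\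
    forall t, t1 <= t -> L v t = homog v t + vgreen (fun s => DN s (x s) *m L v s) t.
    have [c c0 [c1 c2]] := vgreen_sum (index_enum _) (fun i => v 0 i) M20 xi_dom.
    have e : (fun s => \sum_i v 0 i *: (DN s (x s) *m xi i s)) = (fun s => DN s (x s) *m L v s).
      by apply/funext => s; rewrite mulmx_sumr; apply: eq_bigr => i _; rewrite scalemxAr.
    rewrite e in c1 c2; exists c => //; split=> // t tt; rewrite c2//.
    have -> : homog v t = \sum_i v 0 i *: homog (delta_mx 0 i) t.
      have {1}-> : v = \sum_i v 0 i *: delta_mx 0 i by exact: row_sum_delta.
      elim/big_rec2: _ => [|i _ w _ <-]; last by rewrite homog_lin.
      by apply/matrixP => j k; rewrite -[X in homog X](scale0r (0 : 'rV_#|free_set|)) -(addr0 (0 *: _)) homog_lin scale0r add0r !mxE big1 ?mulr0// => i _; rewrite mxE if_same.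
    rewrite -big_split/=; apply: eq_bigr => i _; rewrite -scalerDr; congr (_ *: _).
    by have [_] := Hxi i; apply.
  move=> t tt.
  pose Xi : 'M[R]_(#|free_set|, d) := \matrix_(i, j) xi i t j 0.
  pose df : {linear 'rV[R]_#|free_set| -> 'cV[R]_d} := (trmx \o mulmxr Xi : {linear _ -> _}).
  have dfE v : df v = L v t.
    apply/matrixP => j k; rewrite !mxE summxE; apply: eq_bigr => i _.
    by rewrite !mxE (ord1 k).
  (* Origin of [4 * M ^+ 2]: the quadratic remainder is at most [h * (2 * M * |v|) ^+ 2], [vgreen]
     halves it, and [half_absorb] doubles it. The radius keeps [v + C] among the admissible
     parameters. *)
  apply: (@quad_differentiable R _ _ _ C df (4 * M ^+ 2) ((2 * M)^-1 - `|C|)).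
  + apply/mx_continuous => j k.
    have -> : (fun v => df v j k) = (fun v : 'rV[R]_#|free_set| => \sum_i v 0 i * xi i t j 0).
      apply/funext => v; rewrite dfE /L summxE; apply: eq_bigr => i _.
      by rewrite !mxE (ord1 k).
    exact: (row_lin_continuous (k := id)).
  + by rewrite subr_gt0.
  + move=> v vh; have Ch' : `|v + C| < (2 * M)^-1.
      by apply: (le_lt_trans (ler_normD _ _)); lra.
    rewrite !yz// -xE dfE.
    have [zb' zE'] := Hz _ Ch'; have [zc' zb1'] := zb'.
    have [c c0 [Ld LE']] := LE v.
    have -> : 4 * M ^+ 2 * `|v| ^+ 2 = 2 * (2 * (M * `|v|) ^+ 2) by ring.
    apply: (@half_absorb R R [set t | t1 <= t] (fun t => `|z (v + C) t - x t - L v t|)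
      (2 + \sum_i `|v 0 i| * (2 * M))) tt => /=.
    * by rewrite mulr_ge0// exprn_ge0// mulr_ge0// ltW.
    * by exists t1 => /=.
    * move=> s ss; rewrite normr_ge0/=; apply: (le_trans (ler_normB _ _)); apply: lerD.
        apply: (le_trans (ler_normB _ _)).
        by have := zb1' s ss; have := xb1 s ss; lra.
      apply: (le_trans (ler_norm_sum _ _ _)); apply: ler_sum => i _.
      by rewrite normrZ ler_wpM2l//; have [[_ h1] _] := Hxi i; apply: h1.
    * move=> e e0' He s ss.
      pose N1 s := Nf s (z (v + C) s) - Nf s (x s).
      have N1d : vdom (2 * (M * `|v|)) N1.
        by apply: NB_dom => // u uu; have := Hlip _ u Ch' uu; rewrite addrK.
      have Mv : 0 <= M * `|v| by rewrite mulr_ge0// ltW.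
      have Mv2 : 0 <= 2 * (M * `|v|) by lra.
      have -> : z (v + C) s - x s - L v s = vgreen (fun u => N1 u - DN u (x u) *m L v u) s.
        rewrite -(vgreen_B Mv2 c0 N1d Ld ss) /N1 -(vgreen_B ler01 ler01 (N_dom zb') (N_dom xb) ss).
        rewrite {1}zE'// {1}xE2// {1}LE'//.
        have -> : homog (v + C) s = homog v s + homog C s by have := homog_lin 1 v C s; rewrite !scale1r.
        by apply/matrixP => j k; rewrite !mxE; ring.
      have -> : e / 2 + 2 * (M * `|v|) ^+ 2 = (e + (2 * (M * `|v|)) ^+ 2) / 2 by field.
      have ec : 0 <= e + (2 * (M * `|v|)) ^+ 2 by rewrite addr_ge0// exprn_ge0.
      apply: (vgreen_bound ec _ ss); split.
        by apply: contI_mxB; [have [] := N1d|have [] := Ld].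
      move=> u uu; have [_ hu _] := HH uu.
      have -> : N1 u - DN u (x u) *m L v u =
        (Nf u (z (v + C) u) - Nf u (x u) - DN u (x u) *m (z (v + C) u - x u)) +
        DN u (x u) *m (z (v + C) u - x u - L v u).
        by rewrite (mulmxBr (DN u (x u)) (z (v + C) u - x u)) addrA subrK.
      apply: (le_trans (ler_normD _ _)); rewrite mulrDl addrC; apply: lerD.
        by apply: le_trans (DN_bound _ uu (xb1 u uu)) _; rewrite mulrC ler_wpM2r ?He.
      apply: le_trans (Nf_quad uu (xb1 u uu) (zb1' u uu)) _; rewrite mulrC ler_wpM2r//.
      rewrite ler_pXn2r ?nnegrE//.
      by have := Hlip _ u Ch' uu; rewrite addrK.
- move=> i; rewrite mxE mxE HP0 expR0 mul1r inj_free_val mxE green_start ?addr0//.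
  + by have [/mx_contI h1 _] := N_dom zb; exact: h1.
  + by have := enum_valP i; rewrite free_setE.
Qed.

End DiagonalSystem.

(** * Partial derivatives and Taylor expansion on the cylinder *)

Lemma der_pow (R : realType) (b : nat) (u : R) : is_derive u 1 (fun u : R => u ^+ b) (b%:R * u ^+ b.-1).
Proof.
elim: b => [|b IH].
  by rewrite mul0r; apply: der_ext (derc u 1) => x; rewrite expr0.
have d := derM (is_derive_id u (1 : R)) IH.
apply: is_derive_eq (der_ext _ d) _; first by move=> x; rewrite exprS.
case: b {IH d} => [|b]; first by rewrite !(mul0r, mulr0, addr0, mul1r, expr0).
by rewrite /= mul1r mulrCA -exprS -[b.+2%:R]natr1 mulrDl mul1r addrC.
Qed.

(** * Multi-indices, words of derivatives and monomials *)

Section MultiIndex.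
Variables (R : realType) (n : nat).
Implicit Types (h : 'cV[R]_n) (i j : 'I_n).

Definition setw (w : mindex n) j (b : nat) : mindex n := [ffun i => if i == j then b else w i].

Definition wstep r j (w : mindex n) := [seq setw w j b | b <- iota 0 (r - mabs w).+1].

(** The multi-indices of size at most [r] supported in [cs], produced in the order in which a Taylor
    expansion in one variable at a time meets them. *)
Fixpoint wlist (cs : seq 'I_n) (r : nat) : seq (mindex n) :=
  if cs is j :: cs' then
    flatten [seq wstep r j w | w <- wlist cs' r]
  else [:: [ffun=> 0%N]].

Lemma mabs_setw (w : mindex n) j b : w j = 0%N -> mabs (setw w j b) = (b + mabs w)%N.
Proof.
move=> wj; rewrite /mabs (bigD1 j)//= ffunE eqxx [in RHS](bigD1 j)//= wj add0n; congr addn.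
by apply: eq_bigr => i ij; rewrite ffunE (negbTE ij).
Qed.

Lemma wlist_mem cs r (w : mindex n) : uniq cs -> (w \in wlist cs r) = (mabs w <= r)%N && [forall j, (j \notin cs) ==> (w j == 0%N)].
Proof.
elim: cs w => [|j cs IH] w /=.
  move=> _; rewrite inE; apply/eqP/andP => [->|[_ /forallP H]].
    split; first by rewrite /mabs big1// => i _; rewrite ffunE.
    by apply/forallP => i; rewrite ffunE.
  by apply/ffunP => i; rewrite ffunE; have := H i => /eqP.
move=> /andP[jcs ucs]; apply/flattenP/andP.
  move=> [_ /mapP[w' + ->] /mapP[b + ->]]; rewrite IH// => /andP[w'r /forallP H].
  rewrite mem_iota add0n ltnS => /andP[_ bb].
  have w'j : w' j = 0%N by have := H j; rewrite jcs => /eqP.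
  split; first by rewrite mabs_setw//; lia.
  apply/forallP => i; rewrite inE negb_or ffunE; case: eqP => //= _; exact: H.
move=> [wr /forallP H]; pose w' := setw w j 0.
have w'j : w' j = 0%N by rewrite ffunE eqxx.
have wE : w = setw w' j (w j) by apply/ffunP => i; rewrite !ffunE; case: eqP => // ->.
have wm : mabs w = (w j + mabs w')%N by rewrite {1}wE mabs_setw.
exists (wstep r j w').
  apply/mapP; exists w' => //; rewrite IH//; apply/andP; split; first by lia.
  apply/forallP => i; rewrite /w' ffunE; have [_|ij] := eqVneq i j; first by rewrite implybT.
  by have := H i; rewrite inE negb_or ij.
by apply/mapP; exists (w j) => //; rewrite mem_iota; lia.
Qed.

Lemma wlist_out cs r (w : mindex n) j : uniq cs -> w \in wlist cs r -> j \notin cs -> w j = 0%N.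
Proof. by move=> ucs; rewrite wlist_mem// => /andP[_ /forallP/(_ j)/implyP H] /H/eqP. Qed.

Lemma wlist_uniq cs r : uniq cs -> uniq (wlist cs r).
Proof.
elim: cs => // j cs IH /= /andP[jcs ucs].
apply: (@allpairs_uniq_dep _ (fun=> nat) _ (fun w b => setw w j b)).
- exact: IH.
- by move=> w _; exact: iota_uniq.
- move=> [w b] [w' b'].
  move=> /allpairsPdep[w1 [b1 [w1in _ e1]]] /allpairsPdep[w2 [b2 [w2in _ e2]]] /= e.
  case: e1 e => -> ->; case: e2 => -> -> e.
  have eb : b1 = b2 by have /ffunP/(_ j) := e; rewrite !ffunE eqxx.
  rewrite eb in e *; congr (existT _ _ _); apply/ffunP => i.
  have [->|ij] := eqVneq i j; first by rewrite (wlist_out ucs w1in jcs) (wlist_out ucs w2in jcs).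
  by have /ffunP/(_ i) := e; rewrite !ffunE (negbTE ij).
Qed.

(** For [cs = enum 'I_n] this is the word in terms of which [pderm] is defined. *)
Definition flatw (cs : seq 'I_n) (w : mindex n) := flatten [seq nseq (w j) j | j <- cs].

Lemma flatw_setw cs (w : mindex n) j b : j \notin cs -> flatw (j :: cs) (setw w j b) = nseq b j ++ flatw cs w.
Proof.
move=> jcs; rewrite /flatw /= ffunE eqxx; congr (_ ++ flatten _).
by apply/eq_in_map => i ics; rewrite ffunE; case: eqP ics jcs => // -> ->.
Qed.

Lemma size_flatw cs (w : mindex n) : uniq cs -> (forall j, j \notin cs -> w j = 0%N) -> size (flatw cs w) = mabs w.
Proof.
move=> ucs H; rewrite /flatw size_flatten /shape -map_comp sumnE big_map /mabs.
rewrite (eq_bigr w); last by move=> i _ /=; rewrite size_nseq.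
by rewrite [in RHS](bigID (mem cs))/= [X in (_ + X)%N]big1 ?addn0// big_uniq.
Qed.

Definition hpow h (w : mindex n) : R := \prod_j (h j 0 ^+ w j / (w j)`!%:R).

Lemma hpow_setw h (w : mindex n) j b : w j = 0%N -> hpow h (setw w j b) = h j 0 ^+ b / b`!%:R * hpow h w.
Proof.
move=> wj; rewrite /hpow (bigD1 j)//= ffunE eqxx [in RHS](bigD1 j)//= wj expr0 fact0 divr1 mul1r.
by congr (_ * _); apply: eq_bigr => i ij; rewrite ffunE (negbTE ij).
Qed.

Lemma hpow_bound h (w : mindex n) : `|hpow h w| <= `|h| ^+ mabs w.
Proof.
rewrite /hpow normr_prod /mabs expr_sum; apply: ler_prod => i _; rewrite normr_ge0 normrM normrX /=.
rewrite normfV; apply: (@le_trans _ _ (`|h i 0| ^+ w i)).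
  by rewrite normr_nat ler_pdivrMr ?ltr0n ?fact_gt0// ler_peMr ?exprn_ge0// ler1n fact_gt0.
by rewrite lerXn2r ?nnegrE// mx_norm_entry.
Qed.

End MultiIndex.

(** * Schwarz's theorem and Taylor's formula in a box *)

Section BoxCalculus.
Variables (R : realType) (n : nat).
Implicit Types (y c h : 'cV[R]_n) (i j : 'I_n) (js : seq 'I_n).

Lemma set_coord_id y j : set_coord y j (y j 0) = y.
Proof. by apply/matrixP => i k; rewrite !mxE (ord1 k); case: eqP => // ->. Qed.

Lemma set_coordE y j s i : set_coord y j s i 0 = if i == j then s else y i 0.
Proof. by rewrite mxE. Qed.

Lemma set_coord_same y j s s' : set_coord (set_coord y j s) j s' = set_coord y j s'.
Proof. by apply/matrixP => i k; rewrite !mxE; case: eqP. Qed.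

Lemma set_coordC y i j s s' : i != j ->
  set_coord (set_coord y i s) j s' = set_coord (set_coord y j s') i s.
Proof.
move=> ij; apply/matrixP => k l; rewrite !mxE; case: (k =P j) => [->|//].
by rewrite eq_sym (negbTE ij).
Qed.

Variables (c : 'cV[R]_n) (a : R).
Hypothesis a0 : 0 < a.

(** The open section of the cylinder: at its points every line section of the cylinder is a
    neighbourhood, so partial derivatives are two-sided. *)
Definition box y := `|y - c| < a.

Lemma boxP y : box y <-> forall i, `|y i 0 - c i 0| < a.
Proof.
split=> [H i|H]; first by apply: le_lt_trans H; have := mx_norm_entry (y - c) i 0; rewrite !mxE.
have [i0 _|n0] := pickP (fun i : 'I_n => true); last first.
  apply: le_lt_trans a0; apply: mx_norm_leP => // i; have := n0 i; by [].
pose m := \big[Num.max/0]_i `|y i 0 - c i 0|.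
have ma : m < a by apply: bigmax_lt => // i _.
rewrite /box; apply: le_lt_trans ma; apply: mx_norm_leP.
  by apply: bigmax_ge_id.
by move=> i k; rewrite !mxE (ord1 k); exact: (le_bigmax _ (fun i => `|y i 0 - c i 0|)).
Qed.

Lemma box_between y y' (z : 'cV[R]_n) : box y -> box y' ->
  (forall i, Num.min (y i 0) (y' i 0) <= z i 0 <= Num.max (y i 0) (y' i 0)) -> box z.
Proof.
move=> /boxP yb /boxP yb' H; apply/boxP => i; have := H i; have := yb i; have := yb' i.
rewrite !ltr_norml => /andP[h1 h2] /andP[h3 h4]; rewrite ge_min le_max.
by move=> /andP[/orP[g1|g1] /orP[g2|g2]]; apply/andP; split; lra.
Qed.

(* G js stands for a component of the partial derivative along js of one function *)
Variables (G : seq 'I_n -> 'cV[R]_n -> R) (q : nat).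
Hypothesis Gd : forall js j y, (size js < q)%N -> box y ->
  is_derive (y j 0) 1 (fun s => G js (set_coord y j s)) (G (j :: js) y).

Lemma line_derive js j y s : (size js < q)%N -> box (set_coord y j s) ->
  is_derive s 1 (fun s => G js (set_coord y j s)) (G (j :: js) (set_coord y j s)).
Proof.
move=> js_q /(Gd j js_q); rewrite set_coordE eqxx; apply: der_ext => s'.
by rewrite set_coord_same.
Qed.

Hypothesis Gc : forall js y e, (size js <= q)%N -> box y -> 0 < e ->
  exists2 de, 0 < de & forall y', box y' -> `|y' - y| <= de -> `|G js y' - G js y| <= e.

(** The mean value theorem in direction [i] for the difference in direction [j], then in direction
    [j] for the derivative found. *)
Lemma mixed_difference js i j y s : (size js + 2 <= q)%N -> i != j -> 0 < s ->
  (forall z, `|z - y| <= s -> box z) ->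
  exists2 z, `|z - y| <= s & G js (set_coord (set_coord y i (y i 0 + s)) j (y j 0 + s)) -
    G js (set_coord y i (y i 0 + s)) - G js (set_coord y j (y j 0 + s)) + G js y = s * s * G (j :: i :: js) z.
Proof.
move=> q2 ij s0 yb; pose Y u v := set_coord (set_coord y i u) j v.
have Yb u v : y i 0 <= u <= y i 0 + s -> y j 0 <= v <= y j 0 + s -> `|Y u v - y| <= s.
  move=> /andP[u1 u2] /andP[v1 v2]; apply: mx_norm_leP; first exact: ltW.
  move=> k l; rewrite !mxE (ord1 l); case: eqP => [->|_].
    by rewrite ger0_norm; lra.
  case: eqP => [->|_]; first by rewrite ger0_norm; lra.
  by rewrite subrr normr0 ltW.
have Yj u : Y u (y j 0) = set_coord y i u.
  apply/matrixP => k l; rewrite !mxE; case: (k =P j) => // -> .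
  by rewrite eq_sym (negbTE ij).
have Yi v : Y (y i 0) v = set_coord y j v by rewrite /Y set_coord_id.
have sj : y j 0 < y j 0 + s by rewrite ltrDl.
have si : y i 0 < y i 0 + s by rewrite ltrDl.
have dY v u : y i 0 <= u <= y i 0 + s -> y j 0 <= v <= y j 0 + s ->
    is_derive u 1 (fun u => G js (Y u v)) (G (i :: js) (Y u v)).
  move=> uu vv; have b := yb _ (Yb u v uu vv); move: b; rewrite /Y set_coordC// => b.
  have js1 : (size js < q)%N by move: q2; rewrite addn2; apply: leq_trans; rewrite ltnS leqnSn.
  apply: der_ext (@line_derive js i (set_coord y j v) u js1 b).
  by move=> u' /=; congr (G js _); rewrite [RHS](set_coordC _ _ _ ij).
have vs : y j 0 <= y j 0 + s <= y j 0 + s by rewrite lexx ltW.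
have v0 : y j 0 <= y j 0 <= y j 0 + s by rewrite lexx ltW.
have [u /andP[u1 u2] hu] := mean_value (f := fun u => G js (Y u (y j 0 + s)) - G js (Y u (y j 0)))
  si (fun u uu => derB (dY _ u uu vs) (dY _ u uu v0)).
have uu : y i 0 <= u <= y i 0 + s by rewrite !ltW.
have [v /andP[v1 v2] hv] : exists2 v, y j 0 < v < y j 0 + s &
   G (i :: js) (Y u (y j 0 + s)) - G (i :: js) (Y u (y j 0)) = G (j :: i :: js) (Y u v) * (y j 0 + s - y j 0).
  apply: (mean_value (f := fun v => G (i :: js) (Y u v)) sj) => v vv.
  have js1 : (size (i :: js) < q)%N by move: q2; rewrite addn2.
  exact: (@line_derive (i :: js) j (set_coord y i u) v js1 (yb _ (Yb u v uu vv))).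
exists (Y u v); first by apply: Yb; rewrite // !ltW.
have e : y j 0 + s - y j 0 = s by ring.
have e' : y i 0 + s - y i 0 = s by ring.
move: hu; rewrite hv e e' !Yj !Yi -/(Y _ _) set_coord_id => hu.
transitivity (G (j :: i :: js) (Y u v) * s * s); last by ring.
by rewrite -hu; ring.
Qed.

Lemma box_room y : box y -> exists2 e, 0 < e & forall z, `|z - y| <= e -> box z.
Proof.
move=> yb; exists ((a - `|y - c|) / 2); first by rewrite divr_gt0// subr_gt0.
move=> z zy; rewrite /box; have -> : z - c = (z - y) + (y - c) by rewrite addrA subrK.
by apply: (le_lt_trans (ler_normD _ _)); move: yb; rewrite /box => yb; lra.
Qed.

(** The second difference is symmetric in [i] and [j], so both mixed derivatives take a common value
    at two points within [s] of [y]; continuity lets [s] shrink. *)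
Lemma schwarz js i j y : (size js + 2 <= q)%N -> box y -> G (i :: j :: js) y = G (j :: i :: js) y.
Proof.
move=> q2 yb; have [->//|ij] := eqVneq i j.
have q1 : (size (i :: j :: js) <= q)%N by rewrite /=; lia.
apply/eqP; rewrite -subr_eq0 -normr_le0; apply/ler_addgt0Pr => e e0; rewrite add0r.
have e2 : 0 < e / 2 by rewrite divr_gt0.
have [d1 d10 H1] := Gc q1 yb e2.
have [d2 d20 H2] := @Gc (j :: i :: js) y _ q1 yb e2.
have [d3 d30 H3] := box_room yb.
pose s := Num.min d1 (Num.min d2 d3).
have s0 : 0 < s by rewrite !lt_min d10 d20.
have [s1 s2 s3] : [/\ s <= d1, s <= d2 & s <= d3] by rewrite !ge_min !lexx !orbT.
have sb z : `|z - y| <= s -> box z by move=> zs; apply: H3; exact: le_trans zs s3.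
have [z1 z1s E1] := mixed_difference q2 ij s0 sb.
have ji : j != i by rewrite eq_sym.
have [z2 z2s E2] := mixed_difference q2 ji s0 sb.
have E : G (j :: i :: js) z1 = G (i :: j :: js) z2.
  have ss : s * s != 0 by rewrite mulf_neq0 ?gt_eqF.
  apply: (mulfI ss); rewrite -E1 -E2 (set_coordC _ _ _ ij); ring.
have h1 := H1 z2 (sb _ z2s) (le_trans z2s s1).
have h2 := H2 z1 (sb _ z1s) (le_trans z1s s2).
have -> : G (i :: j :: js) y - G (j :: i :: js) y =
  (G (j :: i :: js) z1 - G (j :: i :: js) y) - (G (i :: j :: js) z2 - G (i :: j :: js) y) by rewrite E; ring.
by apply: (le_trans (ler_normB _ _)); lra.
Qed.

Lemma box_near y j : box y -> \forall s \near y j 0, box (set_coord y j s).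
Proof.
move=> yb; have [e e0 H] := box_room yb.
apply/nbhs_ballP; exists e => // s; rewrite /ball /= => hs; apply: H.
apply: mx_norm_leP; first exact: ltW.
move=> i k; rewrite !mxE (ord1 k); case: eqP => [->|_]; first by rewrite distrC ltW.
by rewrite subrr normr0 ltW.
Qed.

Lemma G_cons_congr js js' j : (size js < q)%N -> (size js' < q)%N ->
  (forall y, box y -> G js y = G js' y) -> forall y, box y -> G (j :: js) y = G (j :: js') y.
Proof.
move=> h1 h2 E y yb; apply: der_uniq (Gd j h1 yb) _.
apply: der_near (Gd j h2 yb); have := box_near j yb.
by apply: filterS => s /E.
Qed.

(** The head letter of one word is moved to the front of the other by adjacent exchanges. An
    exchange at the front is [schwarz]; deeper in the word it is an identity on the box that may be
    differentiated, by [G_cons_congr]. *)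
Lemma G_perm js js' y : (size js <= q)%N -> perm_eq js js' -> box y -> G js y = G js' y.
Proof.
elim: js js' y => [|j js IH] js' y sq; first by rewrite perm_sym => /perm_nilP ->.
move=> pe yb; have jin : j \in js' by rewrite -(perm_mem pe) inE eqxx.
have [s1 [s2 js'E]] : exists s1 s2, js' = s1 ++ j :: s2.
  by case/splitPr: jin => s1 s2; exists s1, s2.
move: pe; rewrite js'E perm_sym -cat1s perm_catCA /= perm_cons perm_sym => pe.
have -> : G (s1 ++ j :: s2) y = G (j :: s1 ++ s2) y.
  have sz : (size (s1 ++ j :: s2) <= q)%N by rewrite size_cat /= addnS -size_cat -(perm_size pe).
  elim: s1 {js'E pe} y yb sz => [//|i s1 IH1] y yb /= sz.
  rewrite (@G_cons_congr (s1 ++ j :: s2) (j :: s1 ++ s2) i) //.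
  - apply: schwarz => //; move: sz; rewrite !size_cat /=; lia.
  - by move: sz; rewrite /= !size_cat /=; lia.
  - by move=> z zb; apply: IH1 => //; lia.
have sq' : (size js < q)%N := sq.
apply: G_cons_congr => //; last by move=> z zb; apply: IH => //; lia.
by rewrite -(perm_size pe).
Qed.

Variable B : R.
Hypothesis GB : forall js y, (size js <= q)%N -> box y -> `|G js y| <= B.

(** Induction on [r]: the derivative in [s] of the remainder is the remainder of order one less for
    the derivative along [j]. The mean value inequality then gives one more factor [|s|], and the
    factorial is given up. *)
Lemma taylor_line js j y r s : (size js + r < q)%N -> box y -> box (set_coord y j (y j 0 + s)) ->
  `|G js (set_coord y j (y j 0 + s)) - \sum_(b < r.+1) s ^+ b / b`!%:R * G (nseq b j ++ js) y|
  <= B * `|s| ^+ r.+1.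
Proof.
elim: r js s => [|r IH] js s sq yb ysb; have B0 : 0 <= B by apply: le_trans (GB (js := [::]) _ yb).
  rewrite big_ord1 /= expr0 fact0 divr1 mul1r expr1.
  have := @der_lip R (fun s => G js (set_coord y j s)) (fun s => G (j :: js) (set_coord y j s)) (y j 0) (y j 0 + s) B.
  rewrite set_coord_id (addrC (y j 0)) addrK; apply=> u uu.
    apply: line_derive; first by lia.
    apply: (box_between yb ysb) => i; rewrite !set_coordE; case: eqP => [->|_]; last by rewrite ge_min le_max lexx.
    by rewrite [y j 0 + s]addrC.
  apply: GB; first by rewrite /=; lia.
  apply: (box_between yb ysb) => i; rewrite !set_coordE; case: eqP => [->|_]; last by rewrite ge_min le_max lexx.
  by rewrite [y j 0 + s]addrC.
pose psi u := G js (set_coord y j (y j 0 + u)) - \sum_(b < r.+2) u ^+ b / b`!%:R * G (nseq b j ++ js) y.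
pose dpsi u := G (j :: js) (set_coord y j (y j 0 + u)) - \sum_(b < r.+1) u ^+ b / b`!%:R * G (nseq b j ++ j :: js) y.
have psi0 : psi 0 = 0.
  rewrite /psi addr0 set_coord_id big_ord_recl /= expr0 fact0 divr1 mul1r big1 ?addr0 ?subrr// => i _.
  by rewrite expr0n /= !mul0r.
have ub u : Num.min 0 s <= u <= Num.max 0 s -> box (set_coord y j (y j 0 + u)).
  move=> uu; apply: (box_between yb ysb) => i; rewrite !set_coordE; case: eqP => [->|_]; last by rewrite ge_min le_max lexx.
  by move: uu; rewrite !ge_min !le_max => /andP[/orP[?|?] /orP[?|?]]; apply/andP; split; apply/orP; lra.
have := @der_lip R psi dpsi 0 s (B * `|s| ^+ r.+1); rewrite psi0 !subr0 [_ ^+ r.+2]exprS => L.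
have -> : B * (`|s| * `|s| ^+ r.+1) = B * `|s| ^+ r.+1 * `|s| by ring.
apply: L => u uu.
  apply: derB.
    have d1 := line_derive (js := js) (j := j) (y := y) (s := y j 0 + u) ltac:(lia) (ub u uu).
    have d2 : is_derive u 1 (fun u => y j 0 + u) 1 by apply: is_derive_eq (derD (derc _ _) (is_derive_id u 1)) _; rewrite add0r.
    by apply: is_derive_eq (der_comp d2 d1) _; rewrite mulr1.
  have e (b : 'I_r.+2) : is_derive u 1 (fun u => u ^+ b / b`!%:R * G (nseq b j ++ js) y)
     (b%:R * u ^+ b.-1 / b`!%:R * G (nseq b j ++ js) y).
    have d1 : is_derive u 1 (fun u : R => u ^+ b) (b%:R * u ^+ b.-1).
      exact: der_pow.
    have := derZ (b`!%:R^-1 * G (nseq b j ++ js) y) d1.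
    move=> d2; apply: is_derive_eq (der_ext _ d2) _; first by move=> v; ring.
    by ring.
  have := @der_sum R _ (index_enum _) predT _ _ u (fun b _ => e b).
  move=> d; apply: is_derive_eq d _.
  rewrite big_ord_recl /= mulr0n !mul0r add0r; apply: eq_bigr => b _.
  rewrite /bump /= add1n /= factS natrM invfM.
  have b1 : b.+1%:R != 0 :> R by rewrite pnatr_eq0.
  have -> : nseq b j ++ j :: js = j :: nseq b j ++ js.
    by elim: (val b) => [//|k IHk]; rewrite /= IHk.
  rewrite add0n; move: b1; move: (b.+1%:R : R) => x x0; move: (b`!%:R^-1 : R) => F.
  by field.
apply: (@le_trans _ _ (B * `|u| ^+ r.+1)).
  by apply: IH => //; [rewrite /=; lia|exact: ub].
apply: ler_wpM2l => //; rewrite ler_pXn2r ?nnegrE//.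
by move: uu; rewrite ge_min le_max => /andP[/orP[?|?] /orP[?|?]]; rewrite ler_norml; have := ler_norm s; have := ler_norm (-s); rewrite normrN; move=> ? ?; apply/andP; split; lra.
Qed.

(** A corner of the path from [y] to [y + h] that moves one coordinate at a time; [cs] lists the
    coordinates already moved. All corners stay in the box because the norm is the maximum norm. *)
Definition add_on (cs : seq 'I_n) y h : 'cV[R]_n :=
  \col_i (if i \in cs then y i 0 + h i 0 else y i 0).

Lemma add_on_cons j cs y h : j \notin cs ->
  add_on (j :: cs) y h = set_coord (add_on cs y h) j (y j 0 + h j 0).
Proof.
move=> jcs; apply/matrixP => i k; rewrite !mxE inE; case: eqP => //= ->; by [].
Qed.

Lemma add_on_cons' j cs y h : j \notin cs ->
  add_on (j :: cs) y h = add_on cs (set_coord y j (y j 0 + h j 0)) h.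
Proof.
move=> jcs; apply/matrixP => i k; rewrite !mxE inE; case: eqP => //= ->.
by rewrite (negbTE jcs).
Qed.

Lemma add_on_enum y h : add_on (enum 'I_n) y h = y + h.
Proof. by apply/matrixP => i k; rewrite !mxE mem_enum (ord1 k). Qed.

Lemma add_on_box cs y h : box y -> box (y + h) -> box (add_on cs y h).
Proof.
move=> yb yhb; apply: (box_between yb yhb) => i; rewrite !mxE.
by case: ifP => _; rewrite ge_min le_max !lexx ?orbT.
Qed.

Lemma lipschitz_on cs js y h : uniq cs -> (size js < q)%N -> box y -> box (y + h) ->
  `|G js (add_on cs y h) - G js y| <= (size cs)%:R * B * `|h|.
Proof.
move=> + jsq yb yhb; have B0 : 0 <= B by apply: le_trans (GB (js := [::]) _ yb).
elim: cs => [_|j cs IH /= /andP[jcs /IH {}IH]].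
  have -> : add_on [::] y h = y by apply/matrixP => i k; rewrite !mxE (ord1 k).
  by rewrite subrr normr0 !mul0r.
have zb := add_on_box cs yb yhb.
have zj : add_on cs y h j 0 = y j 0 by rewrite mxE (negbTE jcs).
have zb' : box (set_coord (add_on cs y h) j (add_on cs y h j 0 + h j 0)).
  by rewrite zj -add_on_cons//; exact: add_on_box.
have := taylor_line (r := 0) (js := js) _ zb zb'; rewrite addn0 => /(_ jsq).
rewrite big_ord1 /= expr0 fact0 divr1 mul1r expr1 zj -add_on_cons// => H.
have -> : G js (add_on (j :: cs) y h) - G js y = (G js (add_on (j :: cs) y h) - G js (add_on cs y h))
   + (G js (add_on cs y h) - G js y) by rewrite addrA subrK.
apply: (le_trans (ler_normD _ _)); rewrite -natr1 mulrDl mulrDl mul1r addrC; apply: lerD => //.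
by apply: le_trans H _; rewrite ler_wpM2l// mx_norm_entry.
Qed.

Lemma lipschitz_box js y y' : (size js < q)%N -> box y -> box y' ->
  `|G js y' - G js y| <= n%:R * B * `|y' - y|.
Proof.
move=> jsq yb yb'; have yb2 : box (y + (y' - y)) by rewrite addrC subrK.
have := lipschitz_on (enum_uniq 'I_n) jsq yb yb2.
by rewrite add_on_enum -cardE card_ord [y + _]addrC subrK.
Qed.

(** Along the path each step is expanded to first order at its own corner. Returning its derivative
    to [y] costs a Lipschitz term, whence the factor [1 + n]. *)
Lemma quadratic_on cs js y h : uniq cs -> ((size js).+1 < q)%N -> box y -> box (y + h) ->
  `|G js (add_on cs y h) - G js y - \sum_(j <- cs) h j 0 * G (j :: js) y| <= (size cs)%:R * (1 + n%:R) * B * `|h| ^+ 2.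
Proof.
move=> + jsq yb yhb; have B0 : 0 <= B by apply: le_trans (GB (js := [::]) _ yb).
elim: cs => [_|j cs IH /= /andP[jcs ucs]].
  have -> : add_on [::] y h = y by apply/matrixP => i k; rewrite !mxE (ord1 k).
  by rewrite subrr big_nil subr0 normr0 !mul0r.
have {}IH := IH ucs.
have zb := add_on_box cs yb yhb.
have zj : add_on cs y h j 0 = y j 0 by rewrite mxE (negbTE jcs).
have zb' : box (set_coord (add_on cs y h) j (add_on cs y h j 0 + h j 0)).
  by rewrite zj -add_on_cons//; exact: add_on_box.
have := taylor_line (r := 1) (js := js) _ zb zb'; rewrite addn1 => /(_ jsq).
rewrite big_ord_recr big_ord1 /= expr0 fact0 divr1 mul1r expr1 divr1 zj -add_on_cons// => H.
have H2 : `|G (j :: js) (add_on cs y h) - G (j :: js) y| <= n%:R * B * `|h|.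
  apply: le_trans (lipschitz_on ucs _ yb yhb) _ => //.
  rewrite -!mulrA ler_wpM2r ?mulr_ge0// ler_nat -[X in (_ <= X)%N](card_ord n) cardE.
  by apply: uniq_leq_size => // k _; rewrite mem_enum.
rewrite big_cons.
have -> : G js (add_on (j :: cs) y h) - G js y - (h j 0 * G (j :: js) y + \sum_(j0 <- cs) h j0 0 * G (j0 :: js) y)
  = (G js (add_on (j :: cs) y h) - (G js (add_on cs y h) + h j 0 * G (j :: js) (add_on cs y h)))
   + h j 0 * (G (j :: js) (add_on cs y h) - G (j :: js) y)
   + (G js (add_on cs y h) - G js y - \sum_(j <- cs) h j 0 * G (j :: js) y) by ring.
apply: (le_trans (ler_normD _ _)); apply: (le_trans (lerD (ler_normD _ _) IH)).
have hj : `|h j 0| <= `|h| by exact: mx_norm_entry.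
have h1 : `|h j 0| ^+ 2 <= `|h| ^+ 2 by rewrite ler_pXn2r ?nnegrE.
have h2 : B * `|h j 0| ^+ 2 <= B * `|h| ^+ 2 by rewrite ler_wpM2l.
have h3 : `|h j 0 * (G (j :: js) (add_on cs y h) - G (j :: js) y)| <= `|h| * (n%:R * B * `|h|).
  by rewrite normrM ler_pM.
by rewrite -natr1; lra.
Qed.

Lemma quadratic_box js y y' : ((size js).+1 < q)%N -> box y -> box y' ->
  `|G js y' - G js y - \sum_j (y' j 0 - y j 0) * G (j :: js) y| <= n%:R * (1 + n%:R) * B * `|y' - y| ^+ 2.
Proof.
move=> jsq yb yb'; have yb2 : box (y + (y' - y)) by rewrite addrC subrK.
have := quadratic_on (enum_uniq 'I_n) jsq yb yb2.
rewrite add_on_enum -cardE card_ord [y + _]addrC subrK big_enum /=.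
by under eq_bigr do rewrite !mxE.
Qed.

(** One unit of error for each term that is expanded further when a coordinate is added. *)
Fixpoint taylor_const (cs : seq 'I_n) r : nat :=
  if cs is _ :: cs' then (taylor_const cs' r + size (wlist cs' r))%N else 0%N.

(** With coordinate [j] moved first, the expansion in the other coordinates has coefficients at
    [y']. Each of them is expanded along [j] to order [r - |w|], so its error
    [B * |h| ^ (r - |w| + 1)] and the factor [|h| ^ |w|] give order [r + 1] in every case. *)
Lemma taylor_on cs r y h : uniq cs -> (r < q)%N -> box y -> box (add_on cs y h) ->
  `|G [::] (add_on cs y h) - \sum_(w <- wlist cs r) hpow h w * G (flatw cs w) y|
    <= (taylor_const cs r)%:R * B * `|h| ^+ r.+1.
Proof.
move=> + rq; elim: cs y => [|j cs IH] y /=.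
  move=> _ yb _; rewrite big_seq1 /flatw /= /hpow big1 ?mul1r; last first.
    by move=> i _; rewrite ffunE expr0 fact0 divr1.
  have -> : add_on [::] y h = y by apply/matrixP => i k; rewrite !mxE (ord1 k).
  by rewrite subrr normr0 !mul0r.
move=> /andP[jcs ucs] yb yhb; have B0 : 0 <= B by apply: le_trans (GB (js := [::]) _ yb).
pose y' := set_coord y j (y j 0 + h j 0).
have yhb' := yhb; rewrite add_on_cons'// in yhb'.
have yb' : box y'.
  apply: (box_between yb yhb) => i; rewrite !mxE inE; case: (i =P j) => [->|_] /=.
    by rewrite ge_min le_max !lexx !orbT.
  by rewrite ge_min le_max !lexx.
have {}IH := IH y' ucs yb' yhb'.
rewrite add_on_cons'// -/y' big_flatten /= big_map.
set S := \sum_(w <- wlist cs r) hpow h w * G (flatw cs w) y' in IH.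
set S' := \sum_(w <- wlist cs r) _.
have -> : G [::] (add_on cs y' h) - S' = (G [::] (add_on cs y' h) - S) + (S - S') by rewrite addrA subrK.
rewrite natrD mulrDl mulrDl; apply: (le_trans (ler_normD _ _)); apply: lerD => //.
rewrite /S /S' -sumrB; apply: (le_trans (ler_norm_sum _ _ _)).
apply: (@le_trans _ _ (\sum_(w <- wlist cs r) B * `|h| ^+ r.+1)); last first.
  by rewrite big_const_seq count_predT iter_addr addr0 -mulrA mulr_natl.
rewrite big_seq [leRHS]big_seq; apply: ler_sum => w win.
have wr : (mabs w <= r)%N by move: win; rewrite wlist_mem// => /andP[].
have wj : w j = 0%N by exact: wlist_out win jcs.
have sw : size (flatw cs w) = mabs w by apply: size_flatw => // i; exact: wlist_out win.
have := @taylor_line (flatw cs w) j y (r - mabs w) (h j 0) ltac:(rewrite sw; lia) yb yb'.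
rewrite -/y' => H.
have -> : \sum_(i <- wstep r j w) hpow h i * G (flatw (j :: cs) i) y =
   hpow h w * \sum_(b < (r - mabs w).+1) h j 0 ^+ b / b`!%:R * G (nseq b j ++ flatw cs w) y.
  rewrite /wstep big_map -[iota _ _]/(index_iota 0 (r - mabs w).+1) big_mkord mulr_sumr; apply: eq_bigr => b _.
  by rewrite hpow_setw// flatw_setw//; ring.
rewrite -mulrBr normrM; apply: (@le_trans _ _ (`|h| ^+ mabs w * (B * `|h| ^+ (r - mabs w).+1))).
  apply: ler_pM => //; first exact: hpow_bound.
  apply: le_trans H _; rewrite ler_wpM2l// lerXn2r ?nnegrE//; exact: mx_norm_entry.
by rewrite mulrCA -exprD addnS subnKC.
Qed.

Lemma taylor_box r y y' : (r < q)%N -> box y -> box y' ->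
  `|G [::] y' - \sum_(w <- wlist (enum 'I_n) r) hpow (y' - y) w * G (flatw (enum 'I_n) w) y|
    <= (taylor_const (enum 'I_n) r)%:R * B * `|y' - y| ^+ r.+1.
Proof.
move=> rq yb yb'; have := @taylor_on (enum 'I_n) r y (y' - y) (enum_uniq 'I_n) rq yb.
by rewrite add_on_enum addrC subrK addrC; apply.
Qed.

End BoxCalculus.

(** * Transfer of these estimates to the partial derivatives on the cylinder *)

Section CylinderCalculus.
Variables (R : realType) (n : nat) (t0 : R) (phi0 : R -> 'cV[R]_n) (a : R).
Hypothesis a0 : 0 < a.
Let D := cylinder t0 phi0 a.
Variables (F : R * 'cV[R]_n -> 'cV[R]_n) (q : nat).
Hypothesis FC : C0y D q F.

Let Gf (t : R) (k : 'I_n) (js : seq 'I_n) (y : 'cV[R]_n) : R := pders D js F (t, y) k 0.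

Lemma box_cylinder t y : t0 <= t -> box (phi0 t) a y -> D (t, y).
Proof. by move=> tt yb; split=> //=; exact: ltW. Qed.

Lemma pders_derive t k js j y : t0 <= t -> (size js < q)%N -> box (phi0 t) a y ->
  is_derive (y j 0) 1 (fun s => Gf t k js (set_coord y j s)) (Gf t k (j :: js) y).
Proof.
move=> tt jsq yb; have [+ _] := FC.
move=> /(_ js j (t, y) jsq (box_cylinder tt yb)) /derivable_within_dcvg.
move=> /(dcvg_entry (i := k) (j := 0)); apply: dcvg_is_derive.
have := box_near j yb; apply: filterS => s sb; exact: box_cylinder.
Qed.

Lemma pders_continuous t k js y e : t0 <= t -> (size js <= q)%N -> box (phi0 t) a y -> 0 < e ->
  exists2 de, 0 < de & forall y', box (phi0 t) a y' -> `|y' - y| <= de -> `|Gf t k js y' - Gf t k js y| <= e.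
Proof.
move=> tt jsq yb e0; have [_ /(_ js jsq) /subspace_continuousP] := FC.
move=> /(_ (t, y) (box_cylinder tt yb)) /cvgrPdist_le/(_ e e0).
rewrite /within /= => /nbhs_ballP[d /= d0 H]; exists (d / 2); first by rewrite divr_gt0.
move=> y' yb' yy'; have : `|pders D js F (t, y) - pders D js F (t, y')| <= e.
  apply: H; last exact: box_cylinder.
  split => /=; first exact: ballxx.
  rewrite mx_norm_ball /ball_ /= distrC; apply: (le_lt_trans yy').
  by rewrite ltr_pdivrMr// mulr_natr mulr2n ltrDl.
rewrite distrC => h; apply: le_trans h; have := mx_norm_entry (pders D js F (t, y') - pders D js F (t, y)) k 0.
by rewrite !mxE.
Qed.

Lemma pders_perm t js js' y : t0 <= t -> (size js <= q)%N -> perm_eq js js' -> box (phi0 t) a y ->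
  pders D js F (t, y) = pders D js' F (t, y).
Proof.
move=> tt jsq pe yb; apply/matrixP => k l; rewrite (ord1 l).
apply: (@G_perm R n (phi0 t) a a0 (Gf t k) q _ _ js js' y jsq pe yb).
- by move=> js1 j z; exact: pders_derive.
- by move=> js1 z e; exact: pders_continuous.
Qed.

Definition wcount (js : seq 'I_n) : mindex n := [ffun j => count_mem j js].

Lemma perm_wcount js : perm_eq js (flatw (enum 'I_n) (wcount js)).
Proof.
apply/permP => p; rewrite /flatw count_flatten -map_comp /=.
rewrite -[in LHS](filter_predT js).
elim: js => [|i js IH].
  by rewrite /= sumnE big_map big1// => i _; rewrite /= ffunE.
rewrite /= filter_predT in IH *; rewrite {}IH !sumnE !big_map /=.
rewrite -big_enum /= !big_enum /= (bigD1 i)//= [in RHS](bigD1 i)//= !ffunE /= eqxx !count_nseq addnA.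
congr addn; last by apply: eq_bigr => j ji; rewrite !ffunE /= eq_sym (negbTE ji).
by rewrite mulnDr muln1.
Qed.

Lemma mabs_wcount js : mabs (wcount js) = size js.
Proof.
rewrite -(size_flatw (cs := enum 'I_n)) ?enum_uniq -?(perm_size (perm_wcount js))//.
by move=> j; rewrite mem_enum.
Qed.

Lemma pderm_flatw w : pderm D w F = pders D (flatw (enum 'I_n) w) F.
Proof. by []. Qed.

Hypothesis FB : forall w : mindex n, (mabs w <= q)%N -> exists M : R, forall p, D p -> `|pderm D w F p| <= M.

(** Bounds are assumed for the order of derivation of [pderm]; inside the box every word may be
    brought into that order. *)
Lemma pders_bounded : exists2 B, 0 <= B & forall t y js, t0 <= t -> (size js <= q)%N -> box (phi0 t) a y ->
  `|pders D js F (t, y)| <= B.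
Proof.
have /choice[M HM] : forall w : mindex n, exists M : R, (mabs w <= q)%N -> forall p, D p -> `|pderm D w F p| <= M.
  move=> w; have [wq|wq] := boolP (mabs w <= q)%N; last by exists 0.
  by have [M HM] := FB wq; exists M.
exists (\sum_(w <- wlist (enum 'I_n) q) `|M w|); first by apply: sumr_ge0.
move=> t y js tt jsq yb; rewrite (pders_perm tt jsq (perm_wcount js) yb) -pderm_flatw.
have wq : (mabs (wcount js) <= q)%N by rewrite mabs_wcount.
apply: le_trans (HM _ wq _ (box_cylinder tt yb)) _; apply: le_trans (ler_norm _) _.
have win : wcount js \in wlist (enum 'I_n) q.
  rewrite wlist_mem ?enum_uniq// wq; apply/forallP => j; by rewrite mem_enum.
by rewrite (big_rem _ win) /= lerDl sumr_ge0.
Qed.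

Lemma pders_estimates : exists2 B, 0 <= B & forall t, t0 <= t ->
  [/\ forall y js, (size js <= q)%N -> box (phi0 t) a y -> `|pders D js F (t, y)| <= B,
      forall y y' js, (size js < q)%N -> box (phi0 t) a y -> box (phi0 t) a y' ->
        `|pders D js F (t, y') - pders D js F (t, y)| <= B * `|y' - y|,
      forall y y' js, ((size js).+1 < q)%N -> box (phi0 t) a y -> box (phi0 t) a y' ->
        `|pders D js F (t, y') - pders D js F (t, y) -
          \sum_j (y' j 0 - y j 0) *: pders D (j :: js) F (t, y)| <= B * `|y' - y| ^+ 2 &
      forall y y' js r, (r + size js < q)%N -> box (phi0 t) a y -> box (phi0 t) a y' ->
        `|pders D js F (t, y') - \sum_(w <- wlist (enum 'I_n) r)
            hpow (y' - y) w *: pders D (flatw (enum 'I_n) w ++ js) F (t, y)| <= B * `|y' - y| ^+ r.+1].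
Proof.
have [B B0 HB] := pders_bounded.
pose C := (\sum_(r < q.+1) (taylor_const (enum 'I_n) r)%:R : R).
have C0 : 0 <= C by apply: sumr_ge0 => r _; rewrite ler0n.
pose K := (1 + n%:R + n%:R * (1 + n%:R) + C) * B.
have n0 : 0 <= n%:R :> R by rewrite ler0n.
have nn : 0 <= n%:R * (1 + n%:R) :> R by rewrite mulr_ge0// addr_ge0.
have K0 : 0 <= K by rewrite mulr_ge0// !addr_ge0.
exists K => // t tt.
have Gd k js j y : (size js < q)%N -> box (phi0 t) a y ->
  is_derive (y j 0) 1 (fun s => Gf t k js (set_coord y j s)) (Gf t k (j :: js) y).
  exact: pders_derive.
have GB k js y : (size js <= q)%N -> box (phi0 t) a y -> `|Gf t k js y| <= B.
  by move=> jsq yb; apply: le_trans (mx_norm_entry _ _ _) (HB t y js tt jsq yb).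
split.
- move=> y js jsq yb; apply: le_trans (HB t y js tt jsq yb) _.
  by rewrite /K -!addrA mulrDl mul1r lerDl mulr_ge0// !addr_ge0.
- move=> y y' js jsq yb yb'; apply: mx_norm_leP; first by rewrite mulr_ge0.
  move=> k l; rewrite !mxE (ord1 l).
  apply: le_trans (lipschitz_box a0 (Gd k) (GB k) jsq yb yb') _.
  by rewrite ler_wpM2r// ler_wpM2r// /K; lra.
- move=> y y' js jsq yb yb'; apply: mx_norm_leP; first by rewrite mulr_ge0// exprn_ge0.
  move=> k l; rewrite !mxE summxE (ord1 l).
  under eq_bigr do rewrite mxE.
  apply: le_trans (quadratic_box a0 (Gd k) (GB k) jsq yb yb') _.
  by rewrite ler_wpM2r ?exprn_ge0// ler_wpM2r//; lra.
- move=> y y' js r rq yb yb'; apply: mx_norm_leP; first by rewrite mulr_ge0// exprn_ge0.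
  move=> k l; rewrite !mxE summxE (ord1 l).
  under eq_bigr do rewrite mxE.
  (* The function expanded is the derivative along [js]. In [pders] the last letter acts first, so
     the further derivatives are prepended. *)
  pose G' js' := Gf t k (js' ++ js).
  have Gd' js' j z : (size js' < q - size js)%N -> box (phi0 t) a z ->
     is_derive (z j 0) 1 (fun s => G' js' (set_coord z j s)) (G' (j :: js') z).
    by move=> h1 zb; apply: Gd => //; rewrite size_cat addnC -ltn_subRL.
  have GB' js' z : (size js' <= q - size js)%N -> box (phi0 t) a z -> `|G' js' z| <= B.
    by move=> h1 zb; apply: GB => //; rewrite size_cat; lia.
  have rq' : (r < q - size js)%N by lia.
  apply: le_trans (taylor_box a0 Gd' GB' rq' yb yb') _.
  rewrite ler_wpM2r ?exprn_ge0// ler_wpM2r//.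
  have rq1 : (r < q.+1)%N by lia.
  apply: (@le_trans _ _ C); last by lra.
  rewrite /C (bigD1 (Ordinal rq1))//= lerDl; apply: sumr_ge0 => *; by rewrite ler0n.
Qed.

End CylinderCalculus.

(** * Formal series in the monomials *)

Lemma big_In (V : nmodType) (T : Type) (L : seq T) (F G : T -> V) : (forall p, List.In p L -> F p = G p) ->
  \sum_(p <- L) F p = \sum_(p <- L) G p.
Proof.
elim: L => [|p L IH] H; first by rewrite !big_nil.
by rewrite !big_cons H ?IH//=; [move=> q qL; apply: H; right|left].
Qed.

Lemma In_mem (T : eqType) (s : seq T) x : List.In x s -> x \in s.
Proof. by elim: s => //= y s IH [->|/IH]; rewrite inE ?eqxx// => ->; rewrite orbT. Qed.

Lemma big_In0 (V : nmodType) (T : Type) (L : seq T) (F : T -> V) : (forall p, List.In p L -> F p = 0) ->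
  \sum_(p <- L) F p = 0.
Proof. by move=> /big_In ->; rewrite big1. Qed.

Lemma fsum_seq (V : nmodType) (T : choiceType) (A : set T) (r : seq T) (f : T -> V) :
  uniq r -> [set` r] `<=` A -> (forall i, A i -> i \notin r -> f i = 0) ->
  \sum_(i \in A) f i = \sum_(i <- r) f i.
Proof.
move=> ur rA H; rewrite (fsbigE _ _ ur rA H) big_seq_cond [RHS]big_seq; apply: eq_bigl => i.
by case ir: (i \in r) => //=; apply/mem_set/rA.
Qed.

Section Monomials.
Variables (R : realType) (m : nat).
Implicit Types (nu a b : mono m).

Lemma enum_msetD_perm a b : perm_eq (enum_mset (msetD a b)) (enum_mset a ++ enum_mset b).
Proof.
by rewrite /perm_eq; apply/allP => x _; rewrite /= count_cat !count_mem_mset msetE2.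
Qed.

Lemma msetD_eq0 a b : msetD a b = mset0 -> a = mset0 /\ b = mset0.
Proof.
move=> /msetP H; split; apply/msetP => x; have := H x; rewrite msetE2 mset0E => /eqP.
  by rewrite addn_eq0 => /andP[/eqP].
by rewrite addn_eq0 => /andP[_ /eqP].
Qed.

Lemma mset_neq0_factor nu : nu <> mset0 -> exists x, x \in nu.
Proof.
move=> n0; case e: (enum_mset nu) => [|x s].
  by case: n0; apply/msetP => x; rewrite mset0E; apply/mset_eq0P; rewrite -topredE /= e.
by exists x; rewrite -topredE /= e inE eqxx.
Qed.

Variable varrho : 'I_m -> R.

Definition frank (x : 'I_m * nat) : R := varrho x.1 + x.2%:R.

Lemma rankE nu : rank varrho nu = \sum_(x <- enum_mset nu) frank x.
Proof. by []. Qed.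

Lemma rankD a b : rank varrho (msetD a b) = rank varrho a + rank varrho b.
Proof. by rewrite !rankE (perm_big _ (enum_msetD_perm a b)) big_cat. Qed.

Lemma rank0 : rank varrho mset0 = 0.
Proof. by rewrite rankE enum_mset0 big_nil. Qed.

Lemma rank1 x : rank varrho (msetn 1 x) = frank x.
Proof. by rewrite rankE enum_msetn big_seq1. Qed.

Lemma msetB1_D nu x : x \in nu -> nu = msetD (msetn 1 x) (msetB nu (msetn 1 x)).
Proof. by move=> xin; rewrite msetB1K. Qed.

Lemma rank_shift nu x : x \in nu ->
  rank varrho (msetD (msetB nu (msetn 1 x)) (msetn 1 (x.1, x.2.+1))) = rank varrho nu + 1.
Proof.
move=> xin; rewrite [in RHS](msetB1_D xin) !rankD !rank1 /frank /= -natr1; ring.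
Qed.

Variable r0 : R.
Hypothesis r00 : 0 < r0.
Hypothesis varrho_ge : forall l, r0 <= varrho l.

Lemma frank_ge x : r0 <= frank x.
Proof. by rewrite /frank; have := varrho_ge x.1; have := ler0n R x.2; lra. Qed.

Lemma rank_ge0 nu : 0 <= rank varrho nu.
Proof. by apply: sumr_ge0 => x _; have := frank_ge x; have := r00; rewrite /frank; lra. Qed.

Lemma rank_size nu : (size (enum_mset nu))%:R * r0 <= rank varrho nu.
Proof.
rewrite rankE; elim: (enum_mset nu) => [|x s IH]; first by rewrite big_nil mul0r.
by rewrite big_cons /= -natr1; have := frank_ge x; lra.
Qed.

Lemma rank_factor nu x : x \in nu -> frank x <= rank varrho nu.
Proof. by move=> xin; rewrite (msetB1_D xin) rankD rank1 lerDl rank_ge0. Qed.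

Lemma rank_gt0 nu : nu <> mset0 -> r0 <= rank varrho nu.
Proof. by move=> /mset_neq0_factor[x /rank_factor]; apply: le_trans; exact: frank_ge. Qed.

Fixpoint words (T : eqType) (al : seq T) (k : nat) : seq (seq T) :=
  if k is k'.+1 then [::] :: [seq y :: s | y <- al, s <- words al k'] else [:: [::]].

Lemma words_mem (T : eqType) (al : seq T) k (s : seq T) : (size s <= k)%N ->
  {subset s <= al} -> s \in words al k.
Proof.
elim: k s => [|k IH] s; first by case: s => // _ _; rewrite inE.
case: s => [|x s] /=; first by move=> _ _; rewrite inE eqxx.
move=> sk sal; rewrite inE /=; apply/allpairsP; exists (x, s); split=> //=.
  by apply: sal; rewrite inE eqxx.
by apply: IH => // y ys; apply: sal; rewrite inE ys orbT.
Qed.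

(** Every factor has rank at least [r0], which bounds the number of factors by X / r0, and a factor
    differentiated [r] times has rank above [r], which bounds the orders by X. *)
Lemma monos_list (X : R) : exists2 s : seq (mono m), uniq s &
  forall nu, (nu \in s) <-> (nu <> mset0 /\ rank varrho nu <= X).
Proof.
pose N := Num.truncn (X / r0); pose Q := Num.truncn X.
pose al := [seq (l, r) | l <- enum 'I_m, r <- iota 0 Q.+1].
pose s := [seq nu <- undup [seq seq_mset w | w <- words al N] | (nu != mset0) && (rank varrho nu <= X)].
exists s; first by rewrite filter_uniq// undup_uniq.
move=> nu; rewrite mem_filter; split=> [/andP[/andP[/eqP ? ?] _] //|[n0 nX]].
rewrite nX (introN eqP n0) /= mem_undup; apply/mapP; exists (enum_mset nu); last by rewrite seq_mset_id.
have X0 : 0 <= X by apply: le_trans nX; exact: rank_ge0.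
apply: words_mem.
  rewrite /N truncn_ge_nat ?divr_ge0// ?(ltW r00)// ler_pdivlMr//.
  exact: le_trans (rank_size nu) nX.
move=> [l r] xin; apply/allpairsP; exists (l, r); split=> //; first by rewrite mem_enum.
rewrite mem_iota /= add0n ltnS /Q truncn_ge_nat//.
have := rank_factor (xin : (l, r) \in nu); rewrite /frank /= => h; have := varrho_ge l; have := r00; lra.
Qed.

End Monomials.

Section Values.
Variables (R : realType) (m : nat) (t0 : R) (eps : 'I_m -> R -> R).
Implicit Types (a b nu : mono m).

Lemma mvalD a b t : mval t0 eps (msetD a b) t = mval t0 eps a t * mval t0 eps b t.
Proof. by rewrite /mval (perm_big _ (enum_msetD_perm a b)) big_cat. Qed.

Lemma mval0 t : mval t0 eps mset0 t = 1.
Proof. by rewrite /mval enum_mset0 big_nil. Qed.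

Lemma mval1 x t : mval t0 eps (msetn 1 x) t = iter x.2 (dI t0) (eps x.1) t.
Proof. by rewrite /mval enum_msetn big_seq1. Qed.

(* formal series with finitely many terms, the coefficients depending on t *)
Definition terms := seq ((R -> R) * mono m).

Definition lrep (L : terms) t : fseries R m := fun nu => \sum_(p <- L) p.1 t * (p.2 == nu)%:R.

Definition lmul (L L' : terms) : terms :=
  [seq (fun t => p.1 t * p'.1 t, msetD p.2 p'.2) | p <- L, p' <- L'].

Definition lone : terms := [:: (fun=> 1, mset0)].

Definition ev (L : terms) t := \sum_(p <- L) p.1 t * mval t0 eps p.2 t.

Lemma ev_mul L L' t : ev (lmul L L') t = ev L t * ev L' t.
Proof.
rewrite /ev /lmul big_allpairs_dep mulr_suml; apply: eq_bigr => p _.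
by rewrite mulr_sumr; apply: eq_bigr => p' _; rewrite /= mvalD; ring.
Qed.

Lemma ev_one t : ev lone t = 1.
Proof. by rewrite /ev big_seq1 mval0 mulr1. Qed.

Lemma lrep_one t : lrep lone t = @fone R m.
Proof. by apply/funext => nu; rewrite /lrep big_seq1 mul1r eq_sym. Qed.

(** The sum over all factorizations of [nu] is supported on the pairs of monomials that occur in the
    two lists. *)
Lemma fmul_rep L L' t nu : fmul (lrep L t) (lrep L' t) nu = lrep (lmul L L') t nu.
Proof.
pose r := [seq p <- undup [seq (p.2, p'.2) | p <- L, p' <- L'] | msetD p.1 p.2 == nu].
have ur : uniq r by rewrite filter_uniq// undup_uniq.
have inr p p' : List.In p L -> List.In p' L' -> ((p.2, p'.2) \in r) = (msetD p.2 p'.2 == nu).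
  move=> pL pL'; rewrite mem_filter /= mem_undup andbC; case: eqP => //= _; rewrite ?andbF ?andbT//.
  have memf : forall (LL LL' : terms), List.In p LL -> List.In p' LL' -> (p.2, p'.2) \in [seq (p.2, p'.2) | p <- LL, p' <- LL'].
    move=> LL LL'; elim: LL => //= p1 LL IH [->|h] h'; rewrite mem_cat; last by rewrite IH ?orbT.
    apply/orP; left; elim: LL' h' {IH} => //= p2 LL' IH2 [->|h2]; rewrite inE; first by rewrite eqxx.
    by rewrite IH2 ?orbT.
  exact: memf.
have E (u v : mono m) : (\sum_(p <- L) p.1 t * (p.2 == u)%:R) * (\sum_(p <- L') p.1 t * (p.2 == v)%:R) =
    \sum_(p <- L) \sum_(p' <- L') p.1 t * p'.1 t * ((u, v) == (p.2, p'.2))%:R.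
  rewrite mulr_suml; apply: eq_bigr => p _; rewrite mulr_sumr; apply: eq_bigr => p' _.
  rewrite xpair_eqE [u == _]eq_sym [v == _]eq_sym.
  by case: (p.2 == u); case: (p'.2 == v); rewrite /= ?(mulr1, mulr0, mul0r).
rewrite /fmul (fsum_seq ur).
- rewrite /lrep /lmul big_allpairs_dep.
  transitivity (\sum_(i <- r) \sum_(p <- L) \sum_(p' <- L') p.1 t * p'.1 t * (i == (p.2, p'.2))%:R).
    by apply: eq_bigr => -[u v] _; rewrite E.
  rewrite exchange_big /=; apply: big_In => p pL.
  rewrite exchange_big /=; apply: big_In => p' pL'.
  rewrite -(inr p p' pL pL') -mulr_sumr; congr (_ * _).
  transitivity (\sum_(i <- r) (if i == (p.2, p'.2) then 1 else 0 : R)).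
    by apply: eq_bigr => -[u v] _; case: eqP.
  by rewrite -big_mkcond /= big_const_seq iter_addr addr0 -(count_uniq_mem _ ur).
- by move=> p /=; rewrite mem_filter => /andP[/eqP].
- move=> p /= pnu pr; rewrite /lrep E.
  apply: big_In0 => q qL; apply: big_In0 => q' qL'.
  case: eqP => e; last by rewrite mulr0.
  move: pr; rewrite (surjective_pairing p) e (inr _ _ qL qL').
  by move: pnu; rewrite (surjective_pairing p) /=; case: e => -> -> ->; rewrite eqxx.
Qed.

End Values.

(** Membership is [List.In] because terms contain functions, which have no decidable equality. *)
Lemma lmul_In (R : realType) (m : nat) (L L' : terms R m) (P : (R -> R) * mono m -> Prop) :
  (forall q q', List.In q L -> List.In q' L' -> P (fun t => q.1 t * q'.1 t, msetD q.2 q'.2)) ->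
  forall p, List.In p (lmul L L') -> P p.
Proof.
move=> H p; rewrite /lmul; elim: L H => [|q L IH] H //= /List.in_app_iff[|]; last first.
  by apply: IH => q1 q2 h1 h2; apply: H => //; right.
move=> /List.in_map_iff[q' [<- h']]; apply: H => //; by left.
Qed.

Section Coefficients.
Variables (R : realType) (n m : nat).
Implicit Types (a b nu : mono m) (w : mindex n) (phi : mono m -> R -> 'cV[R]_n).

(** A coefficient of a product at [nu] involves only divisors of [nu]; this relation is therefore
    compatible with products, and permits truncating an infinite series. *)
Definition agree nu (F F' : fseries R m) := forall a, msubset a nu -> F a = F' a.

Lemma fmul_agree nu F F' G G' : agree nu F F' -> agree nu G G' -> agree nu (fmul F G) (fmul F' G').
Proof.
move=> FF GG a anu; apply: eq_fsbigr => p; rewrite inE /= => e.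
rewrite FF ?GG//; apply: msubset_trans anu; apply/msubsetP => x; rewrite -e msetE2.
  exact: leq_addl.
exact: leq_addr.
Qed.

Definition dL (ML : seq (mono m)) phi j : terms R m := [seq (fun t => phi b t j 0, b) | b <- ML].

Definition powL ML phi w : terms R m := \big[@lmul R m/@lone R m]_j iter (w j) (lmul (dL ML phi j)) (@lone R m).

Lemma lrep_dL ML phi j t b : uniq ML -> lrep (dL ML phi j) t b = if b \in ML then phi b t j 0 else 0.
Proof.
move=> uML; rewrite /lrep /dL big_map /=; case: ifP => bML.
  rewrite (bigD1_seq b)//= eqxx mulr1 big1 ?addr0// => i ib.
  by rewrite (negbTE ib) mulr0.
rewrite big1_seq// => i /= iML; case: eqP => [e|_]; last by rewrite mulr0.
by move: bML; rewrite -e iML.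
Qed.

Lemma dL_In ML phi j p : List.In p (dL ML phi j) -> p.2 \in ML.
Proof.
by rewrite /dL; elim: ML => //= b ML IH [<- /=|/IH]; rewrite inE ?eqxx// => ->; rewrite orbT.
Qed.

(** The series [fdelta] may have infinitely many coefficients. Replacing it by the finite list [ML]
    is harmless as long as [ML] contains all nontrivial divisors of [nu]. *)
Lemma powL_agree ML phi t w nu : uniq ML -> (forall b, b \in ML -> b <> mset0) ->
  (forall b, msubset b nu -> b <> mset0 -> b \in ML) ->
  agree nu (fdelta_pow phi t w) (lrep (powL ML phi w) t).
Proof.
move=> uML ML0 MLnu; rewrite /fdelta_pow /powL.
have dA j : agree nu (fdelta phi t j) (lrep (dL ML phi j) t).
  move=> b bnu; rewrite lrep_dL// /fdelta; case: eqP => [->|b0].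
    by case: ifP => // /ML0.
  by rewrite MLnu.
apply: (big_rec2 (fun F L => agree nu F (lrep L t))); first by rewrite lrep_one.
move=> j F L _ FL.
have iA k : agree nu (iter k (fmul (fdelta phi t j)) (@fone R m)) (lrep (iter k (lmul (dL ML phi j)) (@lone R m)) t).
  elim: k => [|k IH] /=; first by rewrite lrep_one.
  move=> b bnu; rewrite -fmul_rep; exact: fmul_agree.
by move=> b bnu; rewrite -fmul_rep; exact: fmul_agree.
Qed.

Lemma powL_In ML phi w (P : (R -> R) * mono m -> Prop) : P (fun=> 1, mset0) ->
  (forall q q', P q -> P q' -> P (fun t => q.1 t * q'.1 t, msetD q.2 q'.2)) ->
  (forall b j, b \in ML -> P (fun t => phi b t j 0, b)) ->
  forall p, List.In p (powL ML phi w) -> P p.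
Proof.
move=> P1 PM Pd.
have HdL j p : List.In p (dL ML phi j) -> P p.
  rewrite /dL; elim: ML Pd => //= b ML IH Pd [<-|]; first by apply: Pd; rewrite inE eqxx.
  by apply: IH => b' j' h; apply: Pd; rewrite inE h orbT.
rewrite /powL; apply: (big_rec (fun L => forall p, List.In p L -> P p)).
  by move=> p [<-|].
move=> j L _ HL.
have Hit k q : List.In q (iter k (lmul (dL ML phi j)) (@lone R m)) -> P q.
  elim: k q => [|k IH] q /=; first by case=> // <-.
  by apply: lmul_In => q1 q2 h1 h2; apply: PM; [exact: HdL h1|exact: IH].
by apply: lmul_In => q q' hq h'; apply: PM; [exact: Hit hq|exact: HL].
Qed.

Variables (varrho : 'I_m -> R) (r0 : R).
Hypothesis r00 : 0 < r0.
Hypothesis varrho_ge : forall l, r0 <= varrho l.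

Lemma powL_rank ML phi w : (forall b, b \in ML -> b <> mset0) ->
  forall p, List.In p (powL ML phi w) -> (mabs w)%:R * r0 <= rank varrho p.2.
Proof.
move=> ML0; rewrite /powL /mabs.
apply: (big_rec2 (fun (L : terms R m) (k : nat) => forall p, List.In p L -> k%:R * r0 <= rank varrho p.2)).
  by move=> p [<-|//] /=; rewrite rank0 mul0r.
move=> j k L _ HL; apply: lmul_In => q q' hq /HL h' /=.
rewrite rankD natrD mulrDl; apply: lerD => //.
elim: (w j) q hq => [|i IH] q /=; first by case=> // <- /=; rewrite rank0 mul0r.
apply: (lmul_In (P := fun p => i.+1%:R * r0 <= rank varrho p.2)) => q1 q2 h1 h2 /=; rewrite rankD -natr1 mulrDl mul1r addrC; apply: lerD; last exact: IH.
have : q1.2 \in ML by exact: dL_In h1.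
by move=> /ML0; exact: rank_gt0.
Qed.

Lemma ev_powL t0 eps ML phi w t :
  ev t0 eps (powL ML phi w) t = \prod_j (ev t0 eps (dL ML phi j) t) ^+ w j.
Proof.
rewrite /powL; apply: (big_rec2 (fun L x => ev t0 eps L t = x)); first exact: ev_one.
move=> j x L _ <-; rewrite ev_mul; congr (_ * _).
by elim: (w j) => [|k IH]; rewrite ?ev_one ?expr0//= ev_mul IH exprS.
Qed.

Definition xvar (l : 'I_m) : terms R m := [:: (fun=> 1, msetn 1 (l, 0%N))].

Lemma fmul_var l (F F' : fseries R m) nu : (forall b, msetD (msetn 1 (l, 0%N)) b = nu -> F b = F' b) ->
  fmul (@fvar R m l) F nu = fmul (@fvar R m l) F' nu.
Proof.
move=> H; apply: eq_fsbigr => p; rewrite inE /= => e; rewrite /fvar.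
case: eqP => pE; last by rewrite !mul0r.
by rewrite H// -pE.
Qed.

Definition vterm ML phi l w := lmul (xvar l) (powL ML phi w).

Lemma vterm_rank ML phi l w : (forall b, b \in ML -> b <> mset0) ->
  forall p, List.In p (vterm ML phi l w) -> varrho l + (mabs w)%:R * r0 <= rank varrho p.2.
Proof.
move=> ML0; apply: lmul_In => q q' [<-|//] h' /=.
by rewrite rankD rank1 /frank /= addr0 lerD2l; exact: (powL_rank ML0 h').
Qed.

Lemma lrep_rank0 (L : terms R m) t nu X : rank varrho nu < X -> (forall p, List.In p L -> X <= rank varrho p.2) ->
  lrep L t nu = 0.
Proof.
move=> nX HL; apply: big_In0 => p /HL h; case: eqP => [e|_]; last by rewrite mulr0.
by move: h; rewrite e leNgt nX.
Qed.

Lemma fder_rank b nu : (@fder R m b) nu != 0 -> rank varrho nu = rank varrho b + 1.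
Proof.
move=> h; apply: contrapT => ne; move/eqP: h; apply; rewrite /fder big1_seq// => x /= xb.
by case: eqP => // e; exfalso; apply: ne; rewrite e rank_shift.
Qed.

Variables (D : set (R * 'cV[R]_n)) (fl : 'I_m -> R * 'cV[R]_n -> 'cV[R]_n) (phi0 : R -> 'cV[R]_n).

(** The coefficient as a finite sum. A derivative term comes from a monomial of rank one less, and
    cancelling [eps l] lowers the rank by at least [r0], so [ML] is large enough. A multi-index of
    size above [q l] produces only ranks beyond that of [nu]. *)
Lemma gcoef_rep ML X phi nu (q : 'I_m -> nat) t : uniq ML ->
  (forall b, (b \in ML) <-> (b <> mset0 /\ rank varrho b <= X)) ->
  nu <> mset0 -> rank varrho nu - 1 <= X -> rank varrho nu - r0 <= X ->
  (forall l, rank varrho nu < varrho l + (q l).+1%:R * r0) ->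
  gcoef D fl phi0 phi nu t = - (\sum_(b <- ML) @fder R m b nu *: phi b t) +
   \sum_(l < m) \sum_(w <- wlist (enum 'I_n) (q l))
     ((mfact w)%:R^-1 * lrep (vterm ML phi l w) t nu) *: pderm D w (fl l) (t, phi0 t).
Proof.
move=> uML MLP nu0 nX1 nX2 qP; have ML0 b : b \in ML -> b <> mset0 by move=> /MLP[].
rewrite /gcoef; congr (- _ + _).
  apply: fsum_seq => //.
  move=> b /= b0 bML; have [->|/fder_rank h] := eqVneq (@fder R m b nu) 0; first by rewrite scale0r.
  by case/negP: bML; apply/MLP; split=> //; lra.
apply: eq_bigr => l _.
have E w : fmul (@fvar R m l) (fdelta_pow phi t w) nu = lrep (vterm ML phi l w) t nu.
  rewrite (_ : @fvar R m l = lrep (xvar l) t); last first.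
    by apply/funext => b; rewrite /lrep big_seq1 mul1r eq_sym.
  rewrite -fmul_rep (_ : lrep (xvar l) t = @fvar R m l); last first.
    by apply/funext => b; rewrite /lrep big_seq1 mul1r eq_sym.
  apply: fmul_var => b e; apply: (@powL_agree ML phi t w b uML ML0 _ b (msubset_refl b)).
  move=> a ab a0; apply/MLP; split=> //; apply: le_trans nX2.
  have ra : rank varrho a <= rank varrho b.
    by rewrite -(msetBDKC ab) rankD lerDl; exact: (rank_ge0 r00 varrho_ge).
  by rewrite -e rankD rank1 /frank /= addr0; have := varrho_ge l; lra.
rewrite (fsum_seq (r := wlist (enum 'I_n) (q l))).
- by apply: eq_bigr => w _; rewrite E.
- exact: wlist_uniq (enum_uniq _).
- by [].
move=> w _ wn; rewrite E (@lrep_rank0 _ _ _ (varrho l + (mabs w)%:R * r0)) ?mulr0 ?scale0r//.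
  apply: lt_le_trans (qP l) _; rewrite lerD2l ler_wpM2r ?(ltW r00)// ler_nat ltnNge.
  apply: contra wn => wq; rewrite wlist_mem ?enum_uniq// wq /=.
  by apply/forallP => j; rewrite mem_enum.
exact: vterm_rank.
Qed.

Section Membership.
Variables (t0 : R) (k' : nat) (lam : 'I_k' -> R[i]) (K : set (R -> R)).
Hypothesis K3P : K3_class t0 lam K.

(** [K] is an algebra that need not contain the constants. Powers of delta start from the constant
    1, so they are only known to multiply [K] into itself; the derivative of [f_l] in each term
    brings the product back to [K]. *)
Definition multK (g : R -> R) := forall h, K h -> K (fun t => g t * h t).

Lemma K_zero : K (fun=> 0).
Proof.
have [g Kg] := K3_nonempty K3P; have := K3_scale K3P 0 Kg; congr K.
by apply/funext => t; rewrite mul0r.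
Qed.

Lemma K_sum (I : Type) (r : seq I) (F : I -> R -> R) : (forall i, List.In i r -> K (F i)) ->
  K (fun t => \sum_(i <- r) F i t).
Proof.
elim: r => [|i r IH] H.
  by have := K_zero; congr K; apply/funext => t; rewrite big_nil.
have := K3_add K3P (H i (or_introl erefl)) (IH (fun j h => H j (or_intror h))); congr K.
by apply/funext => t; rewrite big_cons.
Qed.

Lemma multK_const c : multK (fun=> c).
Proof. by move=> h Kh; exact: (K3_scale K3P). Qed.

Lemma multK_K g : K g -> multK g.
Proof. by move=> Kg h Kh; exact: (K3_mul K3P). Qed.

Lemma multK_mul g h : multK g -> multK h -> multK (fun t => g t * h t).
Proof.
move=> mg mh f Kf; have := mg _ (mh _ Kf); congr K; apply/funext => t; by rewrite mulrA.
Qed.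

Lemma K_lrep (L : terms R m) nu (h : R -> R) : (forall p, List.In p L -> multK p.1) -> K h ->
  K (fun t => lrep L t nu * h t).
Proof.
move=> HL Kh.
have : K (fun t => \sum_(p <- L) (p.2 == nu)%:R * (p.1 t * h t)).
  by apply: K_sum => p pL; apply: (K3_scale K3P); exact: HL.
by congr K; apply/funext => t; rewrite mulr_suml; apply: eq_bigr => p _; ring.
Qed.

Lemma gcoef_K ML X phi nu (q : 'I_m -> nat) : uniq ML ->
  (forall b, (b \in ML) <-> (b <> mset0 /\ rank varrho b <= X)) ->
  nu <> mset0 -> rank varrho nu - 1 <= X -> rank varrho nu - r0 <= X ->
  (forall l, rank varrho nu < varrho l + (q l).+1%:R * r0) ->
  (forall b, b \in ML -> vecK K (phi b)) ->
  (forall l w, varrho l + (mabs w)%:R * r0 <= rank varrho nu -> vecK K (fun t => pderm D w (fl l) (t, phi0 t))) ->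
  vecK K (gcoef D fl phi0 phi nu).
Proof.
move=> uML MLP nu0 nX1 nX2 qP Kphi Kf i; have ML0 b : b \in ML -> b <> mset0 by move=> /MLP[].
have -> : (fun t => gcoef D fl phi0 phi nu t i 0) = (fun t =>
   (-1) * (\sum_(b <- ML) @fder R m b nu * phi b t i 0) +
   \sum_(l < m) \sum_(w <- wlist (enum 'I_n) (q l))
     (mfact w)%:R^-1 * (lrep (vterm ML phi l w) t nu * pderm D w (fl l) (t, phi0 t) i 0)).
  apply/funext => t; rewrite (gcoef_rep _ _ uML MLP nu0 nX1 nX2 qP) !mxE !summxE mulN1r; congr (- _ + _).
    by apply: eq_bigr => b _; rewrite mxE.
  apply: eq_bigr => l _; rewrite summxE; apply: eq_bigr => w _; by rewrite mxE mulrA.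
apply: (K3_add K3P).
  by apply: (K3_scale K3P); apply: K_sum => b /In_mem bML; apply: (K3_scale K3P); exact: Kphi.
apply: K_sum => l _; apply: K_sum => w _; apply: (K3_scale K3P).
have [h|h] := leP (varrho l + (mabs w)%:R * r0) (rank varrho nu).
  apply: K_lrep; last exact: Kf.
  apply: lmul_In => p p' [<-|//] h' /=; apply: multK_mul; first exact: multK_const.
  apply: (powL_In (P := fun p => multK p.1)) h' => /=; first exact: multK_const.
    by move=> q1 q2; exact: multK_mul.
  by move=> b j bML; apply: multK_K; exact: Kphi.
(* For such [w] nothing is known about the derivative of [f_l], but its factor vanishes identically
   for reasons of rank. *)
have := K_zero; congr K; apply/funext => t.
by rewrite (lrep_rank0 _ h) ?mul0r//; exact: vterm_rank.
Qed.

End Membership.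
End Coefficients.

(** * Complex eigenvectors and linear equations in the algebra K *)

Section ComplexFunctions.
Variable R : realType.
Local Notation C := R[i].
Implicit Types (x y z : C).
Local Notation Re := complex.Re.
Local Notation Im := complex.Im.

Lemma ReD x y : Re (x + y) = Re x + Re y. Proof. by case: x; case: y. Qed.
Lemma ImD x y : Im (x + y) = Im x + Im y. Proof. by case: x; case: y. Qed.
Lemma ReN x : Re (- x) = - Re x. Proof. by case: x. Qed.
Lemma ImN x : Im (- x) = - Im x. Proof. by case: x. Qed.
Lemma ReM x y : Re (x * y) = Re x * Re y - Im x * Im y. Proof. by case: x; case: y. Qed.
Lemma ImM x y : Im (x * y) = Re x * Im y + Im x * Re y. Proof. by case: x; case: y. Qed.

Lemma Re_sum (I : Type) (r : seq I) (F : I -> C) : Re (\sum_(i <- r) F i) = \sum_(i <- r) Re (F i).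
Proof. by elim: r => [|i r IH]; rewrite ?big_nil// !big_cons ReD IH. Qed.
Lemma Im_sum (I : Type) (r : seq I) (F : I -> C) : Im (\sum_(i <- r) F i) = \sum_(i <- r) Im (F i).
Proof. by elim: r => [|i r IH]; rewrite ?big_nil// !big_cons ImD IH. Qed.

Lemma complex_eq x y : Re x = Re y -> Im x = Im y -> x = y.
Proof. by case: x => a b; case: y => c d /= -> ->. Qed.

(** Left eigenvectors for distinct eigenvalues are independent: in a vanishing combination the
    product of [A - lam i] over [i != j] kills every term but the [j]-th. The matrix [V] is the
    inverse of the matrix of left eigenvectors. *)
Lemma eigenvectors (n : nat) (A : 'M[C]_n) (lam : 'I_n -> C) : injective lam ->
  char_poly A = \prod_j ('X - (lam j)%:P) ->
  exists2 V : 'M[C]_n, V \in unitmx & A *m V = V *m diag_mx (\row_j lam j).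
Proof.
move=> lam_inj chiA.
have /choice[v Hv] : forall j, exists v : 'rV[C]_n, v *m A = lam j *: v /\ v != 0.
  move=> j; have : eigenvalue A (lam j).
    by rewrite eigenvalue_root_char chiA (bigD1 j)//= rootM root_XsubC eqxx.
  by move=> /eigenvalueP[v]; exists v.
pose P : 'M[C]_n := \matrix_(j, k) v j 0 k.
have rowP' j : row j P = v j by apply/rowP => k; rewrite !mxE.
have PA : P *m A = diag_mx (\row_j lam j) *m P.
  apply/row_matrixP => j; rewrite !row_mul rowP' row_diag_mx -scalemxAl -rowE rowP' mxE.
  by have [] := Hv j.
have vprod (s : seq 'I_n) k : v k *m \big[mulmx/1%:M]_(i <- s) (A - (lam i)%:M) = (\prod_(i <- s) (lam k - lam i)) *: v k.
  elim: s => [|i s IH]; first by rewrite !big_nil mulmx1 scale1r.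
  rewrite !big_cons mulmxA mulmxBr mul_mx_scalar; have [-> _] := Hv k.
  by rewrite -scalerBl -scalemxAl IH scalerA.
have Pu : P \in unitmx.
  rewrite -row_free_unit; apply: inj_row_free => u uP.
  apply/rowP => j; rewrite [RHS]mxE.
  pose s := rem j (enum 'I_n).
  have : u *m P *m \big[mulmx/1%:M]_(i <- s) (A - (lam i)%:M) = 0 by rewrite uP mul0mx.
  have -> : u *m P = \sum_k u 0 k *: v k.
    rewrite mulmx_sum_row; apply: eq_bigr => k _; by rewrite rowP'.
  rewrite mulmx_suml.
  under eq_bigr => k _ do rewrite -scalemxAl vprod// scalerA.
  rewrite (bigD1 j)//= [X in _ + X]big1 ?addr0; last first.
    move=> k kj; rewrite (_ : \prod_(i <- s) _ = 0) ?mulr0 ?scale0r//.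
    have ks : k \in s by rewrite mem_rem_uniq ?enum_uniq// inE kj mem_enum.
    by rewrite (big_rem _ ks) /= subrr mul0r.
  move=> /eqP; rewrite scaler_eq0; have [_ /negbTE ->] := Hv j.
  rewrite orbF mulf_eq0 => /orP[/eqP//|]; rewrite prodf_seq_eq0 => /hasP[k].
  rewrite mem_rem_uniq ?enum_uniq// inE => /andP[kj _] /=.
  by rewrite subr_eq0 => /eqP/lam_inj e; rewrite e eqxx in kj.
exists (invmx P); first by rewrite unitmx_inv.
have e : P *m (A *m invmx P) = P *m (invmx P *m diag_mx (\row_j lam j)).
  by rewrite mulmxA PA mulmxK// mulmxA mulmxV// mul1mx.
by have := congr1 (mulmx (invmx P)) e; rewrite !mulmxA mulVmx// !mul1mx.
Qed.

Definition dcvgC (S : set R) (g : R -> C) (t : R) (l : C) :=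
  dcvg S (fun s => Re (g s)) t (Re l) /\ dcvg S (fun s => Im (g s)) t (Im l).

Lemma dcvgCD S g h t a b : dcvgC S g t a -> dcvgC S h t b -> dcvgC S (fun s => g s + h s) t (a + b).
Proof.
move=> [g1 g2] [h1 h2]; split; rewrite ?ReD ?ImD.
  have -> : (fun s => Re (g s + h s)) = (fun s => Re (g s) + Re (h s)) by apply/funext => s; rewrite ReD.
  exact: dcvgD.
have -> : (fun s => Im (g s + h s)) = (fun s => Im (g s) + Im (h s)) by apply/funext => s; rewrite ImD.
exact: dcvgD.
Qed.

Lemma dcvgCZ S g t a c : dcvgC S g t a -> dcvgC S (fun s => c * g s) t (c * a).
Proof.
move=> [g1 g2]; split; rewrite ?ReM ?ImM.
  have -> : (fun s => Re (c * g s)) = (fun s => Re c * Re (g s) + - Im c * Im (g s)).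
    by apply/funext => s; rewrite ReM mulNr.
  by rewrite -mulNr; apply: dcvgD; exact: dcvgZ.
have -> : (fun s => Im (c * g s)) = (fun s => Re c * Im (g s) + Im c * Re (g s)).
  by apply/funext => s; rewrite ImM.
by apply: dcvgD; exact: dcvgZ.
Qed.

Lemma dcvg_cst (S : set R) (c t : R) : dcvg S (fun=> c) t 0.
Proof. by apply: is_derive_dcvg; exact: derc. Qed.

Lemma dcvgC_sum S (I : Type) (r : seq I) (F : I -> R -> C) t (l : I -> C) :
  (forall i, dcvgC S (F i) t (l i)) -> dcvgC S (fun s => \sum_(i <- r) F i s) t (\sum_(i <- r) l i).
Proof.
move=> H; elim: r => [|i r IH].
  have -> : (fun s => \sum_(i <- [::]) F i s) = (fun=> 0) by apply/funext => s; rewrite big_nil.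
  by rewrite big_nil; split; exact: dcvg_cst.
have -> : (fun s => \sum_(j <- i :: r) F j s) = (fun s => F i s + \sum_(j <- r) F j s).
  by apply/funext => s; rewrite big_cons.
by rewrite big_cons; apply: dcvgCD.
Qed.

Section KC.
Variables (k' : nat) (t0 : R) (lam : 'I_k' -> C) (K : set (R -> R)).
Hypothesis K3P : K3_class t0 lam K.
Implicit Types (g h : R -> C).

Lemma KC_add g h : reIm K g -> reIm K h -> reIm K (fun t => g t + h t).
Proof.
move=> [g1 g2] [h1 h2]; split.
  by have := K3_add K3P g1 h1; congr K; apply/funext => t; rewrite ReD.
by have := K3_add K3P g2 h2; congr K; apply/funext => t; rewrite ImD.
Qed.

Lemma KC_mul g h : reIm K g -> reIm K h -> reIm K (fun t => g t * h t).
Proof.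
move=> [g1 g2] [h1 h2]; split.
  have := K3_add K3P (K3_mul K3P g1 h1) (K3_scale K3P (-1) (K3_mul K3P g2 h2)).
  by congr K; apply/funext => t; rewrite ReM mulN1r.
have := K3_add K3P (K3_mul K3P g1 h2) (K3_mul K3P g2 h1).
by congr K; apply/funext => t; rewrite ImM.
Qed.

Lemma KC_scale c g : reIm K g -> reIm K (fun t => c * g t).
Proof.
move=> [g1 g2]; split.
  have := K3_add K3P (K3_scale K3P (Re c) g1) (K3_scale K3P (- Im c) g2).
  by congr K; apply/funext => t; rewrite ReM mulNr.
have := K3_add K3P (K3_scale K3P (Re c) g2) (K3_scale K3P (Im c) g1).
by congr K; apply/funext => t; rewrite ImM.
Qed.

Lemma KC_real (g : R -> R) : K g -> reIm K (fun t => real_complex R (g t)).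
Proof. by move=> Kg; split=> //=; exact: (K_zero K3P). Qed.

Lemma KC_zero : reIm K (fun=> 0).
Proof. by split; exact: (K_zero K3P). Qed.

Lemma KC_sum (I : Type) (r : seq I) (F : I -> R -> C) : (forall i, List.In i r -> reIm K (F i)) ->
  reIm K (fun t => \sum_(i <- r) F i t).
Proof.
elim: r => [|i r IH] H.
  by have := KC_zero; congr (reIm K _); apply/funext => t; rewrite big_nil.
have := KC_add (H i (or_introl erefl)) (IH (fun j hj => H j (or_intror hj))); congr (reIm K _).
by apply/funext => t; rewrite big_cons.
Qed.

Lemma K_solveC h z : reIm K h -> (Spec lam `|` Delta lam) z ->
  exists2 y : R -> C, reIm K y & forall t, t0 <= t -> dcvgC `[t0, +oo[ y t (z * y t + h t).
Proof.
move=> hK zS; have [y [yK [[yr _] [yi _]] yE]] := K3_solve K3P hK zS.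
exists y => // t tt; rewrite -yE//=; split=> /=; apply: derivable_within_dcvg.
  exact: (yr 0%N isT t tt).
exact: (yi 0%N isT t tt).
Qed.

End KC.

(** In the eigenbasis the system splits into scalar equations with coefficients in the spectrum,
    which the class [K] solves. Since [A] and [h] are real, the real part of the transformed
    solution is again a solution. *)
Lemma K_solve_linear (n : nat) (t0 : R) (A : 'M[R]_n) (lam : 'I_n -> C) (K : set (R -> R)) (h : R -> 'cV[R]_n) :
  eigenvalues A lam -> K3_class t0 lam K -> ~ Delta lam 0 -> vecK K h ->
  exists y : R -> 'cV[R]_n, K3_solution t0 K A h y.
Proof.
move=> lamP K3P nD hK.
have lam_inj : injective lam.
  move=> i j e; apply/eqP; apply: contrapT => /negP ij; apply: nD.
  by exists i, j; split=> //; rewrite e subrr.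
have [V Vu AV] := eigenvectors lam_inj lamP.
pose hh j t : C := \sum_i invmx V j i * real_complex R (h t i 0).
have hhK j : reIm K (hh j).
  apply: (KC_sum K3P) => i _; apply: (KC_scale K3P); apply: (KC_real K3P); exact: hK.
have /choice[x Hx] : forall j, exists x : R -> C, reIm K x /\
    forall t, t0 <= t -> dcvgC `[t0, +oo[ x t (lam j * x t + hh j t).
  by move=> j; have [|x x1 x2] := K_solveC K3P (hhK j) (z := lam j); [left; exists j|exists x].
pose y t : 'cV[R]_n := \col_i Re (\sum_j V i j * x j t).
have yK i : K (fun t => y t i 0).
  have [+ _] : reIm K (fun t => \sum_j V i j * x j t).
    by apply: (KC_sum K3P) => j _; apply: (KC_scale K3P); have [] := Hx j.
  by congr K; apply/funext => t; rewrite mxE.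
have yd t : t0 <= t -> dcvg `[t0, +oo[ y t (A *m y t + h t).
  move=> tt; apply: dcvg_mx => i k; rewrite (ord1 k).
  have [+ _] : dcvgC `[t0, +oo[ (fun s => \sum_j V i j * x j s) t (\sum_j V i j * (lam j * x j t + hh j t)).
    by apply: dcvgC_sum => j; apply: dcvgCZ; have [_] := Hx j; apply.
  have -> : Re (\sum_j V i j * (lam j * x j t + hh j t)) = (A *m y t + h t) i 0.
    rewrite mxE mxE.
    have -> : \sum_j V i j * (lam j * x j t + hh j t) =
       \sum_k (real_complex R (A i k)) * (\sum_j V k j * x j t) + real_complex R (h t i 0).
      under eq_bigr do rewrite mulrDr mulrA.
      rewrite big_split /=; congr (_ + _).
        transitivity (\sum_j (map_mx (real_complex R) A *m V) i j * x j t).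
          apply: eq_bigr => j _; congr (_ * _).
          by rewrite AV mul_mx_diag !mxE.
        transitivity (\sum_j \sum_k0 real_complex R (A i k0) * (V k0 j * x j t)).
          apply: eq_bigr => j _; rewrite mxE mulr_suml; apply: eq_bigr => k0 _.
          by rewrite mxE mulrA.
        by rewrite exchange_big /=; apply: eq_bigr => k0 _; rewrite mulr_sumr.
      transitivity ((V *m (invmx V *m \col_i real_complex R (h t i 0))) i 0).
        rewrite mxE; apply: eq_bigr => j _; congr (_ * _); rewrite mxE; apply: eq_bigr => k0 _.
        by rewrite mxE.
      by rewrite mulmxA mulmxV// mul1mx mxE.
    rewrite ReD /= Re_sum; congr (_ + _); apply: eq_bigr => k0 _.
    by rewrite ReM /= mul0r subr0 mxE.
  apply: dcvg_ext => // s _; by rewrite mxE.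
have yc : contI t0 y.
  by apply/mx_contI => i k; rewrite (ord1 k); apply/withinP_contI; exact: (K3_continuous K3P (yK i)).
exists y; split=> //; last by move=> t tt; have [_] := dcvg_dI tt (yd t tt).
split=> [[|//] _ t tt|[|[|//]] _] /=.
- by have [] := dcvg_dI tt (yd t tt).
- exact/withinP_contI.
apply/withinP_contI.
have c2 : contI t0 (fun t => A *m y t + h t).
  apply: contI_mxD; first by apply: contI_mulmx => //; exact: contIc.
  by apply/mx_contI => i k; rewrite (ord1 k); apply/withinP_contI; exact: (K3_continuous K3P (hK i)).
rewrite /contI; have -> : (fun t => dI t0 y (Num.max t t0)) = (fun t => A *m y (Num.max t t0) + h (Num.max t t0)).
    apply/funext => t; have tt : t0 <= Num.max t t0 by rewrite le_max lexx orbT.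
  by have [_] := dcvg_dI tt (yd _ tt).
exact: c2.
Qed.

End ComplexFunctions.

(** * Existence of the coefficients *)

Section Ranks.
Variables (R : realType) (m : nat) (varrho : 'I_m.+1 -> R) (rho : nat -> R).
Hypothesis varrho_gt0 : forall l, 0 < varrho l.
Hypothesis varrho_homo : forall l l' : 'I_m.+1, (l <= l')%N -> varrho l <= varrho l'.
Hypothesis rhoP : rank_enum varrho rho.

Lemma varrho_ge0 l : varrho ord0 <= varrho l.
Proof. exact: varrho_homo. Qed.

Lemma rho_mono s s' : (1 <= s)%N -> (s < s')%N -> rho s < rho s'.
Proof.
move=> s1; elim: s' => // s' IH; rewrite ltnS leq_eqVlt => /orP[/eqP <-|ss].
  by have [H _] := rhoP; exact: H.
apply: lt_trans (IH ss) _; have [H _] := rhoP; apply: H; exact: leq_trans s1 (ltnW ss).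
Qed.

Lemma rho_le s s' : (1 <= s)%N -> (s <= s')%N -> rho s <= rho s'.
Proof. by move=> s1; rewrite leq_eqVlt => /orP[/eqP <-//|/(rho_mono s1)/ltW]. Qed.

Lemma rho_le_inv s s' : (1 <= s)%N -> (1 <= s')%N -> rho s <= rho s' -> (s <= s')%N.
Proof.
by move=> s1 s1' h; rewrite leqNgt; apply/negP => /(rho_mono s1'); rewrite ltNge h.
Qed.

Lemma rho_inj s s' : (1 <= s)%N -> (1 <= s')%N -> rho s = rho s' -> s = s'.
Proof.
by move=> s1 s1' e; apply/eqP; rewrite eqn_leq; apply/andP; split; apply: rho_le_inv => //; rewrite e.
Qed.

Lemma rank_rho nu : nu <> mset0 -> exists2 s, (1 <= s)%N & rho s = rank varrho nu.
Proof. by move=> nu0; have [_ H] := rhoP; apply/H; exists nu. Qed.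

(** All ranks are enumerated by [rho], so exceeding [rho k] means reaching [rho k.+1]; this turns
    strict inequalities between ranks into orders of smallness. *)
Lemma rank_gap k nu : (1 <= k)%N -> nu <> mset0 -> rho k < rank varrho nu -> rho k.+1 <= rank varrho nu.
Proof.
move=> k1 nu0; have [s s1 <-] := rank_rho nu0 => h; apply: rho_le => //.
by rewrite ltnNge; apply/negP => sk; have := rho_le s1 sk; rewrite leNgt h.
Qed.

Lemma msetn1_neq0 (x : 'I_m.+1 * nat) : msetn 1 x <> mset0.
Proof. by move=> /msetP/(_ x); rewrite msetnxx mset0E. Qed.

Lemma rho_ge_first k : (1 <= k)%N -> varrho ord0 <= rho k.
Proof.
move=> k1; have [_ H] := rhoP; have [nu nu0 <-] := (H (rho k)).1 (ex_intro2 _ _ k k1 erefl).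
exact: (rank_gt0 (varrho_gt0 ord0) varrho_ge0).
Qed.

End Ranks.

Section Existence.
Variables (R : realType) (n m : nat) (t0 : R) (A : 'M[R]_n) (lam : 'I_n -> R[i]) (K : set (R -> R)).
Variables (D : set (R * 'cV[R]_n)) (phi0 : R -> 'cV[R]_n) (fl : 'I_m.+1 -> R * 'cV[R]_n -> 'cV[R]_n).
Variables (varrho : 'I_m.+1 -> R) (rho : nat -> R) (k : nat).
Hypothesis lamP : eigenvalues A lam.
Hypothesis K3P : K3_class t0 lam K.
Hypothesis noRes : ~ Delta lam 0.
Hypothesis varrho_gt0 : forall l, 0 < varrho l.
Hypothesis varrho_homo : forall l l' : 'I_m.+1, (l <= l')%N -> varrho l <= varrho l'.
Hypothesis rhoP : rank_enum varrho rho.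
Hypothesis H4 : forall l (w : mindex n), varrho l <= rho k ->
  (mabs w)%:Z <= qkl varrho rho k l -> vecK K (fun t => pderm D w (fl l) (t, phi0 t)).
Implicit Types (phi : mono m.+1 -> R -> 'cV[R]_n).

Let r0 := varrho ord0.
Let r00 : 0 < r0. Proof. exact: varrho_gt0. Qed.
Let varrho_ge l : r0 <= varrho l. Proof. exact: varrho_homo. Qed.

Lemma truncn_room (X : R) (l : 'I_m.+1) : 0 <= X -> X < varrho l + (Num.truncn (X / r0)).+1%:R * r0.
Proof.
move=> X0; have := truncnS_gt (X / r0); rewrite ltr_pdivrMr// => h.
by apply: lt_trans h _; rewrite ltrDr.
Qed.

(** Every monomial in the finite form has smaller rank than [nu]; this makes the system for the
    coefficients a recursion. *)
Lemma gcoef_local phi phi' nu t : nu <> mset0 ->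
  (forall b, rank varrho b < rank varrho nu -> phi b = phi' b) ->
  gcoef D fl phi0 phi nu t = gcoef D fl phi0 phi' nu t.
Proof.
move=> nu0 H; pose X := Num.max (rank varrho nu - 1) (rank varrho nu - r0).
have [ML uML MLP] := monos_list r00 varrho_ge X.
have nX1 : rank varrho nu - 1 <= X by rewrite le_max lexx.
have nX2 : rank varrho nu - r0 <= X by rewrite le_max lexx orbT.
have XX : X < rank varrho nu by have := r00; rewrite gt_max => r1; apply/andP; split; lra.
have qP l := truncn_room l (rank_ge0 r00 varrho_ge nu).
rewrite !(gcoef_rep r00 varrho_ge D fl phi0 _ _ uML MLP nu0 nX1 nX2 qP).
have HM b : b \in ML -> phi b = phi' b by move=> /MLP[_ bX]; apply: H; exact: le_lt_trans XX.
congr (- _ + _); first by rewrite !big_seq; apply: eq_bigr => b /HM ->.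
apply: eq_bigr => l _; apply: eq_bigr => w _; congr ((_ * lrep (lmul _ _) _ _) *: _).
rewrite /powL; apply: eq_bigr => j _; congr (iter _ (lmul _) _).
by apply/eq_in_map => b /HM ->.
Qed.

Lemma gcoef_vecK phi nu : nu <> mset0 -> rank varrho nu <= rho k ->
  (forall b, b <> mset0 -> rank varrho b < rank varrho nu -> vecK K (phi b)) ->
  vecK K (gcoef D fl phi0 phi nu).
Proof.
move=> nu0 nuk H; pose X := Num.max (rank varrho nu - 1) (rank varrho nu - r0).
have [ML uML MLP] := monos_list r00 varrho_ge X.
have nX1 : rank varrho nu - 1 <= X by rewrite le_max lexx.
have nX2 : rank varrho nu - r0 <= X by rewrite le_max lexx orbT.
have XX : X < rank varrho nu by have := r00; rewrite gt_max => r1; apply/andP; split; lra.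
have qP l := truncn_room l (rank_ge0 r00 varrho_ge nu).
apply: (gcoef_K r00 varrho_ge K3P uML MLP nu0 nX1 nX2 qP).
  by move=> b /MLP[b0 bX]; apply: H => //; exact: le_lt_trans XX.
move=> l w lw; have lk : varrho l + (mabs w)%:R * r0 <= rho k by exact: le_trans nuk.
apply: H4; first by apply: le_trans lk; rewrite lerDl mulr_ge0// ltW.
rewrite /qkl floor_ge_int ler_pdivlMr//; by move: lk; rewrite -/r0 => lk; rewrite lerBrDl.
Qed.

(** Induction on the rank index. The coefficients of rank [rho j.+1] are solved for all at once, and
    by [gcoef_local] inserting them changes none of the equations treated so far. *)
Theorem coefficients_exist : exists phi, coefficients t0 K A D fl phi0 varrho rho k phi.
Proof.
suff H j : (j <= k)%N -> exists phi, coefficients t0 K A D fl phi0 varrho rho j phi by exact: H.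
elim: j => [|j IH] jk; first by exists (fun _ _ => 0) => s nu; lia.
have [phi Hphi] := IH (ltnW jk).
have Klow nu : nu <> mset0 -> rank varrho nu < rho j.+1 -> vecK K (phi nu).
  move=> nu0 h; have [s s1 e] := rank_rho rhoP nu0.
  have sj : (s <= j)%N.
    rewrite -ltnS ltnNge; apply/negP => js; have := rho_le rhoP (isT : (1 <= j.+1)%N) js.
    by rewrite e leNgt h.
  by have [] := Hphi s nu ltac:(by rewrite s1 sj) (conj nu0 (esym e)).
have /choice[y Hy] : forall nu, exists y : R -> 'cV[R]_n, monos_of_rank varrho (rho j.+1) nu ->
    K3_solution t0 K A (gcoef D fl phi0 phi nu) y.
  move=> nu; have [[nu0 e]|h] := pselect (monos_of_rank varrho (rho j.+1) nu); last by exists (fun=> 0).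
  have gK : vecK K (gcoef D fl phi0 phi nu).
    apply: gcoef_vecK => //; first by rewrite e; apply: (rho_le rhoP).
    by move=> b b0; rewrite e; exact: Klow.
  by have [y Hy] := K_solve_linear lamP K3P noRes gK; exists y.
pose phi' nu := if rank varrho nu == rho j.+1 then y nu else phi nu.
have E nu : nu <> mset0 -> rank varrho nu <= rho j.+1 ->
    gcoef D fl phi0 phi' nu = gcoef D fl phi0 phi nu.
  move=> nu0 h; apply/funext => t; apply: gcoef_local => // b bn.
  by rewrite /phi' lt_eqF// (lt_le_trans bn).
exists phi' => s nu /andP[s1]; rewrite leq_eqVlt => /orP[/eqP e|]; last first.
  rewrite ltnS => sj h; have [nu0 e] := h.
  have rl : rho s < rho j.+1 by apply: (rho_mono rhoP).
  rewrite E//; last by rewrite e ltW.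
  by rewrite /phi' e lt_eqF//; apply: (Hphi s) => //; rewrite s1 sj.
move=> h; have [nu0 e'] := h; rewrite e in h e'.
by rewrite E ?e'//; rewrite /phi' e' eqxx; exact: Hy.
Qed.

End Existence.

(** * The number of parameters *)

Section DimensionBound.
Variable R : realType.

Lemma derivable_on_contI (p q : nat) (t1 : R) (g : R -> 'M[R]_(p, q)) : derivable_on t1 g -> contI t1 g.
Proof.
move=> gd; apply/mx_contI => i j; apply/withinP_contI/subspace_continuousP => t.
rewrite /= in_itv /= andbT => tt; have /derivable_within_dcvg := gd t tt.
move: (dwithin _ _ _) => L /(dcvg_entry (i := i) (j := j)).
move: (L i j) => l /cvgrPdist_le/(_ 1 ltr01) H.
apply/cvgrPdist_le => e e0; rewrite near_withinE.
move: H; rewrite /within /= /dnbhs /within /= => /nbhs_ballP[d /= d0 H].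
pose d' := Num.min d (e / (`|l| + 1)).
have l1 : 0 < `|l| + 1 by rewrite ltr_wpDl.
have d'0 : 0 < d' by rewrite lt_min d0 divr_gt0.
apply/nbhs_ballP; exists d' => // s /= sd' tS; have [->|st] := eqVneq s t; first by rewrite subrr normr0 ltW.
have sd : ball t d s by apply: le_ball sd'; rewrite ge_min lexx.
have h := H s sd st tS.
have s0 : s - t != 0 by rewrite subr_eq0.
have : `|(s - t)^-1 * (g s i j - g t i j)| <= `|l| + 1.
  have -> : (s - t)^-1 * (g s i j - g t i j) = l - (l - (s - t)^-1 *: (g s i j - g t i j)) by rewrite opprB [RHS]addrC subrK.
  by apply: (le_trans (ler_normB _ _)); rewrite lerD2l.
rewrite normrM normfV mulrC ler_pdivrMr ?normr_gt0// => h2; rewrite distrC; apply: (le_trans h2).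
have : `|s - t| < e / (`|l| + 1).
  by move: sd'; rewrite /ball /= distrC => sd'; apply: lt_le_trans sd' _; rewrite ge_min lexx orbT.
by rewrite ltr_pdivlMr// mulrC => /ltW.
Qed.

(** A solution has only a one-sided derivative at its initial time, so derivatives are asked for in
    the open interval and continuity on the closed one. *)
Lemma nincr_interior (f df : R -> R) a b : a <= b -> {within `[a, b], continuous f} ->
  (forall t, a < t < b -> is_derive t 1 f (df t)) -> (forall t, a < t < b -> df t <= 0) -> f b <= f a.
Proof.
rewrite le_eqVlt => /predU1P[->//|ab] fc fd f0.
have Hd : forall t, t \in `]a, b[ -> is_derive t 1 f (df t) by move=> t; rewrite in_itv; exact: fd.
have [c] := MVT ab Hd fc.
rewrite in_itv /= => ct e; rewrite -subr_le0 e; rewrite mulr_le0_ge0 ?f0//.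
by rewrite subr_ge0 ltW.
Qed.

Lemma contI_bounded t0 (f : R -> R) T : contI t0 f -> exists2 M, 0 <= M & forall t, t0 <= t <= T -> `|f t| <= M.
Proof.
move=> fc; have [tT|Tt] := leP t0 T; last first.
  by exists 0 => // t /andP[h1 h2]; have := le_trans h1 h2; rewrite leNgt Tt.
have nc : {within `[t0, T], continuous (fun t => `|f (Num.max t t0)|)}.
  by apply: continuous_subspaceT => t; apply: cvg_norm; exact: fc.
have [c _ H] := EVT_max tT nc; exists (`|f (Num.max c t0)|) => // t tt.
by have := H t; rewrite in_itv /= => /(_ tt); have /andP[h _] := tt; rewrite (max_idPl h).
Qed.

Variables (n m : nat) (t0 : R) (phi0 : R -> 'cV[R]_n) (a : R).
Hypothesis a0 : 0 < a.
Let D := cylinder t0 phi0 a.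

(** A solution may touch the boundary of the closed cylinder, whereas the derivative estimates hold
    in the open one. Both points are pulled towards the axis by the factor [1 - th], and continuity
    of [F] makes the error at most [e]. *)
Lemma lipschitz_cylinder (F : R * 'cV[R]_n -> 'cV[R]_n) q : C0y D q F -> (0 < q)%N ->
  (forall w : mindex n, (mabs w <= q)%N -> exists M : R, forall p, D p -> `|pderm D w F p| <= M) ->
  exists2 B, 0 <= B & forall t y y', D (t, y) -> D (t, y') -> `|F (t, y') - F (t, y)| <= B * `|y' - y|.
Proof.
move=> FC q0 FB; have [B B0 HB] := pders_estimates a0 FC FB; exists B => // t y y' [/= tt yD] [_ /= yD'].
apply/ler_addgt0Pr => e e0.
have Hc z : `|z - phi0 t| <= a -> exists2 de, 0 < de & forall z', `|z' - phi0 t| <= a -> `|z' - z| <= de ->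
    `|F (t, z') - F (t, z)| <= e / 2.
  move=> zD; have [_ /(_ [::] isT) /subspace_continuousP] := FC.
  move=> /(_ (t, z) (conj tt zD)) /cvgrPdist_le/(_ (e / 2)) /(_ ltac:(by rewrite divr_gt0)).
  rewrite /within /= => /nbhs_ballP[d /= d0 H]; exists (d / 2); first by rewrite divr_gt0.
  move=> z' zD' zz'; rewrite distrC; apply: H => //; split => /=; first exact: ballxx.
  rewrite mx_norm_ball /ball_ /= distrC; apply: (le_lt_trans zz').
  by rewrite ltr_pdivrMr// mulr_natr mulr2n ltrDl.
have [d1 d10 H1] := Hc y yD; have [d2 d20 H2] := Hc y' yD'.
pose th := Num.min 1 (Num.min (d1 / a) (d2 / a)).
have th0 : 0 < th by rewrite !lt_min ltr01 !divr_gt0.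
have th1 : th <= 1 by rewrite ge_min lexx.
have tha1 : th * a <= d1 by rewrite -ler_pdivlMr// !ge_min lexx !orbT.
have tha2 : th * a <= d2 by rewrite -ler_pdivlMr// !ge_min lexx !orbT.
pose sh z := z - th *: (z - phi0 t).
have shc z : sh z - phi0 t = (1 - th) *: (z - phi0 t).
  by apply/matrixP => i j; rewrite !mxE; ring.
have sh_box z : `|z - phi0 t| <= a -> box (phi0 t) a (sh z).
  move=> zD; rewrite /box shc normrZ ger0_norm; last by lra.
  apply: (@le_lt_trans _ _ ((1 - th) * a)); first by rewrite ler_wpM2l//; lra.
  by rewrite gtr_pMl//; lra.
have sh_d z : `|z - phi0 t| <= a -> `|sh z - z| <= th * a.
  move=> zD; have -> : sh z - z = - (th *: (z - phi0 t)) by rewrite /sh addrAC subrr add0r.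
  by rewrite normrN normrZ (ger0_norm (ltW th0)) ler_wpM2l// ltW.
have [_ L _ _] := HB t tt.
have h1 := H1 (sh y) (ltW (sh_box _ yD)) (le_trans (sh_d _ yD) tha1).
have h2 := H2 (sh y') (ltW (sh_box _ yD')) (le_trans (sh_d _ yD') tha2).
have h3 := L (sh y) (sh y') [::] q0 (sh_box _ yD) (sh_box _ yD').
have h4 : `|sh y' - sh y| <= `|y' - y|.
  have -> : sh y' - sh y = (1 - th) *: (y' - y) by apply/matrixP => i j; rewrite !mxE; ring.
  rewrite normrZ ger0_norm; last by lra.
  by rewrite ler_piMl//; lra.
have h5 : B * `|sh y' - sh y| <= B * `|y' - y| by rewrite ler_wpM2l.
have -> : F (t, y') - F (t, y) = - (F (t, sh y') - F (t, y')) + (F (t, sh y') - F (t, sh y)) + (F (t, sh y) - F (t, y)).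
  by apply/matrixP => i j; rewrite !mxE; ring.
apply: (le_trans (ler_normD _ _)); apply: (le_trans (lerD (ler_normD _ _) h1)).
rewrite normrN; move: h3 h2; rewrite /pders /=; lra.
Qed.

Variables (A : 'M[R]_n) (f : R -> 'cV[R]_n) (eps : 'I_m -> R -> R) (fl : 'I_m -> R * 'cV[R]_n -> 'cV[R]_n).
Variable q : 'I_m -> nat.
Hypothesis eps_cont : forall l, contI t0 (eps l).
Hypothesis flC : forall l, C0y D (q l) (fl l).
Hypothesis q_gt0 : forall l, (0 < q l)%N.
Hypothesis flB : forall l (w : mindex n), (mabs w <= q l)%N -> exists M : R, forall p, D p -> `|pderm D w (fl l) p| <= M.

(** The sum of squares [u] of the difference satisfies u' <= 2 n L u, so [u] times a decaying
    exponential is nonincreasing. *)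
Lemma solutions_gronwall t1 T : t0 <= t1 -> t1 <= T -> exists2 C, 0 <= C & forall y z : R -> 'cV[R]_n,
  solution A f eps fl D t1 y -> solution A f eps fl D t1 z -> `|y T - z T| <= C * `|y t1 - z t1|.
Proof.
move=> t01 tT.
have /choice[B HB] : forall l, exists B, 0 <= B /\ forall t y y', D (t, y) -> D (t, y') ->
    `|fl l (t, y') - fl l (t, y)| <= B * `|y' - y|.
  by move=> l; have [B B0 H] := lipschitz_cylinder (flC l) (q_gt0 l) (fun w => @flB l w); exists B.
have /choice[M HM] : forall l, exists M, 0 <= M /\ forall t, t0 <= t <= T -> `|eps l t| <= M.
  by move=> l; have [M M0 H] := contI_bounded T (@eps_cont l); exists M.
pose L := n%:R * `|A| + \sum_l M l * B l.
have L0 : 0 <= L.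
  rewrite addr_ge0 ?mulr_ge0//; apply: sumr_ge0 => l _; have [? _] := HB l; have [? _] := HM l.
  exact: mulr_ge0.
have Lip t y z : t0 <= t <= T -> D (t, y) -> D (t, z) ->
    `|rhs A f eps fl t y - rhs A f eps fl t z| <= L * `|y - z|.
  move=> tt yD zD; have -> : rhs A f eps fl t y - rhs A f eps fl t z =
     A *m (y - z) + \sum_(l < m) eps l t *: (fl l (t, y) - fl l (t, z)).
    rewrite /rhs mulmxBr; under [in RHS]eq_bigr do rewrite scalerBr.
    by rewrite sumrB; apply/matrixP => i j; rewrite !mxE; ring.
  apply: (le_trans (ler_normD _ _)); rewrite mulrDl; apply: lerD; first exact: mx_norm_mul.
  apply: (le_trans (ler_norm_sum _ _ _)); rewrite mulr_suml; apply: ler_sum => l _.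
  rewrite normrZ -mulrA; have [M0 HMl] := HM l; have [B0 HBl] := HB l.
  by apply: ler_pM => //; [exact: HMl|exact: HBl].
pose E := expR (2 * n%:R * L * (T - t1)).
(* The estimate gives [n%:R * E] for the squared norms; its square root is replaced by
   [1 + n%:R * E], whose square is larger. *)
exists (1 + n%:R * E); first by rewrite addr_ge0// mulr_ge0// expR_ge0.
move=> y z [yd yE] [zd zE].
pose d t := y t - z t.
pose u t := \sum_i d t i 0 ^+ 2.
pose c := - (2 * n%:R * L).
pose v t := u t * expR (c * (t - t1)).
have vv : v T <= v t1.
  pose du t := \sum_i 2 * d t i 0 * (rhs A f eps fl t (y t) - rhs A f eps fl t (z t)) i 0.
  apply: (nincr_interior (df := fun t => du t * expR (c * (t - t1)) + u t * (expR (c * (t - t1)) * c)) tT).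
  - apply: continuous_subspaceW (_ : {within `[t1, +oo[, continuous v}).
      by apply: subset_itv => //=; rewrite bnd_simp.
    apply/withinP_contI; apply: contIM.
      have /mx_contI yc := derivable_on_contI yd; have /mx_contI zc := derivable_on_contI zd.
      apply: contI_sum => i _; have dc : contI t1 (fun t => d t i 0).
        have -> : (fun t => d t i 0) = (fun t => y t i 0 - z t i 0) by apply/funext => t; rewrite !mxE.
        by apply: contIB.
      exact: contIM.
    apply: (@der_contI _ _ (fun t => expR (c * (t - t1)) * (c * (1 - 0)))) => t _.
  - move=> t /andP[t1t tT']; apply: derM.
      apply: der_sum => i _.
      have dy := @dI_derive_mx _ _ _ _ _ _ i 0 t1t (yd t (ltW t1t)).
      have dz := @dI_derive_mx _ _ _ _ _ _ i 0 t1t (zd t (ltW t1t)).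
      have [_ yE'] := yE t (ltW t1t); have [_ zE'] := zE t (ltW t1t).
      have dd : is_derive t 1 (fun t => d t i 0) ((rhs A f eps fl t (y t) - rhs A f eps fl t (z t)) i 0).
        apply: is_derive_eq (der_ext _ (derB dy dz)) _; first by move=> s; rewrite !mxE.
        by rewrite yE' zE' !mxE.
      apply: is_derive_eq (der_ext _ (derM dd dd)) _; first by move=> s; rewrite expr2.
      by ring.
    apply: is_derive_eq (der_expR (derZ c (derB (is_derive_id t 1) (derc t t1)))) _.
    by rewrite subr0 mulr1.
  - move=> t /andP[t1t tT']; have tt : t0 <= t <= T by rewrite (ltW tT') (le_trans t01 (ltW t1t)).
    have [yD _] := yE t (ltW t1t); have [zD _] := zE t (ltW t1t).
    have e0 : 0 <= expR (c * (t - t1)) by exact: expR_ge0.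
    have -> : du t * expR (c * (t - t1)) + u t * (expR (c * (t - t1)) * c) = (du t + c * u t) * expR (c * (t - t1)) by ring.
    rewrite mulr_le0_ge0//; rewrite /c mulNr subr_le0.
    have du2 : `|d t| ^+ 2 <= u t.
      have [i0|n0] := pickP (fun i : 'I_n => `|d t| == `|d t i 0|).
        move=> /eqP ->; rewrite real_normK ?num_real// /u (bigD1 i0)//= lerDl sumr_ge0// => i _; exact: sqr_ge0.
      have -> : `|d t| = 0.
        apply: contrapT => /eqP/mx_norm_neq0[[i j]] /= e; have := n0 i; rewrite (ord1 j) in e.
        by rewrite /Num.norm /= e eqxx.
      by rewrite expr0n /= sumr_ge0// => i _; exact: sqr_ge0.
    apply: (@le_trans _ _ (\sum_(i < n) 2 * L * u t)); last first.
      by rewrite sumr_const card_ord -mulr_natl; lra.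
    apply: ler_sum => i _; apply: (le_trans (ler_norm _)).
    rewrite !normrM (ger0_norm (_ : 0 <= 2)) // -!mulrA ler_wpM2l//.
    apply: (@le_trans _ _ (`|d t| * (L * `|d t|))).
      apply: ler_pM => //; first exact: mx_norm_entry.
      by apply: le_trans (mx_norm_entry _ _ _) (Lip t _ _ tt yD zD).
    by rewrite mulrCA -expr2 ler_wpM2l.
have uT : `|d T| ^+ 2 <= u T.
  have [i0|n0] := pickP (fun i : 'I_n => `|d T| == `|d T i 0|).
    move=> /eqP ->; rewrite real_normK ?num_real// /u (bigD1 i0)//= lerDl sumr_ge0// => i _; exact: sqr_ge0.
  have -> : `|d T| = 0.
    apply: contrapT => /eqP/mx_norm_neq0[[i j]] /= e; have := n0 i; rewrite (ord1 j) in e.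
    by rewrite /Num.norm /= e eqxx.
  by rewrite expr0n /= sumr_ge0// => i _; exact: sqr_ge0.
have ut1 : u t1 <= n%:R * `|d t1| ^+ 2.
  apply: (@le_trans _ _ (\sum_(i < n) `|d t1| ^+ 2)); last by rewrite sumr_const card_ord mulr_natl.
  apply: ler_sum => i _; rewrite -[X in X <= _]real_normK ?num_real// ler_pXn2r ?nnegrE//.
  exact: mx_norm_entry.
have uTE : u T <= E * u t1.
  move: vv; rewrite /v subrr mulr0 expR0 mulr1 => h.
  have -> : u T = E * (u T * expR (c * (T - t1))).
    by rewrite mulrCA /E -expRD /c mulNr subrr expR0 mulr1.
  by rewrite ler_wpM2l// expR_ge0.
have E0 : 0 <= n%:R * E by rewrite mulr_ge0// expR_ge0.
rewrite -/(d T) -/(d t1) -(@ler_pXn2r _ 2%N)// ?nnegrE ?mulr_ge0// ?addr_ge0//.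
apply: (le_trans uT); apply: (le_trans uTE).
apply: (@le_trans _ _ (E * (n%:R * `|d t1| ^+ 2))); first by rewrite ler_wpM2l// expR_ge0.
rewrite mulrA exprMn ler_wpM2r ?exprn_ge0// [E * _]mulrC.
by nra.
Qed.

(** If N > n, the differential at time [t1] kills some nonzero [v]. Gronwall's inequality bounds the
    difference quotients at any later time by those at [t1], so the derivative along [v] vanishes at
    all times, against independence. *)
Theorem dimension_bound t1 N (U : set 'rV[R]_N) (y : 'rV[R]_N -> R -> 'cV[R]_n) : t0 <= t1 -> open U -> U !=set0 ->
  (forall C, U C -> solution A f eps fl D t1 (y C)) -> independent_family t1 U y -> (N <= n)%N.
Proof.
move=> t01 Uo [C UC] Hs Hi; rewrite leqNgt; apply/negP => nN.
have [Hd Hv] := Hi C UC.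
have d1 := Hd t1 (lexx _).
pose g : {linear 'rV[R]_N -> 'rV[R]_n} := (trmx \o 'd (fun C' => y C' t1) C : {linear _ -> _}).
have : kermx (lin1_mx g) != 0.
  rewrite kermx_eq0 /row_free neq_ltn (leq_ltn_trans (rank_leq_col _) nN) //.
move=> /rowV0Pn[v /sub_kermxP vM v0]; case/eqP: v0; apply: Hv => t tt.
have dv1 : 'D_v (fun C' => y C' t1) C = 0.
  rewrite deriveE//; have := vM; rewrite mul_rV_lin1 /= => /(congr1 trmx).
  by rewrite trmxK trmx0.
have [K K0 HK] := solutions_gronwall t01 tt.
have dd := @diff_derivable _ _ _ _ _ v d1.
rewrite /derive; apply/cvg_lim => //.
apply/cvgrPdist_le => e e0.
have : (fun h : R => h^-1 *: (((fun C' => y C' t1) \o shift C) (h *: v) - y C t1)) @ 0^' --> (0 : 'cV[R]_n).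
  by rewrite -dv1; exact: dd.
move=> /cvgrPdist_le/(_ (e / (K + 1))) /(_ ltac:(by rewrite divr_gt0// ltr_wpDl)) H.
have Uh : (0 : R)^' (fun h : R => U (h *: v + C)).
  have hC : (fun h : R => h *: v + C) @ (0 : R) --> C.
    rewrite -[X in _ --> X]add0r -(scale0r v); apply: cvgD; last exact: cvg_cst.
    by apply: cvgZr_tmp; exact: cvg_id.
  have HU := hC U (open_nbhs_nbhs (conj Uo UC)).
  by rewrite /dnbhs /within /=; apply: (@filterS R (nbhs (0 : R)) _ (fun h : R => U (h *: v + C)) _ _ HU) => x Ux _.
near=> h.
rewrite sub0r normrN normrZ /=.
have UCh : U (h *: v + C).
  by near: h.
have h1 := HK _ _ (Hs _ UCh) (Hs _ UC).
have h2 : `|0 - h^-1 *: (y (h *: v + C) t1 - y C t1)| <= e / (K + 1) by near: h.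
move: h2; rewrite sub0r normrN normrZ => h2.
apply: (@le_trans _ _ (`|h^-1| * (K * `|y (h *: v + C) t1 - y C t1|))); first by rewrite ler_wpM2l.
rewrite mulrCA; apply: (@le_trans _ _ (K * (e / (K + 1)))); first by rewrite ler_wpM2l.
by rewrite mulrCA ler_piMr ?(ltW e0)// ler_pdivrMr ?ltr_wpDl// mul1r lerDl.
Unshelve. all: by end_near. Qed.

End DimensionBound.

(** * The residual of the partial sums *)

Section BigO.
Variables (R : realType) (e : R -> R).
Hypothesis e_gt0 : \forall t \near +oo, 0 < e t.
Hypothesis e_cvg0 : e t @[t --> +oo] --> 0.

Definition bO (V : normedModType R) (c : R) (g : R -> V) :=
  exists M, \forall t \near +oo, `|g t| <= M * e t `^ c.

Lemma e_le1 : \forall t \near +oo, e t <= 1.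
Proof.
move/cvgrPdist_le: e_cvg0 => /(_ 1 ltr01) H; near=> t.
have : `|0 - e t| <= 1 by near: t.
by rewrite sub0r normrN; apply: le_trans; exact: ler_norm.
Unshelve. all: by end_near. Qed.

Lemma bO_pos (V : normedModType R) c (g : R -> V) : bO c g ->
  exists2 M, 0 <= M & \forall t \near +oo, `|g t| <= M * e t `^ c.
Proof.
move=> [M H]; exists `|M| => //; near=> t.
apply: (@le_trans _ _ (M * e t `^ c)); first by near: t.
by rewrite ler_wpM2r ?powR_ge0// ler_norm.
Unshelve. all: by end_near. Qed.

Lemma bO_ext (V : normedModType R) c (g h : R -> V) : bO c g -> (\forall t \near +oo, g t = h t) -> bO c h.
Proof. by move=> [M H] E; exists M; near=> t; rewrite -(near E t)//; near: t. Unshelve. all: by end_near. Qed.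

Lemma bO0 (V : normedModType R) c : bO c (fun=> 0 : V).
Proof. by exists 0; near=> t; rewrite normr0 mul0r. Unshelve. all: by end_near. Qed.

Lemma bO_le (V : normedModType R) c c' (g : R -> V) : c' <= c -> bO c g -> bO c' g.
Proof.
move=> cc' /bO_pos[M M0 H]; exists M; near=> t.
have h1 : 0 < e t by near: t.
have h2 : e t <= 1 by near: t; exact: e_le1.
apply: (@le_trans _ _ (M * e t `^ c)); first by near: t.
by rewrite ler_wpM2l//; apply: ger_powR => //; rewrite h1.
Unshelve. all: by end_near. Qed.

Lemma bOD (V : normedModType R) c (g h : R -> V) : bO c g -> bO c h -> bO c (fun t => g t + h t).
Proof.
move=> [M H] [M' H']; exists (M + M'); near=> t; rewrite mulrDl.
by apply: (le_trans (ler_normD _ _)); apply: lerD; near: t.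
Unshelve. all: by end_near. Qed.

Lemma bON (V : normedModType R) c (g : R -> V) : bO c g -> bO c (fun t => - g t).
Proof. by move=> [M H]; exists M; near=> t; rewrite normrN; near: t. Unshelve. all: by end_near. Qed.

Lemma bO_sum (V : normedModType R) c (I : Type) (r : seq I) (P : pred I) (F : I -> R -> V) :
  (forall i, List.In i r -> P i -> bO c (F i)) -> bO c (fun t => \sum_(i <- r | P i) F i t).
Proof.
elim: r => [|x r IH] H; first by apply: bO_ext (bO0 V c) _; near=> t; rewrite big_nil.
have IH' := IH (fun i hi => H i (or_intror hi)).
have [Px|nPx] := boolP (P x).
  apply: bO_ext (bOD (H x (or_introl erefl) Px) IH') _; near=> t; by rewrite big_cons Px.
by apply: bO_ext IH' _; near=> t; rewrite big_cons (negbTE nPx).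
Unshelve. all: by end_near. Qed.

Lemma bOZ (V : normedModType R) c c' (f : R -> R) (g : R -> V) : bO c f -> bO c' g ->
  bO (c + c') (fun t => f t *: g t).
Proof.
move=> [M H] [M' H']; exists (M * M'); near=> t; rewrite normrZ.
have h1 : 0 < e t by near: t.
rewrite powRD; last by rewrite (gt_eqF h1) /= implybT.
by rewrite mulrACA; apply: ler_pM => //; near: t.
Unshelve. all: by end_near. Qed.

Lemma bO_bounded (V : normedModType R) (g : R -> V) : (exists M, \forall t \near +oo, `|g t| <= M) -> bO 0 g.
Proof. by move=> [M H]; exists M; near=> t; rewrite powRr0 mulr1; near: t. Unshelve. all: by end_near. Qed.

Lemma bO_bZ (V : normedModType R) c (f : R -> R) (g : R -> V) : bO c f -> (exists M, \forall t \near +oo, `|g t| <= M) ->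
  bO c (fun t => f t *: g t).
Proof. by move=> H1 H2; rewrite -[c]addr0; apply: bOZ => //; exact: bO_bounded. Qed.

Lemma bO_Zb (V : normedModType R) c (f : R -> R) (g : R -> V) : (exists M, \forall t \near +oo, `|f t| <= M) -> bO c g ->
  bO c (fun t => f t *: g t).
Proof. by move=> H1 H2; rewrite -[c]add0r; apply: bOZ => //; exact: bO_bounded. Qed.

Lemma bO_cvg0 (V : normedModType R) c (g : R -> V) : 0 < c -> bO c g -> g t @[t --> +oo] --> 0.
Proof.
move=> c0 /bO_pos[M M0 H]; apply/cvgrPdist_le => d d0.
pose x := (d / (M + 1)) `^ c^-1.
have M1 : 0 < M + 1 by rewrite ltr_wpDl.
have x0 : 0 < x by rewrite powR_gt0// divr_gt0.
move/cvgrPdist_le: e_cvg0 => /(_ x x0) He; near=> t.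
rewrite sub0r normrN; apply: (@le_trans _ _ (M * e t `^ c)); first by near: t.
have h1 : 0 < e t by near: t.
have h2 : `|0 - e t| <= x by near: t.
have h3 : e t <= x by move: h2; rewrite sub0r normrN gtr0_norm.
have h4 : e t `^ c <= d / (M + 1).
  have -> : d / (M + 1) = x `^ c by rewrite /x -powRrM mulVf ?gt_eqF// powRr1// ltW// divr_gt0.
  by apply: ge0_ler_powR => //; rewrite ?nnegrE ltW.
apply: (@le_trans _ _ (M * (d / (M + 1)))); first by rewrite ler_wpM2l.
by rewrite mulrCA ler_piMr ?(ltW d0)// ler_pdivrMr// mul1r lerDl.
Unshelve. all: by end_near. Qed.

End BigO.

(** The product rule over factors counted with multiplicity, the form in which [fder] expands the
    derivative of a monomial. *)
Lemma der_prod (R : realType) (T : eqType) (s : seq T) (F : T -> R -> R) (G : T -> R) (t : R) :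
  (forall x, x \in s -> is_derive t 1 (F x) (G x)) ->
  is_derive t 1 (fun u => \prod_(x <- s) F x u) (\sum_(x <- s) (\prod_(y <- rem x s) F y t) * G x).
Proof.
elim: s => [|y s IH] H.
  apply: is_derive_eq (der_ext _ (derc t 1)) _; first by move=> u; rewrite big_nil.
  by rewrite big_nil.
have IH' := IH (fun x xs => H x (mem_behead (s := y :: s) xs)).
apply: is_derive_eq (der_ext _ (derM (H y (mem_head _ _)) IH')) _; first by move=> u; rewrite big_cons.
rewrite big_cons /= eqxx mulrC; congr (_ + _).
rewrite mulr_sumr; apply: eq_big_seq => x xs.
rewrite mulrA; congr (_ * _); case: eqVneq => [->|_]; last by rewrite big_cons.
by rewrite (perm_big _ (perm_to_rem xs)) big_cons.
Qed.

Lemma contI_prod (R : realType) (I : eqType) (r : seq I) t1 (F : I -> R -> R) :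
  (forall i, i \in r -> contI t1 (F i)) -> contI t1 (fun t => \prod_(i <- r) F i t).
Proof.
elim: r => [|x r IH] H.
  have -> : (fun t => \prod_(i <- [::]) F i t) = (fun=> 1) by apply/funext => t; rewrite big_nil.
  exact: contIc.
have -> : (fun t => \prod_(i <- x :: r) F i t) = (fun t => F x t * \prod_(i <- r) F i t).
  by apply/funext => t; rewrite big_cons.
apply: contIM; first exact: H (mem_head _ _).
by apply: IH => i ir; apply: H; rewrite inE ir orbT.
Qed.

(** * The partial sum inserted into the equation *)

Section Residual.
Variables (R : realType) (n m : nat) (t0 : R) (A : 'M[R]_n) (f phi0 : R -> 'cV[R]_n) (a : R).
Variables (eps : 'I_m.+1 -> R -> R) (fl : 'I_m.+1 -> R * 'cV[R]_n -> 'cV[R]_n).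
Variables (varrho : 'I_m.+1 -> R) (rho : nat -> R) (k : nat).
Let D := cylinder t0 phi0 a.
Hypothesis a0 : 0 < a.
Hypothesis varrho_gt0 : forall l, 0 < varrho l.
Hypothesis varrho_homo : forall l l' : 'I_m.+1, (l <= l')%N -> varrho l <= varrho l'.
Hypothesis rhoP : rank_enum varrho rho.
Hypothesis k_gt0 : (0 < k)%N.
Hypothesis H1_smooth : forall l, CI t0 (pkl varrho rho k l) (eps l).
Hypothesis H1_rank : forall l r, (r <= pkl varrho rho k l)%N ->
  bigO_pinfty (iter r (dI t0) (eps l)) (fun t => eps ord0 t `^ ((varrho l + r%:R) / varrho ord0)).
Hypothesis e_gt0 : forall t, t0 <= t -> 0 < eps ord0 t.
Hypothesis e_cvg0 : eps ord0 t @[t --> +oo] --> 0.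
Hypothesis H2 : forall l, C0y D (smoothness varrho rho k l) (fl l).
Hypothesis H3 : forall l (w : mindex n), (mabs w <= smoothness varrho rho k l)%N ->
  exists M : R, forall p, D p -> `|pderm D w (fl l) p| <= M.
Hypothesis phi0C : CI t0 1 phi0.
Hypothesis phi0E : forall t, t0 <= t -> dI t0 phi0 t = A *m phi0 t + f t.
Variable phi : mono m.+1 -> R -> 'cV[R]_n.
Hypothesis phiC : forall nu, nu <> mset0 -> rank varrho nu <= rho k ->
  [/\ CI t0 1 (phi nu), forall i, exists M : R, forall t, t0 <= t -> `|phi nu t i 0| <= M &
      forall t, t0 <= t -> dI t0 (phi nu) t = A *m phi nu t + gcoef D fl phi0 phi nu t].

Let r0 := varrho ord0.
Let r00 : 0 < r0. Proof. exact: varrho_gt0. Qed.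
Let varrho_ge l : r0 <= varrho l. Proof. exact: varrho_homo. Qed.
Let e := eps ord0.
Let e_near : \forall t \near +oo, 0 < e t.
Proof. by apply/near_pinftyP; exists t0 => t; exact: e_gt0. Qed.
Let bO := bO e.
Let p_ l := pkl varrho rho k l.

Lemma mono_le_list : exists2 ML : seq (mono m.+1), uniq ML &
  forall nu, (nu \in ML) <-> (nu <> mset0 /\ rank varrho nu <= rho k).
Proof. exact: monos_list r00 varrho_ge _. Qed.

(** The double sum by ranks becomes one sum over a list. The case [j = 0] is set apart because
    [rho 0] carries no meaning. *)
Lemma psum_list ML j t : uniq ML -> (forall nu, (nu \in ML) <-> (nu <> mset0 /\ rank varrho nu <= rho k)) ->
  (j <= k)%N ->
  psum t0 eps phi0 varrho rho phi j t = phi0 t + \sum_(nu <- ML | rank varrho nu <= rho j) mval t0 eps nu t *: phi nu t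
  \/ j = 0%N.
Proof.
move=> MLu MLP jk; case: j jk => [|j] jk; [by right|left].
rewrite /psum; congr (_ + _).
transitivity (\sum_(1 <= s < j.+2) \sum_(nu <- ML | rank varrho nu == rho s) mval t0 eps nu t *: phi nu t).
  rewrite big_nat [in RHS]big_nat; apply: eq_bigr => s /andP[s1 sj].
  rewrite -[RHS]big_filter; apply: (fsum_seq (V := 'cV[R]_n)); first exact: filter_uniq.
    by move=> nu /=; rewrite mem_filter => /andP[/eqP <- /MLP[? _]].
  move=> nu [nu0 re]; rewrite mem_filter re eqxx /= => /negP[]; apply/MLP; split => //.
  by rewrite re; apply: (rho_le rhoP) => //; rewrite -ltnS (leq_trans sj).
under eq_bigr do rewrite big_mkcond.
rewrite exchange_big /= [in RHS]big_mkcond /= big_seq [in RHS]big_seq.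
apply: eq_bigr => nu /MLP[nu0 nuk].
have [s s1 re] := rank_rho rhoP nu0.
rewrite -re; case: ifP => sj.
  have sin : s \in index_iota 1 j.+2 by rewrite mem_index_iota s1 /= ltnS; exact: (rho_le_inv rhoP) sj.
  rewrite (bigD1_seq s sin (iota_uniq _ _)) /= eqxx big1_seq ?addr0// => s' /andP[ss'].
  rewrite mem_index_iota => /andP[s1' _]; case: eqP => // /(rho_inj rhoP s1 s1') es.
  by rewrite es eqxx in ss'.
rewrite big1_seq// => s' /andP[_]; rewrite mem_index_iota => /andP[s1' sj'].
case: eqP => // es; move: sj; rewrite es (rho_le rhoP)//.
Qed.

(** The order of a factor is at most [rho k - varrho l], and [pkl] exceeds the integer part of that
    number by one; hence one more derivative is available when the monomial is differentiated. *)
Lemma factor_lt nu (x : 'I_m.+1 * nat) : rank varrho nu <= rho k -> x \in nu -> (x.2 < p_ x.1)%N.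
Proof.
move=> nuk xnu; have := rank_factor r00 varrho_ge xnu => h.
have : x.2%:R <= rho k - varrho x.1.
  by move: (le_trans h nuk); rewrite /frank lerBrDl.
rewrite /p_ /pkl => h2.
have : (x.2 : int) <= Num.floor (rho k - varrho x.1) by rewrite floor_ge_int.
by move: (Num.floor _) => z; lia.
Qed.

Lemma eps_derive l r t : (r < p_ l)%N -> t0 < t -> is_derive t 1 (iter r (dI t0) (eps l)) (iter r.+1 (dI t0) (eps l) t).
Proof. by move=> rp tt; have [H _] := H1_smooth l; apply: dI_derive => //; apply: H => //; exact: ltW. Qed.

Lemma eps_contI l r : (r <= p_ l)%N -> contI t0 (iter r (dI t0) (eps l)).
Proof. by move=> rp; apply/withinP_contI; have [_] := H1_smooth l; apply. Qed.

Lemma eps_bO l r : (r <= p_ l)%N -> bO ((varrho l + r%:R) / r0) (iter r (dI t0) (eps l)).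
Proof.
move=> rp; have [M H] := H1_rank rp; exists M; near=> t.
have : `|iter r (dI t0) (eps l) t| <= M * `|eps ord0 t `^ ((varrho l + r%:R) / varrho ord0)| by near: t.
by rewrite (ger0_norm (powR_ge0 _ _)).
Unshelve. all: by end_near. Qed.

Lemma mval_bO nu : (forall x, x \in nu -> (x.2 <= p_ x.1)%N) -> bO (rank varrho nu / r0) (mval t0 eps nu).
Proof.
move=> H; have {}H : forall x, x \in enum_mset nu -> (x.2 <= p_ x.1)%N by move=> x; rewrite -[x \in _]/(x \in nu); exact: H.
rewrite /mval /rank; elim: (enum_mset nu) H => [|x s IH] H.
  rewrite big_nil mul0r; apply: bO_bounded; exists 1; near=> t; by rewrite big_nil normr1.
rewrite big_cons mulrDl.
apply: bO_ext (bOZ e_near (eps_bO (H x (mem_head _ _))) (IH (fun y ys => H y (mem_behead (s := x :: s) ys)))) _.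
by near=> t; rewrite big_cons.
Unshelve. all: by end_near. Qed.

Definition mshift (nu : mono m.+1) (x : 'I_m.+1 * nat) : mono m.+1 :=
  msetD (msetB nu (msetn 1 x)) (msetn 1 (x.1, x.2.+1)).

Definition dmval (nu : mono m.+1) t := \sum_(x <- enum_mset nu) mval t0 eps (mshift nu x) t.

Lemma mval_derive nu t : rank varrho nu <= rho k -> t0 < t -> is_derive t 1 (mval t0 eps nu) (dmval nu t).
Proof.
move=> nuk tt; apply: is_derive_eq (der_prod _) _.
  by move=> x xnu; apply: eps_derive => //; exact: factor_lt nuk xnu.
rewrite /dmval big_seq [in RHS]big_seq; apply: eq_bigr => x xnu.
rewrite mvalD mval1 /=; congr (_ * _); rewrite /mval; apply: perm_big.
rewrite -(perm_cons x) perm_sym (perm_trans _ (perm_to_rem xnu))//.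
rewrite [in X in perm_eq _ X](msetB1_D xnu) perm_sym.
by apply: perm_trans (enum_msetD_perm _ _) _; rewrite enum_msetn /=.
Qed.

Lemma mval_contI nu : (forall x, x \in nu -> (x.2 <= p_ x.1)%N) -> contI t0 (mval t0 eps nu).
Proof.
move=> H; have {}H : forall x, x \in enum_mset nu -> (x.2 <= p_ x.1)%N by move=> x; rewrite -[x \in _]/(x \in nu); exact: H.
by rewrite /mval; apply: contI_prod => x xnu; apply: eps_contI; exact: H.
Qed.

Lemma mshift_factor nu x : rank varrho nu <= rho k -> x \in nu ->
  forall y, y \in mshift nu x -> (y.2 <= p_ y.1)%N.
Proof.
move=> nuk xnu y; rewrite in_msetD in_msetn => /orP[|/andP[_ /eqP ->]] /=; last exact: factor_lt nuk xnu.
move=> yB; apply/ltnW/(factor_lt nuk); rewrite (msetB1_D xnu) in_msetD yB orbT //.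
Qed.


Variable ML : seq (mono m.+1).
Hypothesis MLu : uniq ML.
Hypothesis MLP : forall nu, (nu \in ML) <-> (nu <> mset0 /\ rank varrho nu <= rho k).

Let s := psum t0 eps phi0 varrho rho phi k.

Lemma psum_full t : s t = phi0 t + \sum_(nu <- ML) mval t0 eps nu t *: phi nu t.
Proof.
rewrite /s; have [->|k0] := psum_list t MLu MLP (leqnn k); last by move: k_gt0; rewrite k0.
congr (_ + _); rewrite big_seq_cond [RHS]big_seq; apply: eq_bigl => nu.
by case: (boolP (nu \in ML)) => //= /MLP[_ ->].
Qed.

Definition dpsum t := dI t0 phi0 t + \sum_(nu <- ML) (dmval nu t *: phi nu t + mval t0 eps nu t *: dI t0 (phi nu) t).

Lemma CI1_derive (g : R -> 'cV[R]_n) t i : CI t0 1 g -> t0 < t -> is_derive t 1 (fun u => g u i 0) (dI t0 g t i 0).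
Proof. by move=> [H _] tt; apply: dI_derive_mx => //; apply: (H 0%N) => //; exact: ltW. Qed.

Lemma psum_derive t i : t0 < t -> is_derive t 1 (fun u => s u i 0) (dpsum t i 0).
Proof.
move=> tt.
have h nu : nu \in ML -> is_derive t 1 (fun u => mval t0 eps nu u * phi nu u i 0)
    ((dmval nu t *: phi nu t + mval t0 eps nu t *: dI t0 (phi nu) t) i 0).
  move=> /MLP[nu0 nuk]; have [C _ _] := phiC nu0 nuk.
  by apply: is_derive_eq (derM (mval_derive nuk tt) (CI1_derive i C tt)) _; rewrite !mxE.
have h2 : is_derive t 1 (fun u => \sum_(nu <- ML) (if nu \in ML then mval t0 eps nu u * phi nu u i 0 else 0))
    (\sum_(nu <- ML) (if nu \in ML then (dmval nu t *: phi nu t + mval t0 eps nu t *: dI t0 (phi nu) t) i 0 else 0)).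
  by apply: der_sum => nu _; case: ifP => [/h//|_]; exact: derc.
apply: is_derive_eq (der_ext _ (derD (CI1_derive i phi0C tt) h2)) _.
  move=> u; rewrite psum_full mxE summxE; congr (_ + _).
  by rewrite big_seq [RHS]big_seq; apply: eq_bigr => nu ->; rewrite mxE.
rewrite mxE summxE; congr (_ + _); rewrite big_seq [RHS]big_seq.
by apply: eq_bigr => nu ->.
Qed.

Lemma CI1_contI (g : R -> 'cV[R]_n) : CI t0 1 g -> contI t0 g /\ contI t0 (dI t0 g).
Proof. by move=> [_ H]; split; apply/withinP_contI; [exact: (H 0%N)|exact: (H 1%N)]. Qed.

Lemma dmval_contI nu : rank varrho nu <= rho k -> contI t0 (dmval nu).
Proof.
move=> nuk; rewrite /dmval.
have -> : (fun t => \sum_(x <- enum_mset nu) mval t0 eps (mshift nu x) t) =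
    (fun t => \sum_(x <- enum_mset nu) (if x \in nu then mval t0 eps (mshift nu x) t else 0)).
  by apply/funext => t; rewrite big_seq [RHS]big_seq; apply: eq_bigr => x xnu; rewrite ifT.
apply: contI_sum => x _; case: (boolP (x \in nu)) => [xnu|_]; last exact: contIc.
by apply: mval_contI; exact: mshift_factor.
Qed.

Lemma contI_mxsum (I : Type) (r : seq I) p q (F : I -> R -> 'M[R]_(p, q)) :
  (forall i, List.In i r -> contI t0 (F i)) -> contI t0 (fun t => \sum_(i <- r) F i t).
Proof.
elim: r => [|x r IH] H.
  have -> : (fun t => \sum_(i <- [::]) F i t) = (fun=> 0) by apply/funext => t; rewrite big_nil.
  exact: contIc.
have -> : (fun t => \sum_(i <- x :: r) F i t) = (fun t => F x t + \sum_(i <- r) F i t).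
  by apply/funext => t; rewrite big_cons.
by apply: contI_mxD; [exact: H (or_introl erefl)|apply: IH => i ir; exact: H (or_intror ir)].
Qed.

Lemma ML_factor (nu : mono m.+1) : nu \in ML -> forall x, x \in nu -> (x.2 <= p_ x.1)%N.
Proof. by move=> /MLP[_ nuk] x xnu; apply: ltnW; exact: factor_lt nuk xnu. Qed.

Lemma psum_contI : contI t0 s.
Proof.
have -> : s = (fun t => phi0 t + \sum_(nu <- ML) mval t0 eps nu t *: phi nu t) by apply/funext => t; exact: psum_full.
apply: contI_mxD; first by have [] := CI1_contI phi0C.
apply: contI_mxsum => nu /In_mem nuM; have [nu0 nuk] := (MLP nu).1 nuM; have [C _ _] := phiC nu0 nuk.
apply: contI_mxZ; [exact: mval_contI (ML_factor nuM)|by have [] := CI1_contI C].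
Qed.

Lemma dpsum_contI : contI t0 dpsum.
Proof.
apply: contI_mxD; first by have [] := CI1_contI phi0C.
apply: contI_mxsum => nu /In_mem nuM; have [nu0 nuk] := (MLP nu).1 nuM; have [C _ _] := phiC nu0 nuk.
have [C0 C1] := CI1_contI C.
apply: contI_mxD; apply: contI_mxZ => //; [exact: dmval_contI|exact: mval_contI (ML_factor nuM)].
Qed.

Lemma phi_bounded nu : nu \in ML -> exists M, forall t, t0 <= t -> `|phi nu t| <= M.
Proof.
move=> /MLP[nu0 nuk]; have [_ H _] := phiC nu0 nuk.
have [M HM] := choice H; exists (\sum_i `|M i|) => t tt.
apply: mx_norm_leP => [|i j]; first by rewrite sumr_ge0.
rewrite (ord1 j); apply: le_trans (HM i t tt) _; apply: le_trans (ler_norm _) _.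
by rewrite (bigD1 i)//= lerDl sumr_ge0.
Qed.

Lemma bounded_near (V : normedModType R) (g : R -> V) : (exists M, forall t, t0 <= t -> `|g t| <= M) ->
  exists M, \forall t \near +oo, `|g t| <= M.
Proof. by move=> [M H]; exists M; apply/near_pinftyP; exists t0. Qed.

Lemma psum_sub_phi0 : bO 1 (fun t => s t - phi0 t).
Proof.
apply: (@bO_ext _ _ _ _ (fun t => \sum_(nu <- ML) mval t0 eps nu t *: phi nu t)); last first.
  by near=> t; rewrite psum_full addrAC subrr add0r.
apply: bO_sum => nu /In_mem nuM _; have [nu0 nuk] := (MLP nu).1 nuM.
apply: bO_bZ; [exact: e_near| |exact/bounded_near/phi_bounded].
apply: bO_le (mval_bO (ML_factor nuM)); [exact: e_near|exact: e_cvg0|].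
by rewrite ler_pdivlMr// mul1r; exact: rank_gt0 r00 varrho_ge _ nu0.
Unshelve. all: by end_near. Qed.

Lemma psum_box : \forall t \near +oo, box (phi0 t) a (s t).
Proof.
have /cvgrPdist_lt/(_ a a0) := bO_cvg0 e_near e_cvg0 ltr01 psum_sub_phi0.
by apply: filterS => t; rewrite sub0r normrN.
Qed.

Lemma psum_truncate k0 : (0 < k0 < k)%N ->
  bO (rho k0.+1 / r0) (fun t => s t - psum t0 eps phi0 varrho rho phi k0 t).
Proof.
move=> /andP[k00 k0k].
apply: (@bO_ext _ _ _ _ (fun t => \sum_(nu <- ML | ~~ (rank varrho nu <= rho k0)) mval t0 eps nu t *: phi nu t)); last first.
  near=> t; have [->|k0'] := psum_list t MLu MLP (ltnW k0k); last by move: k00; rewrite k0'.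
  by rewrite psum_full [X in _ = _ + X - _](bigID (fun nu => rank varrho nu <= rho k0)) /= opprD addrACA subrr add0r addrAC subrr add0r.
apply: bO_sum => nu /In_mem nuM; rewrite -ltNge => nuk0; have [nu0 nuk] := (MLP nu).1 nuM.
apply: bO_bZ; [exact: e_near| |exact/bounded_near/phi_bounded].
apply: bO_le (mval_bO (ML_factor nuM)); [exact: e_near|exact: e_cvg0|].
by rewrite ler_pM2r ?invr_gt0//; exact: (rank_gap rhoP).
Unshelve. all: by end_near. Qed.

(** The order up to which [f_l] is expanded. When [varrho l] exceeds [rho k] the integer [qkl] is
    negative, and order 0 already suffices. *)
Definition torder l : nat := if varrho l <= rho k then absz (qkl varrho rho k l) else 0%N.

Lemma torder_room l : rho k < varrho l + (torder l).+1%:R * r0.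
Proof.
rewrite /torder; case: ifPn => [h|]; last first.
  by rewrite -ltNge mul1r => h; apply: lt_trans h _; rewrite ltrDl.
have f0 : 0 <= qkl varrho rho k l by rewrite /qkl floor_ge0 divr_ge0 ?subr_ge0// ltW.
rewrite -ltrBlDl -ltr_pdivrMr//; apply: lt_le_trans (floorD1_gt _) _.
by rewrite -/(qkl varrho rho k l) -addn1 natrD -{1}(gez0_abs f0) intrD.
Qed.

Lemma torder_lt l : (torder l < smoothness varrho rho k l)%N.
Proof.
rewrite /torder /smoothness; case: ifPn => [h|_]; last by move: (qkl _ _ _ _) => z; lia.
have f0 : 0 <= qkl varrho rho k l by rewrite /qkl floor_ge0 divr_ge0 ?subr_ge0// ltW.
by move: (qkl _ _ _ _) f0 => z; lia.
Qed.

(** The rank of eps_l eps_1^j. It allows [rank_gap] to be applied to the exponent of a Taylor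
    remainder. *)
Lemma rank_exists l j : exists2 nu : mono m.+1, nu <> mset0 & rank varrho nu = varrho l + j%:R * r0.
Proof.
elim: j => [|j [nu nu0 H]].
  by exists (msetn 1 (l, 0%N)); [exact: msetn1_neq0|rewrite rank1 /frank /= mul0r].
exists (msetD (msetn 1 (ord0, 0%N)) nu); first by move=> /msetD_eq0[_].
by rewrite rankD rank1 H /frank /= -natr1 /r0; ring.
Qed.

Definition good (p : (R -> R) * mono m.+1) := (exists M, forall t, t0 <= t -> `|p.1 t| <= M) /\
  forall x, x \in p.2 -> (x.2 <= p_ x.1)%N.

Lemma goodM q q' : good q -> good q' -> good (fun t => q.1 t * q'.1 t, msetD q.2 q'.2).
Proof.
move=> [[M HM] H] [[M' HM'] H']; split.
  by exists (M * M') => t tt; rewrite normrM; apply: ler_pM => //; [exact: HM|exact: HM'].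
by move=> x; rewrite in_msetD => /orP[/H|/H'].
Qed.

Lemma good1 x : (x.2 <= p_ x.1)%N -> good (fun=> 1, msetn 1 x).
Proof.
move=> h; split; first by exists 1 => t _; rewrite normr1.
by move=> y; rewrite in_msetn => /andP[_ /eqP ->].
Qed.

Lemma vterm_good l w p : List.In p (vterm ML phi l w) -> good p.
Proof.
apply: lmul_In => q q' [<-|//] H'; apply: goodM; first exact: good1.
move: q' H'; apply: powL_In; first by split; [by exists 1 => t _; rewrite normr1|move=> x; rewrite in_mset0].
- exact: goodM.
move=> b j bM; split; last exact: ML_factor.
have [M HM] := phi_bounded bM; exists M => t tt; exact: le_trans (mx_norm_entry _ _ _) (HM t tt).
Qed.

Lemma term_bO p : good p -> p.2 <> mset0 -> p.2 \notin ML -> bO (rho k.+1 / r0) (fun t => p.1 t * mval t0 eps p.2 t).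
Proof.
move=> [pb pf] p0 pML.
have pk : rho k < rank varrho p.2.
  by rewrite ltNge; apply: contra pML => h; apply/MLP.
apply: (bO_Zb e_near) => //; first exact/bounded_near.
apply: bO_le (mval_bO pf); [exact: e_near|exact: e_cvg0|].
by rewrite ler_pM2r ?invr_gt0//; exact: (rank_gap rhoP).
Qed.

Lemma delta_sum (x : mono m.+1) (F : mono m.+1 -> R) : \sum_(nu <- ML) F nu * (x == nu)%:R = if x \in ML then F x else 0.
Proof.
case: ifPn => xM.
  rewrite (bigD1_seq x xM MLu) /= eqxx mulr1 big1 ?addr0// => nu; rewrite eq_sym => /negbTE ->.
  by rewrite mulr0.
by rewrite big1_seq// => nu /andP[_ nuM]; case: eqP => [e1|]; [rewrite e1 nuM in xM|rewrite mulr0].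
Qed.

(** The terms whose monomials lie outside [ML], that is, beyond rank [rho k] unless the monomial is
    trivial. *)
Definition outer (L : terms R m.+1) t := \sum_(p <- L | p.2 \notin ML) p.1 t * mval t0 eps p.2 t.

Lemma outerE L t : ev t0 eps L t - outer L t = \sum_(nu <- ML) mval t0 eps nu t * lrep L t nu.
Proof.
transitivity (\sum_(p <- L) p.1 t * \sum_(nu <- ML) mval t0 eps nu t * (p.2 == nu)%:R); last first.
  under eq_bigr do rewrite mulr_sumr.
  rewrite exchange_big /=; apply: eq_bigr => nu _; rewrite /lrep mulr_sumr.
  by apply: eq_bigr => p _; rewrite mulrCA.
under eq_bigr do rewrite delta_sum.
rewrite /ev /outer (bigID (fun p => p.2 \notin ML)) /= addrAC subrr add0r big_mkcond /=.
by apply: eq_bigr => p _; rewrite negbK; case: ifP => //; rewrite mulr0.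
Qed.

Lemma outer_bO l w : bO (rho k.+1 / r0) (outer (vterm ML phi l w)).
Proof.
apply: bO_sum => p pL pM; apply: term_bO => //; first exact: vterm_good pL.
move=> p0; have := vterm_rank r00 varrho_ge (fun b hb => ((MLP b).1 hb).1) pL.
rewrite p0 rank0 leNgt => /negP; apply.
by rewrite ltr_wpDr ?mulr_ge0// ltW.
Qed.

Lemma eps_hpow l w t : eps l t * hpow (s t - phi0 t) w = (mfact w)%:R^-1 * ev t0 eps (vterm ML phi l w) t.
Proof.
rewrite /vterm ev_mul ev_powL.
have -> : ev t0 eps (xvar R l) t = eps l t by rewrite /ev /xvar big_seq1 /= mval1 /= mul1r.
rewrite mulrCA; congr (_ * _); rewrite /hpow prodf_div mulrC /mfact natr_prod; congr (_ * _).
apply: eq_bigr => j _; congr (_ ^+ _).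
rewrite psum_full addrAC subrr add0r summxE /ev /dL big_map; apply: eq_bigr => nu _.
by rewrite mxE mulrC.
Qed.


Definition resid t := - dpsum t + rhs A f eps fl t (s t).

Definition shift_rest t := \sum_(b <- ML) \sum_(x <- enum_mset b | mshift b x \notin ML) mval t0 eps (mshift b x) t *: phi b t.

Definition taylor_rest l t := fl l (t, s t) -
  \sum_(w <- wlist (enum 'I_n) (torder l)) hpow (s t - phi0 t) w *: pderm D w (fl l) (t, phi0 t).

Definition outer_rest l t := \sum_(w <- wlist (enum 'I_n) (torder l))
  ((mfact w)%:R^-1 * outer (vterm ML phi l w) t) *: pderm D w (fl l) (t, phi0 t).

(** The equations of the coefficients cancel every term whose monomial is in [ML]. Left over are the
    derivatives of monomials that leave [ML], the Taylor remainders of the [f_l], and the products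
    in the Taylor polynomials that leave [ML]. *)
Lemma residE t : t0 <= t -> resid t = - shift_rest t + \sum_(l < m.+1) (eps l t *: taylor_rest l t + outer_rest l t).
Proof.
move=> tt.
have gE nu : nu \in ML -> mval t0 eps nu t *: dI t0 (phi nu) t = A *m (mval t0 eps nu t *: phi nu t) +
   (- (\sum_(b <- ML) (mval t0 eps nu t * @fder R m.+1 b nu) *: phi b t) +
   \sum_(l < m.+1) \sum_(w <- wlist (enum 'I_n) (torder l))
     ((mfact w)%:R^-1 * (mval t0 eps nu t * lrep (vterm ML phi l w) t nu)) *: pderm D w (fl l) (t, phi0 t)).
  move=> nuM; have [nu0 nuk] := (MLP nu).1 nuM; have [_ _ /(_ t tt) ->] := phiC nu0 nuk.
  rewrite (gcoef_rep r00 varrho_ge (X := rho k) D fl phi0 phi (q := torder) t MLu MLP nu0).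
  - rewrite scalerDr scalemxAr scalerDr scalerN !scaler_sumr; congr (_ + (- _ + _)).
      by apply: eq_bigr => b _; rewrite scalerA.
    apply: eq_bigr => l _; rewrite scaler_sumr; apply: eq_bigr => w _.
    by rewrite scalerA mulrCA.
  - by lra.
  - by move: r00; lra.
  - by move=> l; apply: le_lt_trans nuk (torder_room l).
have sE : \sum_(nu <- ML) mval t0 eps nu t *: dI t0 (phi nu) t = A *m (s t - phi0 t) +
   (- (\sum_(b <- ML) \sum_(x <- enum_mset b | mshift b x \in ML) mval t0 eps (mshift b x) t *: phi b t) +
   \sum_(l < m.+1) \sum_(w <- wlist (enum 'I_n) (torder l))
     ((mfact w)%:R^-1 * (ev t0 eps (vterm ML phi l w) t - outer (vterm ML phi l w) t)) *: pderm D w (fl l) (t, phi0 t)).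
  rewrite (eq_big_seq _ gE) big_split /=; congr (_ + _).
    by rewrite psum_full addrAC subrr add0r mulmx_sumr.
  rewrite big_split /= sumrN; congr (- _ + _).
    rewrite exchange_big /=; apply: eq_bigr => b _; rewrite -!scaler_suml; congr (_ *: _).
    under eq_bigr do rewrite /fder mulr_sumr.
    rewrite exchange_big /= [RHS]big_mkcond /=; apply: eq_bigr => x _.
    by rewrite -(delta_sum (mshift b x) (fun nu => mval t0 eps nu t)); apply: eq_bigr => nu _; rewrite eq_sym.
  rewrite exchange_big /=; apply: eq_bigr => l _; rewrite exchange_big /=; apply: eq_bigr => w _.
  by rewrite -scaler_suml -mulr_sumr outerE.
have dE : dpsum t = A *m s t + f t + (\sum_(b <- ML) \sum_(x <- enum_mset b) mval t0 eps (mshift b x) t *: phi b t)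
   + (- (\sum_(b <- ML) \sum_(x <- enum_mset b | mshift b x \in ML) mval t0 eps (mshift b x) t *: phi b t) +
   \sum_(l < m.+1) \sum_(w <- wlist (enum 'I_n) (torder l))
     ((mfact w)%:R^-1 * (ev t0 eps (vterm ML phi l w) t - outer (vterm ML phi l w) t)) *: pderm D w (fl l) (t, phi0 t)).
  rewrite /dpsum big_split /= sE (phi0E tt) mulmxBr.
  have -> : \sum_(nu <- ML) dmval nu t *: phi nu t = \sum_(b <- ML) \sum_(x <- enum_mset b) mval t0 eps (mshift b x) t *: phi b t.
    by apply: eq_bigr => b _; rewrite scaler_suml.
  rewrite !addrA; congr (_ + _); congr (_ + _).
  by rewrite (addrC (A *m phi0 t + f t + _)) !addrA; apply/matrixP => i j; rewrite !mxE; ring.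
have shE : shift_rest t = \sum_(b <- ML) \sum_(x <- enum_mset b) mval t0 eps (mshift b x) t *: phi b t -
   \sum_(b <- ML) \sum_(x <- enum_mset b | mshift b x \in ML) mval t0 eps (mshift b x) t *: phi b t.
  rewrite -sumrB; apply: eq_bigr => b _.
  by rewrite [X in _ = X - _](bigID (fun x => mshift b x \in ML)) /= addrAC subrr add0r.
have tE : \sum_(l < m.+1) (eps l t *: taylor_rest l t + outer_rest l t) =
   \sum_(l < m.+1) eps l t *: fl l (t, s t) - \sum_(l < m.+1) \sum_(w <- wlist (enum 'I_n) (torder l))
     ((mfact w)%:R^-1 * (ev t0 eps (vterm ML phi l w) t - outer (vterm ML phi l w) t)) *: pderm D w (fl l) (t, phi0 t).
  rewrite -sumrB; apply: eq_bigr => l _; rewrite /taylor_rest /outer_rest scalerBr scaler_sumr -addrA; congr (_ + _).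
  rewrite -sumrN -big_split /= -sumrN; apply: eq_bigr => w _.
  by rewrite scalerA eps_hpow; apply/matrixP => i j; rewrite !mxE; ring.
rewrite /resid dE shE tE /rhs.
by apply/matrixP => i j; rewrite !mxE; ring.
Qed.

Lemma resid_bO : bO (rho k.+1 / r0) resid.
Proof.
apply: (@bO_ext _ _ _ _ (fun t => - shift_rest t + \sum_(l < m.+1) (eps l t *: taylor_rest l t + outer_rest l t))); last first.
  by apply/near_pinftyP; exists t0 => t tt; rewrite residE.
apply: bOD.
  apply: bON; apply: bO_sum => b /In_mem bM _; apply: bO_sum => x /In_mem xb xM.
  have [b0 bk] := (MLP b).1 bM; apply: bO_bZ; [exact: e_near| |exact/bounded_near/phi_bounded].
  apply: bO_le (mval_bO (mshift_factor bk xb)); [exact: e_near|exact: e_cvg0|].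
  have m0 : mshift b x <> mset0 by move=> /msetD_eq0[_]; exact: msetn1_neq0.
  rewrite ler_pM2r ?invr_gt0//; apply: (rank_gap rhoP) => //.
  by rewrite ltNge; apply: contra xM => h; apply/MLP.
apply: bO_sum => l _ _; apply: bOD; last first.
  apply: bO_sum => w /In_mem wL _; apply: bO_bZ; first exact: e_near.
    by apply: (@bO_Zb _ _ e_near R^o _ (fun=> (mfact w)%:R^-1)); [exists `|(mfact w)%:R^-1|; near=> t|exact: outer_bO].
  apply: bounded_near; have wq : (mabs w <= torder l)%N.
    by move: wL; rewrite wlist_mem ?enum_uniq// => /andP[].
  have [M HM] := H3 (ltnW (leq_ltn_trans wq (torder_lt l))).
  by exists M => t tt; apply: HM; split => //=; rewrite subrr normr0 ltW.
(* The remainder multiplied by eps_l is O(e^(varrho_l/varrho_1 + q + 1)) with q the Taylor order;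
   that exponent times varrho_1 is a rank above [rho k], hence at least [rho k.+1]. *)
have [nu nu0 nuE] := rank_exists l (torder l).+1.
have nuk : rho k.+1 <= varrho l + (torder l).+1%:R * r0.
  by rewrite -nuE; apply: (rank_gap rhoP) => //; rewrite nuE; exact: torder_room.
apply: (@bO_le _ _ e_near e_cvg0 _ (varrho l / r0 + (torder l).+1%:R)).
  by rewrite ler_pdivrMr// mulrDl divfK ?gt_eqF.
apply: (bOZ e_near).
  have := @eps_bO l 0 (leq0n _); rewrite addr0; exact.
have [B B0 HB] := pders_estimates a0 (H2 l) (@H3 l).
have [M M0 HM] := bO_pos psum_sub_phi0.
exists (B * M ^+ (torder l).+1); near=> t.
have tt : t0 <= t by near: t; apply/near_pinftyP; exists t0.
have sb : box (phi0 t) a (s t) by near: t; exact: psum_box.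
have pb : box (phi0 t) a (phi0 t) by rewrite /box subrr normr0.
have h : `|s t - phi0 t| <= M * e t `^ 1 by near: t.
have [_ _ _ T] := HB t tt.
have := T (phi0 t) (s t) [::] (torder l) _ pb sb; rewrite addn0 => /(_ (torder_lt l)) T'.
have -> : taylor_rest l t = pders D [::] (fl l) (t, s t) - \sum_(w <- wlist (enum 'I_n) (torder l))
   hpow (s t - phi0 t) w *: pders D (flatw (enum 'I_n) w ++ [::]) (fl l) (t, phi0 t).
  by congr (_ - _); apply: eq_bigr => w _; rewrite cats0.
apply: (le_trans T'); rewrite -mulrA ler_wpM2l// powR_mulrn; last by rewrite ltW// e_gt0.
rewrite -exprMn ler_pXn2r ?nnegrE ?mulr_ge0//; last by rewrite ltW// e_gt0.
by move: h; rewrite powRr1// ltW// e_gt0.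
Unshelve. all: by end_near. Qed.

End Residual.

(** * Solutions near the partial sum *)

Lemma remainder_algebra (R : comNzRingType) (n : nat) (J0 J1 : 'M[R]_n) (h h' F0 F1 F2 : 'cV[R]_n) :
  F2 - F0 - J0 *m h' - (F1 - F0 - J0 *m h) - (J1 - J0) *m (h' - h) = F2 - F1 - J1 *m (h' - h).
Proof.
rewrite mulmxBl (mulmxBr J0); move: (J0 *m h') (J0 *m h) (J1 *m _) => X Y Z.
by apply/matrixP => i j; rewrite !mxE; ring.
Qed.

Lemma variation_algebra (R : fieldType) (V : lmodType R) (th : R) (X Y Z P G : V) : th != 0 ->
  th *: (X - (Y + Z) + (Y - P + (Z + th^-1 *: G))) = th *: (X - P) + G.
Proof.
move=> th0; rewrite -{2}[G]scale1r -(divff th0) -scalerA -scalerDr; congr (_ *: _).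
by rewrite (addrACA Y) (addrA (X - (Y + Z))) subrK addrA.
Qed.

Lemma L1domZ (R : realType) (c : R) g : L1dom g -> L1dom (fun t => c * g t).
Proof. by move=> gL; apply: (L1dom_Mb (C := `|c|)) => //; exists 0. Qed.

Section Perturbation.
Variables (R : realType) (n m d : nat) (t0 : R) (A : 'M[R]_n) (f phi0 : R -> 'cV[R]_n) (a : R).
Variables (eps : 'I_m.+1 -> R -> R) (fl : 'I_m.+1 -> R * 'cV[R]_n -> 'cV[R]_n) (q : 'I_m.+1 -> nat).
Let D := cylinder t0 phi0 a.
Let e := eps ord0.
Variables (s ds : R -> 'cV[R]_n) (de : R -> R) (kappa varpi : R).
Hypothesis a0 : 0 < a.
Hypothesis flC : forall l, C0y D (q l) (fl l).
Hypothesis q2 : forall l, (2 <= q l)%N.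
Hypothesis flB : forall l (w : mindex n), (mabs w <= q l)%N -> exists M : R, forall p, D p -> `|pderm D w (fl l) p| <= M.
Hypothesis e_gt0 : forall t, t0 <= t -> 0 < e t.
Hypothesis e_cvg0 : e t @[t --> +oo] --> 0.
Hypothesis e_der : forall t, t0 < t -> is_derive t 1 e (de t).
Hypothesis eps_cont : forall l, contI t0 (eps l).
Hypothesis eps_bO1 : forall l, bO e 1 (eps l).
Hypothesis f_cont : contI t0 f.
Hypothesis s_cont : contI t0 s.
Hypothesis ds_cont : contI t0 ds.
Hypothesis s_der : forall t i, t0 < t -> is_derive t 1 (fun u => s u i 0) (ds t i 0).
Hypothesis s_box : \forall t \near +oo, box (phi0 t) a (s t).
Hypothesis s_phi0 : bO e 1 (fun t => s t - phi0 t).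
Hypothesis kappa0 : 0 < kappa.
Hypothesis varpi_kappa : varpi <= 1 + kappa.
Let g t := - ds t + rhs A f eps fl t (s t).
Hypothesis g_bO : bO e (kappa + varpi) g.
Hypothesis e_L1 : L1dom (fun t => e t `^ varpi).

Definition jac l t y : 'M[R]_n := \matrix_(i, j) pder D j (fl l) (t, y) i 0.
Definition rem2 t h := \sum_(l < m.+1) eps l t *: (fl l (t, s t + h) - fl l (t, s t) - jac l t (s t) *m h).
Definition drem2 t h := \sum_(l < m.+1) eps l t *: (jac l t (s t + h) - jac l t (s t)).

Lemma rem2_0 t : rem2 t 0 = 0.
Proof. by rewrite /rem2 big1// => l _; rewrite addr0 subrr mulmx0 subr0 scaler0. Qed.
Let e_near : \forall t \near +oo, 0 < e t.
Proof. by apply/near_pinftyP; exists t0 => t; exact: e_gt0. Qed.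

(** [drem2] is the Jacobian of [rem2] in [h] and vanishes at [h = 0]. Two bounded derivatives of the
    [f_l] give the powers of [h], and the factors eps_l = O(e) give [e t]. *)
Lemma rem2_estimates : exists2 K, 0 <= K & \forall t \near +oo, forall h h' v : 'cV[R]_n,
  box (phi0 t) a (s t + h) -> box (phi0 t) a (s t + h') ->
  `|rem2 t h' - rem2 t h - drem2 t h *m (h' - h)| <= K * e t * `|h' - h| ^+ 2 /\
  `|drem2 t h *m v| <= K * e t * `|h| * `|v|.
Proof.
have /choice[B HB] : forall l, exists B, 0 <= B /\ forall t, t0 <= t -> forall y y', box (phi0 t) a y -> box (phi0 t) a y' ->
    `|fl l (t, y') - fl l (t, y) - jac l t y *m (y' - y)| <= B * `|y' - y| ^+ 2 /\
    `|jac l t y' - jac l t y| <= B * `|y' - y|.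
  move=> l; have [B B0 HB] := pders_estimates a0 (flC l) (fun w => @flB l w).
  exists B; split => // t tt y y' yb yb'; have [_ L Q _] := HB t tt; split.
    have := Q y y' [::] (q2 l) yb yb'; congr (`|_ - _| <= _).
    apply/matrixP => i j; rewrite (ord1 j) summxE mxE; apply: eq_bigr => k _.
    by rewrite !mxE mulrC.
  apply: mx_norm_leP => [|i j]; first by rewrite mulr_ge0.
  have := L y y' [:: j] (q2 l) yb yb'; apply: le_trans.
  by rewrite !mxE; apply: le_trans (mx_norm_entry (_ - _) i 0); rewrite !mxE.
have /choice[M HM] : forall l, exists M, 0 <= M /\ \forall t \near +oo, `|eps l t| <= M * e t.
  move=> l; have [M M0 H] := bO_pos (eps_bO1 l); exists M; split => //; near=> t.
  have -> : e t = e t `^ 1 by rewrite powRr1// ltW//; near: t.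
  by near: t.
have {}HM' : \forall t \near +oo, forall l, `|eps l t| <= M l * e t.
  by apply: filter_forall => l; have [] := HM l.
exists (\sum_l M l * (B l * (1 + n%:R))).
  apply: sumr_ge0 => l _; have [? _] := HM l; have [? _] := HB l.
  by rewrite !mulr_ge0// addr_ge0.
near=> t => h h' v hb hb'.
have tt : t0 <= t by near: t; apply/near_pinftyP; exists t0.
have sb : box (phi0 t) a (s t) by near: t.
have et : 0 < e t by near: t.
have em l : `|eps l t| <= M l * e t by move: l; near: t.
split.
  have -> : rem2 t h' - rem2 t h - drem2 t h *m (h' - h) = \sum_(l < m.+1) eps l t *:
     (fl l (t, s t + h') - fl l (t, s t + h) - jac l t (s t + h) *m (s t + h' - (s t + h))).
    rewrite mulmx_suml -!sumrB; apply: eq_bigr => l _.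
    have -> : s t + h' - (s t + h) = h' - h by rewrite opprD addrACA subrr add0r.
    rewrite -scalemxAl -!scalerBr; congr (_ *: _).
    exact: remainder_algebra.
  apply: (le_trans (ler_norm_sum _ _ _)); rewrite !mulr_suml; apply: ler_sum => l _; rewrite normrZ.
  have [Bl0 /(_ t tt _ _ hb hb')[H _]] := HB l; have [M0 _] := HM l.
  have hh : s t + h' - (s t + h) = h' - h by rewrite opprD addrACA subrr add0r.
  rewrite hh in H *.
  apply: (@le_trans _ _ (M l * e t * (B l * `|h' - h| ^+ 2))); first by apply: ler_pM => //; exact: em.
  have -> : M l * (B l * (1 + n%:R)) * e t * `|h' - h| ^+ 2 = M l * e t * (B l * `|h' - h| ^+ 2) * (1 + n%:R) by ring.
  by rewrite ler_peMr ?lerDl// !mulr_ge0// ?exprn_ge0// ltW.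
rewrite mulmx_suml; apply: (le_trans (ler_norm_sum _ _ _)); rewrite !mulr_suml; apply: ler_sum => l _.
rewrite -scalemxAl normrZ.
have [Bl0 /(_ t tt _ _ sb hb)[_ H]] := HB l; have [M0 _] := HM l.
have hh : s t + h - s t = h by rewrite addrAC subrr add0r.
rewrite hh in H.
apply: (@le_trans _ _ (M l * e t * (n%:R * (B l * `|h|) * `|v|))).
  apply: ler_pM; [exact: normr_ge0|exact: normr_ge0|exact: em|].
  by apply: (le_trans (mx_norm_mul _ _)); rewrite ler_wpM2r// ler_wpM2l.
have -> : M l * e t * (n%:R * (B l * `|h|) * `|v|) = M l * e t * (B l * `|h| * `|v|) * n%:R by ring.
have -> : M l * (B l * (1 + n%:R)) * e t * `|h| * `|v| = M l * e t * (B l * `|h| * `|v|) * (1 + n%:R) by ring.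
by rewrite ler_wpM2l ?lerDr// !mulr_ge0// ltW.
Unshelve. all: by end_near. Qed.

Variables (tS : R) (S : R -> 'M[R]_(n, d)) (W : R -> 'M[R]_(d, n)) (p0 : 'I_d -> R -> R) (E : R -> 'M[R]_d).
Hypothesis tS0 : t0 < tS.
Hypothesis SW : forall t, tS <= t -> S t *m W t = 1%:M.
Hypothesis S_der : forall t i j, tS <= t -> is_derive t 1 (fun u => S u i j)
  ((Ahat A D eps fl s t *m S t - S t *m (diag_mx (\row_k p0 k t) + E t)) i j).
Hypothesis SW_bounded : exists M, forall t, tS <= t -> `|S t| <= M /\ `|W t| <= M.
Hypothesis W_cont : contI tS W.
Hypothesis E_cont : contI tS E.
Hypothesis E_L1 : forall i j, L1dom (fun t => E t i j).
Let p j t := p0 j t - kappa * (e t)^-1 * de t.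
Variable b : 'I_d -> bool.
Hypothesis p_dich : exists T M : R, forall j, exists P : R -> R, (forall t, T <= t -> is_derive t 1 P (p j t)) /\
  forall u v : R, T <= u -> u <= v -> (if b j then P v - P u else P u - P v) <= M.

Let theta t := e t `^ kappa.

Lemma theta_gt0 t : t0 <= t -> 0 < theta t.
Proof. by move=> tt; apply: powR_gt0; exact: e_gt0. Qed.

Lemma theta_der t : t0 < t -> is_derive t 1 theta (theta t * (kappa * (e t)^-1 * de t)).
Proof.
move=> tt.
have h : is_derive t 1 (fun u => expR (kappa * ln (e u))) (expR (kappa * ln (e t)) * (kappa * ((e t)^-1 * de t))).
  by apply/der_expR/derZ/der_comp; [exact: e_der|apply: is_derive1_ln; exact/e_gt0/ltW].
rewrite -mulrA; have -> : theta t = expR (kappa * ln (e t)) by rewrite /theta /powR gt_eqF// e_gt0// ltW.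
apply: der_near h; near=> u.
have tu : t0 <= u.
  by near: u; have := nbhs_itvy tt; apply: filterS => u; rewrite /= in_itv /= andbT.
by rewrite /theta /powR gt_eqF// e_gt0.
Unshelve. all: by end_near. Qed.

(** The substitution y = s + theta S z determines only S z'. The right inverse [W] picks one
    admissible z', in which the residual [g] and the remainder [rem2] appear divided by [theta]. *)
Let N t z := E t *m z + W t *m ((theta t)^-1 *: (g t + rem2 t (theta t *: (S t *m z)))).
Let DN t z := E t + W t *m drem2 t (theta t *: (S t *m z)) *m S t.
Let y z t := s t + theta t *: (S t *m z t).

(** Since [S t *m W t = 1%:M], applying [S] recovers the residual and the remainder. The term
    [kappa e'/e] in [p] is cancelled by the derivative of [theta], and [E] by the error term in the
    derivative of [S]. *)
Lemma perturbation_ode (z : R -> 'cV[R]_d) t i : tS <= t ->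
  (forall j, is_derive t 1 (fun u => z u j 0) (p j t * z t j 0 + N t (z t) j 0)) ->
  is_derive t 1 (fun u => y z u i 0) (rhs A f eps fl t (y z t) i 0).
Proof.
move=> tt Hz; have t0t := lt_le_trans tS0 tt.
have th0 := theta_gt0 (ltW t0t).
pose dz : 'cV[R]_d := \col_j (p j t * z t j 0 + N t (z t) j 0).
have [Ah AhE] : exists Ah, Ah = Ahat A D eps fl s t by eexists.
pose dS := Ah *m S t - S t *m (diag_mx (\row_k p0 k t) + E t).
pose dth := theta t * (kappa * (e t)^-1 * de t).
have dy : is_derive t 1 (fun u => y z u i 0) (ds t i 0 + (dth * (S t *m z t) i 0 + theta t * (dS *m z t + S t *m dz) i 0)).
  have h1 : is_derive t 1 (fun u => (S u *m z u) i 0) ((dS *m z t + S t *m dz) i 0).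
    have h : is_derive t 1 (fun u => \sum_j S u i j * z u j 0) (\sum_j (dS i j * z t j 0 + S t i j * dz j 0)).
      apply: der_sum => j _; apply: derM; first by rewrite /dS AhE; exact: S_der.
      by rewrite mxE; exact: Hz.
    apply: is_derive_eq (der_ext _ h) _; first by move=> u; rewrite mxE.
    by rewrite big_split /= !mxE.
  apply: is_derive_eq (der_ext _ (derD (s_der i t0t) (derM (theta_der t0t) h1))) _ => //.
  by move=> u; rewrite !mxE.
apply: is_derive_eq dy _.
have -> : ds t i 0 + (dth * (S t *m z t) i 0 + theta t * (dS *m z t + S t *m dz) i 0) =
   (ds t + (dth *: (S t *m z t) + theta t *: (dS *m z t + S t *m dz))) i 0 by rewrite !mxE.
congr (fun M : 'cV[R]_n => M i 0).
have dzE : dz = diag_mx (\row_k p0 k t) *m z t - (kappa * (e t)^-1 * de t) *: z t + N t (z t).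
  apply/matrixP => j k; rewrite (ord1 k) /dz /p mul_diag_mx !mxE; ring.
have SN : S t *m N t (z t) = S t *m (E t *m z t) + (theta t)^-1 *: (g t + rem2 t (theta t *: (S t *m z t))).
  by rewrite /N mulmxDr (mulmxA (S t) (W t)) SW// mul1mx.
rewrite dzE mulmxDr SN mulmxBr -scalemxAr /dS mulmxBl !mulmxA mulmxDr mulmxDl.
have -> : theta t *: (Ah *m S t *m z t - (S t *m diag_mx (\row_k p0 k t) *m z t + S t *m E t *m z t) +
   (S t *m diag_mx (\row_k p0 k t) *m z t - (kappa * (e t)^-1 * de t) *: (S t *m z t) +
   (S t *m E t *m z t + (theta t)^-1 *: (g t + rem2 t (theta t *: (S t *m z t)))))) =
   theta t *: (Ah *m S t *m z t - (kappa * (e t)^-1 * de t) *: (S t *m z t)) +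
   (g t + rem2 t (theta t *: (S t *m z t))).
  exact/variation_algebra/lt0r_neq0.
rewrite /dth /g /rem2 /rhs /y.
have -> : theta t *: (Ah *m S t *m z t - (kappa * (e t)^-1 * de t) *: (S t *m z t)) =
  A *m (theta t *: (S t *m z t)) + \sum_(l < m.+1) eps l t *: (jac l t (s t) *m (theta t *: (S t *m z t)))
   - (theta t * (kappa * (e t)^-1 * de t)) *: (S t *m z t).
  rewrite scalerBr scalerA -mulmxA AhE /Ahat mulmxDl scalerDr scalemxAr; congr (_ + _ - _).
  rewrite mulmx_suml scaler_sumr; apply: eq_bigr => l _.
  by rewrite -scalemxAl scalerA mulrC -scalerA -scalemxAr.
have -> : \sum_(l < m.+1) eps l t *: (fl l (t, s t + theta t *: (S t *m z t)) - fl l (t, s t) -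
         jac l t (s t) *m (theta t *: (S t *m z t))) =
   \sum_(l < m.+1) eps l t *: fl l (t, s t + theta t *: (S t *m z t)) - \sum_(l < m.+1) eps l t *: fl l (t, s t)
   - \sum_(l < m.+1) eps l t *: (jac l t (s t) *m (theta t *: (S t *m z t))).
  by rewrite -!sumrB; apply: eq_bigr => l _; rewrite !scalerBr.
rewrite mulmxDr.
move: (\sum_(l < _) _) (\sum_(l < _) _) (\sum_(l < _) _) => ? ? ?.
by apply/matrixP => j k; rewrite !mxE; ring.
Qed.


Lemma contI_pair (T1 T2 : topologicalType) t1 (F : R -> T1) (G : R -> T2) :
  contI t1 F -> contI t1 G -> contI t1 (fun t => (F t, G t)).
Proof. by move=> cF cG t; apply: cvg_pair; [exact: cF|exact: cG]. Qed.

Lemma contI_pders l js y1 t1 : t0 <= t1 -> (size js <= q l)%N -> contI t1 y1 -> (forall t, t1 <= t -> D (t, y1 t)) ->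
  contI t1 (fun t => pders D js (fl l) (t, y1 t)).
Proof.
move=> tt jq yc yD; have [_ /(_ js jq) FC] := flC l.
apply: (contI_comp (D := D) (F := pders D js (fl l)) (h := fun t => (t, y1 t)) FC) => //.
by apply: contI_pair => // t; exact: cont_max.
Qed.

Lemma contI_jac l y1 t1 : t0 <= t1 -> contI t1 y1 -> (forall t, t1 <= t -> D (t, y1 t)) ->
  contI t1 (fun t => jac l t (y1 t)).
Proof.
move=> tt yc yD; apply/mx_contI => i j.
have /mx_contI := @contI_pders l [:: j] y1 t1 tt (ltnW (q2 l)) yc yD.
move=> /(_ i 0); congr contI; apply/funext => t; by rewrite mxE.
Qed.

Lemma theta_contI t1 : t0 < t1 -> contI t1 (fun t => (theta t)^-1) /\ contI t1 theta.
Proof.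
move=> tt; split.
  apply: (@der_contI _ _ (fun t => - (theta t) ^- 2 *: (theta t * (kappa * (e t)^-1 * de t)))) => t t1t.
  have t0t := lt_le_trans tt t1t; have h := theta_der t0t.
  by apply: is_deriveV; rewrite gt_eqF// theta_gt0// ltW.
by apply: (@der_contI _ _ (fun t => theta t * (kappa * (e t)^-1 * de t))) => t t1t; apply: theta_der; exact: lt_le_trans t1t.
Qed.

(** Half of the radius [a] is left for [s - phi0] and half for the perturbation; both tend to 0, the
    latter because [kappa] is positive. *)
Lemma box_perturbed : exists2 T, t0 < T & forall t z, T <= t -> `|z : 'cV[R]_d| <= 1 -> box (phi0 t) a (s t + theta t *: (S t *m z)).
Proof.
have [M HM] := SW_bounded.
have th : bO e kappa theta.
  by exists 1; near=> t; rewrite mul1r ger0_norm ?powR_ge0.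
have h1 := bO_cvg0 e_near e_cvg0 kappa0 th.
have h2 := bO_cvg0 e_near e_cvg0 ltr01 s_phi0.
have aM : 0 < a / 2 / (d%:R * `|M| + 1) by rewrite !divr_gt0// ltr_wpDl// mulr_ge0.
have : \forall t \near +oo, forall z : 'cV[R]_d, `|z| <= 1 -> box (phi0 t) a (s t + theta t *: (S t *m z)).
  near=> t => z z1; rewrite /box.
  have tt : tS <= t by near: t; apply/near_pinftyP; exists tS.
  have a1 : `|s t - phi0 t| < a / 2.
    rewrite -normrN -sub0r; near: t; by move/cvgrPdist_lt : h2 => /(_ (a / 2)); apply; rewrite divr_gt0.
  have a2 : `|theta t| <= a / 2 / (d%:R * `|M| + 1).
    rewrite -normrN -sub0r; near: t; by move/cvgrPdist_le : h1 => /(_ _ aM).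
  have [St _] := HM t tt.
  have -> : s t + theta t *: (S t *m z) - phi0 t = (s t - phi0 t) + theta t *: (S t *m z) by rewrite addrAC.
  apply: (le_lt_trans (ler_normD _ _)); rewrite (splitr a) ltr_leD// normrZ.
  apply: (@le_trans _ _ (a / 2 / (d%:R * `|M| + 1) * (d%:R * `|M|))); last first.
    by rewrite mulrAC ler_pdivrMr ?ltr_wpDl ?mulr_ge0// ler_wpM2l ?divr_ge0 ?(ltW a0)// lerDl.
  apply: ler_pM => //; apply: (le_trans (mx_norm_mul _ _)).
  rewrite -[X in _ <= X]mulr1; apply: ler_pM => //.
  by rewrite ler_wpM2l//; apply: le_trans St (ler_norm _).
move/near_pinftyP => [T HT]; exists (Num.max T (t0 + 1)); first by rewrite lt_max ltrDl ltr01 orbT.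
by move=> t z; rewrite ge_max => /andP[/HT H _]; exact: H.
Unshelve. all: by end_near. Qed.

(** After division by [theta] the residual is O(e^varpi), and the quadratic remainder is O(e theta)
    = O(e^(1 + kappa)), which is at most O(e^varpi) by [varpi_kappa]. Together with [E] this gives
    one integrable density for all the estimates that the diagonal system needs. *)
Lemma nonlinear_estimates : exists T0 ht, [/\ T0 > tS, L1dom ht & forall t, T0 <= t ->
  [/\ forall z : 'cV[R]_d, `|z| <= 1 -> D (t, s t + theta t *: (S t *m z)),
   forall z : 'cV[R]_d, `|z| <= 1 -> `|N t z| <= ht t,
   forall z z' : 'cV[R]_d, `|z| <= 1 -> `|z'| <= 1 -> `|N t z - N t z'| <= ht t * `|z - z'|,
   forall z z' : 'cV[R]_d, `|z| <= 1 -> `|z'| <= 1 -> `|N t z' - N t z - DN t z *m (z' - z)| <= ht t * `|z' - z| ^+ 2 &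
   forall z v : 'cV[R]_d, `|z| <= 1 -> `|DN t z *m v| <= ht t * `|v|]].
Proof.
have [T1 T10 HT1] := box_perturbed.
have [M0 HM0] := SW_bounded.
pose M := `|M0|.
have HM t : tS <= t -> `|S t| <= M /\ `|W t| <= M.
  by move=> /HM0[h1 h2]; split; apply: le_trans (ler_norm _).
have M_ge0 : 0 <= M by exact: normr_ge0.
have [K K0 /near_pinftyP[T2 HK]] := rem2_estimates.
have [G G0 /near_pinftyP[T3 HG]] := bO_pos g_bO.
have /near_pinftyP[T4 He] := e_le1 e_cvg0.
pose sig := d%:R * M; pose om := n%:R * M.
have sig0 : 0 <= sig by rewrite mulr_ge0.
have om0 : 0 <= om by rewrite mulr_ge0.
pose hE t := \sum_i \sum_j `|E t i j|.
have hE0 t : 0 <= hE t by rewrite sumr_ge0// => i _; rewrite sumr_ge0.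
(* The 3 is the sum of 2, from the quadratic remainder with [|z' - z| <= 2] in the unit ball, and 1
   from the linear part [DN]. *)
pose c := om * (G + K * sig ^+ 2 * 3).
have c0 : 0 <= c by rewrite mulr_ge0// addr_ge0// !mulr_ge0// exprn_ge0.
pose ht t := d%:R * hE t + c * e t `^ varpi.
exists (Num.max (Num.max T1 T2) (Num.max (Num.max T3 T4) (tS + 1))), ht; split.
- by rewrite !lt_max ltrDl ltr01 !orbT.
- apply: L1domD; last exact: L1domZ.
  by apply: L1domZ; apply: L1dom_sum => i _; apply: L1dom_sum => j _; exact: L1dom_norm.
move=> t; rewrite !ge_max => /andP[/andP[t1 t2] /andP[/andP[t3 t4] t5]].
have ttS : tS <= t by apply: le_trans t5; rewrite lerDl.
have tt0 : t0 < t by apply: lt_le_trans tS0 ttS.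
have et := e_gt0 (ltW tt0); have th := theta_gt0 (ltW tt0).
have [St Wt] := HM t ttS.
have bx z : `|z : 'cV[R]_d| <= 1 -> box (phi0 t) a (s t + theta t *: (S t *m z)) by exact: HT1.
have Sz z : `|S t *m z| <= sig * `|z : 'cV[R]_d|.
  by apply: (le_trans (mx_norm_mul _ _)); rewrite ler_wpM2r// ler_wpM2l.
have Wx x : `|W t *m x| <= om * `|x : 'cV[R]_n|.
  by apply: (le_trans (mx_norm_mul _ _)); rewrite ler_wpM2r// ler_wpM2l.
have Ez z : `|E t *m z| <= d%:R * hE t * `|z : 'cV[R]_d|.
  apply: (le_trans (mx_norm_mul _ _)); rewrite ler_wpM2r// ler_wpM2l//.
  apply: mx_norm_leP => // i j; rewrite /hE (bigD1 i)//= (bigD1 j)//= -addrA lerDl addr_ge0// sumr_ge0// => k _.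
  by rewrite sumr_ge0.
have eth : e t * theta t <= e t `^ varpi.
  have -> : e t * theta t = e t `^ (1 + kappa).
    by rewrite powRD ?(gt_eqF et) ?implybT// powRr1// ltW.
  by apply: ger_powR => //; rewrite et He.
have gth : `|(theta t)^-1 *: g t| <= G * e t `^ varpi.
  rewrite normrZ gtr0_norm ?invr_gt0// mulrC ler_pdivrMr//; apply: (le_trans (HG t t3)).
  by rewrite addrC powRD ?(gt_eqF et) ?implybT// mulrA.
have dh z z' : `|theta t *: (S t *m z') - theta t *: (S t *m z)| <= theta t * sig * `|z' - z : 'cV[R]_d|.
  by rewrite -scalerBr -mulmxBr normrZ gtr0_norm// -mulrA ler_wpM2l// ltW.
have h0 z : `|theta t *: (S t *m z)| <= theta t * sig * `|z : 'cV[R]_d|.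
  by rewrite normrZ gtr0_norm// -mulrA ler_wpM2l// ltW.
have KQ := HK t t2.
have rq z z' : `|z| <= 1 -> `|z'| <= 1 -> `|(theta t)^-1 *: (rem2 t (theta t *: (S t *m z')) - rem2 t (theta t *: (S t *m z)) -
    drem2 t (theta t *: (S t *m z)) *m (theta t *: (S t *m z') - theta t *: (S t *m z)))| <= K * sig ^+ 2 * e t `^ varpi * `|z' - z| ^+ 2.
  move=> z1 z1'; have [h _] := KQ _ _ 0 (bx z z1) (bx z' z1').
  rewrite normrZ gtr0_norm ?invr_gt0// mulrC ler_pdivrMr//; apply: (le_trans h).
  apply: (@le_trans _ _ (K * e t * (theta t * sig * `|z' - z|) ^+ 2)).
    by rewrite ler_wpM2l ?mulr_ge0 ?(ltW et)// ler_pXn2r// ?nnegrE ?mulr_ge0// ltW.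
  have -> : K * e t * (theta t * sig * `|z' - z|) ^+ 2 = (K * sig ^+ 2 * `|z' - z| ^+ 2 * theta t) * (e t * theta t) by ring.
  have -> : K * sig ^+ 2 * e t `^ varpi * `|z' - z| ^+ 2 * theta t = (K * sig ^+ 2 * `|z' - z| ^+ 2 * theta t) * e t `^ varpi by ring.
  by rewrite ler_wpM2l// !mulr_ge0// ?exprn_ge0// ltW.
have dr z (v : 'cV[R]_d) : `|z| <= 1 -> `|(theta t)^-1 *: (drem2 t (theta t *: (S t *m z)) *m (theta t *: (S t *m v)))| <= K * sig ^+ 2 * e t `^ varpi * `|z| * `|v|.
  move=> z1; have [_ h] := KQ _ _ (theta t *: (S t *m v)) (bx z z1) (bx z z1).
  rewrite normrZ gtr0_norm ?invr_gt0// mulrC ler_pdivrMr//; apply: (le_trans h).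
  apply: (@le_trans _ _ (K * e t * (theta t * sig * `|z|) * (theta t * sig * `|v|))).
    have ke : 0 <= K * e t by rewrite mulr_ge0 ?(ltW et).
    by apply: ler_pM => //; [rewrite mulr_ge0|rewrite ler_wpM2l].
  have -> : K * e t * (theta t * sig * `|z|) * (theta t * sig * `|v|) = (K * sig ^+ 2 * `|z| * `|v| * theta t) * (e t * theta t) by ring.
  have -> : K * sig ^+ 2 * e t `^ varpi * `|z| * `|v| * theta t = (K * sig ^+ 2 * `|z| * `|v| * theta t) * e t `^ varpi by ring.
  by rewrite ler_wpM2l// !mulr_ge0// ?exprn_ge0// ltW.
have ev0 : 0 <= e t `^ varpi by exact: powR_ge0.
have Kv : 0 <= K * sig ^+ 2 * e t `^ varpi by rewrite !mulr_ge0// exprn_ge0.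
have cE : c * e t `^ varpi = om * (G * e t `^ varpi) + om * (K * sig ^+ 2 * e t `^ varpi * 3) by rewrite /c; ring.
have omG : 0 <= om * (G * e t `^ varpi) by rewrite !mulr_ge0.
have DNE z (v : 'cV[R]_d) : DN t z *m v = E t *m v + W t *m ((theta t)^-1 *: (drem2 t (theta t *: (S t *m z)) *m (theta t *: (S t *m v)))).
  by rewrite /DN mulmxDl -!scalemxAr scalerA mulVf ?gt_eqF// scale1r !mulmxA.
have NE z z' : N t z' - N t z = E t *m (z' - z) + W t *m ((theta t)^-1 *: (rem2 t (theta t *: (S t *m z')) - rem2 t (theta t *: (S t *m z)))).
  rewrite /N mulmxBr opprD addrACA; congr (_ + _); rewrite -mulmxBr -scalerBr; congr (_ *m (_ *: _)).
  by rewrite opprD addrACA subrr add0r.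
have NDE z z' : N t z' - N t z - DN t z *m (z' - z) = W t *m ((theta t)^-1 *: (rem2 t (theta t *: (S t *m z')) - rem2 t (theta t *: (S t *m z)) -
    drem2 t (theta t *: (S t *m z)) *m (theta t *: (S t *m z') - theta t *: (S t *m z)))).
  rewrite NE DNE opprD addrACA subrr add0r -mulmxBr -scalerBr; congr (_ *m (_ *: (_ - _ *m _))).
  by rewrite mulmxBr scalerBr.
have quad z z' : `|z| <= 1 -> `|z'| <= 1 -> `|N t z' - N t z - DN t z *m (z' - z)| <= om * (K * sig ^+ 2 * e t `^ varpi) * `|z' - z| ^+ 2.
  by move=> z1 z1'; rewrite NDE; apply: (le_trans (Wx _)); rewrite -mulrA ler_wpM2l// rq.
have dnv z (v : 'cV[R]_d) : `|z| <= 1 -> `|DN t z *m v| <= d%:R * hE t * `|v| + om * (K * sig ^+ 2 * e t `^ varpi) * `|v|.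
  move=> z1; rewrite DNE; apply: (le_trans (ler_normD _ _)); apply: lerD => //.
  apply: (le_trans (Wx _)); rewrite -mulrA ler_wpM2l//; apply: (le_trans (dr z v z1)).
  by rewrite -[X in _ <= X]mulr1 mulrAC ler_wpM2l// mulr_ge0.
have oK : 0 <= om * (K * sig ^+ 2 * e t `^ varpi) by rewrite mulr_ge0.
have dE0 : 0 <= d%:R * hE t by rewrite mulr_ge0.
have lip z z' : `|z| <= 1 -> `|z'| <= 1 -> `|N t z' - N t z| <= (d%:R * hE t + om * (K * sig ^+ 2 * e t `^ varpi) * 3) * `|z' - z|.
  move=> z1 z1'; have -> : N t z' - N t z = (N t z' - N t z - DN t z *m (z' - z)) + DN t z *m (z' - z) by rewrite subrK.
  apply: (le_trans (ler_normD _ _)); apply: (le_trans (lerD (quad z z' z1 z1') (dnv z (z' - z) z1))).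
  have zz : `|z' - z| <= 2 by apply: (le_trans (ler_normB _ _)); move: z1 z1'; lra.
  have : om * (K * sig ^+ 2 * e t `^ varpi) * `|z' - z| ^+ 2 <= om * (K * sig ^+ 2 * e t `^ varpi) * (2 * `|z' - z|).
    by rewrite ler_wpM2l// expr2 ler_wpM2r.
  by move=> h; move: (om * _) h oK => u h oK; lra.
split.
- by move=> z z1; apply: box_cylinder; [exact: ltW|exact: bx].
- move=> z z1; have z0 : `|0 : 'cV[R]_d| <= 1 by rewrite normr0.
  have h := lip 0 z z0 z1; have -> : N t z = N t 0 + (N t z - N t 0) by rewrite addrC subrK.
  apply: (le_trans (ler_normD _ _)).
  have N0 : `|N t 0| <= om * (G * e t `^ varpi).
    rewrite /N !mulmx0 scaler0 rem2_0 addr0 add0r; apply: (le_trans (Wx _)); by rewrite ler_wpM2l.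
  rewrite subr0 in h.
  have h2 : (d%:R * hE t + om * (K * sig ^+ 2 * e t `^ varpi) * 3) * `|z| <= d%:R * hE t + om * (K * sig ^+ 2 * e t `^ varpi) * 3.
    by rewrite ler_piMr// addr_ge0// mulr_ge0.
  rewrite /ht cE; move: h h2 N0; rewrite !mulrA; lra.
- move=> z z' z1 z1'; apply: (le_trans (lip z' z z1' z1)); rewrite ler_wpM2r// /ht lerD2l cE.
  by move: omG; rewrite !mulrA; lra.
- move=> z z' z1 z1'; apply: (le_trans (quad z z' z1 z1')); rewrite ler_wpM2r ?exprn_ge0// /ht cE.
  by move: omG oK dE0; rewrite !mulrA; lra.
move=> z v z1; apply: (le_trans (dnv z v z1)); rewrite -mulrDl ler_wpM2r// /ht cE.
by move: omG oK dE0; rewrite !mulrA; lra.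
Qed.

Theorem perturbed_solutions : exists T, forall t1, T <= t1 ->
  exists (eta : R) (z : 'rV[R]_#|free_set b| -> R -> 'cV[R]_d), 0 < eta /\ forall C, `|C| < eta ->
  [/\ solution A f eps fl D t1 (y (z C)), forall t, t1 <= t -> `|z C t| <= 1,
      forall t, t1 <= t -> differentiable (fun C' => z C' t) C &
      forall i, z C t1 (enum_val i) 0 = C 0 i].
Proof.
have [T0 [ht [TtS hL1 Hest]]] := nonlinear_estimates.
have [Tp [Mp Hp]] := p_dich.
pose M := expR (`|Mp|).
have M1 : 1 <= M by rewrite /M -expR0 ler_expR.
(* The largest tail mass for which [M * (2 * eta0)] is at most 1/2; it is reached by starting late
   enough. *)
pose eta0 := 1 / (4 * M).
have M0 : 0 < M by exact: expR_gt0.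
have eta00 : 0 < eta0 by rewrite divr_gt0// mulr_gt0.
have [T [h [H [TT0 HH]]]] := L1dom_tail (Num.max T0 Tp) hL1 eta00.
exists T => t1 Tt1.
have T0t1 : T0 <= t1 by apply: le_trans Tt1; apply: le_trans TT0; rewrite le_max lexx.
have Tpt1 : Tp <= t1 by apply: le_trans Tt1; apply: le_trans TT0; rewrite le_max lexx orbT.
have tSt1 : tS <= t1 by apply: le_trans T0t1; exact: ltW.
have t0t1 : t0 < t1 by exact: lt_le_trans tSt1.
have [P0 HP0] := choice Hp.
pose P j t := P0 j t - P0 j t1.
have HP j t : t1 <= t -> is_derive t 1 (P j) (p j t).
  move=> tt; have [h1 _] := HP0 j; apply: is_derive_eq (derB (h1 t (le_trans Tpt1 tt)) (derc t (P0 j t1))) _.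
  by rewrite subr0.
have Pt1 j : P j t1 = 0 by rewrite /P subrr.
have HM j u v : t1 <= u -> u <= v -> expR (if b j then P j v - P j u else P j u - P j v) <= M.
  move=> tu uv; rewrite ler_expR; have [_ h1] := HP0 j.
  apply: le_trans (ler_norm Mp); apply: le_trans (h1 u v (le_trans Tpt1 tu) uv).
  by case: (b j); rewrite /P; lra.
have HH' t : t1 <= t -> [/\ is_derive t 1 H (h t), 0 <= h t & `|H t| <= eta0].
  move=> tt; have [h1 h2 h3] := HH t (le_trans Tt1 tt); split => //; exact: le_trans h2.
have Meta : M * (2 * eta0) <= 1 / 2.
  by rewrite /eta0 le_eqVlt; apply/orP; left; apply/eqP; field; rewrite gt_eqF.
have hth t : t1 <= t -> ht t <= h t.
  by move=> tt; have [_ h2 _] := HH t (le_trans Tt1 tt); apply: le_trans (ler_norm _) h2.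
have est t : t1 <= t -> _ := fun tt => Hest t (le_trans T0t1 tt).
have Sc : contI t1 S.
  apply/mx_contI => i j; apply: (@der_contI _ _ (fun t => (Ahat A D eps fl s t *m S t - S t *m (diag_mx (\row_k p0 k t) + E t)) i j)) => t tt.
  by apply: S_der; exact: le_trans tt.
have sc := contI_le (ltW t0t1) s_cont.
have [thV thc] := theta_contI t0t1.
have hzc z : bball t1 1 z -> contI t1 (fun t => s t + theta t *: (S t *m z t)).
  by move=> [zc _]; exact: (contI_mxD sc (contI_mxZ thc (contI_mulmx Sc zc))).
have sD t : t1 <= t -> D (t, s t).
  move=> tt; have [h1 _ _ _ _] := est t tt; have := h1 0; rewrite normr0 mulmx0 scaler0 addr0; exact.
have hzD z t : bball t1 1 z -> t1 <= t -> D (t, s t + theta t *: (S t *m z t)).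
  by move=> [_ zb] tt; have [h1 _ _ _ _] := est t tt; apply: h1; exact: zb.
have epsc l : contI t1 (eps l) := contI_le (ltW t0t1) (@eps_cont l).
have flc l y1 : contI t1 y1 -> (forall t, t1 <= t -> D (t, y1 t)) -> contI t1 (fun t => fl l (t, y1 t)).
  by move=> yc yD; exact: (contI_pders (js := [::]) (ltW t0t1) _ yc yD).
have gc : contI t1 g.
  have -> : g = (fun t => rhs A f eps fl t (s t) - ds t) by apply/funext => t; rewrite /g addrC.
  apply: contI_mxB; last exact: contI_le (ltW t0t1) ds_cont.
  have fc : contI t1 (fun t => \sum_(l < m.+1) eps l t *: fl l (t, s t)).
    by apply: contI_mxsum => l _; exact: (contI_mxZ (epsc l) (flc l _ sc sD)).
  have Asc : contI t1 (fun t => A *m s t) by apply: contI_mulmx; [exact: contIc|exact: sc].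
  have fc1 : contI t1 f by exact: contI_le (ltW t0t1) f_cont.
  exact: (contI_mxD (contI_mxD Asc fc1) fc).
have Nc z : bball t1 1 z -> contI t1 (fun t => N t (z t)).
  move=> zb; have [zc _] := zb; have Ec := contI_le tSt1 E_cont; have Wc := contI_le tSt1 W_cont.
  have Szc : contI t1 (fun t => theta t *: (S t *m z t)) := contI_mxZ thc (contI_mulmx Sc zc).
  have rc : contI t1 (fun t => rem2 t (theta t *: (S t *m z t))).
    apply: contI_mxsum => l _; apply: (contI_mxZ (epsc l)); apply: contI_mxB.
      exact: (contI_mxB (flc l _ (hzc z zb) (fun t tt => hzD z t zb tt)) (flc l _ sc sD)).
    exact: (contI_mulmx (contI_jac (ltW t0t1) sc sD) Szc).
  exact: (contI_mxD (contI_mulmx Ec zc) (contI_mulmx Wc (contI_mxZ thV (contI_mxD gc rc)))).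
have DNc z : bball t1 1 z -> contI t1 (fun t => DN t (z t)).
  move=> zb; have [zc _] := zb; have Ec := contI_le tSt1 E_cont; have Wc := contI_le tSt1 W_cont.
  have rc : contI t1 (fun t => drem2 t (theta t *: (S t *m z t))).
    apply: contI_mxsum => l _; apply: (contI_mxZ (epsc l)).
    exact: (contI_mxB (contI_jac (ltW t0t1) (hzc z zb) (fun t tt => hzD z t zb tt)) (contI_jac (ltW t0t1) sc sD)).
  exact: (contI_mxD Ec (contI_mulmx (contI_mulmx Wc rc) Sc)).
have [||||||z [eta [eta1 Hz]]] := @diagonal_system R d t1 p P M h H eta0 b HP Pt1 HM HH' M1 Meta N DN.
- by move=> t z tt z1; have [_ h2 _ _ _] := est t tt; apply: le_trans (h2 z z1) (hth t tt).
- by move=> t z z' tt z1 z1'; have [_ _ h2 _ _] := est t tt; apply: le_trans (h2 z z' z1 z1') _; rewrite ler_wpM2r// hth.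
- by move=> t z z' tt z1 z1'; have [_ _ _ h2 _] := est t tt; apply: le_trans (h2 z z' z1 z1') _; rewrite ler_wpM2r ?exprn_ge0// hth.
- by move=> t z v tt z1; have [_ _ _ _ h2] := est t tt; apply: le_trans (h2 z v z1) _; rewrite ler_wpM2r// hth.
- exact: Nc.
- exact: DNc.
exists eta, z; split => // C /Hz[zb zd zdiff zt1]; split => //; last by have [] := zb.
have yd t : t1 <= t -> forall i, is_derive t 1 (fun u => y (z C) u i 0) (rhs A f eps fl t (y (z C) t) i 0).
  by move=> tt i; apply: perturbation_ode; [exact: le_trans tt|move=> j; exact: zd].
have yd' t : t1 <= t -> derivable_within `[t1, +oo[ (y (z C)) t /\ dI t1 (y (z C)) t = rhs A f eps fl t (y (z C) t).
  by move=> tt; apply: derive_dI_mx => // i j; rewrite (ord1 j); exact: yd.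
split; first by move=> t /yd'[].
by move=> t tt; have [_ h2] := yd' t tt; split => //; exact: hzD.
Qed.

End Perturbation.

(** * Critical products *)

Section CriticalClass.
Variables (R : realType) (m k' : nat) (t0 : R) (eps : 'I_m.+1 -> R -> R) (lam : 'I_k' -> R[i]) (K : set (R -> R)) (varpi : R).
Let e := eps ord0.
Hypothesis K3P : K3_class t0 lam K.
Hypothesis e_gt0 : forall t, t0 <= t -> 0 < e t.
Hypothesis e_cvg0 : e t @[t --> +oo] --> 0.
Hypothesis eps_cont : forall l, contI t0 (eps l).
Hypothesis eps_bO1 : forall l, bO e 1 (eps l).
Hypothesis e_L1 : L1dom (fun t => e t `^ varpi).
Hypothesis H9 : forall l, ~ intRp t0 1 (eps l) -> CI t0 1 (eps l) /\ intRp t0 1 (dI t0 (eps l)).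
Implicit Types (w v : mindex m.+1) (g h : R -> R).

Let e_near : \forall t \near +oo, 0 < e t.
Proof. by apply/near_pinftyP; exists t0 => t; exact: e_gt0. Qed.

Definition nbounded (V : normedModType R) (g : R -> V) := exists M : R, \forall t \near +oo, `|g t| <= M.

Lemma bO_nbounded c g : 0 <= c -> bO e c g -> nbounded (g : R -> R^o).
Proof.
move=> c0 /(bO_le e_near e_cvg0 c0)[M H]; exists M; near=> t.
have : `|g t| <= M * e t `^ 0 by near: t.
by rewrite powRr0 mulr1.
Unshelve. all: by end_near. Qed.

Lemma nboundedM g h : nbounded (g : R -> R^o) -> nbounded (h : R -> R^o) -> nbounded ((fun t => g t * h t) : R -> R^o).
Proof.
move=> [M H] [M' H']; exists (M * M'); near=> t; rewrite normrM.
by apply: ler_pM => //; near: t.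
Unshelve. all: by end_near. Qed.

Lemma nbounded_prod (I : eqType) (r : seq I) (F : I -> R -> R) : (forall i, i \in r -> nbounded (F i : R -> R^o)) ->
  nbounded ((fun t => \prod_(i <- r) F i t) : R -> R^o).
Proof.
elim: r => [|x r IH] H.
  by exists 1; near=> t; rewrite big_nil normr1.
have -> : (fun t => \prod_(i <- x :: r) F i t) = (fun t => F x t * \prod_(i <- r) F i t).
  by apply/funext => t; rewrite big_cons.
apply: nboundedM; first exact: H (mem_head _ _).
by apply: IH => i ir; apply: H; rewrite inE ir orbT.
Unshelve. all: by end_near. Qed.

Lemma L1dom_nb g h : L1dom g -> nbounded (h : R -> R^o) -> L1dom (fun t => h t * g t).
Proof. by move=> gL [M /near_pinftyP H]; exact: L1dom_Mb gL H. Qed.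

Lemma bO_L1 c g : varpi <= c -> bO e c g -> L1dom g.
Proof.
move=> vc /(bO_le e_near e_cvg0 vc)[M /near_pinftyP[T H]]; apply: (L1dom_le (C := M) e_L1).
by exists T => t tt; rewrite (ger0_norm (powR_ge0 _ _)); exact: H.
Qed.

Lemma eps_nbounded l : nbounded (eps l : R -> R^o).
Proof. exact: bO_nbounded ler01 (eps_bO1 l). Qed.

Lemma nbounded_pow g b : nbounded (g : R -> R^o) -> nbounded ((fun t => g t ^+ b) : R -> R^o).
Proof.
move=> [M H]; exists (M ^+ b); near=> t; rewrite normrX.
have h : `|g t| <= M by near: t.
by apply: lerXn2r => //; rewrite nnegrE //; exact: le_trans h.
Unshelve. all: by end_near. Qed.

Lemma contI_pow g b : contI t0 g -> contI t0 (fun t => g t ^+ b).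
Proof.
move=> gc; elim: b => [|b IH]; first exact: contIc.
have -> : (fun t => g t ^+ b.+1) = (fun t => g t * g t ^+ b) by apply/funext => t; rewrite exprS.
exact: contIM.
Qed.

Lemma mu_cont w : contI t0 (mu eps w).
Proof. by apply: contI_prod => l _; apply: contI_pow. Qed.

Lemma mu_nbounded w : nbounded (mu eps w : R -> R^o).
Proof. by apply: nbounded_prod => l _; apply: nbounded_pow; exact: eps_nbounded. Qed.

Lemma mu_bO w : bO e (mabs w)%:R (mu eps w).
Proof.
rewrite /mu /mabs; elim: (index_enum _) => [|l r IH].
  by rewrite big_nil mulr0n; apply: bO_bounded; exists 1; near=> t; rewrite big_nil normr1.
apply: (@bO_ext _ _ _ _ (fun t => eps l t ^+ w l *: (\prod_(j <- r) eps j t ^+ w j : R^o))); last first.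
  by near=> t; rewrite big_cons.
rewrite big_cons natrD; apply: (bOZ e_near) => //.
elim: (w l) => [|b IHb]; first by apply: bO_bounded; exists 1; near=> t; rewrite expr0 normr1.
apply: (@bO_ext _ _ _ _ (fun t => eps l t *: (eps l t ^+ b : R^o))); last by near=> t; rewrite exprS.
by rewrite -natr1 addrC; apply: (bOZ e_near).
Unshelve. all: by end_near. Qed.

Lemma mu_setw w l : w l != 0%N -> forall t, mu eps w t = mu eps (setw w l (w l).-1) t * eps l t.
Proof.
move=> wl t; rewrite /mu (bigD1 l)//= [in RHS](bigD1 l)//= ffunE eqxx.
rewrite mulrAC -exprSr prednK ?lt0n//; congr (_ * _); apply: eq_bigr => j jl.
by rewrite ffunE (negbTE jl).
Qed.

Definition addw w v : mindex m.+1 := [ffun l => (w l + v l)%N].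

Lemma mu_addw w v t : mu eps (addw w v) t = mu eps w t * mu eps v t.
Proof. by rewrite /mu -big_split /=; apply: eq_bigr => l _; rewrite ffunE exprD. Qed.

Lemma mabs_addw w v : mabs (addw w v) = (mabs w + mabs v)%N.
Proof. by rewrite /mabs -big_split /=; apply: eq_bigr => l _; rewrite ffunE. Qed.

Lemma critical_list : exists2 CL : seq (mindex m.+1), uniq CL & forall w, (w \in CL) <-> critical t0 eps varpi w.
Proof.
exists [seq w <- wlist (enum 'I_m.+1) (Num.truncn varpi) | `[<critical t0 eps varpi w>]].
  by rewrite filter_uniq// wlist_uniq// enum_uniq.
move=> w; rewrite mem_filter wlist_mem ?enum_uniq//; split; first by case/andP => /asboolP.
move=> cw; rewrite asboolT //=; apply/andP; split; last by apply/forallP => l; rewrite mem_enum.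
have [_ w2 _] := cw; rewrite -ltnS -(ltr_nat R).
by apply: lt_trans w2 _; rewrite truncnS_gt.
Qed.

Variable CL : seq (mindex m.+1).
Hypothesis CLu : uniq CL.
Hypothesis CLP : forall w, (w \in CL) <-> critical t0 eps varpi w.

(** A product of at least [varpi] factors is O(e^varpi) and thus integrable; a shorter one is
    critical exactly when it is not integrable. *)
Lemma mu_cases w : (1 <= mabs w)%N -> w \in CL \/ L1dom (mu eps w).
Proof.
move=> w1; have [h|h] := EM (intRp t0 1 (mu eps w)).
  by right; apply: (intR1_L1dom _ h); exact: mu_cont.
have [wv|vw] := ltP (mabs w)%:R varpi; first by left; apply/CLP.
by right; exact: bO_L1 vw (mu_bO w).
Qed.

Lemma crit_gt0 w : w \in CL -> (1 <= mabs w)%N.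
Proof. by move=> /CLP[]. Qed.

Lemma crit_cvg0 w : w \in CL -> mu eps w t @[t --> +oo] --> 0.
Proof. by move=> wC; apply: (bO_cvg0 e_near e_cvg0 _ (mu_bO w)); rewrite ltr0n; exact: crit_gt0. Qed.

(** If a factor were integrable, the whole product would be, the other factors being bounded. Hence
    the smoothness in hypothesis 9 is available for every factor of a critical product. *)
Lemma crit_support w l : w \in CL -> w l != 0%N -> ~ intRp t0 1 (eps l).
Proof.
move=> /CLP[_ _ nw] wl H; apply: nw; apply: L1dom_intR1; first exact: mu_cont.
apply: (@L1dom_ext _ (fun t => mu eps (setw w l (w l).-1) t * eps l t)).
  by apply: L1dom_nb; [exact: intR1_L1dom H|exact: mu_nbounded].
by exists t0 => t _; rewrite -mu_setw.
Qed.

Lemma crit_derive w : w \in CL -> exists dmu : R -> R,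
  [/\ forall t, t0 < t -> is_derive t 1 (mu eps w) (dmu t), contI t0 dmu & L1dom dmu].
Proof.
move=> wC.
(* Where [w l = 0] nothing is known about the derivative of [eps l], so the summand is set to 0 by
   hand. *)
pose G l t := if w l == 0%N then 0 else (w l)%:R * eps l t ^+ (w l).-1 * dI t0 (eps l) t.
exists (fun t => \sum_(l <- index_enum 'I_m.+1) (\prod_(j <- rem l (index_enum 'I_m.+1)) eps j t ^+ w j) * G l t).
have HG l : w l != 0%N -> [/\ forall t, t0 < t -> is_derive t 1 (eps l) (dI t0 (eps l) t), contI t0 (dI t0 (eps l)) & L1dom (dI t0 (eps l))].
  move=> /(crit_support wC)/H9[[C1 C2] C3].
  have c : contI t0 (dI t0 (eps l)) by apply/withinP_contI; exact: (C2 1%N).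
  split => //; last exact: intR1_L1dom.
  by move=> t tt; apply: dI_derive => //; apply: (C1 0%N) => //; exact: ltW.
split.
- move=> t tt; apply: der_prod => l _; rewrite /G; have [w0|w0] := eqVneq (w l) 0%N.
    by rewrite w0; exact: derc.
  have [h _ _] := HG l w0; apply: is_derive_eq (der_comp (h t tt) (der_pow (w l) (eps l t))) _.
  by [].
- apply: contI_sum => l _; apply: contIM; first by apply: contI_prod => j _; exact: contI_pow.
  rewrite /G; have [w0|w0] := eqVneq (w l) 0%N; first exact: contIc.
  have [_ h _] := HG l w0; apply: contIM => //; apply: contIZ; exact: contI_pow.
apply: L1dom_sum => l _; apply: L1dom_nb; last by apply: nbounded_prod => j _; apply: nbounded_pow; exact: eps_nbounded.
rewrite /G; have [w0|w0] := eqVneq (w l) 0%N; first exact: L1dom0.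
have [_ _ h] := HG l w0; apply: L1dom_nb => //; apply: nboundedM; last by apply: nbounded_pow; exact: eps_nbounded.
by exists (w l)%:R; near=> t; rewrite ger0_norm.
Unshelve. all: by end_near. Qed.

Lemma K_contI g : K g -> contI t0 g.
Proof. by move=> /(K3_continuous K3P)/withinP_contI. Qed.

Lemma K_nbounded g : K g -> nbounded (g : R -> R^o).
Proof. by move=> /(K3_bounded K3P)[M H]; exists M; apply/near_pinftyP; exists t0. Qed.

(* Dirichlet's test: mu_w (g - M g) has a bounded primitive since g - M g has one and mu_w' is integrable. *)
Lemma crit_mean w g : w \in CL -> K g -> exists M, bprim (fun t => mu eps w t * (g t - M)).
Proof.
move=> wC Kg; have [M [_ [B HB]]] := K3_mean K3P Kg; exists M.
have gc : contI t0 (fun t => g t - M) by apply: contIB; [exact: K_contI|exact: contIc].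
have [dmu [d1 d2 d3]] := crit_derive wC.
have Pd t : t0 < t -> is_derive t 1 (intI t0 (fun t => g t - M)) (g t - M) by exact: intI_derive.
have [Mw /near_pinftyP[T HT]] := mu_nbounded w.
pose P := intI t0 (fun t => g t - M).
have h1 : bprim (fun t => dmu t * P t + mu eps w t * (g t - M)).
  exists (Num.max T (t0 + 1)), (fun t => mu eps w t * P t), (Mw * B) => t; rewrite ge_max => /andP[Tt tt].
  have t0t : t0 < t by apply: lt_le_trans tt; rewrite ltrDl.
  split; first exact: derM (d1 t t0t) (Pd t t0t).
  by rewrite normrM; apply: ler_pM => //; [exact: HT|exact/HB/ltW].
have h2 : bprim (fun t => -1 * (dmu t * P t)).
  apply: bprimZ; apply: (bprim_contI (T0 := t0 + 1)).
    have t01 : t0 <= t0 + 1 by rewrite lerDl.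
    apply: contIM; first exact: contI_le t01 d2.
    by apply: (@der_contI _ _ (fun t => g t - M)) => t tt; apply: Pd; apply: lt_le_trans tt; rewrite ltrDl.
  apply: (@L1dom_ext _ (fun t => P t * dmu t)); last by exists t0 => t _; rewrite mulrC.
  by apply: L1dom_nb => //; exists B; apply/near_pinftyP; exists t0.
by apply: bprim_ext (bprimD h1 h2) _; exists t0 => t _; ring.
Qed.

(** Modulo integrable functions, a combination of critical products with coefficients in [K]: the
    form in which averaging accepts the entries of the linearization. *)
Definition inA g := exists h : mindex m.+1 -> R -> R, (forall w, K (h w)) /\
  L1dom (fun t => g t - \sum_(w <- CL) mu eps w t * h w t).

Lemma inA_L1 g : L1dom g -> inA g.
Proof.
move=> gL; exists (fun _ _ => 0); split; first by move=> w; exact: (K_zero K3P).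
by apply: L1dom_ext gL _; exists t0 => t _; rewrite big1 ?subr0// => w _; rewrite mulr0.
Qed.

Lemma inA_add g h : inA g -> inA h -> inA (fun t => g t + h t).
Proof.
move=> [p [Kp gL]] [q [Kq hL]]; exists (fun w t => p w t + q w t); split.
  by move=> w; exact: (K3_add K3P).
apply: L1dom_ext (L1domD gL hL) _; exists t0 => t _.
by under [in RHS]eq_bigr do rewrite mulrDr; rewrite big_split /=; ring.
Qed.

Lemma inA_ext g h : inA g -> (exists T, forall t, T <= t -> g t = h t) -> inA h.
Proof.
move=> [p [Kp gL]] [T gh]; exists p; split => //; apply: L1dom_ext gL _; exists T => t tt.
by rewrite gh.
Qed.

Lemma inA_sum (I : Type) (r : seq I) (F : I -> R -> R) : (forall i, List.In i r -> inA (F i)) ->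
  inA (fun t => \sum_(i <- r) F i t).
Proof.
elim: r => [|x r IH] H.
  by apply: inA_ext (inA_L1 (@L1dom0 R)) _; exists t0 => t _; rewrite big_nil.
apply: inA_ext (inA_add (H x (or_introl erefl)) (IH (fun i ir => H i (or_intror ir)))) _.
by exists t0 => t _; rewrite big_cons.
Qed.

Lemma inA_mu w h : (1 <= mabs w)%N -> K h -> inA (fun t => mu eps w t * h t).
Proof.
move=> w1 Kh; have [wC|wL] := mu_cases w1; last first.
  apply: inA_L1; apply: (@L1dom_ext _ (fun t => h t * mu eps w t)); last by exists t0 => t _; rewrite mulrC.
  by apply: L1dom_nb => //; exact: K_nbounded.
exists (fun v t => if v == w then h t else 0); split.
  by move=> v; case: (v == w) => //; exact: (K_zero K3P).
apply: L1dom_ext (@L1dom0 R) _; exists t0 => t _.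
rewrite (bigD1_seq w)//= eqxx big1 ?addr0 ?subrr// => v vw; by rewrite (negbTE vw) mulr0.
Qed.

(** The factors that may occur in [inA_mval]: bounded, and integrable as soon as they are genuine
    derivatives. *)
Definition tame (x : 'I_m.+1 * nat) := nbounded (iter x.2 (dI t0) (eps x.1) : R -> R^o) /\
  (x.2 = 0%N \/ L1dom (iter x.2 (dI t0) (eps x.1))).

Lemma mval_nbounded (nu : mono m.+1) : (forall x, x \in nu -> tame x) -> nbounded (mval t0 eps nu : R -> R^o).
Proof. by move=> H; apply: nbounded_prod => x xnu; have [] := H x xnu. Qed.

(** One differentiated factor makes the whole monomial integrable, since the others are bounded.
    Without such a factor the monomial is a product [mu eps w], where [w] counts the occurrences of
    each index. *)
Lemma inA_mval (nu : mono m.+1) h : nu <> mset0 -> (forall x, x \in nu -> tame x) -> K h ->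
  inA (fun t => mval t0 eps nu t * h t).
Proof.
move=> nu0 H Kh; have [/hasP[x xnu x2]|/hasPn nx] := boolP (has (fun x => x.2 != 0%N) (enum_mset nu)).
  have [_ [x20|xL]] := H x xnu; first by rewrite x20 in x2.
  apply: inA_L1; apply: (@L1dom_ext _ (fun t => h t * mval t0 eps (msetB nu (msetn 1 x)) t * iter x.2 (dI t0) (eps x.1) t)).
    apply: L1dom_nb => //; apply: nboundedM; first exact: K_nbounded.
    apply: mval_nbounded => y yB; apply: H; rewrite (msetB1_D xnu) in_msetD yB orbT //.
  exists t0 => t _; rewrite [in RHS](msetB1_D xnu) mvalD mval1; ring.
pose w : mindex m.+1 := [ffun l => count (fun x => x.1 == l) (enum_mset nu)].
have mE t : mval t0 eps nu t = mu eps w t.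
  have -> : mval t0 eps nu t = \prod_(x <- enum_mset nu) eps x.1 t.
    by rewrite /mval; apply: eq_big_seq => x /nx; rewrite negbK => /eqP ->.
  rewrite /mu /w; under [RHS]eq_bigr do rewrite ffunE.
  elim: (enum_mset nu) => [|x s IH]; first by rewrite big_nil big1// => l _; rewrite expr0.
  rewrite big_cons IH /=; under [RHS]eq_bigr do rewrite exprD.
  rewrite big_split /=; congr (_ * _); rewrite (bigD1 x.1)//= eqxx expr1 big1 ?mulr1// => l lx.
  by rewrite eq_sym (negbTE lx) expr0.
have w1 : (1 <= mabs w)%N.
  have [x xnu] := mset_neq0_factor nu0; rewrite /mabs (bigD1 x.1)//= ffunE.
  by apply: leq_trans (leq_addr _ _); rewrite -has_count; apply/hasP; exists x.
by apply: inA_ext (inA_mu w1 Kh) _; exists t0 => t _; rewrite mE.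
Qed.

End CriticalClass.

(** * The linearization along the partial sum, modulo integrable terms *)

Section JacobianExpansion.
Variables (R : realType) (n m : nat) (t0 : R) (A : 'M[R]_n) (lam : 'I_n -> R[i]) (K : set (R -> R)).
Variables (phi0 : R -> 'cV[R]_n) (a : R).
Variables (eps : 'I_m.+1 -> R -> R) (fl : 'I_m.+1 -> R * 'cV[R]_n -> 'cV[R]_n).
Variables (varrho : 'I_m.+1 -> R) (rho : nat -> R) (k : nat) (varpi : R).
Let D := cylinder t0 phi0 a.
Let r0 := varrho ord0.
Let e := eps ord0.
Hypothesis K3P : K3_class t0 lam K.
Hypothesis a0 : 0 < a.
Hypothesis varrho_gt0 : forall l, 0 < varrho l.
Hypothesis varrho_homo : forall l l' : 'I_m.+1, (l <= l')%N -> varrho l <= varrho l'.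
Hypothesis rhoP : rank_enum varrho rho.
Hypothesis k_gt0 : (0 < k)%N.
Hypothesis H1_smooth : forall l, CI t0 (pkl varrho rho k l) (eps l).
Hypothesis H1_rank : forall l r, (r <= pkl varrho rho k l)%N ->
  bigO_pinfty (iter r (dI t0) (eps l)) (fun t => eps ord0 t `^ ((varrho l + r%:R) / varrho ord0)).
Hypothesis e_gt0 : forall t, t0 <= t -> 0 < eps ord0 t.
Hypothesis e_cvg0 : eps ord0 t @[t --> +oo] --> 0.
Hypothesis H2 : forall l, C0y D (smoothness varrho rho k l) (fl l).
Hypothesis H3 : forall l (w : mindex n), (mabs w <= smoothness varrho rho k l)%N ->
  exists M : R, forall p, D p -> `|pderm D w (fl l) p| <= M.
Hypothesis varpi_gt0 : 0 < varpi.
Hypothesis e_L1 : L1dom (fun t => e t `^ varpi).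
Hypothesis H6 : forall l (r : nat), 1 <= rho k - varrho l -> (1 <= r)%N ->
  r%:Z <= Num.floor (rho k - varrho l) -> intRp t0 1 (iter r (dI t0) (eps l)).
Hypothesis H7 : forall l, varrho l <= varpi * varrho ord0 ->
  [/\ C0y D (sl varrho varpi l + 2) (fl l),
      forall w : mindex n, (3 <= mabs w <= sl varrho varpi l + 2)%N ->
        exists M : R, forall p, D p -> `|pderm D w (fl l) p| <= M &
      forall w : mindex n, (1 <= mabs w <= sl varrho varpi l + 1)%N ->
        vecK K (fun t => pderm D w (fl l) (t, phi0 t))].
Variable phi : mono m.+1 -> R -> 'cV[R]_n.
Hypothesis phiC : forall nu, nu <> mset0 -> rank varrho nu <= rho k ->
  [/\ CI t0 1 (phi nu), forall i, exists M : R, forall t, t0 <= t -> `|phi nu t i 0| <= M &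
      forall t, t0 <= t -> dI t0 (phi nu) t = A *m phi nu t + gcoef D fl phi0 phi nu t].
Hypothesis phiK : forall nu, nu <> mset0 -> rank varrho nu <= rho k -> vecK K (phi nu).
Variable ML : seq (mono m.+1).
Hypothesis MLu : uniq ML.
Hypothesis MLP : forall nu, (nu \in ML) <-> (nu <> mset0 /\ rank varrho nu <= rho k).
Let s := psum t0 eps phi0 varrho rho phi k.
Let r00 : 0 < r0. Proof. exact: varrho_gt0. Qed.
Let varrho_ge l : r0 <= varrho l. Proof. exact: varrho_homo. Qed.
Let e_near : \forall t \near +oo, 0 < e t.
Proof. by apply/near_pinftyP; exists t0 => t; exact: e_gt0. Qed.

Lemma eps_contI0 l : contI t0 (eps l).
Proof. exact: (eps_contI H1_smooth (leq0n _) : contI t0 (iter 0 (dI t0) (eps l))). Qed.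

Lemma eps_bOrank l : bO e (varrho l / r0) (eps l).
Proof. by have := eps_bO H1_rank (leq0n (pkl varrho rho k l)); rewrite addr0. Qed.

Lemma eps_bO_one l : bO e 1 (eps l).
Proof. by apply: bO_le (eps_bOrank l) => //; rewrite ler_pdivlMr// mul1r. Qed.

Variable CL : seq (mindex m.+1).
Hypothesis CLu : uniq CL.
Hypothesis CLP : forall w, (w \in CL) <-> critical t0 eps varpi w.
Let inA := inA eps K CL.

Lemma ML_tame (nu : mono m.+1) x : nu \in ML -> x \in nu -> tame t0 eps x.
Proof.
move=> /MLP[nu0 nuk] xnu.
have xp := factor_lt a0 varrho_gt0 varrho_homo k_gt0 nuk xnu.
split.
  apply: (bO_nbounded e_gt0 e_cvg0 _ (eps_bO H1_rank (ltnW xp))).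
  by rewrite divr_ge0// ?addr_ge0// ltW.
have [->|x0] := posnP x.2; [by left|right].
have fx : x.2%:R <= rho k - varrho x.1.
  by move: (le_trans (rank_factor r00 varrho_ge xnu) nuk); rewrite /frank lerBrDl.
apply: intR1_L1dom; first exact: (eps_contI H1_smooth (ltnW xp)).
apply: H6 => //; first by apply: le_trans fx; rewrite ler1n.
by rewrite floor_ge_int.
Qed.

Lemma vterm_tame l w p : List.In p (vterm ML phi l w) -> multK K p.1 /\ forall x, x \in p.2 -> tame t0 eps x.
Proof.
have PM q q' : (multK K q.1 /\ forall x, x \in q.2 -> tame t0 eps x) -> (multK K q'.1 /\ forall x, x \in q'.2 -> tame t0 eps x) ->
   multK K (fun t => q.1 t * q'.1 t) /\ forall x, x \in msetD q.2 q'.2 -> tame t0 eps x.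
  move=> [q1 q2] [q1' q2']; split; first exact: multK_mul.
  by move=> x; rewrite in_msetD => /orP[/q2|/q2'].
have K1 : multK K (fun=> 1) by exact: (multK_const K3P).
apply: (@lmul_In _ _ _ _ (fun p => multK K p.1 /\ forall x, x \in p.2 -> tame t0 eps x)) => q q' [<-|//] H'.
apply: (PM _ _).
  split => // x; rewrite in_msetn => /andP[_ /eqP ->]; split => /=; last by left.
  apply: (bO_nbounded e_gt0 e_cvg0 _ (eps_bOrank l)); by rewrite divr_ge0// ltW.
move: q' H'; apply: powL_In; [by split => // x; rewrite in_mset0|exact: PM|].
move=> b j bM; have [b0 bk] := (MLP b).1 bM; split; first exact/(multK_K K3P)/phiK.
by move=> x; exact: ML_tame.
Qed.

Lemma pders_near_bounded l j : exists M : R, \forall t \near +oo, `|pders D [:: j] (fl l) (t, s t)| <= M.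
Proof.
have [B B0 HB] := pders_estimates a0 (H2 l) (@H3 l).
have s_box := psum_box a0 varrho_gt0 varrho_homo rhoP k_gt0 H1_rank e_gt0 e_cvg0 phiC MLu MLP.
exists B; near=> t.
have tt : t0 <= t by near: t; apply/near_pinftyP; exists t0.
have [h _ _ _] := HB t tt; apply: h; first by rewrite /smoothness; move: (qkl _ _ _ _) => z /=; lia.
by near: t.
Unshelve. all: by end_near. Qed.

(** If [varrho l] exceeds [varpi * varrho ord0], then [eps l] itself is integrable. Otherwise the
    derivative of [f_l] is expanded around [phi0] to the order [sl] of hypothesis 7, which is just
    enough for the remainder times [eps l] to be O(e^varpi). *)
Lemma jac_inA l i j : inA (fun t => eps l t * pder D j (fl l) (t, s t) i 0).
Proof.
have AL1 g : L1dom g -> inA g by exact: (inA_L1 _ K3P).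
have [lv|vl] := leP (varrho l) (varpi * r0); last first.
  apply: AL1; have eL : L1dom (eps l).
    apply: (bO_L1 e_gt0 e_cvg0 e_L1 _ (eps_bOrank l)); by rewrite ler_pdivlMr// ltW.
  apply: (@L1dom_ext _ (fun t => pder D j (fl l) (t, s t) i 0 * eps l t)); last by exists t0 => t _; rewrite mulrC.
  apply: L1dom_nb => //; have [M H] := pders_near_bounded l j; exists M; near=> t.
  by apply: le_trans (mx_norm_entry _ _ _) _; near: t.
have [FC FB FK] := H7 lv.
pose sL := sl varrho varpi l.
have FB' (w : mindex n) : (mabs w <= sL + 2)%N -> exists M : R, forall p, D p -> `|pderm D w (fl l) p| <= M.
  move=> wq; have [w3|w3] := leqP 3 (mabs w); first by apply: FB; rewrite w3.
  by apply: H3; apply: leq_trans (_ : 2 <= _)%N => //; rewrite /smoothness; move: (qkl _ _ _ _) => z; lia.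
have [B B0 HB] := pders_estimates a0 FC FB'.
have s_phi0 := psum_sub_phi0 a0 varrho_gt0 varrho_homo rhoP k_gt0 H1_rank e_gt0 e_cvg0 phiC MLu MLP.
have s_box := psum_box a0 varrho_gt0 varrho_homo rhoP k_gt0 H1_rank e_gt0 e_cvg0 phiC MLu MLP.
have pb t : box (phi0 t) a (phi0 t) by rewrite /box subrr normr0.
pose tw t w := pders D (flatw (enum 'I_n) w ++ [:: j]) (fl l) (t, phi0 t).
have twK w : w \in wlist (enum 'I_n) sL -> K (fun t => tw t w i 0).
  rewrite wlist_mem ?enum_uniq// => /andP[wq _].
  (* Hypothesis 7 speaks of derivatives in the order of [pderm], while here the derivative along [j]
     is taken first; [w'] is the multi-index of the reordered word. *)
  pose w' := wcount (flatw (enum 'I_n) w ++ [:: j]).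
  have sw : size (flatw (enum 'I_n) w ++ [:: j]) = (mabs w + 1)%N.
    by rewrite size_cat size_flatw ?enum_uniq// => x; rewrite mem_enum.
  have w'q : mabs w' = (mabs w + 1)%N by rewrite mabs_wcount.
  apply: (K3_ext K3P (FK w' _ i)); first by rewrite w'q; move: wq; rewrite -/sL; lia.
  move=> t tt; rewrite pderm_flatw /tw; congr (fun_of_matrix _ i 0); apply/esym.
  apply: (pders_perm a0 FC tt _ (perm_wcount _) (pb t)).
  by rewrite sw; move: wq; rewrite -/sL; lia.
have mainA : inA (fun t => \sum_(w <- wlist (enum 'I_n) sL) (eps l t * hpow (s t - phi0 t) w) * tw t w i 0).
  apply: (inA_sum K3P) => w /In_mem wL.
  apply: (@inA_ext _ _ eps K CL (fun t => \sum_(p <- vterm ML phi l w) mval t0 eps p.2 t * (p.1 t * ((mfact w)%:R^-1 * tw t w i 0)))); last first.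
    exists t0 => t _; rewrite (eps_hpow t0 phi0 eps rhoP k_gt0 phi MLu MLP) /ev mulr_sumr mulr_suml.
    by apply: eq_bigr => p _; ring.
  apply: (inA_sum K3P) => p pL; have [pK px] := vterm_tame pL.
  apply: (inA_mval K3P e_gt0 e_cvg0 eps_contI0 eps_bO_one e_L1 CLu CLP) => //.
    move=> p0; have := vterm_rank r00 varrho_ge (fun b hb => ((MLP b).1 hb).1) pL.
    rewrite p0 rank0 leNgt => /negP; apply.
    by rewrite ltr_wpDr ?mulr_ge0// ltW.
  by apply: pK; apply: (K3_scale K3P); exact: twK.
have restL : L1dom (fun t => eps l t * (pder D j (fl l) (t, s t) i 0 - \sum_(w <- wlist (enum 'I_n) sL) hpow (s t - phi0 t) w * tw t w i 0)).
  have f0 : 0 <= Num.floor (varpi - varrho l / r0) by rewrite floor_ge0 subr_ge0 ler_pdivrMr.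
  have vle : varpi <= varrho l / r0 + sL.+1%:R.
    rewrite -lerBlDl ltW//; apply: lt_le_trans (floorD1_gt _) _.
    by rewrite /sL /sl -addn1 natrD -{1}(gez0_abs f0) intrD.
  apply: (bO_L1 e_gt0 e_cvg0 e_L1 vle).
  apply: (@bOZ _ _ e_near R^o _ _ (eps l)); first exact: eps_bOrank.
  have [M M0 HM] := bO_pos s_phi0.
  exists (B * M ^+ sL.+1); near=> t.
  have tt : t0 <= t by near: t; apply/near_pinftyP; exists t0.
  have sb : box (phi0 t) a (s t) by near: t.
  have h : `|s t - phi0 t| <= M * e t `^ 1 by near: t.
  have [_ _ _ T] := HB t tt.
  have sq : (sL + size [:: j] < sl varrho varpi l + 2)%N by rewrite /= -/sL addn1 addn2.
  have T' := T (phi0 t) (s t) [:: j] sL sq (pb t) sb.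
  apply: (@le_trans _ _ (B * `|s t - phi0 t| ^+ sL.+1)).
    apply: le_trans T'; apply: le_trans (mx_norm_entry _ i 0).
    rewrite !mxE summxE le_eqVlt; apply/orP; left; apply/eqP; congr (`|_ - _|).
    by apply: eq_bigr => w _; rewrite !mxE.
  rewrite -mulrA ler_wpM2l// powR_mulrn; last by rewrite ltW// e_gt0.
  rewrite -exprMn lerXn2r ?nnegrE ?mulr_ge0//; last by move: h; rewrite powRr1// ltW// e_gt0.
  by rewrite ltW// e_gt0.
apply: inA_ext (inA_add K3P mainA (AL1 _ restL)) _.
exists t0 => t _; rewrite mulrBr mulr_sumr addrCA -[RHS]addr0; congr (_ + _).
by rewrite -sumrB big1// => w _; rewrite mulrA subrr.
Unshelve. all: by end_near. Qed.

Lemma Ahat_inA i j : inA (fun t => Ahat A D eps fl s t i j - A i j).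
Proof.
apply: (@inA_ext _ _ eps K CL (fun t => \sum_(l <- index_enum 'I_m.+1) eps l t * pder D j (fl l) (t, s t) i 0)).
  by apply: (inA_sum K3P) => l _; exact: jac_inA.
exists t0 => t _; rewrite /Ahat !mxE summxE addrAC subrr add0r.
by apply: eq_bigr => l _; rewrite !mxE.
Qed.

End JacobianExpansion.

(** * Averaging *)

Section ComplexAveraging.
Variables (R : realType) (n m : nat) (t0 : R) (lam : 'I_n -> R[i]) (K : set (R -> R)).
Local Notation C := R[i].
Hypothesis K3P : K3_class t0 lam K.
Variable CL : seq (mindex m.+1).
Hypothesis CL_gt0 : forall w, w \in CL -> (1 <= mabs w)%N.
Variable H : mindex m.+1 -> R -> 'M[C]_n.

Definition mxK (M : R -> 'M[C]_n) := forall i j, reIm K (fun t => M t i j).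
Hypothesis HK : forall w, mxK (H w).

(* The coefficient of mu_w when X = 1 + sum_u mu_u P_u is required to reduce L0 + sum_u mu_u H_u
   to L0 + sum_u mu_u G_u. *)
Definition order_term (P G : mindex m.+1 -> R -> 'M[C]_n) w t : 'M[C]_n :=
  H w t + \sum_(u <- CL) \sum_(v <- CL | addw u v == w) (H u t *m P v t - P u t *m G v t).

Lemma mxK_mul (M N : R -> 'M[C]_n) : mxK M -> mxK N -> mxK (fun t => M t *m N t).
Proof.
move=> MK NK i j; have := @KC_sum _ _ _ _ _ K3P _ (index_enum 'I_n) (fun k t => M t i k * N t k j) (fun k _ => KC_mul K3P (MK i k) (NK k j)).
by congr reIm; apply/funext => t; rewrite mxE.
Qed.

Lemma mxK_add (M N : R -> 'M[C]_n) : mxK M -> mxK N -> mxK (fun t => M t + N t).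
Proof.
move=> MK NK i j; have := KC_add K3P (MK i j) (NK i j).
by congr reIm; apply/funext => t; rewrite mxE.
Qed.

Lemma mxK_scale c (M : R -> 'M[C]_n) : mxK M -> mxK (fun t => c *: M t).
Proof.
by move=> MK i j; have := KC_scale K3P c (MK i j); congr reIm; apply/funext => t; rewrite mxE.
Qed.

Lemma mxK0 : mxK (fun=> 0).
Proof. by move=> i j; have := KC_zero K3P; congr reIm; apply/funext => t; rewrite mxE. Qed.

Lemma mxK_sum (I : Type) (r : seq I) (P : pred I) (F : I -> R -> 'M[C]_n) : (forall i, mxK (F i)) ->
  mxK (fun t => \sum_(i <- r | P i) F i t).
Proof.
move=> FK; elim: r => [|x r IH].
  have -> : (fun t => \sum_(i <- [::] | P i) F i t) = (fun=> 0) by apply/funext => t; rewrite big_nil.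
  exact: mxK0.
have -> : (fun t => \sum_(i <- x :: r | P i) F i t) = if P x then (fun t => F x t + \sum_(i <- r | P i) F i t) else (fun t => \sum_(i <- r | P i) F i t).
  by apply/funext => t; rewrite big_cons; case: (P x).
by case: (P x) => //; exact: mxK_add.
Qed.

Lemma order_term_K P G w : (forall v, mxK (P v)) -> (forall v, mxK (G v)) -> mxK (order_term P G w).
Proof.
move=> PK GK; apply: mxK_add => //; apply: mxK_sum => u; apply: mxK_sum => v.
have := mxK_add (mxK_mul (HK u) (PK v)) (mxK_scale (-1) (mxK_mul (PK u) (GK v))).
by congr mxK; apply/funext => t; rewrite scaleN1r.
Qed.

Definition diag_part (M : 'M[C]_n) : 'M[C]_n := \matrix_(i, j) (if i == j then M i j else 0).

Lemma mxK_diag (M : R -> 'M[C]_n) : mxK M -> mxK (fun t => diag_part (M t)).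
Proof.
move=> MK i j; have [ij|ij] := eqVneq i j.
  by have := MK i j; congr reIm; apply/funext => t; rewrite mxE ij eqxx.
by have := KC_zero K3P; congr reIm; apply/funext => t; rewrite mxE (negbTE ij).
Qed.

(** Off the diagonal the coefficient [lam i - lam j] belongs to [Delta], so the class [K] provides a
    solution. On the diagonal [P] is 0 and the whole of [F] is left as [diag_part]. *)
Lemma solve_offdiagonal (F : R -> 'M[C]_n) : mxK F -> exists2 P : R -> 'M[C]_n, mxK P &
  forall i j t, t0 <= t -> dcvgC `[t0, +oo[ (fun t => P t i j) t
    ((lam i - lam j) * P t i j + F t i j - diag_part (F t) i j).
Proof.
move=> FK.
have /choice[p Hp] : forall ij : 'I_n * 'I_n, exists p : R -> C, reIm K p /\ forall t, t0 <= t ->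
    dcvgC `[t0, +oo[ p t ((lam ij.1 - lam ij.2) * p t + F t ij.1 ij.2 - diag_part (F t) ij.1 ij.2).
  move=> [i j] /=; have [ij|ij] := eqVneq i j.
    exists (fun=> 0); split; first exact: (KC_zero K3P).
    move=> t tt; rewrite ij mulr0 add0r mxE eqxx subrr; split; exact: dcvg_cst.
  have [p pK pE] := K_solveC K3P (FK i j) (or_intror (ex_intro _ i (ex_intro _ j (conj ij erefl)))).
  exists p; split => // t tt; rewrite mxE (negbTE ij) subr0; exact: pE.
exists (fun t => \matrix_(i, j) p (i, j) t).
  by move=> i j; have [h _] := Hp (i, j); move: h; congr reIm; apply/funext => t; rewrite mxE.
move=> i j t tt; have [_ /(_ t tt) h] := Hp (i, j); rewrite mxE; move: h => /=.
congr dcvgC; by apply/funext => u; rewrite mxE.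
Qed.

(** Recursion on the size of [w]: [order_term] at [w] involves pairs with u + v = w, and both are
    strictly smaller because critical indices are nonzero. *)
Theorem averaging_coefficients : exists P G : mindex m.+1 -> R -> 'M[C]_n,
  [/\ forall w, mxK (P w), forall w, mxK (G w),
     forall w t, w \in CL -> G w t = diag_part (order_term P G w t) &
     forall w i j t, w \in CL -> t0 <= t -> dcvgC `[t0, +oo[ (fun t => P w t i j) t
       ((lam i - lam j) * P w t i j + order_term P G w t i j - G w t i j)].
Proof.
have step N : exists P G : mindex m.+1 -> R -> 'M[C]_n,
  [/\ forall w, mxK (P w), forall w, mxK (G w),
     forall w t, w \in CL -> (mabs w < N)%N -> G w t = diag_part (order_term P G w t) &
     forall w i j t, w \in CL -> (mabs w < N)%N -> t0 <= t -> dcvgC `[t0, +oo[ (fun t => P w t i j) t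
       ((lam i - lam j) * P w t i j + order_term P G w t i j - G w t i j)].
  elim: N => [|N [P [G [PK GK GE PE]]]].
    by exists (fun _ _ => 0), (fun _ _ => 0); split => // *; exact: mxK0.
  have /choice[P' HP'] : forall w, exists P' : R -> 'M[C]_n, mxK P' /\ forall i j t, t0 <= t -> dcvgC `[t0, +oo[ (fun t => P' t i j) t
    ((lam i - lam j) * P' t i j + order_term P G w t i j - diag_part (order_term P G w t) i j).
    by move=> w; have [P' h1 h2] := solve_offdiagonal (order_term_K w PK GK); exists P'.
  pose Pn w t := if (mabs w < N)%N then P w t else P' w t.
  pose Gn w t := if (mabs w < N)%N then G w t else diag_part (order_term P G w t).
  have oE w t : (mabs w <= N)%N -> order_term Pn Gn w t = order_term P G w t.
    move=> wN; rewrite /order_term; congr (_ + _); apply: eq_big_seq => u uC.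
    rewrite big_seq_cond [RHS]big_seq_cond; apply: eq_bigr => v /andP[vC /eqP uv].
    have uv' : mabs w = (mabs u + mabs v)%N by rewrite -mabs_addw uv.
    have u1 := CL_gt0 uC; have v1 := CL_gt0 vC.
    have uN : (mabs u < N)%N by apply: leq_trans wN; rewrite uv' -addn1 leq_add2l.
    have vN : (mabs v < N)%N by apply: leq_trans wN; rewrite uv' -add1n leq_add2r.
    by rewrite /Pn /Gn uN vN.
  exists Pn, Gn; split.
  - move=> w i j; rewrite /Pn; case: (mabs w < N)%N; first exact: PK.
    by have [h _] := HP' w; exact: h.
  - move=> w i j; rewrite /Gn; case: (mabs w < N)%N; first exact: GK.
    exact: mxK_diag (order_term_K w PK GK) i j.
  - move=> w t wC wN; rewrite oE// {1}/Gn; case: (ltnP (mabs w) N) => // h; exact: GE.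
  move=> w i j t wC wN tt; rewrite oE// /Gn /Pn; case: (ltnP (mabs w) N) => h; first exact: PE.
  by have [_] := HP' w; apply.
pose N := (\max_(w <- CL) mabs w).+1.
have [P [G [PK GK GE PE]]] := step N.
have wN w : w \in CL -> (mabs w < N)%N by move=> wC; rewrite ltnS; exact: leq_bigmax_seq.
by exists P, G; split => // [w t wC|w i j t wC tt]; [apply: GE|apply: PE] => //; exact: wN.
Qed.
End ComplexAveraging.

(** * Complex matrices as real block matrices *)

Section ComplexBlocks.
Variable R : realType.
Local Notation C := R[i].

(** Multiplication by a + ib in real coordinates; this embedding is additive and multiplicative, and
    takes a real matrix to two diagonal copies of it. *)
Definition cmx (p q : nat) (M : 'M[C]_(p, q)) : 'M[R]_(p + p, q + q) :=
  block_mx (map_mx (@complex.Re R) M) (- map_mx (@complex.Im R) M) (map_mx (@complex.Im R) M) (map_mx (@complex.Re R) M).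

Lemma cmxM (p q r : nat) (M : 'M[C]_(p, q)) (N : 'M[C]_(q, r)) : cmx (M *m N) = cmx M *m cmx N.
Proof.
rewrite /cmx mulmx_block !mulNmx !mulmxN.
have hR : map_mx (@complex.Re R) (M *m N) = map_mx (@complex.Re R) M *m map_mx (@complex.Re R) N - map_mx (@complex.Im R) M *m map_mx (@complex.Im R) N.
  apply/matrixP => i j; rewrite !mxE Re_sum -sumrB; apply: eq_bigr => k _; by rewrite !mxE ReM.
have hI : map_mx (@complex.Im R) (M *m N) = map_mx (@complex.Im R) M *m map_mx (@complex.Re R) N + map_mx (@complex.Re R) M *m map_mx (@complex.Im R) N.
  apply/matrixP => i j; rewrite !mxE Im_sum -big_split /=; apply: eq_bigr => k _.
  by rewrite !mxE ImM addrC.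
by rewrite hR hI opprD addrC; congr block_mx; rewrite addrC.
Qed.

Lemma cmxD (p q : nat) (M N : 'M[C]_(p, q)) : cmx (M + N) = cmx M + cmx N.
Proof.
have hR : map_mx (@complex.Re R) (M + N) = map_mx (@complex.Re R) M + map_mx (@complex.Re R) N by apply/matrixP => i j; rewrite !mxE ReD.
have hI : map_mx (@complex.Im R) (M + N) = map_mx (@complex.Im R) M + map_mx (@complex.Im R) N by apply/matrixP => i j; rewrite !mxE ImD.
by rewrite /cmx hR hI opprD add_block_mx.
Qed.

Lemma cmxN (p q : nat) (M : 'M[C]_(p, q)) : cmx (- M) = - cmx M.
Proof.
have hR : map_mx (@complex.Re R) (- M) = - map_mx (@complex.Re R) M by apply/matrixP => i j; rewrite !mxE ReN.
have hI : map_mx (@complex.Im R) (- M) = - map_mx (@complex.Im R) M by apply/matrixP => i j; rewrite !mxE ImN.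
by rewrite /cmx hR hI opp_block_mx.
Qed.

Lemma cmxB (p q : nat) (M N : 'M[C]_(p, q)) : cmx (M - N) = cmx M - cmx N.
Proof. by rewrite cmxD cmxN. Qed.

Lemma cmx0 (p q : nat) : cmx (0 : 'M[C]_(p, q)) = 0.
Proof. by apply: (addrI (cmx 0)); rewrite -cmxD !addr0. Qed.

Lemma cmx_sum (p q : nat) (I : Type) (r : seq I) (P : pred I) (F : I -> 'M[C]_(p, q)) :
  cmx (\sum_(i <- r | P i) F i) = \sum_(i <- r | P i) cmx (F i).
Proof. by apply: (big_morph _ (@cmxD p q) (@cmx0 p q)). Qed.

Lemma cmx_real (p q : nat) (M : 'M[R]_(p, q)) : cmx (map_mx (real_complex R) M) = block_mx M 0 0 M.
Proof.
have hR : map_mx (@complex.Re R) (map_mx (real_complex R) M) = M by apply/matrixP => i j; rewrite !mxE.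
have hI : map_mx (@complex.Im R) (map_mx (real_complex R) M) = 0 by apply/matrixP => i j; rewrite !mxE.
by rewrite /cmx hR hI oppr0.
Qed.

Lemma cmx1 (p : nat) : cmx (1%:M : 'M[C]_p) = 1%:M.
Proof.
have -> : (1%:M : 'M[C]_p) = map_mx (real_complex R) 1%:M by apply/matrixP => i j; rewrite !mxE; case: eqP.
by rewrite cmx_real -scalar_mx_block.
Qed.

Lemma cmxZ (p q : nat) (c : R) (M : 'M[C]_(p, q)) : cmx (real_complex R c *: M) = c *: cmx M.
Proof.
have hR : map_mx (@complex.Re R) (real_complex R c *: M) = c *: map_mx (@complex.Re R) M.
  by apply/matrixP => i j; rewrite !mxE ReM /= mul0r subr0.
have hI : map_mx (@complex.Im R) (real_complex R c *: M) = c *: map_mx (@complex.Im R) M.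
  by apply/matrixP => i j; rewrite !mxE ImM /= mul0r addr0.
by rewrite /cmx hR hI scale_block_mx scalerN.
Qed.

Lemma cmx_entries (p q : nat) (T : Type) (Q : (T -> R) -> Prop) (M : T -> 'M[C]_(p, q)) :
  (forall g, Q g -> Q (fun t => - g t)) -> (forall i j, Q (fun t => complex.Re (M t i j))) -> (forall i j, Q (fun t => complex.Im (M t i j))) ->
  forall i j, Q (fun t => cmx (M t) i j).
Proof.
move=> QN QR QI i j; case: (split_ordP i) => i' ->; case: (split_ordP j) => j' ->.
- by have := QR i' j'; congr Q; apply/funext => t; rewrite block_mxEul mxE.
- by have := QN _ (QI i' j'); congr Q; apply/funext => t; rewrite block_mxEur !mxE.
- by have := QI i' j'; congr Q; apply/funext => t; rewrite block_mxEdl mxE.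
by have := QR i' j'; congr Q; apply/funext => t; rewrite block_mxEdr mxE.
Qed.
End ComplexBlocks.

(** * Derivatives, integrability and inverses of matrix functions *)

Section MatrixCalculus.
Variable R : realType.

Definition mder (p q : nat) (M : R -> 'M[R]_(p, q)) (t : R) (L : 'M[R]_(p, q)) :=
  forall i j, is_derive t 1 (fun u => M u i j) (L i j).

Lemma mderD p q (M N : R -> 'M[R]_(p, q)) t a b : mder M t a -> mder N t b -> mder (fun u => M u + N u) t (a + b).
Proof.
move=> Ma Nb i j; apply: is_derive_eq (der_ext _ (derD (Ma i j) (Nb i j))) _; last by rewrite mxE.
by move=> u; rewrite mxE.
Qed.

Lemma mder_cst p q (M : 'M[R]_(p, q)) t : mder (fun=> M) t 0.
Proof. by move=> i j; rewrite mxE; exact: derc. Qed.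

Lemma mderM p q r (M : R -> 'M[R]_(p, q)) (N : R -> 'M[R]_(q, r)) t a b : mder M t a -> mder N t b ->
  mder (fun u => M u *m N u) t (a *m N t + M t *m b).
Proof.
move=> Ma Nb i j.
have h : is_derive t 1 (fun u => \sum_k M u i k * N u k j) (\sum_k (a i k * N t k j + M t i k * b k j)).
  by apply: der_sum => k _; apply: derM; [exact: Ma|exact: Nb].
apply: is_derive_eq (der_ext _ h) _; first by move=> u; rewrite mxE.
by rewrite big_split /= !mxE.
Qed.

Lemma mderZ p q (f : R -> R) (M : R -> 'M[R]_(p, q)) (t df : R) a : is_derive t 1 f df -> mder M t a ->
  mder (fun u => f u *: M u) t (df *: M t + f t *: a).
Proof.
move=> fd Ma i j; apply: is_derive_eq (der_ext _ (derM fd (Ma i j))) _; first by move=> u; rewrite mxE.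
by rewrite !mxE.
Qed.

Lemma mder_sum p q (I : eqType) (r : seq I) (M : I -> R -> 'M[R]_(p, q)) t (L : I -> 'M[R]_(p, q)) :
  (forall i, i \in r -> mder (M i) t (L i)) -> mder (fun u => \sum_(i <- r) M i u) t (\sum_(i <- r) L i).
Proof.
elim: r => [|x r IH] H.
  have -> : (fun u => \sum_(i <- [::]) M i u) = (fun=> 0) by apply/funext => u; rewrite big_nil.
  by rewrite big_nil; exact: mder_cst.
have -> : (fun u => \sum_(i <- x :: r) M i u) = (fun u => M x u + \sum_(i <- r) M i u).
  by apply/funext => u; rewrite big_cons.
rewrite big_cons; apply: mderD; first exact: H (mem_head _ _).
by apply: IH => i ir; apply: H; rewrite inE ir orbT.
Qed.

Definition mL1 (p q : nat) (M : R -> 'M[R]_(p, q)) := forall i j, L1dom (fun t => M t i j).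

Lemma nbounded_entry p q (M : R -> 'M[R]_(p, q)) i j : nbounded M -> nbounded ((fun t => M t i j) : R -> R^o).
Proof.
by move=> [c H]; exists c; near=> t; apply: le_trans (mx_norm_entry _ _ _) _; near: t.
Unshelve. all: by end_near. Qed.

Lemma nbounded_mx p q (M : R -> 'M[R]_(p, q)) : (forall i j, nbounded ((fun t => M t i j) : R -> R^o)) -> nbounded M.
Proof.
move=> H; have /choice[c Hc] : forall ij : 'I_p * 'I_q, exists c : R, \forall t \near +oo, `|M t ij.1 ij.2| <= c.
  by move=> [i j]; exact: H.
have {}Hc : \forall t \near +oo, forall ij, `|M t ij.1 ij.2| <= c ij by apply: filter_forall.
exists (\sum_ij `|c ij|); near=> t; apply: mx_norm_leP => [|i j]; first by rewrite sumr_ge0.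
have h : forall ij, `|M t ij.1 ij.2| <= c ij by near: t.
apply: le_trans (h (i, j)) _; apply: le_trans (ler_norm _) _.
by rewrite (bigD1 (i, j))//= lerDl sumr_ge0.
Unshelve. all: by end_near. Qed.

Lemma mx_nboundedM p q r (M : R -> 'M[R]_(p, q)) (N : R -> 'M[R]_(q, r)) : nbounded M -> nbounded N -> nbounded (fun t => M t *m N t).
Proof.
move=> [c H] [c' H']; exists (q%:R * `|c| * c'); near=> t.
apply: le_trans (mx_norm_mul _ _) _; apply: ler_pM => //; last by near: t.
by rewrite ler_wpM2l//; apply: le_trans (ler_norm c); near: t.
Unshelve. all: by end_near. Qed.

Lemma mx_nboundedD p q (M N : R -> 'M[R]_(p, q)) : nbounded M -> nbounded N -> nbounded (fun t => M t + N t).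
Proof.
by move=> [c H] [c' H']; exists (c + c'); near=> t; apply: le_trans (ler_normD _ _) _; apply: lerD; near: t.
Unshelve. all: by end_near. Qed.

Lemma mx_nbounded_cst p q (M : 'M[R]_(p, q)) : nbounded (fun=> M).
Proof. by exists `|M|; near=> t. Unshelve. all: by end_near. Qed.

Lemma mL1D p q (M N : R -> 'M[R]_(p, q)) : mL1 M -> mL1 N -> mL1 (fun t => M t + N t).
Proof.
move=> ML NL i j; apply: L1dom_ext (L1domD (ML i j) (NL i j)) _.
by exists 0 => t _; rewrite mxE.
Qed.

Lemma mL1Mr p q r (M : R -> 'M[R]_(p, q)) (N : R -> 'M[R]_(q, r)) : mL1 M -> nbounded N -> mL1 (fun t => M t *m N t).
Proof.
move=> ML NB i j; apply: (@L1dom_ext _ (fun t => \sum_k N t k j * M t i k)).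
  by apply: L1dom_sum => k _; apply: L1dom_nb => //; exact: nbounded_entry.
by exists 0 => t _; rewrite mxE; apply: eq_bigr => k _; rewrite mulrC.
Qed.

Lemma mL1Ml p q r (M : R -> 'M[R]_(p, q)) (N : R -> 'M[R]_(q, r)) : nbounded M -> mL1 N -> mL1 (fun t => M t *m N t).
Proof.
move=> MB NL i j; apply: (@L1dom_ext _ (fun t => \sum_k M t i k * N t k j)).
  by apply: L1dom_sum => k _; apply: L1dom_nb => //; exact: nbounded_entry.
by exists 0 => t _; rewrite mxE.
Qed.

Lemma mL1Z p q f (M : R -> 'M[R]_(p, q)) : L1dom f -> nbounded M -> mL1 (fun t => f t *: M t).
Proof.
move=> fL MB i j; apply: (@L1dom_ext _ (fun t => M t i j * f t)); last by exists 0 => t _; rewrite mxE mulrC.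
by apply: L1dom_nb => //; exact: nbounded_entry.
Qed.

Lemma mL1_sum p q (I : eqType) (r : seq I) (P : pred I) (M : I -> R -> 'M[R]_(p, q)) :
  (forall i, i \in r -> P i -> mL1 (M i)) -> mL1 (fun t => \sum_(i <- r | P i) M i t).
Proof.
move=> H i j; apply: (@L1dom_ext _ (fun t => \sum_(k <- r | (k \in r) && P k) M k t i j)).
  by apply: L1dom_sum => k /andP[kr Pk]; exact: H.
by exists 0 => t _; rewrite summxE [RHS]big_seq_cond.
Qed.

Lemma mL1_ext p q (M N : R -> 'M[R]_(p, q)) : mL1 M -> (exists T, forall t, T <= t -> M t = N t) -> mL1 N.
Proof. by move=> ML [T H] i j; apply: L1dom_ext (ML i j) _; exists T => t tt; rewrite H. Qed.

(** The factor [p] is the constant of submultiplicativity of the maximum norm. A kernel vector would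
    satisfy |v| <= |v| / 2, and the inverse satisfies Y = 1 - M Y. *)
Lemma near_identity_inv p (M : 'M[R]_p) : p%:R * `|M| <= 1 / 2 -> 1%:M + M \in unitmx /\ `|invmx (1%:M + M)| <= 2.
Proof.
move=> Mh.
have u : 1%:M + M \in unitmx.
  rewrite -row_free_unit -kermx_eq0; apply/rowV0P => v /sub_kermxP.
  rewrite mulmxDr mulmx1 => /eqP; rewrite addr_eq0 => /eqP vE.
  have : `|v| <= `|v| * (1 / 2).
    rewrite {1}vE normrN; apply: le_trans (mx_norm_mul _ _) _.
    by rewrite mulrAC mulrC ler_wpM2l.
  rewrite mulrC => h; apply/eqP; rewrite -normr_le0; move: h; lra.
split => //; set Y := invmx _.
have YE : Y = 1%:M - M *m Y.
  have : (1%:M + M) *m Y = 1%:M by rewrite mulmxV.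
  by rewrite mulmxDl mul1mx => <-; rewrite addrK.
have n1 : `|1%:M : 'M[R]_p| <= 1.
  by apply: mx_norm_leP => // i j; rewrite mxE; case: eqP => _; rewrite ?normr1 ?normr0.
have : `|Y| <= 1 + 1 / 2 * `|Y|.
  rewrite {1}YE; apply: le_trans (ler_normB _ _) _; apply: lerD => //.
  by apply: le_trans (mx_norm_mul _ _) _; rewrite ler_wpM2r.
by lra.
Qed.

Lemma contI_inv t1 (g : R -> R) : contI t1 g -> (forall t, t1 <= t -> g t != 0) -> contI t1 (fun t => (g t)^-1).
Proof.
move=> gc g0 t; apply: cvgV; last exact: gc.
by apply: g0; rewrite le_max lexx orbT.
Qed.

Lemma contI_det p t1 (M : R -> 'M[R]_p) : contI t1 M -> contI t1 (fun t => \det (M t)).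
Proof.
move=> /mx_contI Mc; apply: contI_sum => u _; apply: contIZ; apply: contI_prod => i _; exact: Mc.
Qed.

Lemma contI_invmx p t1 (M : R -> 'M[R]_p) : contI t1 M -> (forall t, t1 <= t -> M t \in unitmx) -> contI t1 (fun t => invmx (M t)).
Proof.
move=> Mc Mu.
have h : contI t1 (fun t => (\det (M t))^-1 *: \adj (M t)).
  apply: contI_mxZ; first by apply: contI_inv; [exact: contI_det|move=> t tt; have := Mu t tt; rewrite unitmxE unitfE].
  apply/mx_contI => i j.
  have -> : (fun t => (\adj (M t)) i j) = (fun t => (-1) ^+ (j + i) * \det (row' j (col' i (M t)))).
    by apply/funext => t; rewrite mxE.
  apply: contIZ; apply: contI_det; apply/mx_contI => i' j'.
  have /mx_contI/(_ (lift j i') (lift i j')) := Mc.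
  by congr contI; apply/funext => t; rewrite !mxE.
rewrite /contI; suff -> : (fun t => invmx (M (Num.max t t1))) = (fun t => (\det (M (Num.max t t1)))^-1 *: \adj (M (Num.max t t1))) by exact: h.
by apply/funext => u; rewrite /invmx Mu // le_max lexx orbT.
Qed.
End MatrixCalculus.

Lemma contIN (R : realType) (t1 : R) (g : R -> R) : contI t1 g -> contI t1 (fun t => - g t).
Proof. by move=> gc t; apply: cvgN; exact: gc. Qed.

Lemma contI_mulmxl (R : realType) (t1 : R) p q r (M : 'M[R]_(p, q)) (F : R -> 'M[R]_(q, r)) :
  contI t1 F -> contI t1 (fun t => M *m F t).
Proof. by move=> Fc; apply: contI_mulmx; [exact: contIc|exact: Fc]. Qed.

Lemma contI_mulmxr (R : realType) (t1 : R) p q r (M : 'M[R]_(q, r)) (F : R -> 'M[R]_(p, q)) :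
  contI t1 F -> contI t1 (fun t => F t *m M).
Proof. by move=> Fc; apply: contI_mulmx; [exact: Fc|exact: contIc]. Qed.

(** * The near-identity transformation *)

Section NearIdentity.
Variables (R : realType) (m N : nat) (t0 : R) (eps : 'I_m.+1 -> R -> R) (CL : seq (mindex m.+1)).
Hypothesis CLu : uniq CL.
Hypothesis mu_c : forall w, contI t0 (mu eps w).
Hypothesis mu_nb : forall w, nbounded (mu eps w : R -> R^o).
Hypothesis mu0 : forall w, w \in CL -> mu eps w t @[t --> +oo] --> 0.
Hypothesis dmuP : forall w, w \in CL -> exists dmu : R -> R,
  [/\ forall t, t0 < t -> is_derive t 1 (mu eps w) (dmu t), contI t0 dmu & L1dom dmu].
Hypothesis muL1 : forall u v, u \in CL -> v \in CL -> addw u v \notin CL -> L1dom (mu eps (addw u v)).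
Variables (L0 : 'M[R]_N) (P Hh G : mindex m.+1 -> R -> 'M[R]_N).
Hypothesis Pc : forall w, contI t0 (P w).
Hypothesis Hc : forall w, contI t0 (Hh w).
Hypothesis Gc : forall w, contI t0 (G w).
Hypothesis Pb : forall w, nbounded (P w).
Hypothesis Hb : forall w, nbounded (Hh w).
Hypothesis Gb : forall w, nbounded (G w).
Definition bil u v t := Hh u t *m P v t - P u t *m G v t.
Let Pdot w t := L0 *m P w t - P w t *m L0 + (Hh w t + \sum_(u <- CL) \sum_(v <- CL | addw u v == w) bil u v t) - G w t.
Hypothesis Pder : forall w t, w \in CL -> t0 < t -> mder (P w) t (Pdot w t).
Variables (tB : R) (B : R -> 'M[R]_N).
Hypothesis tB0 : t0 < tB.
Hypothesis Bc : contI tB B.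
Let Lb t := B t - L0 - \sum_(w <- CL) mu eps w t *: Hh w t.
Hypothesis LbL1 : mL1 Lb.

Lemma bil_nbounded u v : nbounded (bil u v).
Proof.
have [c H] := mx_nboundedM (Hb u) (Pb v); have [c' H'] := mx_nboundedM (Pb u) (Gb v).
by exists (c + c'); near=> t; apply: le_trans (ler_normB _ _) _; apply: lerD; near: t.
Unshelve. all: by end_near. Qed.

Let X t := 1%:M + \sum_(w <- CL) mu eps w t *: P w t.
Let Gam t := \sum_(w <- CL) mu eps w t *: G w t.

(** The derivatives [Pdot] are chosen to cancel everything that carries a critical product. What
    remains is integrable: the error [Lb] of the expansion of [B], the derivatives of the critical
    products, and the noncritical products of two of them. *)
Lemma near_identity_remainder (dmu : mindex m.+1 -> R -> R) t :
  B t *m X t - (\sum_(w <- CL) (dmu w t *: P w t + mu eps w t *: Pdot w t)) - X t *m (L0 + Gam t) =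
  Lb t *m X t - \sum_(w <- CL) dmu w t *: P w t +
  \sum_(u <- CL) \sum_(v <- CL | addw u v \notin CL) mu eps (addw u v) t *: bil u v t.
Proof.
pose Hs := \sum_(w <- CL) mu eps w t *: Hh w t; pose Ps := \sum_(w <- CL) mu eps w t *: P w t.
pose dP := \sum_(w <- CL) dmu w t *: P w t.
(* The quadratic terms are split according to whether the product of two critical products is
   critical again; [Q1] is absorbed by [Pdot], [Q2] is left over. *)
pose Q1 := \sum_(u <- CL) \sum_(v <- CL | addw u v \in CL) mu eps (addw u v) t *: bil u v t.
pose Q2 := \sum_(u <- CL) \sum_(v <- CL | addw u v \notin CL) mu eps (addw u v) t *: bil u v t.
have e1 : \sum_(w <- CL) mu eps w t *: Pdot w t = L0 *m Ps - Ps *m L0 + (Hs + Q1) - Gam t.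
  rewrite /Ps mulmx_sumr mulmx_suml /Hs /Gam.
  have -> : Q1 = \sum_(w <- CL) mu eps w t *: (\sum_(u <- CL) \sum_(v <- CL | addw u v == w) bil u v t).
    under [RHS]eq_bigr do rewrite scaler_sumr.
    rewrite exchange_big /=; apply: eq_bigr => u _.
    under [RHS]eq_bigr do rewrite scaler_sumr big_mkcond.
    rewrite exchange_big /= /Q1 big_mkcond /=; apply: eq_bigr => v _; case: ifP => uvC.
      rewrite (bigD1_seq (addw u v))//= eqxx big1 ?addr0// => w wuv; by rewrite eq_sym (negbTE wuv).
    rewrite big1_seq// => w /andP[_ wC]; case: eqP => // wuv; by rewrite -wuv uvC in wC.
  rewrite -sumrB -!big_split /= -sumrB; apply: eq_bigr => w _.
  by rewrite /Pdot scalerBr scalerDr scalerBr scalerDr scalemxAr scalemxAl.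
have e2 : Hs *m Ps - Ps *m Gam t = Q1 + Q2.
  have -> : Q1 + Q2 = \sum_(u <- CL) \sum_(v <- CL) mu eps (addw u v) t *: bil u v t.
    by rewrite -big_split /=; apply: eq_bigr => u _; rewrite [RHS](bigID (fun v => addw u v \in CL)).
  rewrite /Hs /Ps /Gam !mulmx_suml -sumrB; apply: eq_bigr => u _.
  rewrite !mulmx_sumr -sumrB; apply: eq_bigr => v _.
  by rewrite /bil mu_addw scalerBr -!scalemxAl -!scalemxAr !scalerA.
rewrite big_split /= e1.
have -> : X t = 1%:M + Ps by [].
have -> : B t = Lb t + L0 + Hs by rewrite /Lb /Hs; apply/matrixP => i j; rewrite !mxE; ring.
rewrite -/Q2 -/dP.
rewrite !mulmxDl !mulmxDr !mulmx1 !mul1mx.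
have -> : Hs *m Ps = Q1 + Q2 + Ps *m Gam t by rewrite -e2 subrK.
move: (Lb t *m Ps) (L0 *m Ps) (Ps *m L0) (Ps *m Gam t) (Lb t) (Gam t) => a b c d x y.
by apply/matrixP => i j; rewrite !mxE; ring.
Qed.

(** The critical products tend to 0 and the [P w] are bounded, so [X] tends to the identity and is
    eventually invertible with a bounded inverse. [Lc] is defined as the defect in the equation of
    [X] and evaluated by [near_identity_remainder]. *)
Theorem near_identity : exists T (X Y Lc : R -> 'M[R]_N), [/\ tB <= T,
  forall t, T <= t -> X t *m Y t = 1%:M /\ mder X t (B t *m X t - X t *m (L0 + Gam t) - Lc t),
  [/\ contI T X, contI T Y & contI T Lc], nbounded X /\ nbounded Y & mL1 Lc].
Proof.
have /choice[dmu Hd] : forall w, exists dmu : R -> R, w \in CL ->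
  [/\ forall t, t0 < t -> is_derive t 1 (mu eps w) (dmu t), contI t0 dmu & L1dom dmu].
  move=> w; have [wC|wC] := boolP (w \in CL); last by exists (fun=> 0).
  by have [d Hd] := dmuP wC; exists d.
have Xb : nbounded X.
  apply: mx_nboundedD; first exact: mx_nbounded_cst.
  apply: nbounded_mx => i j.
  have -> : (fun t => (\sum_(w <- CL) mu eps w t *: P w t) i j) = (fun t => \sum_(w <- CL) mu eps w t * P w t i j).
    by apply/funext => t; rewrite summxE; apply: eq_bigr => w _; rewrite mxE.
  elim: CL => [|x r IH]; first by exists 0; near=> t; rewrite big_nil normr0.
  have [M H] := IH; have [M' H'] := nboundedM (mu_nb x) (nbounded_entry i j (Pb x)).
  exists (M' + M); near=> t; rewrite big_cons; apply: le_trans (ler_normD _ _) _; apply: lerD; by near: t.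
have Pi0 : (fun t => \sum_(w <- CL) mu eps w t *: P w t) @ +oo --> (0 : 'M[R]_N).
  have : forall w, w \in CL -> (fun t => mu eps w t *: P w t) @ +oo --> (0 : 'M[R]_N).
    move=> w wC; have [M /near_pinftyP[T1 H]] := Pb w; apply/cvgrPdist_le => d d0.
    have M1 : 0 < `|M| + 1 by rewrite ltr_wpDl.
    have /cvgrPdist_le/(_ (d / (`|M| + 1)) (divr_gt0 d0 M1)) Hm := mu0 wC.
    near=> t; rewrite sub0r normrN normrZ.
    have h1 : `|P w t| <= `|M| + 1.
      have : `|P w t| <= M by near: t; apply/near_pinftyP; exists T1.
      by move=> h; apply: le_trans h _; apply: le_trans (ler_norm _) _; rewrite lerDl.
    have h2 : `|mu eps w t| <= d / (`|M| + 1).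
      have : `|0 - mu eps w t| <= d / (`|M| + 1) by near: t.
      by rewrite sub0r normrN.
    by rewrite -[d](divfK (lt0r_neq0 M1)); apply: ler_pM.
  elim: CL => [|x r IH] H.
    have -> : (fun t => \sum_(w <- [::]) mu eps w t *: P w t) = (fun=> 0) by apply/funext => t; rewrite big_nil.
    exact: cvg_cst.
  have -> : (fun t => \sum_(w <- x :: r) mu eps w t *: P w t) = (fun t => mu eps x t *: P x t + \sum_(w <- r) mu eps w t *: P w t).
    by apply/funext => t; rewrite big_cons.
  rewrite -[X in _ --> X]addr0; apply: cvgD; first exact: H (mem_head _ _).
  by apply: IH => w wr; apply: H; rewrite inE wr orbT.
have N1 : 0 < N%:R + 1 :> R by rewrite ltr_wpDl.
have /cvgrPdist_le/(_ (1 / 2 / (N%:R + 1))) := Pi0.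
move=> /(_ ltac:(by rewrite !divr_gt0)) /near_pinftyP[T2 HT2].
pose T := Num.max tB T2.
have small t : T <= t -> N%:R * `|\sum_(w <- CL) mu eps w t *: P w t| <= 1 / 2.
  rewrite ge_max => /andP[_ /HT2]; rewrite sub0r normrN => h.
  apply: (@le_trans _ _ (N%:R * (1 / 2 / (N%:R + 1)))); first by rewrite ler_wpM2l.
  by rewrite mulrA ler_pdivrMr// mulrC ler_wpM2l ?lerDl// divr_ge0.
have inv t : T <= t -> X t \in unitmx /\ `|invmx (X t)| <= 2 := fun tt => near_identity_inv (small t tt).
have tT : t0 <= T by rewrite le_max (ltW tB0).
have bT : tB <= T by rewrite le_max lexx.
have muc w : contI T (mu eps w) := contI_le tT (@mu_c w).
have Pc' w : contI T (P w) := contI_le tT (@Pc w).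
have Gc' w : contI T (G w) := contI_le tT (@Gc w).
have Xc : contI T X.
  apply: contI_mxD; first exact: contIc.
  by apply: contI_mxsum => w _; exact: contI_mxZ (muc w) (Pc' w).
pose dX t := \sum_(w <- CL) (dmu w t *: P w t + mu eps w t *: Pdot w t).
pose Lc t := B t *m X t - dX t - X t *m (L0 + Gam t).
exists T, X, (fun t => invmx (X t)), Lc; split; [exact: bT| | | |].
- move=> t Tt; have [u _] := inv t Tt; have t0t : t0 < t by apply: lt_le_trans Tt; apply: lt_le_trans bT.
  split; first by rewrite mulmxV.
  have -> : B t *m X t - X t *m (L0 + Gam t) - Lc t = 0 + dX t.
    rewrite /Lc add0r; move: (B t *m X t) (X t *m _) (dX t) => x y z.
    by apply/matrixP => i j; rewrite !mxE; ring.
  apply: mderD; first exact: mder_cst.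
  apply: mder_sum => w wC; have [h _ _] := Hd w wC.
  by apply: mderZ; [exact: h|exact: Pder].
- split; [exact: Xc|by apply: (contI_invmx Xc) => t /inv[]|].
  have Gamc : contI T Gam by apply: contI_mxsum => w _; exact: contI_mxZ (muc w) (Gc' w).
  have bilc u v : contI T (bil u v).
    apply: contI_mxB; first exact: contI_mulmx (contI_le tT (@Hc u)) (Pc' v).
    exact: contI_mulmx (Pc' u) (Gc' v).
  have Pdc w : contI T (Pdot w).
    apply: contI_mxB; last exact: Gc'.
    apply: contI_mxD; first by exact: (contI_mxB (contI_mulmxl (Pc' w)) (contI_mulmxr (Pc' w))).
    apply: contI_mxD; first exact: contI_le tT (@Hc w).
    apply: contI_mxsum => u _.
    have -> : (fun t => \sum_(v <- CL | addw u v == w) bil u v t) = (fun t => \sum_(v <- [seq v <- CL | addw u v == w]) bil u v t).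
      by apply/funext => t; rewrite big_filter.
    by apply: contI_mxsum => v _; exact: bilc.
  have dXc : contI T dX.
    apply: contI_mxsum => w /In_mem wC; have [_ h _] := Hd w wC.
    exact: contI_mxD (contI_mxZ (contI_le tT h) (Pc' w)) (contI_mxZ (muc w) (Pdc w)).
  have LGc : contI T (fun t => L0 + Gam t) by apply: contI_mxD; [exact: contIc|exact: Gamc].
  exact: (contI_mxB (contI_mxB (contI_mulmx (contI_le bT Bc) Xc) dXc) (contI_mulmx Xc LGc)).
- split; [exact: Xb|]; exists 2; apply/near_pinftyP; exists T => t /inv[] //.
apply: (@mL1_ext _ _ _ (fun t => Lb t *m X t + \sum_(w <- CL) (-1 * dmu w t) *: P w t +
  \sum_(u <- CL) \sum_(v <- CL | addw u v \notin CL) mu eps (addw u v) t *: bil u v t)).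
  apply: mL1D; first apply: mL1D; first exact: mL1Mr.
    apply: mL1_sum => w wC _; apply: mL1Z => //; apply: L1domZ; by have [] := Hd w wC.
  apply: mL1_sum => u uC _; apply: mL1_sum => v vC uvC; apply: mL1Z; first exact: muL1.
  exact: bil_nbounded.
exists 0 => t _; rewrite /Lc near_identity_remainder; congr (_ + _ + _).
by rewrite -sumrN; apply: eq_bigr => w _; rewrite mulN1r scaleNr.
Unshelve. all: by end_near. Qed.
End NearIdentity.

(** * Reduction of the linearization to a real diagonal form *)

Section Reduction.
Variables (R : realType) (n m : nat) (t0 : R) (A : 'M[R]_n) (lam : 'I_n -> R[i]) (K : set (R -> R)).
Local Notation C := R[i].
Variables (eps : 'I_m.+1 -> R -> R) (varpi : R).
Hypothesis lamP : eigenvalues A lam.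
Hypothesis K3P : K3_class t0 lam K.
Hypothesis noRes : ~ Delta lam 0.
Hypothesis e_gt0 : forall t, t0 <= t -> 0 < eps ord0 t.
Hypothesis e_cvg0 : eps ord0 t @[t --> +oo] --> 0.
Hypothesis eps_cont : forall l, contI t0 (eps l).
Hypothesis eps_bO1 : forall l, bO (eps ord0) 1 (eps l).
Hypothesis e_L1 : L1dom (fun t => eps ord0 t `^ varpi).
Hypothesis H9 : forall l, ~ intRp t0 1 (eps l) -> CI t0 1 (eps l) /\ intRp t0 1 (dI t0 (eps l)).
Variable CL : seq (mindex m.+1).
Hypothesis CLu : uniq CL.
Hypothesis CLP : forall w, (w \in CL) <-> critical t0 eps varpi w.
Variables (tB : R) (B : R -> 'M[R]_n).
Hypothesis tB0 : t0 < tB.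
Hypothesis Bc : contI tB B.
Hypothesis BA : forall i j, inA eps K CL (fun t => B t i j - A i j).

Let rc := real_complex R.
Let cM (p q : nat) (M : 'M[R]_(p, q)) : 'M[C]_(p, q) := map_mx rc M.

Lemma mxK_cmx (M : R -> 'M[C]_n) : mxK K M -> contI t0 (fun t => cmx (M t)) /\ nbounded (fun t => cmx (M t)).
Proof.
move=> MK; split.
  apply/mx_contI; apply: (cmx_entries (Q := contI t0)).
  - by move=> g; exact: contIN.
  - by move=> i j; have [h _] := MK i j; exact: (K_contI K3P h).
  - by move=> i j; have [_ h] := MK i j; exact: (K_contI K3P h).
apply: nbounded_mx; apply: (cmx_entries (Q := fun g => nbounded (g : R -> R^o))).
- by move=> g [c H]; exists c; near=> t; rewrite normrN; near: t.
- by move=> i j; have [h _] := MK i j; exact: (K_nbounded K3P h).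
- by move=> i j; have [_ h] := MK i j; exact: (K_nbounded K3P h).
Unshelve. all: by end_near. Qed.

Lemma mder_cmx p q (M : R -> 'M[C]_(p, q)) (t : R) (L : 'M[C]_(p, q)) :
  (forall i j, is_derive t 1 (fun u => complex.Re (M u i j)) (complex.Re (L i j))) ->
  (forall i j, is_derive t 1 (fun u => complex.Im (M u i j)) (complex.Im (L i j))) -> mder (fun u => cmx (M u)) t (cmx L).
Proof.
move=> HR HI i j; case: (split_ordP i) => i' ->; case: (split_ordP j) => j' ->.
- apply: is_derive_eq (der_ext _ (HR i' j')) _; first by move=> u; rewrite block_mxEul mxE.
  by rewrite block_mxEul mxE.
- apply: is_derive_eq (der_ext _ (derN (HI i' j'))) _; first by move=> u; rewrite block_mxEur !mxE.
  by rewrite block_mxEur !mxE.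
- apply: is_derive_eq (der_ext _ (HI i' j')) _; first by move=> u; rewrite block_mxEdl mxE.
  by rewrite block_mxEdl mxE.
apply: is_derive_eq (der_ext _ (HR i' j')) _; first by move=> u; rewrite block_mxEdr mxE.
by rewrite block_mxEdr mxE.
Qed.

Lemma cmx_bounds p q (M : R -> 'M[C]_(p, q)) : (forall i j, nbounded ((fun t => complex.Re (M t i j)) : R -> R^o)) ->
  (forall i j, nbounded ((fun t => complex.Im (M t i j)) : R -> R^o)) -> nbounded (fun t => cmx (M t)).
Proof.
move=> H1 H2; apply: nbounded_mx; apply: (cmx_entries (Q := fun g => nbounded (g : R -> R^o))) => //.
by move=> g [c H]; exists c; near=> t; rewrite normrN; near: t.
Unshelve. all: by end_near. Qed.

Lemma cmx_contI p q t1 (M : R -> 'M[C]_(p, q)) : (forall i j, contI t1 (fun t => complex.Re (M t i j))) ->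
  (forall i j, contI t1 (fun t => complex.Im (M t i j))) -> contI t1 (fun t => cmx (M t)).
Proof.
move=> H1 H2; apply/mx_contI; apply: (cmx_entries (Q := contI t1)) => //.
by move=> g; exact: contIN.
Qed.

Lemma diag_mxM p (u v : 'I_p -> C) : diag_mx (\row_j u j) *m diag_mx (\row_j v j) = diag_mx (\row_j (u j * v j)).
Proof. by apply/matrixP => i j; rewrite mul_diag_mx !mxE; case: eqP => _; rewrite ?mulr1n ?mulr0n ?mulr0. Qed.

(** With U = cmx(V) X Rot, the rotation satisfies Rot' = Di Rot and commutes with the real diagonal
    [Dr], so it removes the imaginary part: U' is cmx(B) U - U (Dr + E), with E the conjugated
    defect [Lc]. The upper half of U satisfies the same equation with B itself. By [crit_mean] the
    diagonal may be replaced by its averages up to a bounded primitive. *)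
Theorem reduction : exists tS (S : R -> 'M[R]_(n, n + n)) (W : R -> 'M[R]_(n + n, n)) (p0 : 'I_(n + n) -> R -> R) (E : R -> 'M[R]_(n + n)),
  [/\ tB <= tS,
   forall t, tS <= t -> S t *m W t = 1%:M /\ mder S t (B t *m S t - S t *m (diag_mx (\row_k p0 k t) + E t)),
   contI tS W /\ contI tS E, (exists M, forall t, tS <= t -> `|S t| <= M /\ `|W t| <= M) /\ mL1 E &
   forall k, exists j (c : mindex m.+1 -> R), bprim (fun t => p0 k t - (complex.Re (lam j) + \sum_(w <- CL) c w * mu eps w t))].
Proof.
have lam_inj : injective lam.
  by move=> i j ij; apply: contrapT => /eqP inj; apply: noRes; exists i, j; rewrite ij subrr.
have [V Vu AV] := eigenvectors lam_inj lamP.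
have /choice[hA HhA] : forall ij : 'I_n * 'I_n, exists h : mindex m.+1 -> R -> R, (forall w, K (h w)) /\
    L1dom (fun t => (B t ij.1 ij.2 - A ij.1 ij.2) - \sum_(w <- CL) mu eps w t * h w t).
  by move=> [i j]; exact: BA.
pose Hr w t : 'M[R]_n := \matrix_(i, j) hA (i, j) w t.
pose Hc w t : 'M[C]_n := invmx V *m cM (Hr w t) *m V.
have cstK (M : 'M[C]_n) (F : R -> 'M[C]_n) : mxK K F -> mxK K (fun t => M *m F t).
  move=> FK i j; have := @KC_sum _ _ _ _ _ K3P _ (index_enum 'I_n) (fun k t => M i k * F t k j) (fun k _ => KC_scale K3P (M i k) (FK k j)).
  by congr reIm; apply/funext => t; rewrite mxE.
have cstK' (M : 'M[C]_n) (F : R -> 'M[C]_n) : mxK K F -> mxK K (fun t => F t *m M).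
  move=> FK i j; have := @KC_sum _ _ _ _ _ K3P _ (index_enum 'I_n) (fun k t => M k j * F t i k) (fun k _ => KC_scale K3P (M k j) (FK i k)).
  by congr reIm; apply/funext => t; rewrite mxE; apply: eq_bigr => k _; rewrite mulrC.
have HcK w : mxK K (Hc w).
  apply: cstK'; apply: cstK => i j; have [h _] := HhA (i, j).
  have := KC_real K3P (h w); congr reIm; apply/funext => t; by rewrite !mxE.
have [P [G [PK GK GE PE]]] := averaging_coefficients K3P (crit_gt0 CLP) HcK.
pose L0c := diag_mx (\row_j lam j).
have VAV : invmx V *m cM A *m V = L0c by rewrite -mulmxA AV mulmxA mulVmx// mul1mx.
pose Bt t := cmx (invmx V) *m cmx (cM (B t)) *m cmx V.
have cBc : contI tB (fun t => cmx (cM (B t))).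
  apply: cmx_contI => i j.
    by have /mx_contI/(_ i j) := Bc; congr contI; apply/funext => t; rewrite mxE.
  have -> : (fun t => complex.Im (cM (B t) i j)) = (fun=> 0) by apply/funext => t; rewrite mxE.
  exact: contIc.
have Btc : contI tB Bt.
  exact: (contI_mulmxr (contI_mulmxl cBc)).
have rL1 : mL1 (fun t => B t - A - \sum_(w <- CL) mu eps w t *: Hr w t).
  move=> i j; have [_ h] := HhA (i, j); apply: L1dom_ext h _; exists 0 => t _.
  by rewrite !mxE summxE /=; congr (_ - _); apply: eq_bigr => w _; rewrite !mxE.
have LbL1 : mL1 (fun t => Bt t - cmx L0c - \sum_(w <- CL) mu eps w t *: cmx (Hc w t)).
  apply: (@mL1_ext _ _ _ (fun t => cmx (invmx V) *m cmx (cM (B t - A - \sum_(w <- CL) mu eps w t *: Hr w t)) *m cmx V)).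
    apply: mL1Mr; last exact: mx_nbounded_cst.
    apply: mL1Ml; first exact: mx_nbounded_cst.
    apply: (cmx_entries (Q := @L1dom R)).
    - by move=> g gL; apply: L1dom_ext (L1domZ (-1) gL) _; exists 0 => t _; rewrite mulN1r.
    - by move=> i j; apply: L1dom_ext (rL1 i j) _; exists 0 => t _; rewrite /cM [in RHS]mxE.
    - by move=> i j; apply: L1dom_ext (@L1dom0 R) _; exists 0 => t _; rewrite /cM [in RHS]mxE.
  exists 0 => t _.
  have -> : cM (B t - A - \sum_(w <- CL) mu eps w t *: Hr w t) = cM (B t) - cM A - \sum_(w <- CL) rc (mu eps w t) *: cM (Hr w t).
    by rewrite /cM !map_mxB map_mx_sum; congr (_ - _); apply: eq_bigr => w _; rewrite map_mxZ.
  rewrite !cmxB !mulmxBr !mulmxBl; congr (_ - _ - _); first by rewrite -!cmxM VAV.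
  rewrite cmx_sum mulmx_sumr mulmx_suml; apply: eq_bigr => w _.
  by rewrite /rc cmxZ -scalemxAr -scalemxAl -!cmxM.
have Pder w t : w \in CL -> t0 < t -> mder (fun u => cmx (P w u)) t (cmx L0c *m cmx (P w t) - cmx (P w t) *m cmx L0c +
   (cmx (Hc w t) + \sum_(u <- CL) \sum_(v <- CL | addw u v == w) bil (fun w t => cmx (P w t)) (fun w t => cmx (Hc w t)) (fun w t => cmx (G w t)) u v t) - cmx (G w t)).
  move=> wC tt.
  have -> : cmx L0c *m cmx (P w t) - cmx (P w t) *m cmx L0c +
   (cmx (Hc w t) + \sum_(u <- CL) \sum_(v <- CL | addw u v == w) bil (fun w t => cmx (P w t)) (fun w t => cmx (Hc w t)) (fun w t => cmx (G w t)) u v t) - cmx (G w t)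
   = cmx (L0c *m P w t - P w t *m L0c + order_term CL Hc P G w t - G w t).
    rewrite cmxB cmxD cmxB (cmxM L0c) (cmxM (P w t)); congr (_ + _ - _); rewrite /order_term cmxD; congr (_ + _).
    rewrite cmx_sum; apply: eq_bigr => u _; rewrite cmx_sum; apply: eq_bigr => v _.
    by rewrite /bil cmxB (cmxM (Hc u t)) (cmxM (P u t)).
  have hE i j : (L0c *m P w t - P w t *m L0c + order_term CL Hc P G w t - G w t) i j =
     (lam i - lam j) * P w t i j + order_term CL Hc P G w t i j - G w t i j.
    rewrite [LHS]mxE [X in X + _]mxE [X in X + _ + _]mxE.
    rewrite [X in _ + X]mxE [X in _ + X + _ + _]mxE mul_diag_mx mul_mx_diag !mxE.
    by rewrite mulrBl [P w t i j * _]mulrC.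
  by apply: mder_cmx => i j; rewrite hE; have [hR hI] := PE w i j t wC (ltW tt); apply: (dcvg_is_derive (nbhs_itvy tt)).
have muL1 u v : u \in CL -> v \in CL -> addw u v \notin CL -> L1dom (mu eps (addw u v)).
  move=> uC vC uvC; have [|h|//] := mu_cases e_gt0 e_cvg0 eps_cont eps_bO1 e_L1 CLP (w := addw u v).
    by rewrite mabs_addw; apply: leq_trans (leq_addr _ _); exact: (crit_gt0 CLP uC).
  by rewrite h in uvC.
have [T [X [Y [Lc [TB XY [Xc Yc Lcc] [Xb Yb] LcL1]]]]] := near_identity CLu (mu_cont eps_cont) (mu_nbounded e_gt0 e_cvg0 eps_bO1)
   (crit_cvg0 e_gt0 e_cvg0 eps_bO1 CLP) (crit_derive e_gt0 e_cvg0 eps_cont eps_bO1 H9 CLP) muL1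
   (fun w => (mxK_cmx (PK w)).1) (fun w => (mxK_cmx (HcK w)).1) (fun w => (mxK_cmx (GK w)).1)
   (fun w => (mxK_cmx (PK w)).2) (fun w => (mxK_cmx (HcK w)).2) (fun w => (mxK_cmx (GK w)).2) Pder tB0 Btc LbL1.
have t0T : t0 <= T by apply: le_trans TB; exact: ltW.
pose dj j t : C := lam j + \sum_(w <- CL) rc (mu eps w t) * G w t j j.
have ReE j t : complex.Re (dj j t) = complex.Re (lam j) + \sum_(w <- CL) mu eps w t * complex.Re (G w t j j).
  by rewrite /dj ReD Re_sum; congr (_ + _); apply: eq_bigr => w _; rewrite ReM /= mul0r subr0.
have ImE j t : complex.Im (dj j t) = complex.Im (lam j) + \sum_(w <- CL) mu eps w t * complex.Im (G w t j j).
  by rewrite /dj ImD Im_sum; congr (_ + _); apply: eq_bigr => w _; rewrite ImM /= mul0r addr0.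
have diagE t : cmx L0c + \sum_(w <- CL) mu eps w t *: cmx (G w t) = cmx (diag_mx (\row_j dj j t)).
  under eq_bigr do rewrite -cmxZ.
  rewrite -cmx_sum -cmxD; congr cmx; apply/matrixP => i j; rewrite !mxE summxE.
  have [<-|ij] := eqVneq i j.
    by rewrite !mulr1n /dj; congr (_ + _); apply: eq_bigr => w _; rewrite mxE.
  rewrite !mulr0n add0r big1_seq// => w /andP[_ wC].
  by rewrite mxE (GE w t wC) mxE (negbTE ij) mulr0.
have /choice[Th HTh] : forall j, exists F : R -> R, forall t, t0 <= t -> is_derive t 1 F (complex.Im (dj j t)).
  move=> j; have [|F HF _] := @contI_primitive R (fun t => complex.Im (dj j t)) t0; last by exists F.
  have -> : (fun t => complex.Im (dj j t)) = (fun t => complex.Im (lam j) + \sum_(w <- CL) mu eps w t * complex.Im (G w t j j)).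
    by apply/funext => t; rewrite ImE.
  apply: contID; first exact: contIc.
  apply: contI_sum => w _; apply: contIM; first exact: mu_cont.
  by have [_ h] := GK w j j; exact: (K_contI K3P h).
have Thc j : contI t0 (Th j) := der_contI (HTh j).
have cosc j : contI t0 (fun t => cos (Th j t)).
  by apply: (@der_contI _ _ (fun t => - sin (Th j t) * complex.Im (dj j t))) => t tt; apply: der_cos; exact: HTh.
have sinc j : contI t0 (fun t => sin (Th j t)).
  by apply: (@der_contI _ _ (fun t => cos (Th j t) * complex.Im (dj j t))) => t tt; apply: der_sin; exact: HTh.
(* The unit complex number of angle [Th j t], a primitive of the imaginary part of the diagonal;
   [zc] is its conjugate and inverse. *)
pose z j t : C := Complex (cos (Th j t)) (sin (Th j t)).
pose zc j t : C := Complex (cos (Th j t)) (- sin (Th j t)).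
pose Rot t := cmx (diag_mx (\row_j z j t)).
pose RotV t := cmx (diag_mx (\row_j zc j t)).
have RR t : Rot t *m RotV t = 1%:M.
  rewrite /Rot /RotV -cmxM diag_mxM -cmx1; congr cmx.
  apply/matrixP => i j; rewrite !mxE; congr (_ *+ _); apply: complex_eq; rewrite ?ReM ?ImM /=.
    by rewrite mulrN opprK -!expr2 cos2Dsin2.
  by rewrite mulrN mulrC addNr.
have diagc t1 (y : 'I_n -> R -> C) : (forall j, contI t1 (fun t => complex.Re (y j t))) -> (forall j, contI t1 (fun t => complex.Im (y j t))) ->
    contI t1 (fun t => cmx (diag_mx (\row_j y j t))).
  move=> yR yI; apply: cmx_contI => i j.
    have -> : (fun t => complex.Re (diag_mx (\row_j y j t) i j)) = (fun t => (i == j)%:R * complex.Re (y i t)).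
      by apply/funext => t; rewrite !mxE; case: eqP => _; rewrite ?mulr1n ?mulr0n ?mul1r ?mul0r.
    exact: contIZ.
  have -> : (fun t => complex.Im (diag_mx (\row_j y j t) i j)) = (fun t => (i == j)%:R * complex.Im (y i t)).
    by apply/funext => t; rewrite !mxE; case: eqP => _; rewrite ?mulr1n ?mulr0n ?mul1r ?mul0r.
  exact: contIZ.
have diagb (y : 'I_n -> R -> C) : (forall j t, `|complex.Re (y j t)| <= 1) -> (forall j t, `|complex.Im (y j t)| <= 1) ->
    nbounded (fun t => cmx (diag_mx (\row_j y j t))).
  move=> yR yI; apply: cmx_bounds => i j; exists 1; apply/near_pinftyP; exists 0 => t _; rewrite !mxE;
    by case: eqP => _; rewrite ?mulr1n ?mulr0n ?normr0.
have cos1 x : `|cos x : R| <= 1 by rewrite ler_norml cos_geN1 cos_le1.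
have sin1 x : `|sin x : R| <= 1 by rewrite ler_norml sin_geN1 sin_le1.
have Rotc : contI t0 Rot by apply: diagc => j; [exact: cosc|exact: sinc].
have RotVc : contI t0 RotV by apply: diagc => j; [exact: cosc|exact: contIN (sinc j)].
have Rotb : nbounded Rot by apply: diagb => j t; [exact: cos1|exact: sin1].
have RotVb : nbounded RotV by apply: diagb => j t; [exact: cos1|rewrite /= normrN; exact: sin1].
pose Di t := cmx (diag_mx (\row_j Complex 0 (complex.Im (dj j t)))).
pose Dr t := cmx (diag_mx (\row_j rc (complex.Re (dj j t)))).
have Rotd t : t0 <= t -> mder Rot t (Di t *m Rot t).
  move=> tt; rewrite /Di /Rot -cmxM diag_mxM; apply: mder_cmx => i j.
    have [<-|ij] := eqVneq i j.
      apply: is_derive_eq (der_ext _ (der_cos (HTh i t tt))) _; first by move=> u; rewrite !mxE eqxx mulr1n.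
      by rewrite !mxE eqxx mulr1n ReM /= mul0r sub0r mulNr mulrC.
    apply: is_derive_eq (der_ext _ (derc t 0)) _; first by move=> u; rewrite !mxE (negbTE ij).
    by rewrite !mxE (negbTE ij).
  have [<-|ij] := eqVneq i j.
    apply: is_derive_eq (der_ext _ (der_sin (HTh i t tt))) _; first by move=> u; rewrite !mxE eqxx mulr1n.
    by rewrite !mxE eqxx mulr1n ImM /= mul0r add0r mulrC.
  apply: is_derive_eq (der_ext _ (derc t 0)) _; first by move=> u; rewrite !mxE (negbTE ij).
  by rewrite !mxE (negbTE ij).
have DE t : cmx (diag_mx (\row_j dj j t)) = Dr t + Di t.
  rewrite -cmxD; congr cmx; apply/matrixP => i j; rewrite !mxE -mulrnDl; congr (_ *+ _).
  by apply: complex_eq; rewrite ?ReD ?ImD /= ?addr0 ?add0r.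
have DrRot t : Dr t *m Rot t = Rot t *m Dr t.
  by rewrite /Dr /Rot -!cmxM !diag_mxM; congr cmx; congr diag_mx; apply/matrixP => i j; rewrite !mxE mulrC.
(* Each complex coordinate occurs twice, for its real and its imaginary part, with the same real
   coefficient. *)
pose js (k : 'I_(n + n)) : 'I_n := match fintype.split k with inl j => j | inr j => j end.
pose p0 k t := complex.Re (dj (js k) t).
have DrE t : Dr t = diag_mx (\row_k p0 k t).
  have -> : Dr t = cmx (cM (diag_mx (\row_j complex.Re (dj j t)))).
    congr cmx; apply/matrixP => i j; rewrite !mxE; by case: eqP => _; rewrite ?mulr1n ?mulr0n.
  rewrite cmx_real -diag_mx_row; congr diag_mx; apply/matrixP => i k; rewrite !mxE /p0 /js.
  by case: (fintype.split k) => j; rewrite mxE.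
pose cV := cmx V; pose cVi := cmx (invmx V).
have VVi : cV *m cVi = 1%:M by rewrite -cmxM mulmxV// cmx1.
(* [e1] keeps the first half of the rows and intertwines the block form of the real matrix [B] with
   [B]; since [e1 *m e2] is the identity, [W] is a right inverse of [S]. *)
pose e1 : 'M[R]_(n, n + n) := row_mx 1%:M 0.
pose e2 : 'M[R]_(n + n, n) := col_mx 1%:M 0.
pose U t := cV *m X t *m Rot t.
pose S t := e1 *m U t.
pose W t := RotV t *m Y t *m cVi *m e2.
pose E t := RotV t *m Y t *m Lc t *m Rot t.
have Sb : nbounded S.
  apply: mx_nboundedM; first exact: mx_nbounded_cst.
  by apply: mx_nboundedM => //; apply: mx_nboundedM => //; exact: mx_nbounded_cst.
have Wb : nbounded W.
  by apply: mx_nboundedM; [apply: mx_nboundedM; [apply: mx_nboundedM|]|] => //; exact: mx_nbounded_cst.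
have [MS /near_pinftyP[TS HS]] := Sb; have [MW /near_pinftyP[TW HW]] := Wb.
pose tS := Num.max T (Num.max TS TW).
have TtS : T <= tS by rewrite le_max lexx.
exists tS, S, W, p0, E; split.
- exact: le_trans TtS.
- move=> t tSt; have Tt := le_trans TtS tSt; have [XY1 Xd] := XY t Tt; split.
    rewrite /S /W /U !mulmxA -[e1 *m cV *m X t *m Rot t *m RotV t]mulmxA RR mulmx1.
    rewrite -[e1 *m cV *m X t *m Y t]mulmxA XY1 mulmx1 -[e1 *m cV *m cVi]mulmxA VVi mulmx1.
    by rewrite mul_row_col mulmx1 mul0mx addr0.
  have h := mderM (mder_cst e1 t) (mderM (mderM (mder_cst cV t) Xd) (Rotd t (le_trans t0T Tt))).
  move=> i j; apply: is_derive_eq (h i j) _; congr (fun_of_matrix _ i j).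
  rewrite !mul0mx !add0r diagE DE -DrE.
  have UE : U t *m E t = cV *m Lc t *m Rot t.
    rewrite /U /E !mulmxA -[cV *m X t *m Rot t *m RotV t]mulmxA RR mulmx1.
    by rewrite -[cV *m X t *m Y t]mulmxA XY1 mulmx1.
  have UD : U t *m Dr t = cV *m X t *m Dr t *m Rot t by rewrite /U -mulmxA -DrRot mulmxA.
  have VB : cV *m Bt t = cmx (cM (B t)) *m cV by rewrite /Bt !mulmxA VVi mul1mx.
  have eB : e1 *m cmx (cM (B t)) = B t *m e1.
    by rewrite cmx_real mul_row_block mul_mx_row !mul1mx !mul0mx !mulmx0 !mulmx1 addr0 add0r.
  have SE1 : B t *m S t = e1 *m (cmx (cM (B t)) *m U t) by rewrite /S mulmxA -eB mulmxA.
  have SE2 : S t *m (Dr t + E t) = e1 *m (U t *m Dr t + U t *m E t) by rewrite /S -(mulmxA e1 (U t)) (mulmxDr (U t) (Dr t)).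
  rewrite SE1 SE2 -mulmxBr; congr (e1 *m _).
  rewrite UE UD (mulmxBr cV) (mulmxBr cV) (mulmxDr (X t)) (mulmxDr cV) !mulmxBl mulmxDl (mulmxA cV (Bt t)) VB /U !mulmxA.
  move: (cmx (cM (B t)) *m cV *m X t *m Rot t) (cV *m X t *m Dr t *m Rot t) (cV *m X t *m Di t *m Rot t) (cV *m Lc t *m Rot t) => a b c d.
  by apply/matrixP => x y; rewrite !mxE; ring.
- have le1 := le_trans t0T TtS; have Rc := contI_le le1 Rotc; have Rvc := contI_le le1 RotVc.
  have Yc' := contI_le TtS Yc; have Lc' := contI_le TtS Lcc; split.
    exact: (contI_mulmxr (contI_mulmxr (contI_mulmx Rvc Yc'))).
  exact: (contI_mulmx (contI_mulmx (contI_mulmx Rvc Yc') Lc') Rc).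
- split; last first.
    by apply: mL1Mr => //; apply: mL1Ml => //; exact: mx_nboundedM.
  exists (`|MS| + `|MW|) => t; rewrite !ge_max => /andP[_ /andP[tS1 tW1]]; split.
    by apply: le_trans (HS t tS1) _; apply: le_trans (ler_norm _) _; rewrite lerDl.
  by apply: le_trans (HW t tW1) _; apply: le_trans (ler_norm _) _; rewrite lerDr.
move=> k; exists (js k).
have /choice[c Hcm] : forall w, exists c : R, w \in CL -> bprim (fun t => mu eps w t * (complex.Re (G w t (js k) (js k)) - c)).
  move=> w; have [wC|wC] := boolP (w \in CL); last by exists 0.
  have [h _] := GK w (js k) (js k).
  by have [c Hcc] := crit_mean K3P e_gt0 e_cvg0 eps_cont eps_bO1 H9 CLP wC h; exists c.
exists c; apply: bprim_ext (bprim_sum CL (P := fun w => w \in CL) Hcm) _.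
exists 0 => t _; rewrite /p0 ReE -big_seq opprD addrACA subrr add0r -sumrB.
by apply: eq_bigr => w _; ring.
Unshelve. all: by end_near. Qed.
End Reduction.

(** * Sign alternative and conclusion *)

Section Dichotomy.
Variable R : realType.
Implicit Types (p P : R -> R).

(** Subtracting the bounded primitive [H] leaves a primitive of [main], which is monotone where
    [main] has a sign; [H] costs at most [2 * B]. *)
Lemma sign_primitive p (main : R -> R) (T : R) P : (\forall t \near +oo, 0 <= main t) \/ (\forall t \near +oo, main t <= 0) ->
  bprim (fun t => p t - main t) -> (forall t, T <= t -> is_derive t 1 P (p t)) ->
  exists T' M : R, T <= T' /\ ((forall u v, T' <= u -> u <= v -> P u - P v <= M) \/
     (forall u v, T' <= u -> u <= v -> P v - P u <= M)).
Proof.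
move=> sgn [T1 [H [B HB]]] HP.
have PH u : Num.max T T1 <= u -> is_derive u 1 (fun t => P t - H t) (main u).
  rewrite ge_max => /andP[Tu T1u]; apply: is_derive_eq (derB (HP u Tu) (HB u T1u).1) _.
  by rewrite opprB addrC subrK.
case: sgn => /near_pinftyP[T2 Hs]; exists (Num.max (Num.max T T1) T2), (2 * B);
    (split; first by rewrite !le_max lexx); [left|right] => u v; rewrite ge_max => /andP[Tu T2u] uv.
  have h : P u - H u <= P v - H v.
    apply: (der_le0 (f := fun t => P t - H t) (df := main) uv) => t /andP[ut _]; [apply: PH; exact: le_trans ut|apply: Hs; exact: le_trans ut].
  have := Tu; rewrite ge_max => /andP[_ T1u].
  have [_ h1] := HB u T1u; have [_ h2] := HB v (le_trans T1u uv).
  move: h1 h2; rewrite !ler_norml => /andP[_ h1] /andP[h2 _]; lra.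
have h : - (P u - H u) <= - (P v - H v).
  apply: (der_le0 (f := fun t => - (P t - H t)) (df := fun t => - main t) uv) => t /andP[ut _].
    by apply: derN; apply: PH; exact: le_trans ut.
  by rewrite oppr_ge0; apply: Hs; exact: le_trans ut.
have := Tu; rewrite ge_max => /andP[_ T1u].
have [_ h1] := HB u T1u; have [_ h2] := HB v (le_trans T1u uv).
move: h1 h2; rewrite !ler_norml => /andP[h1 _] /andP[_ h2]; lra.
Qed.

(** A primitive that almost increases and does not diverge to +oo is bounded, so it may be treated
    as forward. One that almost decreases cannot diverge to +oo, so [b] is true there. Thus the
    index set counted in the statement is an admissible choice of forward coordinates. *)
Lemma divergence_dichotomy T P (b : bool) M : (b <-> ~ (P t @[t --> +oo] --> +oo)) ->
  ((forall u v, T <= u -> u <= v -> P u - P v <= M) \/ (forall u v, T <= u -> u <= v -> P v - P u <= M)) ->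
  exists M', forall u v : R, T <= u -> u <= v -> (if b then P v - P u else P u - P v) <= M'.
Proof.
move=> bP [H|H].
  case: b bP => bP; last by exists M.
  have : ~ (P t @[t --> +oo] --> +oo) by apply/bP.
  move=> /cvgryPge/existsNP[Bd nB].
  (* [P] returns below some level [Bd] at arbitrarily late times [t']; then [P v] is below [Bd + M],
     while [P u] is at least [P T - M]. *)
  exists (Bd + M + M - P T) => u v Tu uv.
  have [t' vt' Pt'] : exists2 t', v <= t' & P t' < Bd.
    apply: contrapT => nex; apply: nB; apply/near_pinftyP; exists v => t vt.
    by rewrite leNgt; apply/negP => h; apply: nex; exists t.
  have h1 := H v t' (le_trans Tu uv) vt'; have h2 := H T u (lexx _) Tu.
  by lra.
case: b bP => bP; first by exists M.
exfalso; have : ~ ~ (P t @[t --> +oo] --> +oo) by move=> h; have := (bP.2 h).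
apply; move=> /cvgryPge/(_ (P T + M + 1))/near_pinftyP[T1 H1].
have h1 := H T (Num.max T T1) (lexx _) ltac:(by rewrite le_max lexx).
have h2 := H1 (Num.max T T1) ltac:(by rewrite le_max lexx orbT).
by lra.
Qed.

Lemma uniform_dichotomy d (p : 'I_d -> R -> R) (b : 'I_d -> bool) :
  (forall j, exists (T M : R) (P : R -> R), (forall t : R, T <= t -> is_derive t 1 P (p j t)) /\
    forall u v : R, T <= u -> u <= v -> (if b j then P v - P u else P u - P v) <= M) ->
  exists T M : R, forall j, exists P : R -> R, (forall t, T <= t -> is_derive t 1 P (p j t)) /\
    forall u v : R, T <= u -> u <= v -> (if b j then P v - P u else P u - P v) <= M.
Proof.
move=> /choice[T /choice[M H]].
have le_sum (F : 'I_d -> R) j : F j <= \sum_i `|F i|.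
  by apply: le_trans (ler_norm _) _; rewrite (bigD1 j)//= lerDl sumr_ge0.
exists (\sum_i `|T i|), (\sum_i `|M i|) => j; have [P [H1 H2]] := H j.
exists P; split; first by move=> t tt; apply: H1; exact: le_trans tt.
by move=> u v Tu uv; apply: le_trans (H2 u v (le_trans (le_sum T j) Tu) uv) (le_sum M j).
Qed.
End Dichotomy.

Section MatrixInverseBound.
Variable R : realType.

Lemma nbounded_sum (I : Type) (r : seq I) (F : I -> R -> R) : (forall i, nbounded (F i : R -> R^o)) ->
  nbounded ((fun t => \sum_(i <- r) F i t) : R -> R^o).
Proof.
move=> H; elim: r => [|x r [M IH]]; first by exists 0; near=> t; rewrite big_nil normr0.
have [M' H'] := H x; exists (M' + M); near=> t; rewrite big_cons.
by apply: le_trans (ler_normD _ _) _; apply: lerD; near: t.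
Unshelve. all: by end_near. Qed.

Lemma nbounded_det p (M : R -> 'M[R]_p) : nbounded M -> nbounded ((fun t => \det (M t)) : R -> R^o).
Proof.
move=> Mb; apply: nbounded_sum => u; apply: nboundedM; last by apply: nbounded_prod => i _; exact: nbounded_entry.
by exists 1; near=> t; rewrite normrX normrN1 expr1n.
Unshelve. all: by end_near. Qed.

(** Cramer's rule: the entries of the adjugate are bounded and the determinant is bounded away from
    0. *)
Lemma nbounded_invmx p (M : R -> 'M[R]_p) c : 0 < c -> nbounded M -> (\forall t \near +oo, c <= `|\det (M t)|) ->
  nbounded (fun t => invmx (M t)).
Proof.
move=> c0 Mb dc; apply: nbounded_mx => i j.
have [B HB] : nbounded ((fun t => (\adj (M t)) i j) : R -> R^o).
  have -> : (fun t => (\adj (M t)) i j) = (fun t => (-1) ^+ (j + i) * \det (row' j (col' i (M t)))).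
    by apply/funext => t; rewrite mxE.
  apply: nboundedM; first by exists `|(-1) ^+ (j + i)|; near=> t.
  apply: nbounded_det; apply: nbounded_mx => i' j'.
  have [B HB] := nbounded_entry (lift j i') (lift i j') Mb; exists B; near=> t; rewrite !mxE; by near: t.
exists (c^-1 * B); near=> t.
have dt : c <= `|\det (M t)| by near: t.
have d0 : \det (M t) != 0 by rewrite -normr_gt0; exact: lt_le_trans dt.
rewrite /invmx unitmxE unitfE d0 mxE normrM; apply: ler_pM => //; last by near: t.
by rewrite normfV lef_pV2 ?posrE// normr_gt0.
Unshelve. all: by end_near. Qed.

Lemma mulmx_linear_differentiable n d (M : 'M[R]_(n, d)) (z : 'cV[R]_d) : differentiable (fun x : 'cV[R]_d => M *m x) z.
Proof.
have h : continuous (mulmx M : 'cV[R]_d -> 'cV[R]_n).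
  apply/mx_continuous => i j x; have -> : (fun x : 'cV[R]_d => (M *m x) i j) = (fun x => \sum_k M i k * x k j).
    by apply/funext => y; rewrite mxE.
  elim: (index_enum _) => [|k r IH].
    have -> : (fun x : 'cV[R]_d => \sum_(k <- [::]) M i k * x k j) = (fun=> 0) by apply/funext => y; rewrite big_nil.
    exact: cst_continuous.
  have -> : (fun x : 'cV[R]_d => \sum_(k <- k :: r) M i k * x k j) = (fun x => M i k * x k j + \sum_(k <- r) M i k * x k j).
    by apply/funext => y; rewrite big_cons.
  apply: (@cvgD _ _ _ (nbhs x) _ (fun x : 'cV[R]_d => M i k * x k j)); last exact: IH.
  apply: (@cvgM _ _ (nbhs x) _ (fun=> M i k) (fun x : 'cV[R]_d => x k j)); first exact: cvg_cst.
  exact: coord_continuous.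
exact: (@linear_differentiable _ _ _ (mulmx M : {linear 'cV[R]_d -> 'cV[R]_n}) z h).
Qed.
End MatrixInverseBound.

Lemma contI_ext (R : realType) (V : topologicalType) t1 (g h : R -> V) : (forall t, t1 <= t -> g t = h t) -> contI t1 g -> contI t1 h.
Proof.
move=> gh; rewrite /contI; suff -> : (fun t => h (Num.max t t1)) = (fun t => g (Num.max t t1)) by [].
by apply/funext => t; rewrite gh// le_max lexx orbT.
Qed.

Lemma contI_powR (R : realType) t1 (g : R -> R) p : contI t1 g -> (forall t, t1 <= t -> 0 < g t) -> contI t1 (fun t => g t `^ p).
Proof.
move=> gc g0; apply: (contI_ext (g := fun t => expR (p * ln (g t)))).
  by move=> t tt; rewrite /powR gt_eqF// g0.
apply: contI_expR; apply: contIZ => t.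
have g0' : 0 < g (Num.max t t1) by apply: g0; rewrite le_max lexx orbT.
by apply: (continuous_comp (gc t)); exact: continuous_ln.
Qed.

(** * The hypotheses put together *)

Section Assembly.
Variables (R : realType) (n m : nat) (t0 : R) (A : 'M[R]_n)
    (lam : 'I_n -> R[i]) (K : set (R -> R))
    (f phi0 : R -> 'cV[R]_n) (a : R)
    (eps : 'I_m.+1 -> R -> R) (fl : 'I_m.+1 -> R * 'cV[R]_n -> 'cV[R]_n)
    (varrho : 'I_m.+1 -> R) (rho : nat -> R) (k k0 : nat) (varpi : R).
Let D := cylinder t0 phi0 a.
Hypothesis lamP : eigenvalues A lam.
Hypothesis K3P : K3_class t0 lam K.
Hypothesis f_K3 : vecK K f.
Hypothesis phi0P : K3_solution t0 K A f phi0.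
Hypothesis a_gt0 : 0 < a.
Hypothesis varrho_gt0 : forall l, 0 < varrho l.
Hypothesis varrho_homo : forall l l' : 'I_m.+1, (l <= l')%N -> varrho l <= varrho l'.
Hypothesis rhoP : rank_enum varrho rho.
Hypothesis k_gt0 : (0 < k)%N.
Hypothesis k0_gt0 : (0 < k0)%N.
Hypothesis H1_smooth : forall l, CI t0 (pkl varrho rho k l) (eps l).
Hypothesis H1_rank : forall l r, (r <= pkl varrho rho k l)%N ->
  bigO_pinfty (iter r (dI t0) (eps l)) (fun t => eps ord0 t `^ ((varrho l + r%:R) / varrho ord0)).
Hypothesis e_cvg0 : eps ord0 t @[t --> +oo] --> 0.
Hypothesis H2 : forall l, C0y D (smoothness varrho rho k l) (fl l).
Hypothesis H3 : forall l (w : mindex n), (mabs w <= smoothness varrho rho k l)%N ->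
  exists M : R, forall p, D p -> `|pderm D w (fl l) p| <= M.
Hypothesis varpi_gt0 : 0 < varpi.
Hypothesis H5 : intRp t0 varpi (eps ord0).
Hypothesis H6 : forall l (r : nat), 1 <= rho k - varrho l -> (1 <= r)%N ->
  r%:Z <= Num.floor (rho k - varrho l) -> intRp t0 1 (iter r (dI t0) (eps l)).
Hypothesis H7 : forall l, varrho l <= varpi * varrho ord0 ->
  [/\ C0y D (sl varrho varpi l + 2) (fl l),
      forall w : mindex n, (3 <= mabs w <= sl varrho varpi l + 2)%N ->
        exists M : R, forall p, D p -> `|pderm D w (fl l) p| <= M &
      forall w : mindex n, (1 <= mabs w <= sl varrho varpi l + 1)%N ->
        vecK K (fun t => pderm D w (fl l) (t, phi0 t))].
Hypothesis noRes : ~ Delta lam 0.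
Hypothesis H9 : forall l, ~ intRp t0 1 (eps l) -> CI t0 1 (eps l) /\ intRp t0 1 (dI t0 (eps l)).
Hypothesis e_gt0 : forall t, t0 <= t -> 0 < eps ord0 t.
Hypothesis H10 : forall (gamma1 : R) (gamma : mindex m.+1 -> R),
  let h := fun t => gamma1 * (eps ord0 t)^-1 * dI t0 (eps ord0) t +
    \sum_(w \in critical t0 eps varpi) (gamma w * mu eps w t) in
  (\forall t \near +oo, 0 <= h t) \/ (\forall t \near +oo, h t <= 0).
Hypothesis H11 : varrho ord0 * varpi < rho k.+1.
Hypothesis H11' : varrho ord0 * (2 * varpi - 1) <= rho k.+1.
Hypothesis H12 : rho k0.+1 + varpi * varrho ord0 <= rho k.+1.

Let e := eps ord0.
Let r0 := varrho ord0.
Let kappa := rho k.+1 / r0 - varpi.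
Let r00 : 0 < r0. Proof. exact: varrho_gt0. Qed.
Let eps_c l : contI t0 (eps l). Proof. exact: (eps_contI0 H1_smooth). Qed.
Let eps_1 l : bO e 1 (eps l). Proof. exact: (eps_bO_one varrho_gt0 varrho_homo H1_rank e_gt0 e_cvg0). Qed.
Let e_near : \forall t \near +oo, 0 < e t.
Proof. by apply/near_pinftyP; exists t0 => t; exact: e_gt0. Qed.

Lemma gauge_L1 : L1dom (fun t => e t `^ varpi).
Proof.
apply: (@L1dom_ext _ (fun t => `|e t| `^ varpi)).
  apply: (intRp_L1dom _ H5); apply: (contI_ext (g := fun t => e t `^ varpi)).
    by move=> t tt; rewrite gtr0_norm// e_gt0.
  by apply: contI_powR; [exact: eps_c|exact: e_gt0].
by exists t0 => t tt; rewrite gtr0_norm// e_gt0.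
Qed.

(** The smallest rank is [varrho ord0], so [rho k - varrho ord0] is nonnegative; hence eps_1 is of
    class C^1 with a controlled derivative. *)
Lemma pkl_gt0 : (0 < pkl varrho rho k ord0)%N.
Proof.
have : 0 <= Num.floor (rho k - varrho ord0).
  by rewrite floor_ge0 subr_ge0; exact: (rho_ge_first varrho_gt0 varrho_homo rhoP).
by rewrite /pkl; move: (Num.floor _) => z; lia.
Qed.

Lemma kappa_gt0 : 0 < kappa.
Proof. by rewrite subr_gt0 ltr_pdivlMr// mulrC. Qed.

(** The second inequality of hypothesis 11, rewritten as the condition under which the quadratic
    remainder is integrable. *)
Lemma kappa_varpi : varpi <= 1 + kappa.
Proof.
have : 2 * varpi - 1 <= rho k.+1 / r0 by rewrite ler_pdivlMr// mulrC.
by rewrite /kappa; lra.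
Qed.

(** Hypothesis 12, rewritten: the perturbation of size e^kappa is no larger than the tail cut off at
    order [k0]. *)
Lemma kappa_trunc : rho k0.+1 / r0 <= kappa.
Proof. by rewrite /kappa lerBrDr -{1}[varpi](mulfK (lt0r_neq0 r00)) -mulrDl ler_pM2r ?invr_gt0. Qed.

Lemma trunc_lt : (k0 < k)%N.
Proof.
rewrite ltnNge; apply/negP => kk0.
have := rho_le rhoP (ltn0Sn k) (kk0 : (k.+1 <= k0.+1)%N); have := mulr_gt0 varpi_gt0 r00; have := H12.
by rewrite /r0; lra.
Qed.

(** The derivative of eps_1 is O(e^((varrho_1 + 1)/varrho_1)), so the quotient is
    O(e^(1/varrho_1)). *)
Lemma logder_cvg0 : (e t)^-1 * dI t0 e t @[t --> +oo] --> 0.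
Proof.
have h := eps_bO H1_rank pkl_gt0.
apply: (bO_cvg0 e_near e_cvg0 (c := 1 / r0)); first by rewrite divr_gt0.
have hi : bO e (- 1) ((fun t => (e t)^-1) : R -> R^o).
  exists 1; near=> t; have et : 0 < e t by near: t.
  by rewrite mul1r powR_inv1 ?(ltW et)// gtr0_norm ?invr_gt0.
have := bOZ e_near hi h; congr (bO e _ _).
by rewrite mulrDl divff ?gt_eqF// addrA addNr add0r.
Unshelve. all: by end_near. Qed.

(** If [re] is nonzero, all other terms tend to 0 and [re] decides the sign. If it is 0, the
    function is of the form covered by hypothesis 10. *)
Lemma main_sign CL (re gamma1 : R) (c : mindex m.+1 -> R) : uniq CL -> (forall w, (w \in CL) <-> critical t0 eps varpi w) ->
  let h t := re + \sum_(w <- CL) c w * mu eps w t + gamma1 * (e t)^-1 * dI t0 e t in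
  (\forall t \near +oo, 0 <= h t) \/ (\forall t \near +oo, h t <= 0).
Proof.
move=> CLu CLP h.
have [re0|re0] := eqVneq re 0.
  have := H10 gamma1 c; have hE t : gamma1 * (eps ord0 t)^-1 * dI t0 (eps ord0) t + \sum_(w \in critical t0 eps varpi) (c w * mu eps w t) = h t.
    rewrite (fsum_seq (r := CL)) //; [|by move=> w /= /CLP|by move=> w /CLP ->].
    by rewrite /h re0 add0r addrC.
  by move=> [H|H]; [left|right]; apply: filterS H => t; rewrite /= hE.
have hc : h t @[t --> +oo] --> re.
  rewrite -[X in _ --> X]addr0 -[X in _ --> X + _]addr0; apply: cvgD; first apply: cvgD; first exact: cvg_cst.
    have : forall w, w \in CL -> (c w * mu eps w t) @[t --> +oo] --> 0.
      move=> w wC; rewrite -[X in _ --> X](mulr0 (c w)); apply: cvgMl_tmp.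
      exact: (crit_cvg0 e_gt0 e_cvg0 eps_1 CLP wC).
    elim: (CL) => [|x r IH] H.
      have -> : (fun t => \sum_(w <- [::]) c w * mu eps w t) = (fun=> 0) by apply/funext => t; rewrite big_nil.
      exact: cvg_cst.
    have -> : (fun t => \sum_(w <- x :: r) c w * mu eps w t) = (fun t => c x * mu eps x t + \sum_(w <- r) c w * mu eps w t).
      by apply/funext => t; rewrite big_cons.
    rewrite -[X in _ --> X]addr0; apply: cvgD; first exact: H (mem_head _ _).
    by apply: IH => w wr; apply: H; rewrite inE wr orbT.
  have -> : (fun t => gamma1 * (e t)^-1 * dI t0 e t) = (fun t => gamma1 * ((e t)^-1 * dI t0 e t)).
    by apply/funext => t; rewrite mulrA.
  rewrite -[X in _ --> X](mulr0 gamma1); apply: cvgMl_tmp; exact: logder_cvg0.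
have re1 : 0 < `|re| by rewrite normr_gt0.
move/cvgrPdist_le: hc => /(_ `|re| re1) H.
have [rp|rn] := ltP 0 re.
  left; apply: filterS H => t; rewrite (gtr0_norm rp) ler_norml => /andP[_]; lra.
right; apply: filterS H => t; rewrite (ler0_norm rn) ler_norml => /andP[h1 _]; move: h1; lra.
Qed.

Variable phi : mono m.+1 -> R -> 'cV[R]_n.
Hypothesis phiP : coefficients t0 K A D fl phi0 varrho rho k phi.
Let s := psum t0 eps phi0 varrho rho phi k.
Let sk0 := psum t0 eps phi0 varrho rho phi k0.

Lemma coefficient_solution nu : nu <> mset0 -> rank varrho nu <= rho k ->
  K3_solution t0 K A (gcoef D fl phi0 phi nu) (phi nu).
Proof.
move=> nu0 nuk; have [j j1 rj] := rank_rho rhoP nu0.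
apply: (phiP (s := j)); last by split.
by rewrite j1 /=; apply: (rho_le_inv rhoP) => //; rewrite rj.
Qed.

Lemma phi_regular nu : nu <> mset0 -> rank varrho nu <= rho k ->
  [/\ CI t0 1 (phi nu), forall i, exists M : R, forall t, t0 <= t -> `|phi nu t i 0| <= M &
      forall t, t0 <= t -> dI t0 (phi nu) t = A *m phi nu t + gcoef D fl phi0 phi nu t].
Proof.
by move=> nu0 nuk; have [h1 h2 h3] := coefficient_solution nu0 nuk; split => // i; exact: (K3_bounded K3P (h1 i)).
Qed.

Let fc : contI t0 f.
Proof. by apply/mx_contI => i j; rewrite (ord1 j); exact: (K_contI K3P (f_K3 i)). Qed.

Let q2 l : (2 <= smoothness varrho rho k l)%N.
Proof. by rewrite /smoothness; move: (qkl _ _ _ _) => z; lia. Qed.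

(** The remainder is the tail [s - sk0], whose monomials have rank at least [rho k0.+1], plus a
    perturbation of size e^kappa, which [kappa_trunc] compares with it. *)
Lemma expansion_family d t1 (S : R -> 'M[R]_(n, d)) (z : R -> 'cV[R]_d) M : t0 <= t1 ->
  (forall t, t1 <= t -> `|S t| <= M) -> (forall t, t1 <= t -> `|z t| <= 1) ->
  solution A f eps fl D t1 (fun t => s t + e t `^ kappa *: (S t *m z t)) ->
  let r t := s t + e t `^ kappa *: (S t *m z t) - sk0 t in
  solution A f eps fl D t1 (fun t => sk0 t + r t) /\ bigO_pinfty r (fun t => e t `^ (rho k0.+1 / r0)).
Proof.
move=> t01 SM z1 sol r; split.
  by have -> : (fun t => sk0 t + r t) = (fun t => s t + e t `^ kappa *: (S t *m z t)) by apply/funext => t; rewrite /r addrC subrK.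
have [ML MLu MLP] := mono_le_list rho k varrho_gt0 varrho_homo.
have h1 := psum_truncate a_gt0 varrho_gt0 varrho_homo rhoP k_gt0 H1_rank e_gt0 e_cvg0 phi_regular MLu MLP
  (k0 := k0) ltac:(by rewrite k0_gt0 trunc_lt).
have h2 : bO e (rho k0.+1 / r0) (fun t => e t `^ kappa *: (S t *m z t)).
  apply: (bO_le e_near e_cvg0 kappa_trunc); apply: (bO_bZ e_near).
    by exists 1; near=> t; rewrite mul1r ger0_norm ?powR_ge0.
  exists (d%:R * `|M| * 1); apply/near_pinftyP; exists t1 => t tt.
  apply: le_trans (mx_norm_mul _ _) _; apply: ler_pM => //; last exact: z1.
  by rewrite ler_wpM2l//; apply: le_trans (SM t tt) (ler_norm _).
have [B HB] := bOD h1 h2.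
exists B; near=> t; rewrite (ger0_norm (powR_ge0 _ _)).
have -> : r t = s t - sk0 t + e t `^ kappa *: (S t *m z t) by rewrite /r addrAC.
by near: t.
Unshelve. all: by end_near. Qed.

Lemma Ahat_contI t1 : t0 <= t1 -> contI t1 s -> (forall t, t1 <= t -> D (t, s t)) -> contI t1 (Ahat A D eps fl s).
Proof.
move=> t01 sc sD; apply: contI_mxD; first exact: contIc.
apply: contI_mxsum => l _; apply: contI_mxZ; first exact: contI_le t01 (@eps_c l).
exact: (contI_jac H2 q2 t01 sc sD).
Qed.

Lemma solutions_from_reduction d (S : R -> 'M[R]_(n, d)) (W : R -> 'M[R]_(d, n)) (p0 : 'I_d -> R -> R) (E : R -> 'M[R]_d) tS (b : 'I_d -> bool) :
  t0 < tS -> (forall t, tS <= t -> S t *m W t = 1%:M) ->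
  (forall t, tS <= t -> mder S t (Ahat A D eps fl s t *m S t - S t *m (diag_mx (\row_k p0 k t) + E t))) ->
  (exists M, forall t, tS <= t -> `|S t| <= M /\ `|W t| <= M) ->
  contI tS W -> contI tS E -> mL1 E ->
  (forall j, exists (T M : R) (P : R -> R), (forall t : R, T <= t -> is_derive t 1 P (p0 j t - kappa * (e t)^-1 * dI t0 e t)) /\
    forall u v : R, T <= u -> u <= v -> (if b j then P v - P u else P u - P v) <= M) ->
  exists T, forall t1, T <= t1 -> exists (eta : R) (z : 'rV[R]_#|free_set b| -> R -> 'cV[R]_d), 0 < eta /\ forall C, `|C| < eta ->
  [/\ solution A f eps fl D t1 (fun t => s t + e t `^ kappa *: (S t *m z C t)), forall t, t1 <= t -> `|z C t| <= 1,
      forall t, t1 <= t -> differentiable (fun C' => z C' t) C &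
      forall i, z C t1 (enum_val i) 0 = C 0 i].
Proof.
move=> tS0 SW Sd SWb Wc Ec EL pd.
have [ML MLu MLP] := mono_le_list rho k varrho_gt0 varrho_homo.
have [_ phi0C phi0E] := phi0P.
have rb := resid_bO a_gt0 varrho_gt0 varrho_homo rhoP k_gt0 H1_rank e_gt0 e_cvg0 H2 H3 phi0E phi_regular MLu MLP.
(* The residual is thus O(theta e^varpi), as the perturbation argument expects. *)
have kv : rho k.+1 / varrho ord0 = kappa + varpi by rewrite /kappa subrK.
rewrite kv in rb.
apply: (perturbed_solutions a_gt0 H2 q2 H3 e_gt0 e_cvg0 _ eps_c eps_1 fc
  (psum_contI a_gt0 varrho_gt0 varrho_homo rhoP k_gt0 H1_smooth phi0C phi_regular MLu MLP)
  (dpsum_contI a_gt0 varrho_gt0 varrho_homo k_gt0 H1_smooth phi0C phi_regular MLP)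
  (fun t i => psum_derive a_gt0 varrho_gt0 varrho_homo rhoP k_gt0 H1_smooth phi0C phi_regular MLu MLP i)
  (psum_box a_gt0 varrho_gt0 varrho_homo rhoP k_gt0 H1_rank e_gt0 e_cvg0 phi_regular MLu MLP)
  (psum_sub_phi0 a_gt0 varrho_gt0 varrho_homo rhoP k_gt0 H1_rank e_gt0 e_cvg0 phi_regular MLu MLP)
  kappa_gt0 kappa_varpi rb gauge_L1 tS0 SW _ SWb Wc Ec EL (uniform_dichotomy pd)).
- by move=> t tt; exact: (eps_derive H1_smooth pkl_gt0 tt).
- by move=> t i j tt; exact: Sd.
Qed.

(** The reduced system has 2n real coordinates. For each of them the sign alternative decides
    between the forward and the backward Green's formula. *)
Theorem expansion_exists : \forall t1 \near +oo, exists r : R -> 'cV[R]_n,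
  solution A f eps fl D t1 (fun t => sk0 t + r t) /\ bigO_pinfty r (fun t => e t `^ (rho k0.+1 / r0)).
Proof.
have [ML MLu MLP] := mono_le_list rho k varrho_gt0 varrho_homo.
have [_ phi0C _] := phi0P.
have [CL CLu CLP] := critical_list t0 eps varpi.
have s_box := psum_box a_gt0 varrho_gt0 varrho_homo rhoP k_gt0 H1_rank e_gt0 e_cvg0 phi_regular MLu MLP.
have sc := psum_contI a_gt0 varrho_gt0 varrho_homo rhoP k_gt0 H1_smooth phi0C phi_regular MLu MLP.
have [Tb HTb] := (near_pinftyP _).1 s_box.
pose tB := Num.max Tb (t0 + 1).
have t0B : t0 < tB by rewrite lt_max ltrDl ltr01 orbT.
have Bc : contI tB (Ahat A D eps fl s).
  apply: Ahat_contI; [exact: ltW|exact: contI_le (ltW t0B) sc|].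
  move=> t tt; apply: box_cylinder; first exact: le_trans (ltW t0B) tt.
  by apply: HTb; apply: le_trans tt; rewrite le_max lexx.
have BA := Ahat_inA K3P a_gt0 varrho_gt0 varrho_homo rhoP k_gt0 H1_smooth H1_rank e_gt0 e_cvg0 H2 H3 varpi_gt0 gauge_L1 H6 H7
  phi_regular (fun nu nu0 nuk => let: And3 h _ _ := coefficient_solution nu0 nuk in h) MLu MLP CLu CLP.
have [tS [S [W [p0 [E [tBS SWd [Wc Ec] [SWb EL] pm]]]]]] :=
  reduction lamP K3P noRes e_gt0 e_cvg0 eps_c eps_1 gauge_L1 H9 CLu CLP t0B Bc BA.
have t0S : t0 < tS := lt_le_trans t0B tBS.
have dc j : exists (bb : bool) (T M : R) (P : R -> R), (forall t : R, T <= t -> is_derive t 1 P (p0 j t - kappa * (e t)^-1 * dI t0 e t)) /\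
    forall u v : R, T <= u -> u <= v -> (if bb then P v - P u else P u - P v) <= M.
  have [i [c hb]] := pm j.
  have sg := main_sign (complex.Re (lam i)) (- kappa) c CLu CLP.
  have hb' : bprim (fun t => (p0 j t - kappa * (e t)^-1 * dI t0 e t) - (complex.Re (lam i) + \sum_(w <- CL) c w * mu eps w t + - kappa * (e t)^-1 * dI t0 e t)).
    by apply: bprim_ext hb _; exists 0 => t _; rewrite !mulNr; ring.
  have [Tm [Hm [Bm HB]]] := hb'.
  have mc : contI t0 (fun t => complex.Re (lam i) + \sum_(w <- CL) c w * mu eps w t + - kappa * (e t)^-1 * dI t0 e t).
    apply: contID; first apply: contID; first exact: contIc.
      by apply: contI_sum => w _; apply: contIZ; exact: (mu_cont eps_c).
    apply: contIM; last exact: (eps_contI H1_smooth pkl_gt0).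
    by apply: contIZ; apply: contI_inv => [|t tt]; [exact: eps_c|rewrite gt_eqF// e_gt0].
  have [Fm HFm _] := contI_primitive mc.
  pose P t := Hm t + Fm t.
  have HP t : Num.max Tm t0 <= t -> is_derive t 1 P (p0 j t - kappa * (e t)^-1 * dI t0 e t).
    rewrite ge_max => /andP[h1 h2]; apply: is_derive_eq (derD (HB t h1).1 (HFm t h2)) _.
    by rewrite subrK.
  have [T' [M' [TT' [H|H]]]] := sign_primitive sg hb' HP.
    by exists false, T', M', P; split => // t tt; apply: HP; exact: le_trans tt.
  by exists true, T', M', P; split => // t tt; apply: HP; exact: le_trans tt.
have [b Hb] := choice dc.
have [T HT] := solutions_from_reduction t0S (fun t tt => (SWd t tt).1) (fun t tt => (SWd t tt).2) SWb Wc Ec EL Hb.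
have [M HM] := SWb.
apply/near_pinftyP; exists (Num.max T tS) => t1; rewrite ge_max => /andP[Tt1 tSt1].
have [eta [z [eta0 Hz]]] := HT t1 Tt1.
(* One value of the parameter is enough; in the doubled coordinates the number of parameters has no
   meaning for the equation. *)
have [] := Hz 0; first by rewrite normr0.
move=> sol z1 _ _; eexists.
apply: (expansion_family (S := S) (z := z 0) (M := M)) => //; first exact: le_trans (ltW t0S) tSt1.
by move=> t tt; have [] := HM t (le_trans tSt1 tt).
Qed.

(** The given matrix [Q] plays the role of [S], with defect E = 0 and the real parts of [d] on the
    diagonal. Independence is seen at [t1]: the free coordinates of z start at C, and [Q t1] is
    invertible, so C is recovered from the remainder up to the positive factor e^kappa. *)
Theorem expansion_manifold (tQ : R) Q d gamma sigma : t0 <= tQ ->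
  diagonalization t0 tQ lam eps varpi (Ahat A D eps fl s) Q d gamma sigma ->
  let N := #|free_indices t0 tQ eps varrho rho varpi k d| in
  \forall t1 \near +oo, exists (eta : R) (r : 'rV[R]_N -> R -> 'cV[R]_n),
    [/\ 0 < eta,
        forall C, `|C| < eta -> solution A f eps fl D t1 (fun t => sk0 t + r C t) /\ bigO_pinfty (r C) (fun t => e t `^ (rho k0.+1 / r0)) &
        independent_family t1 [set C | `|C| < eta] r].
Proof.
move=> t0Q [[QC [MQ HQ] [c c0 Qdet]] _ Qtr sigP dE] N.
have [CL CLu CLP] := critical_list t0 eps varpi.
pose tS := tQ + 1.
have tQS : tQ < tS by rewrite ltrDl.
have t0S : t0 < tS := le_lt_trans t0Q tQS.
have Qu t : tQ <= t -> Q t \in unitmx.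
  by move=> tt; rewrite unitmxE unitfE -normr_gt0; apply: lt_le_trans c0 (Qdet t tt).
pose W t := invmx (Q t).
have Qc : contI tQ Q by apply/withinP_contI; exact: (QC.2 0%N).
have Qb : nbounded Q by exists MQ; apply/near_pinftyP; exists tQ => t /HQ[].
have Wb : nbounded W.
  by apply: (nbounded_invmx c0 Qb); apply/near_pinftyP; exists tQ.
have [MW /near_pinftyP[TW HW]] := Wb.
pose tS' := Num.max tS TW.
have tSS : tS <= tS' by rewrite le_max lexx.
have tQS' : tQ < tS' := lt_le_trans tQS tSS.
have t0S' : t0 < tS' := lt_le_trans t0S tSS.
pose p0 j t := complex.Re (d j t).
pose FI := free_indices t0 tQ eps varrho rho varpi k d.
pose b j := j \in FI.
have SW t : tS' <= t -> Q t *m W t = 1%:M.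
  by move=> tt; rewrite mulmxV// Qu// (le_trans (ltW tQS')).
have Qd t : tS' <= t -> mder Q t (Ahat A D eps fl s t *m Q t - Q t *m (diag_mx (\row_k p0 k t) + 0)).
  move=> tt i j; have tQt := lt_le_trans tQS' tt.
  apply: is_derive_eq (dI_derive_mx i j tQt (QC.1 0%N isT t (ltW tQt))) _; congr (fun_of_matrix _ i j).
  have := congr1 (fun M => Q t *m M) (Qtr t (ltW tQt)); rewrite mulmxA mulmxV ?Qu ?(ltW tQt)// mul1mx => h.
  by rewrite addr0 -h opprB addrC subrK.
have SWb : exists M, forall t, tS' <= t -> `|Q t| <= M /\ `|W t| <= M.
  exists (`|MQ| + `|MW|) => t tt; have [h1 _] := HQ t (le_trans (ltW tQS') tt).
  have h2 : `|W t| <= MW by apply: HW; apply: le_trans tt; rewrite le_max lexx orbT.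
  split; first by apply: le_trans h1 _; apply: le_trans (ler_norm _) _; rewrite lerDl.
  by apply: le_trans h2 _; apply: le_trans (ler_norm _) _; rewrite lerDr.
have Wc : contI tS' W.
  by apply: (contI_invmx (contI_le (ltW tQS') Qc)) => t tt; apply: Qu; exact: le_trans (ltW tQS') tt.
have E0 : mL1 (fun=> 0 : 'M[R]_n) by move=> i j; apply: L1dom_ext (@L1dom0 R) _; exists 0 => t _; rewrite mxE.
have ReE j t : tQ <= t -> complex.Re (d j t) = complex.Re (lam j) + \sum_(w <- CL) complex.Re (gamma j w) * mu eps w t + complex.Re (sigma j t).
  move=> tt; rewrite (dE j t tt) (fsum_seq (r := CL)) //; [|by move=> w /= /CLP|].
    by rewrite !ReD Re_sum; congr (_ + _ + _); apply: eq_bigr => w _; rewrite ReM /= mulr0 subr0.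
  by move=> w /CLP ->.
pose pj j := pjj t0 eps varrho rho varpi k d j.
have pjE j t : pj j t = p0 j t - kappa * (e t)^-1 * dI t0 e t.
  by rewrite /pj /pjj /p0 /kappa /r0 /e; ring.
have sc j : contI tQ (fun t => complex.Re (sigma j t)).
  by apply/withinP_contI; have [_ []] := sigP j.
have mc j : contI t0 (fun t => complex.Re (lam j) + \sum_(w <- CL) complex.Re (gamma j w) * mu eps w t + - kappa * (e t)^-1 * dI t0 e t).
  apply: contID; first apply: contID; first exact: contIc.
    by apply: contI_sum => w _; apply: contIZ; exact: (mu_cont eps_c).
  apply: contIM; last exact: (eps_contI H1_smooth pkl_gt0).
  by apply: contIZ; apply: contI_inv => [|t tt]; [exact: eps_c|rewrite gt_eqF// e_gt0].
have pjd j t : tQ <= t -> pj j t = (complex.Re (lam j) + \sum_(w <- CL) complex.Re (gamma j w) * mu eps w t + - kappa * (e t)^-1 * dI t0 e t) + complex.Re (sigma j t).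
  by move=> tt; rewrite pjE /p0 ReE// !mulNr; ring.
have pjc j : contI tQ (pj j).
  apply: (contI_ext _ (contID (contI_le t0Q (mc j)) (sc j))) => t tt; by rewrite pjd.
have pd j : exists (T M : R) (P : R -> R), (forall t : R, T <= t -> is_derive t 1 P (p0 j t - kappa * (e t)^-1 * dI t0 e t)) /\
    forall u v : R, T <= u -> u <= v -> (if b j then P v - P u else P u - P v) <= M.
  have HP t : tS <= t -> is_derive t 1 (intI tQ (pj j)) (pj j t).
    by move=> tt; apply: intI_derive => //; exact: lt_le_trans tt.
  have sg := main_sign (complex.Re (lam j)) (- kappa) (fun w => complex.Re (gamma j w)) CLu CLP.
  (* By convergence of its integral, [sigma j] contributes only a bounded primitive, so it does not
     disturb the sign alternative. *)
  have hb : bprim (fun t => pj j t - (complex.Re (lam j) + \sum_(w <- CL) complex.Re (gamma j w) * mu eps w t + - kappa * (e t)^-1 * dI t0 e t)).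
    have := intR_bprim (sc j) (sigP j).1.1; move=> h; apply: bprim_ext h _; exists tQ => t tt.
    by rewrite (pjd j t tt) addrAC subrr add0r.
  have [T' [M' [TT' HH]]] := sign_primitive sg hb HP.
  (* [b] is the indicator of the index set in the statement; [divergence_dichotomy] shows that this
     prescribed choice is admissible. *)
  have bP : b j <-> ~ (intI tQ (pj j) t @[t --> +oo] --> +oo).
    by rewrite /b /FI /free_indices inE; split => [/negP h H|h]; [apply: h; exact/asboolP|apply/negP => /asboolP].
  have [M'' H''] := divergence_dichotomy bP HH.
  exists T', M'', (intI tQ (pj j)); split => // t tt; rewrite -pjE; apply: HP; exact: le_trans tt.
have Ec : contI tS' (fun=> 0 : 'M[R]_n) by exact: contIc.
have [T HT] := solutions_from_reduction t0S' SW Qd SWb Wc Ec E0 pd.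
have fE : free_set b = FI by apply/setP => j; rewrite free_setE.
rewrite fE in HT.
have [M HM] := SWb.
apply/near_pinftyP; exists (Num.max T tS') => t1; rewrite ge_max => /andP[Tt1 tSt1].
have [eta [z [eta0 Hz]]] := HT t1 Tt1.
have t0t1 : t0 <= t1 := le_trans (ltW t0S') tSt1.
pose r C t := s t + e t `^ kappa *: (Q t *m z C t) - sk0 t.
exists eta, r; split; [exact: eta0| |].
  move=> C /Hz[sol z1 _ _].
  by apply: (expansion_family (S := Q) (z := z C) (M := M)) => // t tt; have [] := HM t (le_trans tSt1 tt).
move=> C CU; have [_ _ zd _] := Hz C CU; split.
  move=> t tt; have -> : (fun C' => r C' t) = (fun x => s t - sk0 t + (e t `^ kappa *: Q t) *m x) \o (fun C' => z C' t).
    by apply/funext => C'; rewrite /r /= -scalemxAl addrAC.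
  apply: differentiable_comp; first exact: zd.
  by apply: differentiableD; [exact: differentiable_cst|exact: mulmx_linear_differentiable].
move=> v Dv; apply/matrixP => i0 i; rewrite (ord1 i0) [RHS]mxE; apply/eqP; rewrite -normr_le0.
have th0 : 0 < e t1 `^ kappa by rewrite powR_gt0// e_gt0.
have WQ : W t1 *m Q t1 = 1%:M by rewrite mulVmx// Qu// (le_trans (ltW tQS')).
have Uh : (0 : R)^' (fun h : R => `|h *: v + C| < eta).
  have hC : (fun h : R => h *: v + C) @ (0 : R) --> C.
    rewrite -[X in _ --> X]add0r -(scale0r v); apply: cvgD; last exact: cvg_cst.
    by apply: cvgZr_tmp; exact: cvg_id.
  have nC : nbhs C [set C | `|C| < eta].
    apply/nbhs_ballP; exists (eta - `|C|); rewrite /= ?subr_gt0// => C'.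
    rewrite mx_norm_ball /ball_ /= => CC'; have -> : C' = C - (C - C') by rewrite subKr.
    by apply: le_lt_trans (ler_normB _ _) _; move: CC'; lra.
  have HU := hC _ nC.
  by rewrite /dnbhs /within /=; apply: (@filterS R (nbhs (0 : R)) _ (fun h : R => `|h *: v + C| < eta) _ _ HU) => x Ux _.
have dv1 := Dv t1 (lexx _).
have rd : differentiable (fun C' => r C' t1) C.
  have -> : (fun C' => r C' t1) = (fun x => s t1 - sk0 t1 + (e t1 `^ kappa *: Q t1) *m x) \o (fun C' => z C' t1).
    by apply/funext => C'; rewrite /r /= -scalemxAl addrAC.
  apply: differentiable_comp; first exact: zd.
  by apply: differentiableD; [exact: differentiable_cst|exact: mulmx_linear_differentiable].
have dd := @diff_derivable _ _ _ _ _ v rd.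
(* Each component of [v] is shown to be at most [x]. A small difference quotient of [r] at [t1],
   multiplied by [W t1], has the entry [e t1 ^ kappa * v 0 i] for every [h], and [cW] absorbs the
   norm of [W t1]. *)
apply/ler_addgt0Pr => x x0; rewrite add0r.
pose cW := n%:R * `|W t1| + 1.
have cW0 : 0 < cW by rewrite ltr_wpDl// mulr_ge0.
have : (fun h : R => h^-1 *: (((fun C' => r C' t1) \o shift C) (h *: v) - r C t1)) @ 0^' --> (0 : 'cV[R]_n).
  by rewrite -dv1; exact: dd.
move=> /cvgrPdist_le/(_ (x * e t1 `^ kappa / cW)) /(_ ltac:(by rewrite !divr_gt0// mulr_gt0)) H.
have [h [h0 hU hH]] : exists h : R, [/\ h != 0, `|h *: v + C| < eta & `|0 - h^-1 *: (r (h *: v + C) t1 - r C t1)| <= x * e t1 `^ kappa / cW].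
  have : (0 : R)^' (fun h : R => [/\ h != 0, `|h *: v + C| < eta & `|0 - h^-1 *: (r (h *: v + C) t1 - r C t1)| <= x * e t1 `^ kappa / cW]).
    near=> h; split; [by near: h; exact: nbhs_dnbhs_neq|by near: h|by near: h].
  by move=> /filter_ex[h Hh]; exists h.
have [_ _ _ z1] := Hz _ hU; have [_ _ _ z2] := Hz _ CU.
have key : (W t1 *m (h^-1 *: (r (h *: v + C) t1 - r C t1))) (enum_val i) 0 = e t1 `^ kappa * v 0 i.
  have -> : r (h *: v + C) t1 - r C t1 = e t1 `^ kappa *: (Q t1 *m (z (h *: v + C) t1 - z C t1)).
    rewrite /r opprB addrA subrK opprD addrACA subrr add0r -scalerBr -mulmxBr; congr (_ *: _).
  rewrite -!scalemxAr mulmxA WQ mul1mx !mxE z1 z2 !mxE addrK.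
  by rewrite mulrCA mulKf.
have : `|e t1 `^ kappa * v 0 i| <= cW * (x * e t1 `^ kappa / cW).
  rewrite -key; apply: le_trans (mx_norm_entry _ _ _) _; apply: le_trans (mx_norm_mul _ _) _.
  move: hH; rewrite sub0r normrN => hH; apply: ler_pM => //.
  by rewrite /cW lerDl.
rewrite mulrCA divff ?gt_eqF// mulr1 normrM gtr0_norm// [X in _ <= X]mulrC ler_pM2l//.
Unshelve. all: by end_near. Qed.
End Assembly.

Theorem mainTheorem5 (R : realType) (n m : nat) (t0 : R) (A : 'M[R]_n)
    (lam : 'I_n -> R[i]) (K : set (R -> R))
    (f phi0 : R -> 'cV[R]_n) (a : R)
    (eps : 'I_m.+1 -> R -> R) (fl : 'I_m.+1 -> R * 'cV[R]_n -> 'cV[R]_n)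
    (varrho : 'I_m.+1 -> R) (rho : nat -> R) (k k0 : nat) (varpi : R)
    (D := cylinder t0 phi0 a)
    (n_ge2 : (2 <= n)%N)
    (lamP : eigenvalues A lam)
    (K3P : K3_class t0 lam K)
    (f_K3 : vecK K f)
    (phi0P : K3_solution t0 K A f phi0)
    (a_gt0 : 0 < a)
    (varrho_gt0 : forall l, 0 < varrho l)
    (varrho_homo : forall l l' : 'I_m.+1, (l <= l')%N -> varrho l <= varrho l')
    (rhoP : rank_enum varrho rho)
    (k_gt0 : (0 < k)%N) (k0_gt0 : (0 < k0)%N)
    (H1_smooth : forall l, CI t0 (pkl varrho rho k l) (eps l))
    (H1_rank : forall l r, (r <= pkl varrho rho k l)%N ->
       bigO_pinfty (iter r (dI t0) (eps l))
         (fun t => eps ord0 t `^ ((varrho l + r%:R) / varrho ord0)))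
    (H1_ge0 : forall t, t0 <= t -> 0 <= eps ord0 t)
    (H1_o1 : eps ord0 t @[t --> +oo] --> 0)
    (H2 : forall l, C0y D (smoothness varrho rho k l) (fl l))
    (H3 : forall l (w : mindex n), (mabs w <= smoothness varrho rho k l)%N ->
       exists M : R, forall p, D p -> `|pderm D w (fl l) p| <= M)
    (H4 : forall l (w : mindex n), varrho l <= rho k ->
       (mabs w)%:Z <= qkl varrho rho k l ->
       vecK K (fun t => pderm D w (fl l) (t, phi0 t)))
    (varpi_gt0 : 0 < varpi)
    (H5 : intRp t0 varpi (eps ord0))
    (H6 : forall l (r : nat), 1 <= rho k - varrho l -> (1 <= r)%N ->
       r%:Z <= Num.floor (rho k - varrho l) -> intRp t0 1 (iter r (dI t0) (eps l)))
    (H7 : forall l, varrho l <= varpi * varrho ord0 ->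
       [/\ C0y D (sl varrho varpi l + 2) (fl l),
           forall w : mindex n, (3 <= mabs w <= sl varrho varpi l + 2)%N ->
             exists M : R, forall p, D p -> `|pderm D w (fl l) p| <= M &
           forall w : mindex n, (1 <= mabs w <= sl varrho varpi l + 1)%N ->
             vecK K (fun t => pderm D w (fl l) (t, phi0 t))])
    (H8 : ~ Delta lam 0)
    (H9 : forall l, ~ intRp t0 1 (eps l) ->
       [/\ {in `[t0, +oo[ &, {homo eps l : s t / s <= t}} \/
             {in `[t0, +oo[ &, {homo eps l : s t / s <= t >-> t <= s}},
           eps l t @[t --> +oo] --> 0,
           CI t0 1 (eps l) &
           intRp t0 1 (dI t0 (eps l))])
    (H9_gt0 : forall t, t0 <= t -> 0 < eps ord0 t)
    (H10 : forall (gamma1 : R) (gamma : mindex m.+1 -> R),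
       let h := fun t => gamma1 * (eps ord0 t)^-1 * dI t0 (eps ord0) t +
         \sum_(w \in critical t0 eps varpi) (gamma w * mu eps w t) in
       (\forall t \near +oo, 0 <= h t) \/ (\forall t \near +oo, h t <= 0))
    (H11 : varrho ord0 * varpi < rho k.+1)
    (H11' : varrho ord0 * (2 * varpi - 1) <= rho k.+1)
    (H12 : rho k0.+1 + varpi * varrho ord0 <= rho k.+1) :
  (exists phi : mono m.+1 -> R -> 'cV[R]_n,
     coefficients t0 K A D fl phi0 varrho rho k phi) /\
  (forall phi : mono m.+1 -> R -> 'cV[R]_n,
     coefficients t0 K A D fl phi0 varrho rho k phi ->
     let s := psum t0 eps phi0 varrho rho phi k in
     let expansion (t1 : R) (r : R -> 'cV[R]_n) :=
       solution A f eps fl D t1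
         (fun t => psum t0 eps phi0 varrho rho phi k0 t + r t) /\
       bigO_pinfty r (fun t => eps ord0 t `^ (rho k0.+1 / varrho ord0)) in
     (exists t, [/\ t0 <= t, D (t, s t) & - dI t0 s t + rhs A f eps fl t (s t) <> 0]) ->
     (\forall t1 \near +oo, exists r, expansion t1 r) /\
     (forall (tQ : R) Q d gamma sigma, t0 <= tQ ->
        (forall t, tQ <= t -> D (t, s t)) ->
        diagonalization t0 tQ lam eps varpi (Ahat A D eps fl s) Q d gamma sigma ->
        let N := #|free_indices t0 tQ eps varrho rho varpi k d| in
        \forall t1 \near +oo, exists (eta : R) (r : 'rV[R]_N -> R -> 'cV[R]_n),
          [/\ 0 < eta,
              forall C, `|C| < eta -> expansion t1 (r C) &
              independent_family t1 [set C | `|C| < eta] r])) /\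
  (forall (t1 : R) (N : nat) (U : set 'rV[R]_N) (y : 'rV[R]_N -> R -> 'cV[R]_n),
     t0 <= t1 -> open U -> U !=set0 ->
     (forall C, U C -> solution A f eps fl D t1 (y C)) ->
     independent_family t1 U y -> (N <= n)%N).
Proof.
have H9' l : ~ intRp t0 1 (eps l) -> CI t0 1 (eps l) /\ intRp t0 1 (dI t0 (eps l)) by move=> /H9[].
split; first exact: (coefficients_exist lamP K3P H8 varrho_gt0 varrho_homo rhoP H4).
split.
  move=> phi phiP s expansion _; split.
    exact: (expansion_exists lamP K3P f_K3 phi0P a_gt0 varrho_gt0 varrho_homo rhoP k_gt0 k0_gt0 H1_smooth H1_rank
      H1_o1 H2 H3 varpi_gt0 H5 H6 H7 H8 H9' H9_gt0 H10 H11 H11' H12 phiP).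
  move=> tQ Q d gamma sigma t0Q _ dg.
  exact: (expansion_manifold K3P f_K3 phi0P a_gt0 varrho_gt0 varrho_homo rhoP k_gt0 k0_gt0 H1_smooth H1_rank
    H1_o1 H2 H3 varpi_gt0 H5 H9_gt0 H10 H11 H11' H12 phiP t0Q dg).
move=> t1 N U y t01 Uo U0 Us Ui.
apply: (dimension_bound a_gt0 _ H2 _ (fun l w => @H3 l w) t01 Uo U0 Us Ui).
  by move=> l; exact: (eps_contI0 H1_smooth).
by move=> l; rewrite /smoothness; move: (qkl _ _ _ _) => z; lia.
Qed.
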